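(* Consider a fixed holomorphic cusp form of weight $\kappa\in\mathbb Z_+$ for the full modular group with Fourier expansion $\sum_{n=1}^\infty a(n)\,n^{(\kappa-1)/2}\,e(nz)$ for $\Im z>0$. Let $M\in[1,\infty[$, $\Delta\in[1,M]$ and $\alpha\in\mathbb R$. If $\Delta\ll M^{2/3}$, then \[\sum_{M\leqslant n\leqslant M+\Delta}a(n)\,e(n\alpha)\ll\Delta^{1/6}\,M^{1/3+\varepsilon},\] and if $M^{2/3}\ll\Delta$, then \[\sum_{M\leqslant n\leqslant M+\Delta}a(n)\,e(n\alpha)\ll\Delta\,M^{-2/9+\varepsilon},\] where the implicit constants depend only on the cusp form and $\varepsilon$.
   Context: $e(x)=e^{2\pi ix}$; $\varepsilon$ denotes an arbitrarily small fixed positive number. *)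

(* Defs.v *)
(* Stdlib reals and Coquelicot (complex numbers, complex derivatives, series). *)
From Stdlib Require Import Reals ZArith.
From Coquelicot Require Import Coquelicot.

Open Scope R_scope.

Definition Cexp (z : C) : C :=
  (exp (Re z) * cos (Im z), exp (Re z) * sin (Im z)).

(* e(z) = exp(2 pi i z), for complex z; real arguments are coerced by [RtoC]. *)
Definition e (z : C) : C := Cexp (RtoC (2 * PI) * Ci * z)%C.

Definition upper_half_plane (z : C) : Prop := 0 < Im z.

(* Functions on the upper half-plane are total functions [C -> C] whose values
   elsewhere are irrelevant.  The upper half-plane is open, so the complex
   derivative at its points depends only on the values there. *)
Definition holomorphic_on_upper_half_plane (f : C -> C) : Prop :=
  forall z : C, upper_half_plane z ->
    ex_derive (K := C_AbsRing) (V := C_NormedModule) f z.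

Definition modular_of_weight (kappa : nat) (f : C -> C) : Prop :=
  forall a b c d : Z, (a * d - b * c = 1)%Z ->
  forall z : C, upper_half_plane z ->
    f ((RtoC (IZR a) * z + RtoC (IZR b)) / (RtoC (IZR c) * z + RtoC (IZR d)))%C
    = ((RtoC (IZR c) * z + RtoC (IZR d)) ^ kappa * f z)%C.

(* f(z) -> 0 as Im z -> +oo, uniformly in Re z. *)
Definition vanishes_at_infinity (f : C -> C) : Prop :=
  forall eta : R, 0 < eta ->
  exists Y : R, forall z : C, upper_half_plane z -> Y < Im z -> Cmod (f z) < eta.

(* The full modular group has a single cusp, at infinity. *)
Record is_cusp_form (kappa : nat) (f : C -> C) : Prop := {
  cusp_form_holomorphic : holomorphic_on_upper_half_plane f;
  cusp_form_modular : modular_of_weight kappa f;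
  cusp_form_cuspidal : vanishes_at_infinity f
}.

(* f(z) = sum_{n >= 1} a(n) n^((kappa-1)/2) e(nz).  Coquelicot's series start
   at 0, so the m-th term is the one for n = m + 1, and [a 0] is not used. *)
Definition has_normalized_fourier_expansion
    (kappa : nat) (f : C -> C) (a : nat -> C) : Prop :=
  forall z : C, upper_half_plane z ->
    is_series (K := C_AbsRing) (V := C_NormedModule)
      (fun m : nat =>
         let n := S m in
         (a n * RtoC (Rpower (INR n) ((INR kappa - 1) / 2))
              * e (RtoC (INR n) * z))%C)
      (f z).

(* Sum of F(n) over the integers n with x <= n <= y, for 0 <= x; it is 0 when
   there is no such n. *)
Definition sum_between (x y : R) (F : nat -> C) : C :=
  sum_n_m (G := C_AbelianMonoid) F (Z.to_nat (Zceil x)) (Z.to_nat (Zfloor y)).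

Definition short_exponential_sum (a : nat -> C) (M Delta alpha : R) : C :=
  sum_between M (M + Delta)
    (fun n : nat => (a n * e (RtoC (INR n * alpha)))%C).

(* Main.v *)
(* Besides modularity, the only input is that y^(k/2) |f(z)| is bounded.  Write
   the sum as the integral of Phi(x) = f(x + i/mu) e(-mu (x + i/mu)), mu ~ M,
   against a geometric sum of N terms, and cut the period into N cells of
   length rho = 1/N.  For N <= M^(2/3) everything follows from
     int_J Phi << mu^(k/2 + eps) rho^(5/6) mu^(-1/6),   |J| <= rho,
   and longer sums are split into blocks of length M^(2/3).

   Near a Dirichlet approximation p/q of J, on a dyadic range of |x - p/q|,
   substitute x = sigma u with sigma = (p s; q r) in SL_2(Z), so that
   3S <= q u + r <= 6S; then u runs over W << rho S^2 unit intervals.  For every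
   prime c, tile [0,1] by arcs around the fractions a/c and carry each arc into
   [-1,1] by an element of SL_2(Z) with lower row (c, d).  By modularity all arcs become
   integrals of the same values of f, at height S^2/mu, against explicit
   oscillating weights.  Averaging over the primes c <= 2P and applying
   Cauchy-Schwarz leaves a quadratic form in these weights: the off-diagonal
   terms are estimated by the first-derivative test and a count of the matrices
   tau' tau^-1, the diagonal ones by squaring out a sum over W integer
   translates.  If W is too small compared with the resonance length
   S^3/(mu |q|), the weights are nearly a single e(-n0 v), and the case W = 1 of
   the estimate, for n0 in place of mu, is applied instead. *)
Require Import Defs.
From Stdlib Require Import Reals ZArith Lra Lia Psatz List FinFun Znumtheory.
From Coquelicot Require Import Coquelicot.
Import ListNotations.
Open Scope R_scope.

(** The exponents come from one balance. On the range of size [S] put X = mu/S^2 and let om bound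
    the number of unit intervals; the trivial bound for one of them is [Nrm] = mu^(k/2)/S^2. Every
    prime reproduces the same integral, so averaging over U primes gains sqrt U in Cauchy-Schwarz as
    long as the off-diagonal terms do not exceed the diagonal ones. This limits P to about
    (X/om^2)^(1/3), and the outcome is Nrm sqrt(om/P) = Nrm om^(5/6) X^(-1/6). As om is a multiple
    of rho S^2, the parameter S cancels: all dyadic ranges contribute equally and only a logarithm
    is lost. The condition N <= M^(2/3) keeps the resonance length R below om^(5/3), and then the
    loss of sqrt R in the resonant case is affordable. The sixth roots [g], [n], [t], [v] make all
    these exponents integers. Changes of path rest on termwise primitives of the Fourier series,
    which make an integral of f(z) e(-mu z) depend on its end points only. *)

Ltac asR := match goal with |- @eq _ ?a ?b => change (@eq R a b) end.

Ltac msimp := repeat progress (cbv [plus scal mult opp minus zero one]; simpl).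
Ltac mring := msimp; asR; ring.

Ltac pos := first [assumption | lra | lazymatch goal with
  | |- 0 < _ * _ => apply Rmult_lt_0_compat; pos
  | |- 0 < _ / _ => apply Rdiv_lt_0_compat; pos
  | |- 0 < / _ => apply Rinv_0_lt_compat; pos
  | |- 0 < _ ^ _ => apply pow_lt; pos
  | |- 0 < exp _ => apply exp_pos
  | |- 0 < Rpower _ _ => apply exp_pos
  | |- 0 < sqrt _ => apply sqrt_lt_R0; pos
  | |- 0 < INR _ => apply lt_0_INR; lia
  | |- 0 < IZR _ => apply IZR_lt; lia
  | |- 0 < _ + _ => first [apply Rplus_lt_le_0_compat; pos | apply Rplus_le_lt_0_compat; pos]
  | |- 0 <= _ * _ => apply Rmult_le_pos; pos
  | |- 0 <= _ / _ => apply Rdiv_le_0_compat; pos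
  | |- 0 <= / _ => left; apply Rinv_0_lt_compat; pos
  | |- 0 <= _ ^ 2 => apply pow2_ge_0
  | |- 0 <= _ ^ _ => apply pow_le; pos
  | |- 0 <= sqrt _ => apply sqrt_pos
  | |- 0 <= Cmod _ => apply Cmod_ge_0
  | |- 0 <= Rabs _ => apply Rabs_pos
  | |- 0 <= INR _ => apply pos_INR
  | |- 0 <= IZR _ => apply IZR_le; lia
  | |- 0 <= exp _ => left; apply exp_pos
  | |- 0 <= Rpower _ _ => left; apply exp_pos
  | |- 0 <= _ + _ => apply Rplus_le_le_0_compat; pos
  | |- _ <> 0 => apply Rgt_not_eq; red; pos
  end].

(* In the sections where [S] is a real number, [suc] is the successor on [nat]. *)
Notation suc := Datatypes.S.

Tactic Notation "via" uconstr(H) := eapply Rle_trans; [apply H|].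

Ltac arith := first [lra | lia | pos | nra].

(** * Calculus of complex-valued functions of a real variable *)

Definition Dc (f : R -> C) (x : R) (d : C) : Prop :=
  @is_derive R_AbsRing C_R_NormedModule f x d.

Definition Cc (f : R -> C) (x : R) : Prop :=
  @continuous R_UniformSpace C_UniformSpace f x.

Definition CInt (f : R -> C) (a b : R) : C := @RInt C_R_CompleteNormedModule f a b.

Lemma Ceq (z w : C) : fst z = fst w -> snd z = snd w -> z = w.
Proof. destruct z, w; simpl; intros; subst; reflexivity. Qed.

Lemma Dc_fst f x d : Dc f x d -> is_derive (fun t => fst (f t)) x (fst d).
Proof.
  intros H. unfold Dc, is_derive in *.
  refine (filterdiff_ext_lin _ _ _ (filterdiff_comp' f fst x _ _ H
    (filterdiff_linear _ is_linear_fst)) _).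
  intros y; simpl; reflexivity.
Qed.

Lemma Dc_snd f x d : Dc f x d -> is_derive (fun t => snd (f t)) x (snd d).
Proof.
  intros H. unfold Dc, is_derive in *.
  refine (filterdiff_ext_lin _ _ _ (filterdiff_comp' f snd x _ _ H
    (filterdiff_linear _ is_linear_snd)) _).
  intros y; simpl; reflexivity.
Qed.

(** Recombining the coordinates along the real basis (1, 0), (0, 1) reduces the product, inverse and
    exponential rules to real derivatives. *)
Lemma Dc_pair f x d : is_derive (fun t => fst (f t)) x (fst d) ->
  is_derive (fun t => snd (f t)) x (snd d) -> Dc f x d.
Proof.
  intros H1 H2. unfold Dc.
  apply (is_derive_ext (fun t => plus (scal (fst (f t)) ((1, 0) : C_R_NormedModule))
     (scal (snd (f t)) ((0, 1) : C_R_NormedModule)))).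
  { intros t. apply Ceq; mring. }
  replace d with (plus (scal (fst d) ((1, 0) : C_R_NormedModule))
     (scal (snd d) ((0, 1) : C_R_NormedModule))).
  2:{ apply Ceq; mring. }
  apply @is_derive_plus.
  - apply (@is_derive_scal_l R_AbsRing C_R_NormedModule); exact H1.
  - apply (@is_derive_scal_l R_AbsRing C_R_NormedModule); exact H2.
Qed.

Lemma Dc_eq f x d d' : Dc f x d -> d = d' -> Dc f x d'.
Proof. intros H <-; exact H. Qed.

Lemma Dc_ext f g x d : (forall t, f t = g t) -> Dc f x d -> Dc g x d.
Proof. intros H; apply is_derive_ext; exact H. Qed.

Lemma Dc_const c x : Dc (fun _ => c) x 0%C.
Proof. apply (@is_derive_const R_AbsRing C_R_NormedModule). Qed.

Lemma Dc_RtoC g x d : is_derive g x d -> Dc (fun t => RtoC (g t)) x (RtoC d).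
Proof.
  intros H; apply Dc_pair; simpl; auto.
  apply (@is_derive_const R_AbsRing R_NormedModule).
Qed.

Lemma Dc_id x : Dc (fun t => RtoC t) x 1%C.
Proof. apply (Dc_RtoC (fun t => t)). apply (@is_derive_id R_AbsRing). Qed.

Lemma Dc_plus f g x df dg : Dc f x df -> Dc g x dg ->
  Dc (fun t => f t + g t)%C x (df + dg)%C.
Proof. intros; apply (@is_derive_plus R_AbsRing C_R_NormedModule); assumption. Qed.

Lemma Dc_opp f x df : Dc f x df -> Dc (fun t => - f t)%C x (- df)%C.
Proof. intros; apply (@is_derive_opp R_AbsRing C_R_NormedModule); assumption. Qed.

Lemma Dc_minus f g x df dg : Dc f x df -> Dc g x dg ->
  Dc (fun t => f t - g t)%C x (df - dg)%C.
Proof. intros; apply Dc_plus; auto; apply Dc_opp; auto. Qed.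

Lemma is_derive_eqv (g : R -> R) x (d d' : R) : is_derive g x d -> d = d' -> is_derive g x d'.
Proof. intros H <-; exact H. Qed.

Lemma is_derive_Rmult (f g : R -> R) x (df dg : R) : is_derive f x df -> is_derive g x dg ->
  is_derive (fun t => f t * g t) x (df * g x + f x * dg).
Proof.
  intros. apply (is_derive_mult f g x df dg); auto.
  intros; apply Rmult_comm.
Qed.

Lemma Dc_mult f g x df dg : Dc f x df -> Dc g x dg ->
  Dc (fun t => f t * g t)%C x (df * g x + f x * dg)%C.
Proof.
  intros Hf Hg.
  pose proof (Dc_fst _ _ _ Hf) as F1; pose proof (Dc_snd _ _ _ Hf) as F2.
  pose proof (Dc_fst _ _ _ Hg) as G1; pose proof (Dc_snd _ _ _ Hg) as G2.
  apply Dc_pair; simpl.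
  - eapply is_derive_eqv.
    + apply (@is_derive_minus R_AbsRing R_NormedModule);
        apply is_derive_Rmult; eassumption.
    + mring.
  - eapply is_derive_eqv.
    + apply (@is_derive_plus R_AbsRing R_NormedModule);
        apply is_derive_Rmult; eassumption.
    + mring.
Qed.

Lemma Dc_conj f x d : Dc f x d -> Dc (fun t => Cconj (f t)) x (Cconj d).
Proof.
  intros H; apply Dc_pair; simpl.
  - exact (Dc_fst _ _ _ H).
  - apply (@is_derive_opp R_AbsRing R_NormedModule (fun t => snd (f t))).
    exact (Dc_snd _ _ _ H).
Qed.

Lemma Dc_inv f x d : Dc f x d -> f x <> 0%C -> Dc (fun t => / f t)%C x (- d / (f x * f x))%C.
Proof.
  intros H Hn.
  pose proof (Dc_fst _ _ _ H) as F1; pose proof (Dc_snd _ _ _ H) as F2.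
  assert (Hq : fst (f x) * fst (f x) + snd (f x) * snd (f x) <> 0).
  { intros E. apply Hn. apply Ceq; simpl; nra. }
  assert (Hq2 : fst (f x) * (fst (f x) * 1) + snd (f x) * (snd (f x) * 1) <> 0) by arith.
  apply Dc_pair; unfold Cinv; simpl.
  - eapply is_derive_eqv.
    + apply (is_derive_div (fun t => fst (f t))
        (fun t => fst (f t) * (fst (f t) * 1) + snd (f t) * (snd (f t) * 1)) x (fst d)).
      * exact F1.
      * apply (@is_derive_plus R_AbsRing R_NormedModule); apply is_derive_Rmult;
          try eassumption; apply is_derive_Rmult; try eassumption;
          apply (@is_derive_const R_AbsRing R_NormedModule).
      * exact Hq2.
    + msimp; asR; field. split; [|exact Hq].
      intros E. apply Hq. nra.
  - eapply is_derive_eqv.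
    + apply (is_derive_div (fun t => - snd (f t))
        (fun t => fst (f t) * (fst (f t) * 1) + snd (f t) * (snd (f t) * 1)) x (- snd d)).
      * apply (@is_derive_opp R_AbsRing R_NormedModule (fun t => snd (f t))). exact F2.
      * apply (@is_derive_plus R_AbsRing R_NormedModule); apply is_derive_Rmult;
          try eassumption; apply is_derive_Rmult; try eassumption;
          apply (@is_derive_const R_AbsRing R_NormedModule).
      * exact Hq2.
    + msimp; asR; field. split; [|exact Hq].
      intros E. apply Hq. nra.
Qed.

Lemma Dc_pow f x d n : Dc f x d -> Dc (fun t => f t ^ n)%C x (RtoC (INR n) * f x ^ (pred n) * d)%C.
Proof.
  intros H. induction n as [|n IH].
  - simpl. eapply Dc_eq; [apply Dc_const|]. ring.
  - eapply Dc_ext; [intros t; symmetry; apply Cpow_S|].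
    eapply Dc_eq; [apply Dc_mult; [exact H|exact IH]|].
    rewrite S_INR, RtoC_plus. destruct n as [|n]; simpl pred.
    + simpl. ring.
    + rewrite Cpow_S. simpl pred. ring.
Qed.

Lemma Dc_Cexp f x d : Dc f x d -> Dc (fun t => Cexp (f t)) x (d * Cexp (f x))%C.
Proof.
  intros H.
  pose proof (Dc_fst _ _ _ H) as F1; pose proof (Dc_snd _ _ _ H) as F2.
  apply Dc_pair; unfold Cexp, Re, Im; simpl.
  - eapply is_derive_eqv.
    + apply is_derive_Rmult.
      * apply (is_derive_comp exp); [apply is_derive_exp|exact F1].
      * apply (is_derive_comp cos); [apply is_derive_cos|exact F2].
    + mring.
  - eapply is_derive_eqv.
    + apply is_derive_Rmult.
      * apply (is_derive_comp exp); [apply is_derive_exp|exact F1].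
      * apply (is_derive_comp sin); [apply is_derive_sin|exact F2].
    + mring.
Qed.

Lemma Dc_e f x d : Dc f x d -> Dc (fun t => e (f t)) x (RtoC (2 * PI) * Ci * d * e (f x))%C.
Proof.
  intros H. unfold e. eapply Dc_eq.
  - apply (Dc_Cexp (fun t => RtoC (2 * PI) * Ci * f t)%C).
    apply Dc_mult; [apply Dc_const|exact H].
  - simpl. ring.
Qed.

Lemma Dc_Cc f x d : Dc f x d -> Cc f x.
Proof.
  intros H. apply (@ex_derive_continuous R_AbsRing C_R_NormedModule).
  exists d; exact H.
Qed.

Lemma Cc_pair f x : continuous (fun t => fst (f t)) x -> continuous (fun t => snd (f t)) x -> Cc f x.
Proof.
  intros H1 H2. unfold Cc.
  apply (continuous_ext (fun t => (fst (f t), snd (f t)))).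
  { intros t; destruct (f t); reflexivity. }
  apply (continuous_comp_2 (fun t => fst (f t)) (fun t => snd (f t)) (fun a b => (a, b)));
    auto.
  apply (continuous_ext (fun p => p)); [intros [a b]; reflexivity|].
  apply continuous_id.
Qed.

Lemma Cc_fst f x : Cc f x -> continuous (fun t => fst (f t)) x.
Proof. intros H. apply (continuous_comp f fst); [exact H|]. apply continuous_fst. Qed.

Lemma Cc_snd f x : Cc f x -> continuous (fun t => snd (f t)) x.
Proof. intros H. apply (continuous_comp f snd); [exact H|]. apply continuous_snd. Qed.

Lemma Cc_const c x : Cc (fun _ => c) x.
Proof. apply continuous_const. Qed.

Lemma Cc_ext f g x : (forall t, f t = g t) -> Cc f x -> Cc g x.
Proof. intros H; apply continuous_ext; exact H. Qed.

Lemma Cc_plus f g x : Cc f x -> Cc g x -> Cc (fun t => f t + g t)%C x.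
Proof. intros; apply (@continuous_plus R_UniformSpace R_AbsRing C_R_NormedModule); assumption. Qed.

Lemma Cc_opp f x : Cc f x -> Cc (fun t => - f t)%C x.
Proof. intros; apply (@continuous_opp R_UniformSpace R_AbsRing C_R_NormedModule); assumption. Qed.

Lemma Cc_minus f g x : Cc f x -> Cc g x -> Cc (fun t => f t - g t)%C x.
Proof. intros; apply Cc_plus; auto; apply Cc_opp; auto. Qed.

Lemma Cc_mult f g x : Cc f x -> Cc g x -> Cc (fun t => f t * g t)%C x.
Proof.
  intros Hf Hg.
  pose proof (Cc_fst _ _ Hf) as F1; pose proof (Cc_snd _ _ Hf) as F2.
  pose proof (Cc_fst _ _ Hg) as G1; pose proof (Cc_snd _ _ Hg) as G2.
  apply Cc_pair; simpl.
  - apply (@continuous_minus R_UniformSpace R_AbsRing R_NormedModule);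
    apply (@continuous_mult R_UniformSpace R_AbsRing); assumption.
  - apply (@continuous_plus R_UniformSpace R_AbsRing R_NormedModule);
    apply (@continuous_mult R_UniformSpace R_AbsRing); assumption.
Qed.

Lemma Cc_conj f x : Cc f x -> Cc (fun t => Cconj (f t)) x.
Proof.
  intros H; apply Cc_pair; simpl.
  - exact (Cc_fst _ _ H).
  - apply (@continuous_opp R_UniformSpace R_AbsRing R_NormedModule (fun t => snd (f t))).
    exact (Cc_snd _ _ H).
Qed.

Lemma Cc_Cmod f x : Cc f x -> continuous (fun t => Cmod (f t)) x.
Proof.
  intros H. apply (continuous_ext (fun t => @norm R_AbsRing C_R_NormedModule (f t))).
  { intros t; symmetry; apply Cmod_norm. }
  apply (continuous_comp f (@norm R_AbsRing C_R_NormedModule)); [exact H|].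
  apply (@filterlim_norm R_AbsRing C_R_NormedModule).
Qed.

Lemma ex_CInt f a b : (forall x, Rmin a b <= x <= Rmax a b -> Cc f x) ->
  @ex_RInt C_R_NormedModule f a b.
Proof. intros H. apply (@ex_RInt_continuous C_R_CompleteNormedModule). exact H. Qed.

Lemma ex_CInt_le f a b : a <= b -> (forall x, a <= x <= b -> Cc f x) ->
  @ex_RInt C_R_NormedModule f a b.
Proof.
  intros H1 H. apply ex_CInt. rewrite Rmin_left, Rmax_right by lra. exact H.
Qed.

Lemma is_CInt_unique f a b l : @is_RInt C_R_NormedModule f a b l -> CInt f a b = l.
Proof. apply (@is_RInt_unique C_R_CompleteNormedModule). Qed.

Lemma CInt_correct f a b : @ex_RInt C_R_NormedModule f a b -> @is_RInt C_R_NormedModule f a b (CInt f a b).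
Proof. apply (@RInt_correct C_R_CompleteNormedModule). Qed.

Lemma CInt_FTC f df a b : a <= b -> (forall x, a <= x <= b -> Dc f x (df x)) ->
  (forall x, a <= x <= b -> Cc df x) -> @is_RInt C_R_NormedModule df a b (f b - f a)%C.
Proof.
  intros Hab H1 H2.
  apply (@is_RInt_derive C_R_CompleteNormedModule f df a b);
    rewrite Rmin_left, Rmax_right by lra; assumption.
Qed.

Lemma CInt_point f a : CInt f a a = 0%C.
Proof. apply (@RInt_point C_R_CompleteNormedModule). Qed.

Lemma CInt_Chasles f a b c : @ex_RInt C_R_NormedModule f a b -> @ex_RInt C_R_NormedModule f b c ->
  (CInt f a b + CInt f b c)%C = CInt f a c.
Proof. apply (@RInt_Chasles C_R_CompleteNormedModule). Qed.

Lemma CInt_ext f g a b : a <= b -> (forall x, a < x < b -> f x = g x) -> CInt f a b = CInt g a b.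
Proof.
  intros Hab H. apply (@RInt_ext C_R_CompleteNormedModule).
  rewrite Rmin_left, Rmax_right by lra. exact H.
Qed.

Lemma is_CInt_fst f a b l : @is_RInt C_R_NormedModule f a b l ->
  is_RInt (fun t => fst (f t)) a b (fst l).
Proof. apply is_RInt_fct_extend_fst. Qed.

Lemma is_CInt_snd f a b l : @is_RInt C_R_NormedModule f a b l ->
  is_RInt (fun t => snd (f t)) a b (snd l).
Proof. apply is_RInt_fct_extend_snd. Qed.

Lemma is_CInt_pair f a b l : is_RInt (fun t => fst (f t)) a b (fst l) ->
  is_RInt (fun t => snd (f t)) a b (snd l) -> @is_RInt C_R_NormedModule f a b l.
Proof. intros H1 H2. apply is_RInt_fct_extend_pair; assumption. Qed.

Lemma is_CInt_scal c f a b l : @is_RInt C_R_NormedModule f a b l ->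
  @is_RInt C_R_NormedModule (fun t => c * f t)%C a b (c * l)%C.
Proof.
  intros H.
  pose proof (is_CInt_fst _ _ _ _ H) as H1. pose proof (is_CInt_snd _ _ _ _ H) as H2.
  apply is_CInt_pair; simpl.
  - apply (@is_RInt_minus R_NormedModule); apply (@is_RInt_scal R_NormedModule); assumption.
  - apply (@is_RInt_plus R_NormedModule); apply (@is_RInt_scal R_NormedModule); assumption.
Qed.

Lemma CInt_scal c f a b : @ex_RInt C_R_NormedModule f a b ->
  CInt (fun t => c * f t)%C a b = (c * CInt f a b)%C.
Proof. intros H. apply is_CInt_unique, is_CInt_scal, CInt_correct, H. Qed.

Lemma CInt_plus f g a b : @ex_RInt C_R_NormedModule f a b -> @ex_RInt C_R_NormedModule g a b ->
  CInt (fun t => f t + g t)%C a b = (CInt f a b + CInt g a b)%C.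
Proof. apply (@RInt_plus C_R_CompleteNormedModule). Qed.

Lemma CInt_minus f g a b : @ex_RInt C_R_NormedModule f a b -> @ex_RInt C_R_NormedModule g a b ->
  CInt (fun t => f t - g t)%C a b = (CInt f a b - CInt g a b)%C.
Proof. apply (@RInt_minus C_R_CompleteNormedModule). Qed.

Lemma CInt_le (f : R -> C) (g : R -> R) a b l : a <= b -> @ex_RInt C_R_NormedModule f a b -> is_RInt g a b l ->
  (forall x, a <= x <= b -> Cmod (f x) <= g x) -> Cmod (CInt f a b) <= l.
Proof.
  intros Hab Hf Hg H. rewrite Cmod_norm.
  apply (@norm_RInt_le C_R_NormedModule f g a b _ _ Hab).
  - intros x Hx. rewrite <- Cmod_norm. apply H, Hx.
  - apply CInt_correct, Hf.
  - exact Hg.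
Qed.

Lemma CInt_bound f a b M : a <= b -> @ex_RInt C_R_NormedModule f a b ->
  (forall x, a <= x <= b -> Cmod (f x) <= M) -> Cmod (CInt f a b) <= M * (b - a).
Proof.
  intros Hab Hf H. apply (CInt_le f (fun _ => M)); auto.
  evar_last; [apply is_RInt_const|]. mring.
Qed.

Lemma CInt_comp_shift f a b s : @ex_RInt C_R_NormedModule f (a + s) (b + s) ->
  CInt (fun t => f (t + s)) a b = CInt f (a + s) (b + s).
Proof.
  intros H. apply is_CInt_unique.
  assert (H1 := CInt_correct _ _ _ H).
  replace (a + s) with (1 * a + s) in H1 by ring. replace (b + s) with (1 * b + s) in H1 by ring.
  apply (@is_RInt_comp_lin C_R_NormedModule) in H1.
  rewrite !Rmult_1_l in H1.
  eapply is_RInt_ext; [|exact H1].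
  intros x _. cbv beta. replace (1 * x + s) with (x + s) by ring. apply (@scal_one R_AbsRing).
Qed.

(** * The function [e] and elementary bounds for the modulus *)

Lemma Cexp_add z w : Cexp (z + w)%C = (Cexp z * Cexp w)%C.
Proof.
  unfold Cexp, Cplus, Cmult, Re, Im; simpl.
  rewrite exp_plus, cos_plus, sin_plus. apply Ceq; simpl; ring.
Qed.

Lemma Cmod_Cexp z : Cmod (Cexp z) = exp (Re z).
Proof.
  unfold Cmod, Cexp; simpl.
  replace (exp (Re z) * cos (Im z) * (exp (Re z) * cos (Im z) * 1) +
    exp (Re z) * sin (Im z) * (exp (Re z) * sin (Im z) * 1))
    with (exp (Re z) * exp (Re z) * (Rsqr (sin (Im z)) + Rsqr (cos (Im z))))
    by (unfold Rsqr; ring).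
  rewrite sin2_cos2, Rmult_1_r. apply sqrt_square. left; apply exp_pos.
Qed.

Lemma e_add z w : e (z + w)%C = (e z * e w)%C.
Proof. unfold e. rewrite <- Cexp_add. f_equal. ring. Qed.

Lemma Cmod_e z : Cmod (e z) = exp (- (2 * PI * Im z)).
Proof. unfold e. rewrite Cmod_Cexp. f_equal. unfold Re, Im; simpl; ring. Qed.

Lemma Cmod_e_real x : Cmod (e (RtoC x)) = 1.
Proof. rewrite Cmod_e. unfold Im; simpl. rewrite Rmult_0_r, Ropp_0. apply exp_0. Qed.

Lemma e_0 : e 0%C = 1%C.
Proof.
  unfold e. replace (RtoC (2 * PI) * Ci * 0)%C with (RtoC 0) by ring.
  unfold Cexp, Re, Im; simpl. rewrite exp_0, cos_0, sin_0. apply Ceq; simpl; ring.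
Qed.

Lemma e_opp z : (e z * e (- z))%C = 1%C.
Proof. rewrite <- e_add. replace (z + - z)%C with (RtoC 0) by ring. apply e_0. Qed.

Lemma e_nat n : e (RtoC (INR n)) = 1%C.
Proof.
  unfold e, Cexp, Re, Im; simpl.
  replace (((2 * PI * 0 - 0 * 1) * INR n - (2 * PI * 1 + 0 * 0) * 0)) with 0 by ring.
  replace (((2 * PI * 0 - 0 * 1) * 0 + (2 * PI * 1 + 0 * 0) * INR n)) with (0 + 2 * INR n * PI) by ring.
  rewrite exp_0, cos_period, sin_period, cos_0, sin_0. apply Ceq; simpl; ring.
Qed.

Lemma e_Z n : e (RtoC (IZR n)) = 1%C.
Proof.
  destruct (Z.abs_or_opp_abs n) as [H|H].
  - rewrite H, <- (Zabs2Nat.id_abs n), <- INR_IZR_INZ. apply e_nat.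
  - pose proof (e_opp (RtoC (IZR n))) as H1.
    rewrite <- RtoC_opp, <- opp_IZR in H1.
    replace (- n)%Z with (Z.abs n) in H1 by lia.
    rewrite <- (Zabs2Nat.id_abs n), <- INR_IZR_INZ, e_nat, Cmult_1_r in H1. exact H1.
Qed.

Lemma Cmod_conj z : Cmod (Cconj z) = Cmod z.
Proof. unfold Cmod, Cconj; simpl. f_equal; ring. Qed.

Lemma Re_le_Cmod z : Rabs (Re z) <= Cmod z.
Proof. eapply Rle_trans; [apply Rmax_l|apply Rmax_Cmod]. Qed.

Lemma Im_le_Cmod z : Rabs (Im z) <= Cmod z.
Proof. eapply Rle_trans; [apply Rmax_r|apply Rmax_Cmod]. Qed.

Lemma Cmod_le_sum z : Cmod z <= Rabs (Re z) + Rabs (Im z).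
Proof.
  unfold Cmod. rewrite <- (sqrt_square (Rabs (Re z) + Rabs (Im z))).
  - apply sqrt_le_1_alt. unfold Re, Im. simpl.
    pose proof (Rabs_pos (fst z)); pose proof (Rabs_pos (snd z)).
    rewrite <- (Rabs_sqr (fst z)) || idtac.
    assert (Ha : Rabs (fst z) * Rabs (fst z) = fst z * fst z)
      by (rewrite <- Rabs_mult; apply Rabs_right; nra).
    assert (Hb : Rabs (snd z) * Rabs (snd z) = snd z * snd z)
      by (rewrite <- Rabs_mult; apply Rabs_right; nra).
    nra.
  - pose proof (Rabs_pos (Re z)); pose proof (Rabs_pos (Im z)); lra.
Qed.

Lemma Cmod_sqr z : Cmod z ^ 2 = Re z ^ 2 + Im z ^ 2.
Proof. unfold Cmod. rewrite pow2_sqrt; [reflexivity|]. simpl; nra. Qed.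

Lemma Cmod_sub_ge (z w : C) : Cmod z - Cmod w <= Cmod (z - w)%C.
Proof.
  pose proof (Cmod_triangle (z - w) w) as H.
  replace (z - w + w)%C with z in H by ring. lra.
Qed.

Lemma Im_scal r z : Im (RtoC r * z)%C = r * Im z.
Proof. unfold Im, Cmult, RtoC; simpl. ring. Qed.

Lemma exp_le_mono x y : x <= y -> exp x <= exp y.
Proof. intros [H|H]; [left; apply exp_increasing, H|rewrite H; apply Rle_refl]. Qed.

(** * Dirichlet approximation *)

(** Neighbours in the Farey sequence of order [S Q]: when the order grows by one, either the pair
    stays or one end is replaced by the mediant. The lower bound on q + q' says that no fraction of
    admissible denominator lies strictly between. *)
Lemma farey (Q : nat) (x : R) : exists p q p' q' : Z,
  (p' * q - p * q' = 1)%Z /\ (1 <= q <= Z.of_nat (S Q))%Z /\ (1 <= q' <= Z.of_nat (S Q))%Z /\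
  (Z.of_nat (S (S Q)) <= q + q')%Z /\ IZR p <= IZR q * x /\ IZR q' * x <= IZR p'.
Proof.
  induction Q as [|Q (p & q & p' & q' & H1 & H2 & H3 & H4 & H5 & H6)].
  - destruct (Zfloor_bound x) as [B1 B2].
    exists (Zfloor x), 1%Z, (Zfloor x + 1)%Z, 1%Z.
    rewrite plus_IZR. repeat split; try lia; lra.
  - destruct (Z_le_gt_dec (Z.of_nat (S (S (S Q)))) (q + q')) as [Hle|Hgt].
    + exists p, q, p', q'. repeat split; try lia; lra.
    + destruct (Rle_dec (IZR (p + p')) (IZR (q + q') * x)) as [Hx|Hx].
      * exists (p + p')%Z, (q + q')%Z, p', q'. repeat split; try lia; try lra.
      * exists p, q, (p + p')%Z, (q + q')%Z. repeat split; try lia; try lra.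
Qed.

(** Besides the approximation it supplies [s] and [r]: the other Farey neighbour completes [p], [q]
    to a matrix of determinant 1. The neighbour chosen is the one on the same side of the mediant as
    [x]. *)
Lemma dirichlet (Q : nat) (x : R) : exists p s q r : Z,
  (p * r - s * q = 1)%Z /\ (1 <= q <= Z.of_nat (S Q))%Z /\
  Rabs (IZR q * x - IZR p) * INR (S (S Q)) <= 1.
Proof.
  destruct (farey Q x) as (p & q & p' & q' & H1 & H2 & H3 & H4 & H5 & H6).
  assert (Hdet : IZR p' * IZR q - IZR p * IZR q' = 1)
    by (rewrite <- !mult_IZR, <- minus_IZR, H1; reflexivity).
  assert (Hs : INR (S (S Q)) <= IZR q + IZR q')
    by (rewrite INR_IZR_INZ, <- plus_IZR; apply IZR_le; lia).
  assert (Hq : 1 <= IZR q) by (apply IZR_le; lia).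
  assert (Hq' : 1 <= IZR q') by (apply IZR_le; lia).
  destruct (Rle_dec (IZR (p + p')) (IZR (q + q') * x)) as [Hx|Hx];
    rewrite !plus_IZR in Hx.
  - exists p', p, q', q. split; [lia|]. split; [lia|].
    rewrite Rabs_left1 by lra.
    apply Rle_trans with ((IZR p' - IZR q' * x) * (IZR q + IZR q')); [|nra].
    replace (- (IZR q' * x - IZR p')) with (IZR p' - IZR q' * x) by ring.
    apply Rmult_le_compat_l; lra.
  - exists p, (- p')%Z, q, (- q')%Z. split; [lia|]. split; [lia|].
    rewrite Rabs_right by lra.
    apply Rle_trans with ((IZR q * x - IZR p) * (IZR q + IZR q')); [|nra].
    apply Rmult_le_compat_l; lra.
Qed.

(** * Fourier series: growth of the coefficients and uniform tails *)

Notation Cseries := (@is_series C_AbsRing C_NormedModule).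
Notation Csum := (@sum_n C_AbelianMonoid).

Lemma Cseries_eps (a : nat -> C) (l : C) : Cseries a l <->
  forall eps, 0 < eps -> exists N, forall n, (N <= n)%nat -> Cmod (Csum a n - l)%C < eps.
Proof.
  pose proof (@filterlim_locally_ball_norm C_AbsRing nat C_NormedModule eventually _
    (Csum a) l) as E.
  unfold is_series. split.
  - intros H eps Heps.
    destruct (proj1 E H (mkposreal eps Heps)) as [N HN]. exists N. intros n Hn. apply (HN n Hn).
  - intros H. apply E. intros [eps Heps].
    destruct (H eps Heps) as [N HN]. exists N. intros n Hn. apply (HN n Hn).
Qed.

Lemma Csum_S (a : nat -> C) n : Csum a (S n) = (Csum a n + a (S n))%C.
Proof. apply (@sum_Sn C_AbelianMonoid). Qed.

Lemma Csum_0 (a : nat -> C) : Csum a 0 = a 0%nat.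
Proof. apply (@sum_O C_AbelianMonoid). Qed.

Lemma Cseries_unique (a : nat -> C) l l' : Cseries a l -> Cseries a l' -> l = l'.
Proof.
  intros H H'. rewrite Cseries_eps in H, H'.
  apply Ceq_minus, Cmod_eq_0.
  destruct (Rle_lt_or_eq_dec _ _ (Cmod_ge_0 (l - l')%C)) as [Hp|Hp]; [|auto].
  exfalso.
  destruct (H (Cmod (l - l') / 2)%R) as [N HN]; [lra|].
  destruct (H' (Cmod (l - l') / 2)%R) as [N' HN']; [lra|].
  specialize (HN (N + N')%nat ltac:(lia)). specialize (HN' (N + N')%nat ltac:(lia)).
  pose proof (Cmod_triangle (Csum a (N + N') - l') (- (Csum a (N + N') - l)))%C as T.
  rewrite Cmod_opp in T.
  replace (Csum a (N + N') - l' + - (Csum a (N + N') - l))%C with (l - l')%C in T by ring.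
  lra.
Qed.

Lemma Cmod_Csum_le (a : nat -> C) (b : nat -> R) n : (forall m, Cmod (a m) <= b m) ->
  Cmod (Csum a n) <= sum_n b n.
Proof.
  intros H. induction n.
  - rewrite Csum_0, sum_O. apply H.
  - rewrite Csum_S, sum_Sn. via Cmod_triangle.
    apply Rplus_le_compat; auto.
Qed.

Lemma Cseries_bound (a : nat -> C) (b : nat -> R) l s : Cseries a l -> is_series b s ->
  (forall m, Cmod (a m) <= b m) -> Cmod l <= s.
Proof.
  intros Ha Hb H.
  apply Rnot_lt_le. intros Hlt.
  rewrite Cseries_eps in Ha. destruct (Ha ((Cmod l - s) / 2)%R) as [N HN]; [lra|].
  assert (Hb' := proj1 (filterlim_locally (sum_n b) s) Hb).
  destruct (Hb' (mkposreal ((Cmod l - s) / 2) ltac:(lra))) as [N' HN'].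
  specialize (HN (N + N')%nat ltac:(lia)). specialize (HN' (N + N')%nat ltac:(lia)).
  unfold ball in HN'; simpl in HN'. unfold AbsRing_ball, abs, minus, plus, opp in HN'; simpl in HN'.
  apply Rabs_def2 in HN'.
  pose proof (Cmod_Csum_le a b (N + N')%nat H).
  pose proof (Cmod_sub_ge l (Csum a (N + N'))) as T.
  replace (l - Csum a (N + N'))%C with (- (Csum a (N + N') - l))%C in T by ring.
  rewrite Cmod_opp in T. lra.
Qed.

Lemma Cseries_terms_bounded (a : nat -> C) l : Cseries a l ->
  exists K, 0 < K /\ forall n, Cmod (a n) <= K.
Proof.
  intros H. rewrite Cseries_eps in H. destruct (H 1 Rlt_0_1) as [N HN].
  assert (Hfin : exists K, 0 < K /\ forall n, (n <= N)%nat -> Cmod (a n) <= K).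
  { clear HN. induction N as [|N (K & HK & IH)].
    - exists (Cmod (a 0%nat) + 1). split; [pose proof (Cmod_ge_0 (a 0%nat)); lra|].
      intros n Hn. replace n with 0%nat by lia. lra.
    - exists (K + Cmod (a (S N))). pose proof (Cmod_ge_0 (a (S N))). split; [lra|].
      intros n Hn. destruct (Nat.eq_dec n (S N)) as [->|Hne]; [lra|].
      specialize (IH n ltac:(lia)). lra. }
  destruct Hfin as (K & HK & Hfin).
  exists (K + 2). split; [lra|]. intros n.
  destruct (le_lt_dec n N) as [Hn|Hn]; [specialize (Hfin n Hn); lra|].
  destruct n as [|n]; [lia|].
  pose proof (HN (S n) ltac:(lia)) as H1. pose proof (HN n ltac:(lia)) as H2.
  rewrite Csum_S in H1.
  pose proof (Cmod_triangle (Csum a n + a (S n) - l) (- (Csum a n - l)))%C as T.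
  rewrite Cmod_opp in T.
  replace (Csum a n + a (S n) - l + - (Csum a n - l))%C with (a (S n)) in T by ring.
  lra.
Qed.

(** Here [A n] stands for a(n) n^((k-1)/2). That the expansion starts with e(z) is what produces
    exponential decay at infinity. *)
Record modform (k : nat) (f : C -> C) (A : nat -> C) : Prop := {
  mf_weight : (0 < k)%nat;
  mf_cont : forall z, 0 < Im z -> @continuous C_UniformSpace C_UniformSpace f z;
  mf_modular : modular_of_weight k f;
  mf_series : forall z, 0 < Im z ->
    Cseries (fun m => A (S m) * e (RtoC (INR (S m)) * z))%C (f z)
}.

(** The terms of the convergent series at iy are bounded. This crude growth, with [y] arbitrarily
    small, is the only individual bound on coefficients that is ever used. *)
Lemma coef_growth k f A : modform k f A -> forall y, 0 < y ->
  exists K, 0 < K /\ forall n, Cmod (A (S n)) <= K * exp (2 * PI * INR (S n) * y).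
Proof.
  intros Hf y Hy.
  destruct (Cseries_terms_bounded _ _ (mf_series _ _ _ Hf (0, y) Hy)) as (K & HK & H).
  exists K. split; [exact HK|]. intros n. specialize (H n).
  rewrite Cmod_mult, Cmod_e in H.
  rewrite Im_scal in H. change (Im (0, y)) with y in H.
  replace (2 * PI * INR (S n) * y) with (2 * PI * (INR (S n) * y)) by ring.
  rewrite exp_Ropp in H. pose proof (exp_pos (2 * PI * (INR (S n) * y))) as E.
  apply (Rmult_le_compat_r _ _ _ (Rlt_le _ _ E)) in H.
  rewrite Rmult_assoc, Rinv_l, Rmult_1_r in H by lra. exact H.
Qed.

Lemma exp_INR x n : exp (INR n * x) = exp x ^ n.
Proof.
  induction n; [simpl; rewrite Rmult_0_l; apply exp_0|].
  rewrite S_INR, Rmult_plus_distr_r, exp_plus, IHn. simpl. rewrite Rmult_1_l. ring.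
Qed.

(** Half of the height pays for the growth of the coefficients and the other half leaves a geometric
    series. Uniformity on the half-plane is what allows sums and integrals to be exchanged. *)
Lemma series_tail k f A : modform k f A -> forall delta, 0 < delta ->
  exists K q, 0 < K /\ 0 < q < 1 /\ forall N z, delta <= Im z ->
    Cmod (f z - Csum (fun m => A (S m) * e (RtoC (INR (S m)) * z))%C N)%C <= K * q ^ N.
Proof.
  intros Hf d Hd.
  destruct (coef_growth _ _ _ Hf (d / 2)) as (K & HK & H); [lra|].
  set (q := exp (- (PI * d))).
  assert (Hq : 0 < q < 1).
  { split; [apply exp_pos|]. unfold q. rewrite <- exp_0. apply exp_increasing.
    pose proof PI_RGT_0. nra. }
  exists (K / (1 - q)), q. split; [pos|]. split; [exact Hq|].
  intros N z Hz.
  set (a := fun m => (A (S m) * e (RtoC (INR (S m)) * z))%C).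
  assert (Ha : forall m, Cmod (a m) <= K * q ^ S m).
  { intros m. unfold a. rewrite Cmod_mult, Cmod_e.
    eapply Rle_trans.
    - apply Rmult_le_compat_r; [left; apply exp_pos|apply H].
    - rewrite Rmult_assoc, <- exp_plus. apply Rmult_le_compat_l; [lra|].
      unfold q. rewrite <- exp_INR.
      rewrite Im_scal. apply exp_le_mono.
      pose proof PI_RGT_0.
      assert (0 <= PI * INR (S m) * (Im z - d)) by pos.
      nra. }
  assert (Hs : Cseries a (f z)) by (apply (mf_series _ _ _ Hf); lra).
  assert (Ht : Cseries (fun m => a (S N + m)%nat) (f z - Csum a N)%C).
  { apply (@is_series_incr_n C_AbsRing C_NormedModule a (S N)); [lia|].
    refine (eq_ind _ (fun l => Cseries a l) Hs _ _).
    simpl pred. change (f z = (f z - Csum a N + Csum a N)%C). ring. }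
  apply (Cseries_bound _ (fun m => (K * q ^ N) * q ^ m) _ _ Ht).
  - replace (K / (1 - q) * q ^ N) with ((K * q ^ N) * / (1 - q)) by (unfold Rdiv; ring).
    apply (is_series_scal_l (K * q ^ N) (fun m => q ^ m) (/ (1 - q))). apply is_series_geom.
    rewrite Rabs_right; lra.
  - intros m. via Ha.
    rewrite Rmult_assoc. apply Rmult_le_compat_l; [lra|].
    replace (q ^ S (S N + m)) with (q ^ N * q ^ m * (q * q)).
    + assert (0 < q ^ N * q ^ m) by pos.
      assert (q * q <= 1) by nra. nra.
    + rewrite <- pow_add. replace (S (S N + m)) with (N + m + 2)%nat by lia.
      rewrite (pow_add q (N + m)). simpl. ring.
Qed.

Lemma mf_Cc k f A g t : modform k f A -> Cc g t -> 0 < Im (g t) -> Cc (fun s => f (g s)) t.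
Proof.
  intros Hf Hg Hp. unfold Cc. apply (continuous_comp g f); [exact Hg|].
  apply (mf_cont _ _ _ Hf _ Hp).
Qed.

(** * Boundedness of y^(k/2) |f| *)

(** High up, the expansion decays like exp(-pi y), which absorbs the factor y^(k/2). *)
Lemma mf_high k f A : modform k f A -> exists B, 0 < B /\ forall z, / 5 <= Im z -> Cmod (f z) * Rpower (Im z) (INR k / 2) <= B.
Proof.
  intros Hf.
  (* The height 1/10 is half of 1/5: for y >= 1/5 the n-th term is then at most a constant times
     exp(-pi n y). *)
  destruct (coef_growth _ _ _ Hf (/ 10)) as (K & HK & H); [lra|].
  pose proof PI_RGT_0 as Hpi.
  pose proof (lt_0_INR k (mf_weight _ _ _ Hf)) as Hk.
  set (q0 := exp (- (PI / 5))).
  assert (Hq0 : 0 < q0 < 1).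
  { split; [apply exp_pos|]. unfold q0. rewrite <- exp_0. apply exp_increasing. lra. }
  exists (K / (1 - q0) * exp (INR k / 2 * ln (INR k / 2))).
  split; [apply Rmult_lt_0_compat; [pos|apply exp_pos]|].
  intros z Hz. set (y := Im z) in *. set (q := exp (- (PI * y))).
  assert (Hq : 0 < q <= q0).
  { split; [apply exp_pos|]. unfold q, q0. apply exp_le_mono. nra. }
  assert (H1 : Cmod (f z) <= K / (1 - q0) * exp (- (PI * y))).
  { apply Rle_trans with ((K * q) * / (1 - q)).
    - apply (Cseries_bound _ (fun m => (K * q) * q ^ m) _ _ (mf_series _ _ _ Hf z ltac:(unfold y in Hz; lra))).
      + apply (is_series_scal_l (K * q) (fun m => q ^ m) (/ (1 - q))). apply is_series_geom.
        rewrite Rabs_right; lra.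
      + intros m. rewrite Cmod_mult, Cmod_e, Im_scal. fold y.
        eapply Rle_trans.
        * apply Rmult_le_compat_r; [left; apply exp_pos|apply H].
        * rewrite !Rmult_assoc, <- exp_plus. apply Rmult_le_compat_l; [lra|].
          change (q * q ^ m) with (q ^ S m). unfold q. rewrite <- exp_INR.
          apply exp_le_mono.
          assert (0 <= PI * INR (S m) * (y - / 5)) by pos.
          nra.
    - unfold q. unfold Rdiv. rewrite !Rmult_assoc. apply Rmult_le_compat_l; [lra|].
      rewrite Rmult_comm. apply Rmult_le_compat_r; [left; apply exp_pos|].
      apply Rinv_le_contravar; unfold q in Hq; lra. }
  unfold Rpower.
  apply Rle_trans with (K / (1 - q0) * exp (- (PI * y)) * exp (INR k / 2 * ln y)).
  - apply Rmult_le_compat_r; [left; apply exp_pos|exact H1].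
  - rewrite Rmult_assoc, <- exp_plus. apply Rmult_le_compat_l.
    + pos.
    + apply exp_le_mono.
      (* The tangent to the logarithm at k/2, the point where y^(k/2) exp(-y) is largest. *)
      assert (L : ln y <= ln (INR k / 2) + (y / (INR k / 2) - 1)).
      { replace y with (INR k / 2 * (y / (INR k / 2))) at 1 by (field; lra).
        assert (0 < y / (INR k / 2)) by pos.
        rewrite ln_mult by lra. apply Rplus_le_compat_l.
        pose proof (exp_ineq1_le (ln (y / (INR k / 2)))) as E. rewrite exp_ln in E by lra. lra. }
      apply (Rmult_le_compat_l (INR k / 2)) in L; [|lra].
      replace (INR k / 2 * (ln (INR k / 2) + (y / (INR k / 2) - 1))) with
        (INR k / 2 * ln (INR k / 2) + y - INR k / 2) in L by (field; lra).
      pose proof (PI2_1). nra.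
Qed.

Lemma Im_mobius (a b c d : R) z : a * d - b * c = 1 -> (RtoC c * z + RtoC d)%C <> 0%C ->
  Im ((RtoC a * z + RtoC b) / (RtoC c * z + RtoC d))%C = Im z / Cmod (RtoC c * z + RtoC d)%C ^ 2.
Proof.
  intros Hdet Hn. rewrite Cmod_sqr.
  assert (Hq : (c * fst z + d) ^ 2 + (c * snd z) ^ 2 <> 0).
  { intros E. assert (c * fst z + d = 0) by nra. assert (c * snd z = 0) by nra.
    apply Hn. apply Ceq; unfold RtoC, Cmult, Cplus; simpl; lra. }
  unfold Im, Re, Cdiv, Cinv, Cmult, Cplus, RtoC; simpl.
  replace (c * fst z - 0 * snd z + d) with (c * fst z + d) by ring.
  replace (c * snd z + 0 * fst z + 0) with (c * snd z) by ring.
  replace (snd z) with ((a * d - b * c) * snd z) at 8 by (rewrite Hdet; ring).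
  field. simpl in Hq. intros E; apply Hq; lra.
Qed.

Lemma mobius_den_nz (c d : R) z : 0 < Im z -> c <> 0 \/ d <> 0 -> (RtoC c * z + RtoC d)%C <> 0%C.
Proof.
  intros Hz Hcd E.
  assert (E1 : Im (RtoC c * z + RtoC d)%C = 0) by (rewrite E; reflexivity).
  assert (E2 : Re (RtoC c * z + RtoC d)%C = 0) by (rewrite E; reflexivity).
  unfold Im, Re, Cmult, Cplus, RtoC in *; simpl in *.
  assert (c * snd z = 0) by lra.
  destruct (Rmult_integral _ _ H); [|lra]. subst c. destruct Hcd; lra.
Qed.

(** y^(k/2) |f| is invariant under the modular group. Instead of a fundamental domain, a Dirichlet
    approximation p/q of x with denominators up to about y^(-1/2) is used: |qz - p|^2 <= 5y, so the
    matrix with lower row (q, -p) lifts z to height at least 1/5. *)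
Theorem mf_bound k f A : modform k f A -> exists B, 0 < B /\ forall z, 0 < Im z -> Cmod (f z) * Rpower (Im z) (INR k / 2) <= B.
Proof.
  intros Hf. destruct (mf_high _ _ _ Hf) as (B & HB & H).
  exists B. split; [exact HB|]. intros z Hz.
  destruct (Rle_dec (/ 5) (Im z)) as [Hh|Hh]; [auto|].
  set (y := Im z) in *. set (x := Re z).
  pose proof (sqrt_lt_R0 _ Hz) as Hs. pose proof (sqrt_sqrt y (Rlt_le _ _ Hz)) as Hss.
  assert (Hs1 : sqrt y < 1) by arith.
  assert (Hinv : 1 < / sqrt y) by (rewrite <- Rinv_1; apply Rinv_lt_contravar; lra).
  set (Q := Z.to_nat (Zfloor (/ sqrt y))).
  destruct (Zfloor_bound (/ sqrt y)) as [F1 F2].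
  assert (F0 : (0 <= Zfloor (/ sqrt y))%Z) by (apply Zfloor_lub; simpl; lra).
  assert (HQ : INR Q = IZR (Zfloor (/ sqrt y))) by (unfold Q; rewrite INR_IZR_INZ, Z2Nat.id; auto).
  destruct (dirichlet Q x) as (p & s & q & r & Hdet & Hq & Hap).
  assert (Hq1 : 1 <= IZR q) by (apply IZR_le; lia).
  assert (Hq2 : IZR q <= INR Q + 1) by (rewrite <- S_INR, INR_IZR_INZ; apply IZR_le; lia).
  rewrite !S_INR in Hap.
  set (w := (RtoC (IZR q) * z + RtoC (IZR (- p)))%C).
  assert (Hw : w <> 0%C) by (apply mobius_den_nz; [exact Hz|left; lra]).
  assert (HN : Cmod w ^ 2 = (IZR q * x - IZR p) ^ 2 + (IZR q * y) ^ 2).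
  { rewrite Cmod_sqr. unfold w, x, y, Re, Im, Cmult, Cplus, RtoC; simpl. rewrite opp_IZR. ring. }
  assert (Hw5 : Cmod w ^ 2 <= 5 * y).
  { rewrite HN.
    assert (T1 : Rabs (IZR q * x - IZR p) <= sqrt y).
    { apply Rmult_le_reg_r with (/ sqrt y); [lra|]. rewrite Rinv_r by lra.
      eapply Rle_trans; [|exact Hap]. apply Rmult_le_compat_l; [apply Rabs_pos|]. lra. }
    assert (T2 : (IZR q * x - IZR p) ^ 2 <= y).
    { rewrite <- Hss, <- Rsqr_pow2, Rsqr_abs. unfold Rsqr.
      apply Rmult_le_compat; auto using Rabs_pos. }
    assert (T3 : IZR q * y <= 2 * sqrt y).
    { replace (2 * sqrt y) with (2 * / sqrt y * y) by (rewrite <- Hss at 2; field; lra).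
      apply Rmult_le_compat_r; lra. }
    assert (T4 : (IZR q * y) ^ 2 <= 4 * y).
    { assert (0 <= IZR q * y) by nra. nra. }
    lra. }
  assert (Hmp : 0 < Cmod w) by (apply Cmod_gt_0, Hw).
  pose proof (mf_modular _ _ _ Hf (- r)%Z s q (- p)%Z ltac:(lia) z Hz) as Hmod.
  set (gz := ((RtoC (IZR (- r)) * z + RtoC (IZR s)) / (RtoC (IZR q) * z + RtoC (IZR (- p))))%C) in *.
  assert (HY : Im gz = y / Cmod w ^ 2).
  { unfold gz. rewrite Im_mobius; [reflexivity| |exact Hw].
    rewrite !opp_IZR. rewrite <- (mult_IZR s q). replace (- IZR r * - IZR p) with (IZR p * IZR r) by ring.
    rewrite <- mult_IZR, <- minus_IZR, Hdet. reflexivity. }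
  assert (Hw2 : 0 < Cmod w ^ 2) by pos.
  assert (HY5 : / 5 <= Im gz).
  { rewrite HY. apply Rmult_le_reg_r with (Cmod w ^ 2); [lra|].
    unfold Rdiv. rewrite Rmult_assoc, Rinv_l by lra. lra. }
  specialize (H gz HY5). fold w in Hmod. rewrite Hmod, Cmod_mult, Cmod_pow, HY in H.
  eapply Rle_trans; [|exact H]. right.
  unfold Rdiv at 2. rewrite <- Rpower_mult_distr; [|exact Hz|pos].
  replace (Rpower (/ Cmod w ^ 2) (INR k / 2)) with (/ Cmod w ^ k).
  - field. apply pow_nonzero. lra.
  - rewrite <- Rpower_pow, <- (Rpower_pow 2) by lra. rewrite <- !Rpower_Ropp.
    rewrite Rpower_mult. f_equal. simpl. field.
Qed.

(** * Path independence from termwise primitives *)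

Ltac asC := match goal with |- @eq _ ?a ?b => change (@eq C a b) end.

(** A primitive of e((m - mu) z). The term m = mu is the only one that is not periodic. *)
Definition prim (m mu : nat) (z : C) : C :=
  if Nat.eqb m mu then z
  else (e (RtoC (INR m - INR mu) * z) / (RtoC (2 * PI) * Ci * RtoC (INR m - INR mu)))%C.

Definition E (mu : nat) (z : C) : C := e (RtoC (- INR mu) * z)%C.

Lemma Dc_E mu g t d : Dc g t d ->
  Dc (fun s => E mu (g s)) t (RtoC (2 * PI) * Ci * (RtoC (- INR mu) * d) * E mu (g t))%C.
Proof.
  intros H. unfold E. apply (Dc_e (fun s => RtoC (- INR mu) * g s)%C).
  eapply Dc_eq; [apply Dc_mult; [apply Dc_const|exact H]|]. simpl. ring.
Qed.

Lemma two_pi_i_nz : (RtoC (2 * PI) * Ci)%C <> 0%C.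
Proof.
  apply Cmult_neq_0; [|apply Ci_nz].
  intros E0. apply RtoC_inj in E0. pose proof PI_RGT_0. lra.
Qed.

Lemma Dc_prim m mu g t d : Dc g t d ->
  Dc (fun s => prim m mu (g s)) t (e (RtoC (INR m) * g t) * (E mu (g t) * d))%C.
Proof.
  intros H. unfold prim, E. destruct (Nat.eqb m mu) eqn:Em.
  - apply Nat.eqb_eq in Em; subst m. eapply Dc_eq; [exact H|].
    rewrite Cmult_assoc, <- e_add.
    replace (RtoC (INR mu) * g t + RtoC (- INR mu) * g t)%C with (RtoC 0)
      by (rewrite RtoC_opp; ring).
    rewrite e_0. ring.
  - apply Nat.eqb_neq in Em.
    assert (Hn : RtoC (INR m - INR mu) <> 0%C).
    { intros E0. apply RtoC_inj in E0. apply Em, INR_eq. lra. }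
    eapply Dc_eq.
    + unfold Cdiv. apply Dc_mult; [|apply Dc_const].
      apply (Dc_e (fun s => RtoC (INR m - INR mu) * g s)%C).
      apply Dc_mult; [apply Dc_const|exact H].
    + rewrite Cmult_assoc, <- e_add.
      replace (RtoC (INR m) * g t + RtoC (- INR mu) * g t)%C with (RtoC (INR m - INR mu) * g t)%C
        by (rewrite RtoC_minus, RtoC_opp; ring).
      simpl. pose proof two_pi_i_nz. field. repeat split; auto.
      * intros E0. apply H0. rewrite E0. ring.
      * intros E0. apply H0. rewrite E0. ring.
Qed.

Lemma ex_RInt_cont (g : R -> R) a b : a <= b -> (forall x, a <= x <= b -> continuous g x) -> ex_RInt g a b.
Proof.
  intros Hab H. apply (@ex_RInt_continuous R_CompleteNormedModule).
  rewrite Rmin_left, Rmax_right by lra. exact H.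
Qed.

(** The integral of f(z) e(-mu z) from [z0] to [z1], expressed by termwise primitives, so that it
    visibly depends on the end points alone. *)
Definition pathval (A : nat -> C) (mu : nat) (z0 z1 l : C) : Prop :=
  Cseries (fun m => A (S m) * (prim (S m) mu z1 - prim (S m) mu z0))%C l.

Lemma geom_small K q I eps : 0 < K -> 0 < q < 1 -> 0 <= I -> 0 < eps ->
  exists N, forall n, (N <= n)%nat -> K * q ^ n * I < eps.
Proof.
  intros HK Hq HI He.
  destruct (pow_lt_1_zero q ltac:(rewrite Rabs_right; lra) (eps / (K * (I + 1)))) as [N HN].
  { pos. }
  exists N. intros n Hn. specialize (HN n Hn).
  rewrite Rabs_right in HN by (apply Rle_ge, pow_le; lra).
  apply (Rmult_lt_compat_r (K * (I + 1))) in HN; [|nra].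
  unfold Rdiv in HN. rewrite Rmult_assoc, Rinv_l, Rmult_1_r in HN by nra.
  nra.
Qed.

(** Termwise integration, justified by the uniform tail bound on Im z >= delta. Together with the
    uniqueness of the sum of a series it plays the part of Cauchy's theorem. *)
Lemma path_series k f A mu g dg a b delta : modform k f A -> a <= b -> 0 < delta ->
  (forall t, a <= t <= b -> Dc g t (dg t)) ->
  (forall t, a <= t <= b -> Cc dg t) ->
  (forall t, a <= t <= b -> delta <= Im (g t)) ->
  pathval A mu (g a) (g b) (CInt (fun t => f (g t) * (E mu (g t) * dg t))%C a b).
Proof.
  intros Hf Hab Hd H1 H2 H3. unfold pathval.
  destruct (series_tail _ _ _ Hf delta Hd) as (K & q & HK & Hq & Ht).
  set (w := fun t => (E mu (g t) * dg t)%C).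
  assert (Hw : forall t, a <= t <= b -> Cc w t).
  { intros t Hi. apply Cc_mult; [|auto]. eapply Dc_Cc, Dc_E, H1, Hi. }
  assert (Hwi : ex_RInt (fun t => Cmod (w t)) a b).
  { apply ex_RInt_cont; [exact Hab|]. intros t Hi. apply Cc_Cmod, Hw, Hi. }
  destruct Hwi as [I HI].
  assert (HI0 : 0 <= I).
  { apply (is_RInt_ge_0 (fun t => Cmod (w t)) a b); auto. intros; apply Cmod_ge_0. }
  set (P := fun n t => Csum (fun m => A (S m) * e (RtoC (INR (S m)) * g t))%C n).
  set (T := fun m => (A (S m) * (prim (S m) mu (g b) - prim (S m) mu (g a)))%C).
  assert (Hterm : forall m, @is_RInt C_R_NormedModule
    (fun t => (A (S m) * e (RtoC (INR (S m)) * g t)) * w t)%C a b (T m)).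
  { intros m. unfold T.
    apply (is_RInt_ext (fun t => (A (S m) * (e (RtoC (INR (S m)) * g t) * w t))%C)).
    { intros t _. asC. ring. }
    apply is_CInt_scal. apply (CInt_FTC (fun t => prim (S m) mu (g t))).
    - exact Hab.
    - intros t Hi. apply Dc_prim, H1, Hi.
    - intros t Hi. apply Cc_mult; [|apply Hw, Hi].
      eapply Dc_Cc. apply (Dc_e (fun s => RtoC (INR (S m)) * g s)%C).
      apply Dc_mult; [apply Dc_const|apply H1, Hi]. }
  assert (HP : forall n, @is_RInt C_R_NormedModule (fun t => P n t * w t)%C a b (Csum T n)).
  { induction n.
    - rewrite Csum_0. unfold P. eapply is_RInt_ext; [|apply (Hterm 0%nat)].
      intros t _. cbv beta. rewrite Csum_0. reflexivity.
    - rewrite Csum_S. eapply is_RInt_ext;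
        [|apply (@is_RInt_plus C_R_NormedModule _ _ _ _ _ _ IHn (Hterm (S n)))].
      intros t _. unfold P. rewrite Csum_S.
      change (P n t * w t + (A (S (S n)) * e (RtoC (INR (S (S n))) * g t)) * w t =
        (P n t + A (S (S n)) * e (RtoC (INR (S (S n))) * g t)) * w t)%C. ring. }
  assert (Hfi : @ex_RInt C_R_NormedModule (fun t => f (g t) * w t)%C a b).
  { apply ex_CInt_le; [exact Hab|]. intros t Hi. apply Cc_mult; [|auto].
    apply (mf_Cc _ _ _ _ _ Hf); [eapply Dc_Cc, H1, Hi|]. specialize (H3 t Hi); lra. }
  change (Cseries T (CInt (fun t => f (g t) * w t)%C a b)).
  apply Cseries_eps. intros eps He.
  destruct (geom_small K q I eps HK Hq HI0 He) as [N HN]. exists N. intros n Hn.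
  eapply Rle_lt_trans; [|apply (HN n Hn)].
  replace (Csum T n - CInt (fun t => f (g t) * w t)%C a b)%C with
    (- (CInt (fun t => f (g t) * w t - P n t * w t)%C a b))%C.
  2:{ rewrite CInt_minus; [|exact Hfi|eexists; apply HP].
      rewrite (is_CInt_unique _ _ _ _ (HP n)). ring. }
  rewrite Cmod_opp.
  apply (CInt_le _ (fun t => K * q ^ n * Cmod (w t)) a b); [exact Hab| | |].
  - apply (@ex_RInt_minus C_R_NormedModule); [exact Hfi|eexists; apply HP].
  - apply (@is_RInt_scal R_NormedModule). exact HI.
  - intros t Hi. replace (f (g t) * w t - P n t * w t)%C with ((f (g t) - P n t) * w t)%C by ring.
    rewrite Cmod_mult. apply Rmult_le_compat_r; [apply Cmod_ge_0|].
    apply Ht, H3, Hi.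
Qed.

Lemma pathval_add A mu z0 z1 z2 l l' : pathval A mu z0 z1 l -> pathval A mu z1 z2 l' ->
  pathval A mu z0 z2 (l + l')%C.
Proof.
  intros H H'. unfold pathval in *.
  eapply is_series_ext; [|apply (@is_series_plus C_AbsRing C_NormedModule _ _ _ _ H H')].
  intros n. cbv [plus]; simpl. ring.
Qed.

Lemma pathval_unique A mu z0 z1 l l' : pathval A mu z0 z1 l -> pathval A mu z0 z1 l' -> l = l'.
Proof. apply Cseries_unique. Qed.

Lemma Cseries_single (a : nat -> C) N : (forall m, m <> N -> a m = 0%C) -> Cseries a (a N).
Proof.
  intros H. apply Cseries_eps. intros eps He. exists N. intros n Hn.
  assert (Hs : (Csum a n : C) = a N).
  { assert (Hlt : forall m, (m < N)%nat -> (Csum a m : C) = 0%C).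
    { induction m; intros Hm; [rewrite Csum_0; apply H; lia|].
      rewrite Csum_S, IHm, (H (S m)) by lia. ring. }
    induction Hn as [|n Hn IH].
    - destruct N; [apply Csum_0|]. rewrite Csum_S, Hlt by lia. ring.
    - rewrite Csum_S, IH, (H (S n)) by lia. ring. }
  rewrite Hs. replace (a N - a N)%C with (RtoC 0) by ring. rewrite Cmod_0. exact He.
Qed.

Definition pt (x y : R) : C := (x, y).

Lemma Dc_hline (y x : R) : Dc (fun t => pt t y) x 1%C.
Proof.
  unfold pt. apply Dc_pair; simpl; [apply (@is_derive_id R_AbsRing)|
    apply (@is_derive_const R_AbsRing R_NormedModule)].
Qed.

(** Over a full period each periodic primitive returns to its value, and the exceptional one grows
    by 1. *)
Lemma coef_int k f A n s y : modform k f A -> 0 < y ->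
  CInt (fun x => f (pt x y) * (E (S n) (pt x y) * 1))%C s (s + 1) = A (S n).
Proof.
  intros Hf Hy.
  eapply Cseries_unique.
  - apply (path_series k f A (S n) (fun t => pt t y) (fun _ => 1%C) s (s + 1) y Hf).
    + lra.
    + exact Hy.
    + intros t _. apply Dc_hline.
    + intros t _. apply Cc_const.
    + intros t _. unfold Im; simpl; lra.
  - set (a := fun m : nat => (A (S m) * (prim (S m) (S n) (pt (s + 1) y) - prim (S m) (S n) (pt s y)))%C).
    replace (A (S n)) with (a n).
    + apply Cseries_single. intros m Hm. unfold a, prim.
      replace (Nat.eqb (S m) (S n)) with false by (symmetry; apply Nat.eqb_neq; lia).
      replace (RtoC (INR (S m) - INR (S n)) * (pt (s + 1) y))%C with
        (RtoC (INR (S m) - INR (S n)) * (pt s y) + RtoC (INR (S m) - INR (S n)))%C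
        by (apply Ceq; simpl; ring).
      rewrite e_add. rewrite !INR_IZR_INZ, <- minus_IZR, e_Z. unfold Cdiv. ring.
    + unfold a, prim. rewrite Nat.eqb_refl.
      replace ((pt (s + 1) y) - (pt s y))%C with (RtoC 1) by (apply Ceq; simpl; ring). ring.
Qed.

Lemma mf_bound_at k f B z delta : 0 < delta -> delta <= Im z ->
  Cmod (f z) * Rpower (Im z) (INR k / 2) <= B ->
  Cmod (f z) <= B * Rpower delta (- (INR k / 2)).
Proof.
  intros Hd Hz H.
  assert (H1 : Rpower delta (INR k / 2) <= Rpower (Im z) (INR k / 2)).
  { apply Rle_Rpower_l; [|lra]. pose proof (pos_INR k); lra. }
  assert (H2 : 0 < Rpower delta (INR k / 2)) by arith.
  rewrite Rpower_Ropp. apply Rmult_le_reg_r with (Rpower delta (INR k / 2)); [exact H2|].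
  rewrite Rmult_assoc, Rinv_l, Rmult_1_r by lra.
  eapply Rle_trans; [|exact H]. apply Rmult_le_compat_l; [apply Cmod_ge_0|exact H1].
Qed.

Definition bounded_by (k : nat) (f : C -> C) (B : R) : Prop :=
  0 < B /\ forall z, 0 < Im z -> Cmod (f z) * Rpower (Im z) (INR k / 2) <= B.

Lemma Cmod_E mu z : Cmod (E mu z) = exp (2 * PI * INR mu * Im z).
Proof. unfold E. rewrite Cmod_e, Im_scal. f_equal. ring. Qed.

(** Meant for the short segments that join the ends of two paths: the lower height [delta] controls
    f and the upper height [h] controls e(-mu z). *)
Lemma seg_path k f A B mu z1 z2 delta h len : modform k f A -> bounded_by k f B ->
  0 < delta -> delta <= Im z1 <= h -> delta <= Im z2 <= h -> Cmod (z2 - z1)%C <= len ->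
  exists l, pathval A mu z1 z2 l /\
    Cmod l <= B * Rpower delta (- (INR k / 2)) * exp (2 * PI * INR mu * h) * len.
Proof.
  intros Hf [HB Hb] Hd Hz1 Hz2 Hlen.
  set (g := fun t : R => (z1 + RtoC t * (z2 - z1))%C).
  assert (HI : forall t, Im (g t) = Im z1 + t * (Im z2 - Im z1)).
  { intros t. unfold g, Im, Cplus, Cmult, Cminus, Copp, RtoC; simpl. ring. }
  assert (HIm : forall t, 0 <= t <= 1 -> delta <= Im (g t) <= h).
  { intros t Ht. rewrite HI. nra. }
  assert (Hg : forall t, Dc g t (z2 - z1)%C).
  { intros t. eapply Dc_eq.
    - apply Dc_plus; [apply Dc_const|]. apply Dc_mult; [apply Dc_id|apply Dc_const].
    - simpl. ring. }
  pose proof (path_series k f A mu g (fun _ => (z2 - z1)%C) 0 1 delta Hf ltac:(lra) Hd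
    (fun t _ => Hg t) (fun t _ => Cc_const _ t) (fun t Ht => proj1 (HIm t Ht))) as HP.
  replace (g 0) with z1 in HP by (unfold g; ring).
  replace (g 1) with z2 in HP by (unfold g; ring).
  eexists; split; [exact HP|].
  replace (B * Rpower delta (- (INR k / 2)) * exp (2 * PI * INR mu * h) * len) with
    (B * Rpower delta (- (INR k / 2)) * exp (2 * PI * INR mu * h) * len * (1 - 0)) by ring.
  apply CInt_bound; [lra| |].
  - apply ex_CInt_le; [lra|]. intros t Ht. apply Cc_mult.
    + apply (mf_Cc _ _ _ _ _ Hf); [eapply Dc_Cc, Hg|]. specialize (HIm t Ht). lra.
    + apply Cc_mult; [|apply Cc_const]. eapply Dc_Cc, Dc_E, Hg.
  - intros t Ht. specialize (HIm t Ht). rewrite !Cmod_mult, Cmod_E.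
    rewrite (Rmult_assoc (B * _)).
    apply Rmult_le_compat; [apply Cmod_ge_0| | |].
    + pos.
    + apply (mf_bound_at k f B (g t) delta); [lra|lra|]. apply Hb. lra.
    + apply Rmult_le_compat; [left; apply exp_pos|apply Cmod_ge_0| |exact Hlen].
      apply exp_le_mono. pose proof PI_RGT_0. pose proof (pos_INR mu).
      apply Rmult_le_compat_l; [|lra]. nra.
Qed.

(** * Moebius substitutions and the change of path *)

Definition den (c d v y : R) : C := (RtoC c * pt v y + RtoC d)%C.

Definition mob (a b c d : R) (z : C) : C := ((RtoC a * z + RtoC b) / (RtoC c * z + RtoC d))%C.

Lemma den_parts c d v y : den c d v y = (c * v + d, c * y).
Proof. unfold den, pt, Cmult, Cplus, RtoC; simpl. apply Ceq; simpl; ring. Qed.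

Lemma den_nz c d v y : c * v + d <> 0 -> den c d v y <> 0%C.
Proof.
  intros H E0. rewrite den_parts in E0. apply H. apply (f_equal fst) in E0. exact E0.
Qed.

Lemma Dc_den c d v y : Dc (fun t => den c d t y) v (RtoC c).
Proof.
  unfold den. eapply Dc_eq.
  - apply Dc_plus; [|apply Dc_const]. apply Dc_mult; [apply Dc_const|apply Dc_hline].
  - simpl. ring.
Qed.

Lemma Dc_mob a b c d v y : a * d - b * c = 1 -> c * v + d <> 0 ->
  Dc (fun t => mob a b c d (pt t y)) v (/ (den c d v y * den c d v y))%C.
Proof.
  intros Hdet Hn. pose proof (den_nz c d v y Hn) as Hd.
  unfold mob, Cdiv. eapply Dc_eq.
  - apply Dc_mult; [|apply Dc_inv; [apply (Dc_den c d v y)|exact Hd]].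
    apply (Dc_den a b v y).
  - simpl. fold (den c d v y).
    change (RtoC a * pt v y + RtoC b)%C with (den a b v y).
    assert (HH : (RtoC a * den c d v y - RtoC c * den a b v y)%C = 1%C).
    { unfold den. replace (RtoC 1) with (RtoC a * RtoC d - RtoC b * RtoC c)%C; [ring|].
      rewrite <- !RtoC_mult, <- RtoC_minus, Hdet. reflexivity. }
    transitivity ((RtoC a * den c d v y - RtoC c * den a b v y) / (den c d v y * den c d v y))%C.
    + field. exact Hd.
    + rewrite HH. field. exact Hd.
Qed.

(** The displacement iy is divided by the denominators at both points because the determinant is 1.
    It serves twice: to compare path ends, and later to write an image point as a real point plus a
    small shift. *)
Lemma mob_diff a b c d v y : a * d - b * c = 1 -> c * v + d <> 0 ->
  (mob a b c d (pt v y) - RtoC ((a * v + b) / (c * v + d)))%C =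
  (Ci * RtoC y / (den c d v y * RtoC (c * v + d)))%C.
Proof.
  intros Hdet Hn. pose proof (den_nz c d v y Hn) as Hd.
  assert (Hr : RtoC (c * v + d) <> 0%C) by (intros E0; apply RtoC_inj in E0; lra).
  assert (Hi : RtoC y = (RtoC (a * d - b * c) * RtoC y)%C) by (rewrite Hdet; ring).
  rewrite Hi, RtoC_div by exact Hn. unfold mob. fold (den c d v y).
  rewrite RtoC_minus, !RtoC_plus, !RtoC_mult in *.
  unfold den, pt in *.
  replace ((v, y) : C) with (RtoC v + Ci * RtoC y)%C in * by (apply Ceq; simpl; ring).
  field. split; assumption.
Qed.

Lemma Cmod_den_ge c d v y : Rabs (c * v + d) <= Cmod (den c d v y).
Proof. rewrite den_parts. apply (Re_le_Cmod (c * v + d, c * y)). Qed.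

Lemma Cmod_den_sqr c d v y : Cmod (den c d v y) ^ 2 = (c * v + d) ^ 2 + (c * y) ^ 2.
Proof. rewrite den_parts, Cmod_sqr. reflexivity. Qed.

(** Since |cz + d| is of size S on the line of height y = S^2/mu, its image stays at heights between
    1/(37 mu) and 1/mu, and its ends lie within 2/mu of those of the horizontal path at height 1/mu.
    Two connecting segments close the contour and form the error; modularity turns the integral
    along the image into one of f at height y. *)
Lemma link k f A B mu (a b c d : Z) s v1 v2 S : modform k f A -> bounded_by k f B ->
  (a * d - b * c = 1)%Z -> (1 <= mu)%nat -> v1 <= v2 -> 0 < S -> (s = 1 \/ s = -1) ->
  (forall v, v1 <= v <= v2 -> S <= s * (IZR c * v + IZR d) <= 6 * S) ->
  let y := S ^ 2 / INR mu in
  Rabs (IZR c) * y <= S ->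
  let sg v := (IZR a * v + IZR b) / (IZR c * v + IZR d) in
  sg v1 <= sg v2 /\
  Cmod (CInt (fun x => f (pt x (/ INR mu)) * (E mu (pt x (/ INR mu)) * 1))%C (sg v1) (sg v2) -
    CInt (fun v => f (pt v y) * (den (IZR c) (IZR d) v y ^ k / (den (IZR c) (IZR d) v y ^ 2) *
       E mu (mob (IZR a) (IZR b) (IZR c) (IZR d) (pt v y))))%C v1 v2)%C
  <= 4 * B * Rpower 37 (INR k / 2) * exp (2 * PI) * (Rpower (INR mu) (INR k / 2) / INR mu).
Proof.
  intros Hf Hb Hdet Hmu Hv HS Hs Hden y Hcy sg.
  assert (Hmu1 : 1 <= INR mu) by (apply (le_INR 1); exact Hmu).
  assert (Hdetr : IZR a * IZR d - IZR b * IZR c = 1)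
    by (rewrite <- !mult_IZR, <- minus_IZR, Hdet; reflexivity).
  assert (Hy : 0 < y) by (unfold y; apply Rdiv_lt_0_compat; [nra|lra]).
  set (ca := IZR a) in *. set (cb := IZR b) in *. set (cc := IZR c) in *. set (cd := IZR d) in *.
  assert (Hnz : forall v, v1 <= v <= v2 -> cc * v + cd <> 0).
  { intros v Hi. specialize (Hden v Hi). intros E0. rewrite E0 in Hden. lra. }
  assert (Hab : forall v, v1 <= v <= v2 -> Rabs (cc * v + cd) = s * (cc * v + cd)).
  { intros v Hi. specialize (Hden v Hi). destruct Hs; subst s.
    - rewrite Rabs_right; lra.
    - rewrite Rabs_left; lra. }
  assert (Hmono : sg v1 <= sg v2).
  { pose proof (Hnz v1 ltac:(lra)). pose proof (Hnz v2 ltac:(lra)).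
    apply Rminus_le. replace (sg v1 - sg v2) with
      (- ((v2 - v1) / ((cc * v1 + cd) * (cc * v2 + cd)))).
    - pose proof (Hden v1 ltac:(lra)). pose proof (Hden v2 ltac:(lra)).
      assert (0 < (cc * v1 + cd) * (cc * v2 + cd)) by arith.
      assert (0 <= (v2 - v1) / ((cc * v1 + cd) * (cc * v2 + cd))) by pos.
      lra.
    - unfold sg. replace (v2 - v1) with ((ca * cd - cb * cc) * (v2 - v1)) by (rewrite Hdetr; ring).
      field. auto. }
  split; [exact Hmono|].
  (* 37 = 6^2 + 1, from |cv + d| <= 6S and |c| y <= S. *)
  assert (HP : forall v, v1 <= v <= v2 -> S ^ 2 <= Cmod (den cc cd v y) ^ 2 <= 37 * S ^ 2).
  { intros v Hi. rewrite Cmod_den_sqr. specialize (Hden v Hi).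
    assert ((cc * v + cd) ^ 2 = (s * (cc * v + cd)) ^ 2) by arith.
    assert ((cc * y) ^ 2 = (Rabs cc * y) ^ 2) by (rewrite !Rpow_mult_distr, <- (pow2_abs cc); reflexivity).
    rewrite H, H0. assert (0 <= Rabs cc * y) by pos.
    split; nra. }
  set (M v := mob ca cb cc cd (pt v y)).
  assert (HIm : forall v, v1 <= v <= v2 -> / (37 * INR mu) <= Im (M v) <= / INR mu).
  { intros v Hi. unfold M, mob. rewrite Im_mobius; [|exact Hdetr|].
    2:{ apply (den_nz cc cd v y), Hnz, Hi. }
    change (Im (pt v y)) with y. change (RtoC cc * pt v y + RtoC cd)%C with (den cc cd v y).
    specialize (HP v Hi). assert (0 < S ^ 2) by nra.
    replace (/ (37 * INR mu)) with (y * / (37 * S ^ 2)) by (unfold y; field; split; nra).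
    replace (/ INR mu) with (y * / S ^ 2) by (unfold y; field; split; nra).
    split; (apply Rmult_le_compat_l; [lra|]); apply Rinv_le_contravar; lra. }
  assert (Hdist : forall v, v1 <= v <= v2 -> Cmod (M v - pt (sg v) (/ INR mu))%C <= 2 * / INR mu).
  { intros v Hi.
    replace (M v - pt (sg v) (/ INR mu))%C with
      ((M v - RtoC (sg v)) + - (Ci * RtoC (/ INR mu)))%C.
    2:{ unfold pt. apply Ceq; simpl; ring. }
    via Cmod_triangle.
    rewrite Cmod_opp, Cmod_mult, Cmod_Ci, Cmod_R, Rabs_right
      by (left; apply Rinv_0_lt_compat; lra).
    assert (Cmod (M v - RtoC (sg v))%C <= / INR mu); [|lra].
    unfold M, sg. rewrite mob_diff by auto.
    pose proof (den_nz cc cd v y (Hnz v Hi)) as Hdz.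
    rewrite Cmod_div, !Cmod_mult, Cmod_Ci, !Cmod_R, (Rabs_right y) by
      (first [lra | apply Cmult_neq_0; [exact Hdz| intros E0; apply RtoC_inj in E0; apply (Hnz v Hi E0)]]).
    rewrite (Hab v Hi). specialize (Hden v Hi). pose proof (Cmod_den_ge cc cd v y) as G.
    rewrite (Hab v Hi) in G.
    replace (/ INR mu) with (y * / (S * S)) by (unfold y; field; split; nra).
    rewrite Rmult_1_l. apply Rmult_le_compat_l; [lra|]. apply Rinv_le_contravar; nra. }
  set (delta := / (37 * INR mu)).
  assert (Hdelta : 0 < delta) by (unfold delta; apply Rinv_0_lt_compat; lra).
  assert (Hdl : delta <= / INR mu) by (unfold delta; apply Rinv_le_contravar; lra).
  pose proof (path_series k f A mu (fun t => pt t (/ INR mu)) (fun _ => 1%C) (sg v1) (sg v2)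
    delta Hf Hmono Hdelta (fun t _ => Dc_hline (/ INR mu) t) (fun t _ => Cc_const _ t)
    (fun t _ => Hdl)) as P1.
  pose proof (path_series k f A mu M (fun v => / (den cc cd v y * den cc cd v y))%C v1 v2
    delta Hf Hv Hdelta (fun t Ht => Dc_mob ca cb cc cd t y Hdetr (Hnz t Ht))) as P2.
  assert (P2' := P2 ltac:(intros t Ht; eapply Dc_Cc, Dc_inv;
    [apply Dc_mult; apply Dc_den|apply Cmult_neq_0; apply den_nz, Hnz, Ht])
    (fun t Ht => proj1 (HIm t Ht))).
  clear P2.
  destruct (seg_path k f A B mu (pt (sg v1) (/ INR mu)) (M v1) delta (/ INR mu) (2 * / INR mu) Hf Hb Hdelta)
    as (l1 & L1 & L1b).
  { unfold Im, pt; simpl; lra. } { apply HIm; lra. } { apply Hdist; lra. }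
  destruct (seg_path k f A B mu (M v2) (pt (sg v2) (/ INR mu)) delta (/ INR mu) (2 * / INR mu) Hf Hb Hdelta)
    as (l2 & L2 & L2b).
  { apply HIm; lra. } { unfold Im, pt; simpl; lra. }
  { replace (pt (sg v2) (/ INR mu) - M v2)%C with (- (M v2 - pt (sg v2) (/ INR mu)))%C by ring.
    rewrite Cmod_opp. apply Hdist; lra. }
  (* The direct route and the route through both segments have the same path value, so the
     difference to be estimated is exactly [l1 + l2]. *)
  pose proof (pathval_unique _ _ _ _ _ _ P1 (pathval_add _ _ _ _ _ _ _
     (pathval_add _ _ _ _ _ _ _ L1 P2') L2)) as HE.
  rewrite HE.
  replace (CInt (fun v => f (pt v y) * (den cc cd v y ^ k / den cc cd v y ^ 2 *
       E mu (mob ca cb cc cd (pt v y))))%C v1 v2) with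
    (CInt (fun t => f (M t) * (E mu (M t) * / (den cc cd t y * den cc cd t y)))%C v1 v2).
  2:{ apply CInt_ext; [exact Hv|]. intros v Hi.
      pose proof (mf_modular _ _ _ Hf a b c d Hdet (pt v y) Hy) as HM.
      fold ca cb cc cd in HM. unfold M, mob. rewrite HM. change (RtoC cc * pt v y + RtoC cd)%C with (den cc cd v y).
      pose proof (den_nz cc cd v y (Hnz v ltac:(lra))). simpl Cpow. field. auto. }
  match goal with |- Cmod ?x <= _ => replace x with (l1 + l2)%C by ring end.
  via Cmod_triangle.
  eapply Rle_trans; [apply Rplus_le_compat; [exact L1b|exact L2b]|].
  right. unfold delta.
  replace (2 * PI * INR mu * / INR mu) with (2 * PI) by (field; lra).
  rewrite Rpower_Ropp.
  assert (HR : Rpower (/ (37 * INR mu)) (INR k / 2) = / (Rpower 37 (INR k / 2) * Rpower (INR mu) (INR k / 2))).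
  { rewrite Rpower_mult_distr by lra. unfold Rpower. rewrite <- exp_Ropp. f_equal.
    rewrite ln_Rinv by lra. ring. }
  rewrite HR, Rinv_inv. field. lra.
Qed.

(** * A first-derivative test for products of two weights *)

Ltac ccont := lazymatch goal with
  | |- Cc (fun _ => ?c) _ => apply Cc_const
  | |- Cc (fun t => Cplus (@?f t) (@?g t)) ?x => refine (Cc_plus f g x _ _); ccont
  | |- Cc (fun t => Cminus (@?f t) (@?g t)) ?x => refine (Cc_minus f g x _ _); ccont
  | |- Cc (fun t => Cmult (@?f t) (@?g t)) ?x => refine (Cc_mult f g x _ _); ccont
  | |- Cc (fun t => Copp (@?f t)) ?x => apply (Cc_opp f x); ccont
  | |- Cc (fun t => Cconj (@?f t)) ?x => apply (Cc_conj f x); ccont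
  | |- _ => idtac
  end.

Lemma Cmod_pow_le z X n : Cmod z <= X -> Cmod (z ^ n)%C <= X ^ n.
Proof. intros H. rewrite Cmod_pow. apply pow_incr. split; [apply Cmod_ge_0|exact H]. Qed.

Lemma Cmod_inv_le z m : 0 < m -> m <= Cmod z -> Cmod (/ z)%C <= / m.
Proof.
  intros Hm H. rewrite Cmod_inv.
  - apply Rinv_le_contravar; lra.
  - apply Cmod_gt_0. lra.
Qed.

Lemma ge_nz z m : 0 < m -> m <= Cmod z -> z <> 0%C.
Proof. intros H1 H2. apply Cmod_gt_0. lra. Qed.

(** The integrand is the derivative of a monotone function, so the bound does not involve the length
    of the interval. The number [sg] is the constant sign of cv + d. *)
Lemma RInt_inv_sqr (c d sg a b m : R) : (sg = 1 \/ sg = -1) -> a <= b -> 0 < m ->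
  (forall v, a <= v <= b -> m <= sg * (c * v + d)) ->
  exists I, is_RInt (fun v => Rabs c / (sg * (c * v + d)) ^ 2) a b I /\ I <= / m.
Proof.
  intros Hsg Hab Hm H.
  set (t := if Rle_dec 0 (sg * c) then 1 else -1).
  assert (Ht : Rabs c = t * (sg * c)).
  { unfold t. destruct (Rle_dec 0 (sg * c)); destruct Hsg; subst sg.
    - rewrite Rabs_right; lra. - rewrite Rabs_left1; lra.
    - rewrite Rabs_left1; lra. - rewrite Rabs_right; lra. }
  assert (Ht1 : t = 1 \/ t = -1) by (unfold t; destruct (Rle_dec 0 (sg * c)); auto).
  exists (- t / (sg * (c * b + d)) - - t / (sg * (c * a + d))).
  split.
  - apply (is_RInt_derive (fun v => - t / (sg * (c * v + d))) (fun v => Rabs c / (sg * (c * v + d)) ^ 2));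
      rewrite Rmin_left, Rmax_right by lra; intros v Hv; specialize (H v Hv).
    + assert (Hp : sg * (c * v + d) <> 0) by pos.
      rewrite Ht. auto_derive; [exact Hp|]. field.
      split; intros E0; apply Hp; rewrite E0; ring.
    + apply (@ex_derive_continuous R_AbsRing R_NormedModule). auto_derive.
      apply Rgt_not_eq. apply Rmult_lt_0_compat; lra.
  - pose proof (H a ltac:(lra)) as Ha. pose proof (H b ltac:(lra)) as Hb.
    assert (0 < / (sg * (c * a + d)) <= / m).
    { split; [pos|apply Rinv_le_contravar; lra]. }
    assert (0 < / (sg * (c * b + d)) <= / m).
    { split; [pos|apply Rinv_le_contravar; lra]. }
    unfold Rdiv. destruct Ht1 as [->| ->]; lra.
Qed.

Lemma signed_le_Rabs s x : s = 1 \/ s = -1 -> s * x <= Rabs x.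
Proof. intros [-> | ->]; unfold Rabs; destruct (Rcase_abs x); lra. Qed.

(* Away from the zeros of [P - Q] the integrand is
   [h F'] with [h = P^k Q^k / (2 pi i mu (P - Q)(P + Q))]. *)
Lemma vdc k mu c d y c' d' y' s sg a b S m K0 F0 (F : R -> C) :
  (1 <= k)%nat -> 0 < mu -> 0 < S -> 0 < m -> 0 <= K0 -> 0 <= F0 -> a <= b ->
  (s = 1 \/ s = -1) -> (sg = 1 \/ sg = -1) ->
  let P v := den c d v y in let Q v := den c' d' v y' in
  (forall v, a <= v <= b -> S <= s * (c * v + d)) ->
  (forall v, a <= v <= b -> S <= s * (c' * v + d')) ->
  (forall v, a <= v <= b -> Cmod (P v) <= 7 * S) ->
  (forall v, a <= v <= b -> Cmod (Q v) <= 7 * S) ->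
  (Rabs c + Rabs c') * (b - a) <= K0 * S ->
  (forall v, a <= v <= b -> m <= sg * ((c - c') * v + (d - d'))) ->
  (forall v, a <= v <= b ->
     Dc F v (RtoC (2 * PI) * Ci * RtoC mu * (/ (Q v ^ 2) - / (P v ^ 2)) * F v)%C) ->
  (forall v, a <= v <= b -> Cmod (F v) <= F0) ->
  Cmod (CInt (fun v => P v ^ k / (P v ^ 2) * (Q v ^ k / (Q v ^ 2)) * F v)%C a b) <=
  ((INR k + 1) * K0 + 3) * F0 * (7 * S) ^ (2 * k) / (mu * S * m).
Proof.
  intros Hk Hmu HS Hm HK0 HF0 Hab Hs Hsg P Q HP HQ HP7 HQ7 Hlen Hl HF HFb.
  set (kap := (/ (RtoC (2 * PI) * Ci * RtoC mu))%C).
  assert (Hmuz : RtoC mu <> 0%C) by (intros E0; apply RtoC_inj in E0; lra).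
  pose proof two_pi_i_nz as Hpi.
  assert (Hkap : Cmod kap <= / (2 * mu)).
  { unfold kap. pose proof PI2_1.
    apply Cmod_inv_le; [lra|].
    rewrite !Cmod_mult, Cmod_Ci, !Cmod_R, !Rabs_right by lra. nra. }
  assert (HPS : forall v, a <= v <= b -> S <= Cmod (P v)).
  { intros v Hv. via (HP v Hv). via (signed_le_Rabs s (c * v + d) Hs). apply Cmod_den_ge. }
  assert (HQS : forall v, a <= v <= b -> S <= Cmod (Q v)).
  { intros v Hv. via (HQ v Hv). via (signed_le_Rabs s (c' * v + d') Hs). apply Cmod_den_ge. }
  assert (HPQ : forall v, a <= v <= b -> sg * ((c - c') * v + (d - d')) <= Cmod (P v - Q v)%C).
  { intros v Hv. via (signed_le_Rabs sg ((c - c') * v + (d - d')) Hsg). eapply Rle_trans; [|apply Re_le_Cmod].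
    right. f_equal. unfold P, Q. rewrite !den_parts. unfold Re; simpl. ring. }
  assert (HPp : forall v, a <= v <= b -> 2 * S <= Cmod (P v + Q v)%C).
  { intros v Hv. eapply Rle_trans; [|apply Re_le_Cmod]. unfold P, Q. rewrite !den_parts. unfold Re; simpl.
    eapply Rle_trans; [|apply (signed_le_Rabs s _ Hs)]. pose proof (HP v Hv). pose proof (HQ v Hv). lra. }
  assert (DP : forall v, Dc P v (RtoC c)) by (intros v; apply Dc_den).
  assert (DQ : forall v, Dc Q v (RtoC c')) by (intros v; apply Dc_den).
  clearbody P Q.
  destruct k as [|p]; [lia|].
  set (X := 7 * S).
  set (h := fun v => (kap * (P v ^ suc p * Q v ^ suc p * (/ (P v - Q v) * / (P v + Q v))))%C).
  set (dh := fun v => (kap *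
     ((RtoC (INR (suc p)) * P v ^ p * RtoC c * Q v ^ suc p +
        P v ^ suc p * (RtoC (INR (suc p)) * Q v ^ p * RtoC c')) * (/ (P v - Q v) * / (P v + Q v)) +
      P v ^ suc p * Q v ^ suc p *
        (- (RtoC c - RtoC c') * (/ (P v - Q v) * / (P v - Q v)) * / (P v + Q v) +
         / (P v - Q v) * (- (RtoC c + RtoC c') * (/ (P v + Q v) * / (P v + Q v))))))%C).
  assert (NPQ : forall v, a <= v <= b -> (P v - Q v)%C <> 0%C).
  { intros v Hv. apply (ge_nz _ m Hm). eapply Rle_trans; [apply (Hl v Hv)|apply HPQ, Hv]. }
  assert (NPp : forall v, a <= v <= b -> (P v + Q v)%C <> 0%C).
  { intros v Hv. apply (ge_nz _ (2 * S)); [lra|]. apply HPp, Hv. }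
  assert (NP : forall v, a <= v <= b -> P v <> 0%C).
  { intros v Hv. apply (ge_nz _ S HS), HPS, Hv. }
  assert (NQ : forall v, a <= v <= b -> Q v <> 0%C).
  { intros v Hv. apply (ge_nz _ S HS), HQS, Hv. }
  assert (CR : forall v, a <= v <= b -> Cc (fun t => / (P t - Q t))%C v).
  { intros v Hv. eapply Dc_Cc, Dc_inv; [apply Dc_minus; auto|apply NPQ, Hv]. }
  assert (CT : forall v, a <= v <= b -> Cc (fun t => / (P t + Q t))%C v).
  { intros v Hv. eapply Dc_Cc, Dc_inv; [apply Dc_plus; auto|apply NPp, Hv]. }
  assert (CPp : forall n v, Cc (fun t => P t ^ n)%C v) by (intros n v; eapply Dc_Cc, Dc_pow, DP).
  assert (CQp : forall n v, Cc (fun t => Q t ^ n)%C v) by (intros n v; eapply Dc_Cc, Dc_pow, DQ).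
  assert (CF : forall v, a <= v <= b -> Cc F v) by (intros v Hv; eapply Dc_Cc, HF, Hv).
  assert (Dh : forall v, a <= v <= b -> Dc h v (dh v)).
  { intros v Hv. unfold h. eapply Dc_eq.
    - apply Dc_mult; [apply Dc_const|]. apply Dc_mult.
      + apply Dc_mult; apply Dc_pow; auto.
      + apply Dc_mult; (apply Dc_inv; [|auto]); [apply Dc_minus|apply Dc_plus]; auto.
    - unfold dh. simpl pred.
      cbv beta. field. split; auto. }
  assert (Cdh : forall v, a <= v <= b -> Cc dh v).
  { intros v Hv. unfold dh.
    ccont; first [exact (CPp _ v) | exact (CQp _ v) | exact (CR v Hv) | exact (CT v Hv)]. }
  set (dF := fun v => (RtoC (2 * PI) * Ci * RtoC mu * (/ (Q v ^ 2) - / (P v ^ 2)) * F v)%C).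
  assert (CdF : forall v, a <= v <= b -> Cc dF v).
  { intros v Hv. unfold dF. apply Cc_mult; [|auto]. apply Cc_mult; [apply Cc_const|].
    apply Cc_minus; (eapply Dc_Cc, Dc_inv; [apply Dc_pow; auto|apply Cpow_nz; auto]). }
  assert (Ch : forall v, a <= v <= b -> Cc h v) by (intros v Hv; eapply Dc_Cc, Dh, Hv).
  assert (I1 : @is_RInt C_R_NormedModule (fun v => dh v * F v + h v * dF v)%C a b (h b * F b - h a * F a)%C).
  { apply (CInt_FTC (fun v => h v * F v)%C); [exact Hab| |].
    - intros v Hv. apply Dc_mult; [apply Dh, Hv|apply HF, Hv].
    - intros v Hv. apply Cc_plus; apply Cc_mult; auto. }
  assert (E1 : @ex_RInt C_R_NormedModule (fun v => dh v * F v)%C a b).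
  { apply ex_CInt_le; auto. intros v Hv. apply Cc_mult; auto. }
  assert (E2 : @ex_RInt C_R_NormedModule (fun v => h v * dF v)%C a b).
  { apply ex_CInt_le; auto. intros v Hv. apply Cc_mult; auto. }
  assert (EQ : CInt (fun v => P v ^ suc p / (P v ^ 2) * (Q v ^ suc p / (Q v ^ 2)) * F v)%C a b
    = (h b * F b - h a * F a - CInt (fun v => dh v * F v) a b)%C).
  { pose proof (is_CInt_unique _ _ _ _ I1) as U. rewrite CInt_plus in U by assumption.
    rewrite <- U.
    transitivity (CInt (fun v => h v * dF v)%C a b); [|ring].
    apply CInt_ext; [exact Hab|]. intros v Hv. unfold h, dF, kap.
    assert (Hv' : a <= v <= b) by lra.
    simpl (_ ^ 2)%C. field. repeat split; auto.
    - intros E0. apply Hpi. rewrite E0. ring.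
    - intros E0. apply Hpi. rewrite E0. ring. }
  rewrite EQ. clear EQ I1.
  assert (HX : 0 < X) by (unfold X; lra).
  set (A := / (2 * mu) * X ^ (2 * suc p) * / (2 * S)).
  assert (HXp : 0 < X ^ (2 * suc p)) by pos.
  assert (HA : 0 < A).
  { unfold A. apply Rmult_lt_0_compat; [apply Rmult_lt_0_compat; [|exact HXp]|];
      apply Rinv_0_lt_compat; lra. }
  assert (HXX : X ^ suc p * X ^ suc p = X ^ (2 * suc p)).
  { rewrite <- pow_add. f_equal. lia. }
  assert (BP : forall n v, a <= v <= b -> Cmod (P v ^ n)%C <= X ^ n).
  { intros; apply Cmod_pow_le, HP7; auto. }
  assert (BQ : forall n v, a <= v <= b -> Cmod (Q v ^ n)%C <= X ^ n).
  { intros; apply Cmod_pow_le, HQ7; auto. }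
  set (l := fun v => sg * ((c - c') * v + (d - d'))).
  assert (BR : forall v, a <= v <= b -> Cmod (/ (P v - Q v))%C <= / l v).
  { intros v Hv. apply Cmod_inv_le; [unfold l; specialize (Hl v Hv); lra|apply HPQ, Hv]. }
  assert (BRm : forall v, a <= v <= b -> / l v <= / m).
  { intros v Hv. apply Rinv_le_contravar; [lra|apply Hl, Hv]. }
  assert (BT : forall v, a <= v <= b -> Cmod (/ (P v + Q v))%C <= / (2 * S)).
  { intros v Hv. apply Cmod_inv_le; [lra|apply HPp, Hv]. }
  assert (Bh : forall v, a <= v <= b -> Cmod (h v) <= A * / m).
  { intros v Hv. unfold h. rewrite !Cmod_mult.
    unfold A. rewrite <- HXX.
    replace (/ (2 * mu) * (X ^ suc p * X ^ suc p) * / (2 * S) * / m) with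
      (/ (2 * mu) * (X ^ suc p * X ^ suc p * (/ m * / (2 * S)))) by ring.
    specialize (BR v Hv). specialize (BRm v Hv).
    apply Rmult_le_compat; [apply Cmod_ge_0| |exact Hkap|].
    { pos. }
    apply Rmult_le_compat; try (repeat apply Rmult_le_pos; apply Cmod_ge_0).
    - apply Rmult_le_compat; try apply Cmod_ge_0; auto.
    - apply Rmult_le_compat; try apply Cmod_ge_0; auto. lra. }
  set (cc := Rabs c + Rabs c').
  (* The contributions to h' are kept apart. The powers and 1/(P + Q) cost (|c| + |c'|)/S, which is
     controlled by the length of the interval; 1/(P - Q) costs |c - c'|/l^2, whose integral is at
     most 1/m whatever the length. *)
  assert (Bdh : forall v, a <= v <= b ->
    Cmod (dh v) <= A * (/ m * ((INR (suc p) + 1) * cc * / S) + Rabs (c - c') / l v ^ 2)).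
  { intros v Hv. unfold dh.
    specialize (BR v Hv). specialize (BRm v Hv). specialize (BT v Hv).
    assert (Hn0 : 0 <= INR (suc p)) by arith.
    rewrite Cmod_mult.
    replace (A * (/ m * ((INR (suc p) + 1) * cc * / S) + Rabs (c - c') / l v ^ 2)) with
     (/ (2 * mu) * ((X ^ (2 * suc p) * / S) * (INR (suc p) * cc) * (/ m * / (2 * S)) +
        X ^ (2 * suc p) * (Rabs (c - c') * (/ l v * / l v) * / (2 * S) + / m * (cc * (/ S * / (2 * S)))))).
    2:{ unfold A. field. repeat split; try lra. unfold l. specialize (Hl v Hv). lra. }
    apply Rmult_le_compat; [apply Cmod_ge_0|apply Cmod_ge_0|exact Hkap|].
    via Cmod_triangle. apply Rplus_le_compat.
    - rewrite Cmod_mult. rewrite (Cmod_mult (/ (P v - Q v))).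
      apply Rmult_le_compat; try (repeat apply Rmult_le_pos; apply Cmod_ge_0).
      + assert (HXS : X ^ p * X ^ suc p <= X ^ (2 * suc p) * / S).
        { assert (HU : 0 < X ^ p * X ^ suc p) by pos.
          replace (X ^ (2 * suc p) * / S) with (7 * (X ^ p * X ^ suc p)); [lra|].
          rewrite <- HXX. clear HU. change (X ^ suc p) with (X * X ^ p).
          set (t := X ^ p). unfold X. field; lra. }
        via Cmod_triangle. rewrite !Cmod_mult, !Cmod_R.
        rewrite (Rabs_right (INR _)) by lra.
        assert (G1 : Cmod (P v ^ p)%C * Cmod (Q v ^ suc p)%C <= X ^ p * X ^ suc p).
        { apply Rmult_le_compat; try apply Cmod_ge_0; auto. }
        assert (G2 : Cmod (P v ^ suc p)%C * Cmod (Q v ^ p)%C <= X ^ p * X ^ suc p).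
        { rewrite Rmult_comm. apply Rmult_le_compat; try apply Cmod_ge_0; auto. }
        set (Y := X ^ (2 * suc p) * / S) in *.
        set (u1 := Cmod (P v ^ p)%C * Cmod (Q v ^ suc p)%C) in *.
        set (u2 := Cmod (P v ^ suc p)%C * Cmod (Q v ^ p)%C) in *.
        replace (INR (suc p) * Cmod (P v ^ p)%C * Rabs c * Cmod (Q v ^ suc p)%C)
          with (u1 * (INR (suc p) * Rabs c)) by (unfold u1; ring).
        replace (Cmod (P v ^ suc p)%C * (INR (suc p) * Cmod (Q v ^ p)%C * Rabs c'))
          with (u2 * (INR (suc p) * Rabs c')) by (unfold u2; ring).
        unfold cc. rewrite !Rmult_plus_distr_l.
        apply Rplus_le_compat; (apply Rmult_le_compat_r; [apply Rmult_le_pos; [lra|apply Rabs_pos]|lra]).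
      + apply Rmult_le_compat; try apply Cmod_ge_0; lra.
    - rewrite Cmod_mult. apply Rmult_le_compat; try apply Cmod_ge_0.
      + rewrite Cmod_mult, <- HXX. apply Rmult_le_compat; try apply Cmod_ge_0; auto.
      + via Cmod_triangle. apply Rplus_le_compat.
        * rewrite !Cmod_mult, Cmod_opp, <- RtoC_minus, Cmod_R.
          apply Rmult_le_compat; try apply Cmod_ge_0; [|  |exact BT].
          { pos. }
          apply Rmult_le_compat_l; [apply Rabs_pos|].
          apply Rmult_le_compat; try apply Cmod_ge_0; lra.
        * rewrite !Cmod_mult, Cmod_opp, <- RtoC_plus, Cmod_R.
          apply Rmult_le_compat; try apply Cmod_ge_0; [|lra|].
          { pos. }
          apply Rmult_le_compat; try apply Rabs_pos; [| apply Rabs_triang|].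
          { pos. }
          apply Rmult_le_compat; try apply Cmod_ge_0; [|exact BT].
          eapply Rle_trans; [exact BT|]. apply Rinv_le_contravar; lra. }
  destruct (RInt_inv_sqr (c - c') (d - d') sg a b m Hsg Hab Hm Hl) as (I & HI & HIm).
  assert (BI : Cmod (CInt (fun v => dh v * F v)%C a b) <= F0 * (A * (/ m * ((INR (suc p) + 1) * K0 + 1)))).
  { eapply Rle_trans.
    - apply (CInt_le _ (fun v => F0 * (A * (/ m * ((INR (suc p) + 1) * cc * / S) + Rabs (c - c') / l v ^ 2)))
        a b (F0 * (A * ((b - a) * (/ m * ((INR (suc p) + 1) * cc * / S)) + I)))); [exact Hab|exact E1| |].
      + apply (@is_RInt_scal R_NormedModule). apply (@is_RInt_scal R_NormedModule).
        apply (@is_RInt_plus R_NormedModule); [|exact HI]. apply (@is_RInt_const R_NormedModule).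
      + intros v Hv. rewrite Cmod_mult, Rmult_comm.
        apply Rmult_le_compat; try apply Cmod_ge_0; auto.
    - apply Rmult_le_compat_l; [exact HF0|]. apply Rmult_le_compat_l; [lra|].
      assert (0 < / m) by pos.
      assert (Hn0 : 0 <= INR (suc p)) by arith.
      assert (cc * (b - a) * / S <= K0).
      { apply Rmult_le_reg_r with S; [lra|]. rewrite Rmult_assoc, Rinv_l by lra. unfold cc. lra. }
      rewrite Rmult_plus_distr_l. apply Rplus_le_compat; [|lra].
      replace ((b - a) * (/ m * ((INR (suc p) + 1) * cc * / S))) with
        (/ m * ((INR (suc p) + 1) * (cc * (b - a) * / S))) by ring.
      apply Rmult_le_compat_l; [lra|]. apply Rmult_le_compat_l; lra. }
  assert (Bb : Cmod (h b * F b)%C <= F0 * (A * / m)).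
  { rewrite Cmod_mult, Rmult_comm. apply Rmult_le_compat; try apply Cmod_ge_0; [apply HFb|apply Bh]; lra. }
  assert (Ba : Cmod (h a * F a)%C <= F0 * (A * / m)).
  { rewrite Cmod_mult, Rmult_comm. apply Rmult_le_compat; try apply Cmod_ge_0; [apply HFb|apply Bh]; lra. }
  assert (Htot : Cmod (h b * F b - h a * F a - CInt (fun v => dh v * F v) a b)%C <=
     F0 * (A * / m) + F0 * (A * / m) + F0 * (A * (/ m * ((INR (suc p) + 1) * K0 + 1)))).
  { via Cmod_triangle. rewrite Cmod_opp. apply Rplus_le_compat; [|exact BI].
    via Cmod_triangle. rewrite Cmod_opp. lra. }
  eapply Rle_trans; [exact Htot|].
  assert (Hn0 : 0 <= INR (suc p)) by arith.
  set (Z := F0 * (X ^ (2 * suc p) * (/ mu * / S * / m))).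
  assert (HZ : 0 <= Z).
  { unfold Z. apply Rmult_le_pos; [lra|]. left. apply Rmult_lt_0_compat; [exact HXp|].
    apply Rmult_lt_0_compat; [pos|]; apply Rinv_0_lt_compat; lra. }
  replace (F0 * (A * / m) + F0 * (A * / m) + F0 * (A * (/ m * ((INR (suc p) + 1) * K0 + 1))))
    with (((INR (suc p) + 1) * K0 + 3) * (Z * / 4)) by (unfold A, Z; field; lra).
  replace (((INR (suc p) + 1) * K0 + 3) * F0 * X ^ (2 * suc p) / (mu * S * m))
    with (((INR (suc p) + 1) * K0 + 3) * Z) by (unfold Z; field; lra).
  apply Rmult_le_compat_l; [nra|lra].
Qed.

(** * Finite sums, bilinear forms and duality *)

Fixpoint rsum {I : Type} (l : list I) (g : I -> R) : R :=
  match l with nil => 0 | x :: r => g x + rsum r g end.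

Fixpoint csum {I : Type} (l : list I) (g : I -> C) : C :=
  match l with nil => RtoC 0 | x :: r => (g x + csum r g)%C end.

Lemma rsum_le {I} (l : list I) g h : (forall x, In x l -> g x <= h x) -> rsum l g <= rsum l h.
Proof.
  induction l as [|x l IH]; intros H; simpl; [lra|].
  pose proof (H x (or_introl eq_refl)). assert (rsum l g <= rsum l h) by (apply IH; intros; apply H; right; auto).
  lra.
Qed.

Lemma rsum_ext {I} (l : list I) g h : (forall x, In x l -> g x = h x) -> rsum l g = rsum l h.
Proof.
  induction l as [|x l IH]; intros H; simpl; [reflexivity|].
  rewrite (H x (or_introl eq_refl)), IH; [reflexivity|]. intros; apply H; right; auto.
Qed.

Lemma rsum_ge0 {I} (l : list I) g : (forall x, In x l -> 0 <= g x) -> 0 <= rsum l g.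
Proof.
  induction l as [|x l IH]; intros H; simpl; [lra|].
  pose proof (H x (or_introl eq_refl)). assert (0 <= rsum l g) by (apply IH; intros; apply H; right; auto).
  lra.
Qed.

Lemma rsum_const {I} (l : list I) c : rsum l (fun _ => c) = INR (length l) * c.
Proof.
  induction l as [|x l IH]; simpl rsum; simpl length; [simpl; ring|].
  rewrite IH, S_INR. ring.
Qed.

Lemma rsum_scal {I} (l : list I) c g : rsum l (fun x => c * g x) = c * rsum l g.
Proof. induction l as [|x l IH]; simpl; [ring|]. rewrite IH; ring. Qed.

Lemma rsum_plus {I} (l : list I) g h : rsum l (fun x => g x + h x) = rsum l g + rsum l h.
Proof. induction l as [|x l IH]; simpl; [ring|]. rewrite IH; ring. Qed.

Lemma rsum_0 {I} (l : list I) : rsum l (fun _ => 0) = 0.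
Proof. rewrite rsum_const; ring. Qed.

Lemma rsum_swap {I J} (l : list I) (l' : list J) g :
  rsum l (fun x => rsum l' (fun y => g x y)) = rsum l' (fun y => rsum l (fun x => g x y)).
Proof.
  induction l as [|x l IH]; simpl.
  - symmetry. apply rsum_0.
  - rewrite IH, <- rsum_plus. reflexivity.
Qed.

Lemma rsum_app {I} (l l' : list I) g : rsum (l ++ l') g = rsum l g + rsum l' g.
Proof. induction l as [|x l IH]; simpl; [ring|]. rewrite IH; ring. Qed.

Lemma rsum_map {I J} (l : list I) (p : I -> J) g : rsum (map p l) g = rsum l (fun x => g (p x)).
Proof. induction l as [|x l IH]; simpl; [reflexivity|]. rewrite IH; reflexivity. Qed.

Lemma rsum_flat_map {I J} (l : list I) (p : I -> list J) g :
  rsum (flat_map p l) g = rsum l (fun x => rsum (p x) g).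
Proof. induction l as [|x l IH]; simpl; [reflexivity|]. rewrite rsum_app, IH; reflexivity. Qed.

Lemma rsum_le_const {I} (l : list I) g c : (forall x, In x l -> g x <= c) ->
  rsum l g <= INR (length l) * c.
Proof. intros H. rewrite <- (rsum_const l c). apply rsum_le, H. Qed.

Lemma csum_ext {I} (l : list I) g h : (forall x, In x l -> g x = h x) -> csum l g = csum l h.
Proof.
  induction l as [|x l IH]; intros H; simpl; [reflexivity|].
  rewrite (H x (or_introl eq_refl)), IH; [reflexivity|]. intros; apply H; right; auto.
Qed.

Lemma csum_mult_l {I} (l : list I) c g : csum l (fun x => (c * g x)%C) = (c * csum l g)%C.
Proof. induction l as [|x l IH]; simpl; [ring|]. rewrite IH; ring. Qed.

Lemma csum_plus {I} (l : list I) g h : csum l (fun x => (g x + h x)%C) = (csum l g + csum l h)%C.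
Proof. induction l as [|x l IH]; simpl; [ring|]. rewrite IH; ring. Qed.

Lemma csum_minus {I} (l : list I) g h : csum l (fun x => (g x - h x)%C) = (csum l g - csum l h)%C.
Proof. induction l as [|x l IH]; simpl; [ring|]. rewrite IH; ring. Qed.

Lemma csum_conj {I} (l : list I) g : Cconj (csum l g) = csum l (fun x => Cconj (g x)).
Proof.
  induction l as [|x l IH]; simpl; [apply Ceq; simpl; ring|].
  rewrite <- IH. apply Ceq; simpl; ring.
Qed.

Lemma csum_app {I} (l l' : list I) g : csum (l ++ l') g = (csum l g + csum l' g)%C.
Proof. induction l as [|x l IH]; simpl; [ring|]. rewrite IH; ring. Qed.

Lemma csum_flat_map {I J} (l : list I) (p : I -> list J) g :
  csum (flat_map p l) g = csum l (fun x => csum (p x) g).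
Proof. induction l as [|x l IH]; simpl; [reflexivity|]. rewrite csum_app, IH; reflexivity. Qed.

Lemma csum_map {I J} (l : list I) (p : I -> J) g : csum (map p l) g = csum l (fun x => g (p x)).
Proof. induction l as [|x l IH]; simpl; [reflexivity|]. rewrite IH; reflexivity. Qed.

Lemma Cmod_csum_le {I} (l : list I) g h : (forall x, In x l -> Cmod (g x) <= h x) ->
  Cmod (csum l g) <= rsum l h.
Proof.
  induction l as [|x l IH]; intros H; simpl; [rewrite Cmod_0; lra|].
  via Cmod_triangle. apply Rplus_le_compat.
  - apply H; left; reflexivity.
  - apply IH. intros; apply H; right; auto.
Qed.

Lemma is_CInt_csum {I} (l : list I) (g : I -> R -> C) (v : I -> C) a b :
  (forall x, In x l -> @is_RInt C_R_NormedModule (g x) a b (v x)) ->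
  @is_RInt C_R_NormedModule (fun t => csum l (fun x => g x t)) a b (csum l v).
Proof.
  induction l as [|x l IH]; intros H; simpl.
  - evar_last; [apply is_RInt_const|]. apply (@scal_zero_r R_AbsRing C_R_NormedModule).
  - apply (@is_RInt_plus C_R_NormedModule (g x)).
    + apply H; left; reflexivity.
    + apply IH. intros; apply H; right; auto.
Qed.

Definition inb (p q v : R) : bool := if Rle_dec p v then (if Rle_dec v q then true else false) else false.

(** Extension by zero gives all arcs a common interval of integration, as Cauchy-Schwarz
    requires. *)
Definition chi (p q : R) (g : R -> C) (v : R) : C := if inb p q v then g v else RtoC 0.

Lemma is_CInt_chi g p q a b : a <= p -> q <= b -> p <= q ->
  (forall v, p <= v <= q -> Cc g v) ->
  @is_RInt C_R_NormedModule (chi p q g) a b (CInt g p q).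
Proof.
  intros H1 H2 H3 Hg.
  assert (Hz : forall u v, @is_RInt C_R_NormedModule (fun _ => RtoC 0) u v (RtoC 0)).
  { intros u v. evar_last; [apply is_RInt_const|]. apply (@scal_zero_r R_AbsRing C_R_NormedModule). }
  replace (CInt g p q) with (RtoC 0 + CInt g p q + RtoC 0)%C by ring.
  apply (@is_RInt_Chasles C_R_NormedModule _ a q b).
  - apply (@is_RInt_Chasles C_R_NormedModule _ a p q).
    + eapply is_RInt_ext; [|apply Hz]. intros v Hv. rewrite Rmin_left, Rmax_right in Hv by lra.
      unfold chi, inb. destruct (Rle_dec p v); [lra|reflexivity].
    + eapply is_RInt_ext; [|apply CInt_correct, ex_CInt_le; [exact H3|exact Hg]].
      intros v Hv. rewrite Rmin_left, Rmax_right in Hv by lra.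
      unfold chi, inb. destruct (Rle_dec p v); [|lra]. destruct (Rle_dec v q); [reflexivity|lra].
  - eapply is_RInt_ext; [|apply Hz]. intros v Hv. rewrite Rmin_left, Rmax_right in Hv by lra.
    unfold chi, inb. destruct (Rle_dec p v); [|lra]. destruct (Rle_dec v q); [lra|reflexivity].
Qed.

(** The inner product of two truncated weights. Disjoint intervals are singled out because an
    integral with reversed ends would not vanish. *)
Definition ip (p q p' q' : R) (g g' : R -> C) : C :=
  if Rle_dec (Rmax p p') (Rmin q q') then
    CInt (fun v => g v * Cconj (g' v))%C (Rmax p p') (Rmin q q') else RtoC 0.

Lemma is_CInt_ip g g' p q p' q' a b : a <= p -> q <= b -> p <= q -> p' <= q' ->
  (forall v, p <= v <= q -> Cc g v) -> (forall v, p' <= v <= q' -> Cc g' v) ->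
  @is_RInt C_R_NormedModule (fun v => chi p q g v * Cconj (chi p' q' g' v))%C a b (ip p q p' q' g g').
Proof.
  intros H1 H2 H3 H3' Hg Hg'. unfold ip.
  assert (Hpw : forall v, (chi p q g v * Cconj (chi p' q' g' v))%C =
     chi (Rmax p p') (Rmin q q') (fun v => g v * Cconj (g' v))%C v).
  { intros v. unfold chi, inb.
    pose proof (Rmax_l p p'); pose proof (Rmax_r p p'); pose proof (Rmin_l q q'); pose proof (Rmin_r q q').
    destruct (Rle_dec (Rmax p p') v) as [Ha|Ha].
    - destruct (Rle_dec v (Rmin q q')) as [Hb|Hb].
      + repeat (destruct (Rle_dec _ _); [|lra]). reflexivity.
      + destruct (Rle_dec p v); [|lra]. destruct (Rle_dec p' v); [|lra].
        destruct (Rle_dec v q), (Rle_dec v q'); try (apply Ceq; simpl; ring).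
        exfalso; apply Hb; apply Rmin_glb; assumption.
    - destruct (Rle_dec p v); [|apply Ceq; simpl; ring].
      destruct (Rle_dec p' v); [exfalso; apply Ha; apply Rmax_lub; assumption|].
      destruct (Rle_dec v q); apply Ceq; simpl; ring. }
  eapply is_RInt_ext; [intros v _; symmetry; apply Hpw|].
  pose proof (Rmax_l p p'); pose proof (Rmax_r p p'); pose proof (Rmin_l q q'); pose proof (Rmin_r q q').
  destruct (Rle_dec (Rmax p p') (Rmin q q')) as [Hle|Hle].
  - apply is_CInt_chi; try lra. intros v Hv. apply Cc_mult; [apply Hg; lra|apply Cc_conj, Hg'; lra].
  - eapply is_RInt_ext; [|evar_last; [apply is_RInt_const|apply (@scal_zero_r R_AbsRing C_R_NormedModule)]].
    intros v _. unfold chi, inb. destruct (Rle_dec (Rmax p p') v); [|reflexivity].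
    destruct (Rle_dec v (Rmin q q')); [exfalso; lra|reflexivity].
Qed.

Lemma csum_mul_conj {I J} (l : list I) (l' : list J) g h :
  (csum l g * Cconj (csum l' h))%C = csum l (fun x => csum l' (fun y => g x * Cconj (h y))%C).
Proof.
  rewrite csum_conj. induction l as [|x l IH]; simpl; [ring|].
  rewrite <- IH, csum_mult_l. ring.
Qed.

Lemma quad_int {I} (l : list I) (lo hi : I -> R) (W : I -> R -> C) a b :
  (forall j, In j l -> a <= lo j /\ lo j <= hi j /\ hi j <= b) ->
  (forall j, In j l -> forall v, lo j <= v <= hi j -> Cc (W j) v) ->
  @is_RInt C_R_NormedModule (fun v => csum l (fun j => chi (lo j) (hi j) (W j) v) *
     Cconj (csum l (fun j => chi (lo j) (hi j) (W j) v)))%C a b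
   (csum l (fun j => csum l (fun j' => ip (lo j) (hi j) (lo j') (hi j') (W j) (W j')))).
Proof.
  intros H1 H2.
  eapply is_RInt_ext; [intros v _; symmetry; apply csum_mul_conj|].
  apply (is_CInt_csum l (fun j v => csum l (fun j' => chi (lo j) (hi j) (W j) v * Cconj (chi (lo j') (hi j') (W j') v))%C)).
  intros j Hj.
  apply (is_CInt_csum l (fun j' v => chi (lo j) (hi j) (W j) v * Cconj (chi (lo j') (hi j') (W j') v))%C).
  intros j' Hj'. pose proof (H1 j Hj). pose proof (H1 j' Hj').
  apply is_CInt_ip; try lra; auto.
Qed.

Lemma Re_mul_conj z : Re (z * Cconj z)%C = Cmod z ^ 2.
Proof. rewrite Cmod_sqr. unfold Re, Im, Cconj, Cmult; simpl. ring. Qed.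

(* Duality: the linear functional is the integral of [f] against
   [G = sum_j chi_j W_j], and [int |G|^2] is the quadratic form below. *)
Lemma dual_bound {I} (l : list I) (lo hi : I -> R) (W : I -> R -> C) (f : R -> C) a b F T :
  a <= b -> 0 <= F -> 0 < T ->
  (forall j, In j l -> a <= lo j /\ lo j <= hi j /\ hi j <= b) ->
  (forall j, In j l -> forall v, lo j <= v <= hi j -> Cc (W j) v) ->
  (forall v, a <= v <= b -> Cc f v) -> (forall v, a <= v <= b -> Cmod (f v) <= F) ->
  Re (csum l (fun j => csum l (fun j' => ip (lo j) (hi j) (lo j') (hi j') (W j) (W j')))) <= T ->
  Cmod (csum l (fun j => CInt (fun v => f v * W j v)%C (lo j) (hi j))) <= F * sqrt (T * (b - a)).
Proof.
  intros Hab HF HT H1 H2 Hf HfF HQ.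
  pose proof (quad_int l lo hi W a b H1 H2) as HG.
  set (G := fun v => csum l (fun j => chi (lo j) (hi j) (W j) v)) in *.
  set (Q := csum l (fun j => csum l (fun j' => ip (lo j) (hi j) (lo j') (hi j') (W j) (W j')))) in *.
  assert (HfG : @is_RInt C_R_NormedModule (fun v => f v * G v)%C a b
     (csum l (fun j => CInt (fun v => f v * W j v)%C (lo j) (hi j)))).
  { apply (is_RInt_ext (fun v => csum l (fun j => chi (lo j) (hi j) (fun v => f v * W j v)%C v))).
    - intros v _. unfold G. rewrite <- csum_mult_l. apply csum_ext. intros j _.
      unfold chi. destruct (inb _ _ _); [reflexivity|]. asC. ring.
    - apply (is_CInt_csum l (fun j v => chi (lo j) (hi j) (fun v => f v * W j v)%C v)).
      intros j Hj. pose proof (H1 j Hj). apply is_CInt_chi; try lra.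
      intros v Hv. apply Cc_mult; [apply Hf; lra|apply H2; auto]. }
  rewrite <- (is_CInt_unique _ _ _ _ HfG).
  destruct (Req_dec a b) as [->|Hne].
  { rewrite CInt_point, Cmod_0. apply Rmult_le_pos; [exact HF|apply sqrt_pos]. }
  (* Cauchy-Schwarz in the pointwise form |G| <= t/2 + |G|^2/(2t), with the [t] that balances both
     parts after integration. *)
  set (t := sqrt (T / (b - a))).
  assert (Ht : 0 < t) by (apply sqrt_lt_R0, Rdiv_lt_0_compat; lra).
  assert (Htt : t * t * (b - a) = T).
  { unfold t. rewrite sqrt_sqrt; [field; lra|left; apply Rdiv_lt_0_compat; lra]. }
  assert (Hsq : sqrt (T * (b - a)) = t * (b - a)).
  { rewrite <- Htt. replace (t * t * (b - a) * (b - a)) with ((t * (b - a)) * (t * (b - a))) by ring.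
    apply sqrt_square. nra. }
  rewrite Hsq.
  eapply Rle_trans.
  - apply (CInt_le _ (fun v => F * (t / 2 + / (2 * t) * fst (G v * Cconj (G v))%C)) a b
     (F * ((b - a) * (t / 2) + / (2 * t) * Re Q))); [exact Hab|eexists; exact HfG| |].
    + apply (@is_RInt_scal R_NormedModule). apply (@is_RInt_plus R_NormedModule).
      * apply (@is_RInt_const R_NormedModule).
      * apply (@is_RInt_scal R_NormedModule). apply is_CInt_fst. exact HG.
    + intros v Hv. rewrite Cmod_mult.
      apply Rmult_le_compat; try apply Cmod_ge_0; [apply HfF, Hv|].
      change (fst (G v * Cconj (G v))%C) with (Re (G v * Cconj (G v))%C). rewrite Re_mul_conj.
      set (x := Cmod (G v)) in *.
      apply Rmult_le_reg_l with (2 * t); [lra|].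
      replace (2 * t * (t / 2 + / (2 * t) * x ^ 2)) with (t * t + x * x) by (field; lra).
      pose proof (Rle_0_sqr (t - x)) as Q0; unfold Rsqr in Q0; lra.
  - apply Rmult_le_compat_l; [exact HF|].
    assert (/ (2 * t) * Re Q <= / (2 * t) * T).
    { apply Rmult_le_compat_l; [left; apply Rinv_0_lt_compat; lra|exact HQ]. }
    replace (/ (2 * t) * T) with (t * (b - a) / 2) in H by (rewrite <- Htt; field; lra).
    lra.
Qed.

(** * Counting integers; harmonic sums *)

Definition zrange (lo : Z) (n : nat) : list Z := map (fun i => (lo + Z.of_nat i)%Z) (seq 0 n).

Lemma In_zrange lo n x : In x (zrange lo n) <-> (lo <= x < lo + Z.of_nat n)%Z.
Proof.
  unfold zrange. rewrite in_map_iff. split.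
  - intros (i & <- & Hi). apply in_seq in Hi. lia.
  - intros H. exists (Z.to_nat (x - lo)). rewrite in_seq. lia.
Qed.

Lemma NoDup_zrange lo n : NoDup (zrange lo n).
Proof.
  unfold zrange. apply Injective_map_NoDup; [|apply seq_NoDup].
  intros i j H. lia.
Qed.

Lemma length_zrange lo n : length (zrange lo n) = n.
Proof. unfold zrange. rewrite length_map, length_seq. reflexivity. Qed.

Lemma count_interval (l : list Z) (x ell : R) : NoDup l -> 0 <= ell ->
  (forall z, In z l -> x <= IZR z <= x + ell) -> INR (length l) <= ell + 1.
Proof.
  intros Hl He H.
  set (lo := Zceil x). set (n := Z.to_nat (Zfloor (x + ell) - lo + 1)).
  destruct (Zceil_bound x) as [C1 C2]. destruct (Zfloor_bound (x + ell)) as [F1 F2].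
  assert (Hle : (length l <= n)%nat).
  { rewrite <- (length_zrange lo n). apply NoDup_incl_length; [exact Hl|].
    intros z Hz. apply In_zrange. specialize (H z Hz).
    assert ((lo <= z)%Z) by (unfold lo; rewrite <- (Zceil_eq z (IZR z)); [apply Zceil_le; lra|lra]).
    assert ((z <= Zfloor (x + ell))%Z) by (apply Zfloor_lub; lra).
    unfold n. lia. }
  apply le_INR in Hle. unfold n in Hle.
  destruct (Z_le_gt_dec 0 (Zfloor (x + ell) - lo + 1)) as [Hp|Hp].
  - rewrite (INR_IZR_INZ (Z.to_nat _)), Z2Nat.id in Hle by exact Hp.
    rewrite plus_IZR, minus_IZR in Hle. unfold lo in Hle. lra.
  - replace (Z.to_nat (Zfloor (x + ell) - lo + 1)) with 0%nat in Hle by lia. simpl in Hle. lra.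
Qed.

Lemma count_congruent (l : list Z) (x ell : R) (g : Z) : NoDup l -> 0 <= ell -> (0 < g)%Z ->
  (forall z, In z l -> x <= IZR z <= x + ell) ->
  (forall z w, In z l -> In w l -> (g | z - w)%Z) -> INR (length l) <= ell / IZR g + 1.
Proof.
  intros Hl He Hg H Hc.
  assert (Hg1 : 0 < IZR g) by arith.
  destruct l as [|z0 l'] eqn:El; [simpl; assert (0 <= ell / IZR g) by pos; lra|].
  rewrite <- El in *. assert (Hz0 : In z0 l) by (rewrite El; left; reflexivity).
  set (ph := fun z => ((z - z0) / g)%Z).
  assert (Hph : forall z, In z l -> (z = z0 + g * ph z)%Z).
  { intros z Hz. unfold ph. destruct (Hc z z0 Hz Hz0) as [w Hw]. rewrite Hw.
    rewrite Z_div_mult by lia. lia. }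
  rewrite <- (length_map ph). apply (count_interval _ ((x - IZR z0) / IZR g)).
  - apply NoDup_map_NoDup_ForallPairs; [|exact Hl].
    intros z w Hz Hw E. rewrite (Hph z Hz), (Hph w Hw), E. reflexivity.
  - pos.
  - intros k Hk. apply in_map_iff in Hk. destruct Hk as (z & <- & Hz).
    specialize (H z Hz). rewrite (Hph z Hz), plus_IZR, mult_IZR in H.
    split.
    + apply Rmult_le_reg_r with (IZR g); [exact Hg1|]. unfold Rdiv. rewrite Rmult_assoc, Rinv_l; lra.
    + apply Rmult_le_reg_r with (IZR g); [exact Hg1|].
      replace (((x - IZR z0) / IZR g + ell / IZR g) * IZR g) with (x - IZR z0 + ell) by (field; lra). lra.
Qed.

Lemma rsum_remove {I} (dec : forall x y : I, {x = y} + {x <> y}) (l : list I) g y :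
  NoDup l -> In y l -> rsum l g = g y + rsum (remove dec y l) g.
Proof.
  induction l as [|x l IH]; intros Hn Hy; [destruct Hy|].
  inversion_clear Hn. simpl. destruct (dec y x) as [->|Hne].
  - rewrite notin_remove by assumption. reflexivity.
  - destruct Hy as [->|Hy]; [congruence|]. simpl. rewrite IH by assumption. ring.
Qed.

Lemma NoDup_remove_dec {I} (dec : forall x y : I, {x = y} + {x <> y}) (l : list I) y :
  NoDup l -> NoDup (remove dec y l).
Proof.
  induction l as [|x l IH]; intros Hn; simpl; [exact Hn|]. inversion_clear Hn.
  destruct (dec y x); [auto|]. constructor; [|auto].
  intros Hin. apply in_remove in Hin. tauto.
Qed.

(** For enlarging a sum: the terms are moved along an injection into a list over which a nonnegative
    majorant is summed completely. *)
Lemma rsum_inj {I J} (dec : forall x y : J, {x = y} + {x <> y}) (l : list I) (R0 : list J)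
  (ph : I -> J) (g : I -> R) (B : J -> R) :
  NoDup l -> NoDup R0 -> (forall x y, In x l -> In y l -> ph x = ph y -> x = y) ->
  (forall x, In x l -> In (ph x) R0) -> (forall y, In y R0 -> 0 <= B y) ->
  (forall x, In x l -> g x <= B (ph x)) -> rsum l g <= rsum R0 B.
Proof.
  intros Hl. revert R0. induction Hl as [|x l Hx Hl IH]; intros R0 HR Hinj Hin HB Hg; simpl.
  - apply rsum_ge0, HB.
  - rewrite (rsum_remove dec R0 B (ph x)) by (auto; apply Hin; left; reflexivity).
    apply Rplus_le_compat; [apply Hg; left; reflexivity|].
    apply IH.
    + apply NoDup_remove_dec, HR.
    + intros; apply Hinj; simpl; auto.
    + intros y Hy. apply in_in_remove; [|apply Hin; right; exact Hy].
      intros E. apply Hx. rewrite <- (Hinj y x); simpl; auto.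
    + intros y Hy. apply in_remove in Hy. apply HB; tauto.
    + intros; apply Hg; right; auto.
Qed.

Lemma rsum_fiber {I J} (dec : forall x y : J, {x = y} + {x <> y}) (l : list I) (L : list J)
  (ph : I -> J) (w : J -> R) (cnt : J -> R) :
  NoDup L -> (forall x, In x l -> In (ph x) L) -> (forall y, In y L -> 0 <= w y) ->
  (forall y, In y L -> INR (length (filter (fun x => if dec (ph x) y then true else false) l)) <= cnt y) ->
  rsum l (fun x => w (ph x)) <= rsum L (fun y => cnt y * w y).
Proof.
  intros HL Hin Hw Hc.
  assert (E : rsum l (fun x => w (ph x)) =
    rsum L (fun y => INR (length (filter (fun x => if dec (ph x) y then true else false) l)) * w y)).
  { clear Hc. induction l as [|x l IH]; simpl.
    - rewrite (rsum_ext L _ (fun _ => 0)); [symmetry; apply rsum_0|]. intros; ring.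
    - rewrite IH by (intros; apply Hin; right; auto).
      rewrite (rsum_remove dec L (fun y => INR (length (filter _ l)) * w y) (ph x)) by
        (auto; apply Hin; left; reflexivity).
      rewrite (rsum_remove dec L _ (ph x)) by (auto; apply Hin; left; reflexivity).
      destruct (dec (ph x) (ph x)) as [_|]; [|congruence]. simpl length. rewrite S_INR.
      rewrite (rsum_ext (remove dec (ph x) L) (fun y => INR (length (if if dec (ph x) y then true else false
         then x :: filter (fun x0 => if dec (ph x0) y then true else false) l
         else filter (fun x0 => if dec (ph x0) y then true else false) l)) * w y)
         (fun y => INR (length (filter (fun x0 => if dec (ph x0) y then true else false) l)) * w y)).
      + ring.
      + intros y Hy. apply in_remove in Hy. destruct (dec (ph x) y); [destruct Hy; congruence|reflexivity]. }
  rewrite E. apply rsum_le. intros y Hy. apply Rmult_le_compat_r; auto.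
Qed.

Lemma length_fiber {I J} (dec : forall x y : J, {x = y} + {x <> y}) (l : list I) (ph : I -> J) D1 D2 :
  0 <= D2 -> INR (length (nodup dec (map ph l))) <= D1 ->
  (forall y, INR (length (filter (fun x => if dec (ph x) y then true else false) l)) <= D2) ->
  INR (length l) <= D1 * D2.
Proof.
  intros H0 H1 H2.
  assert (H : rsum l (fun _ => 1) <= rsum (nodup dec (map ph l)) (fun _ => D2 * 1)).
  { apply (rsum_fiber dec l (nodup dec (map ph l)) ph (fun _ => 1) (fun _ => D2)).
    - apply NoDup_nodup.
    - intros x Hx. apply nodup_In, in_map, Hx.
    - intros; lra.
    - intros y _. apply H2. }
  rewrite !rsum_const, !Rmult_1_r in H.
  eapply Rle_trans; [exact H|]. apply Rmult_le_compat_r; assumption.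
Qed.

Lemma rsum_filter_le {I} (p : I -> bool) (l : list I) g : (forall x, In x l -> 0 <= g x) ->
  rsum (filter p l) g <= rsum l g.
Proof.
  induction l as [|x l IH]; intros H; simpl; [lra|].
  pose proof (H x (or_introl eq_refl)).
  assert (rsum (filter p l) g <= rsum l g) by (apply IH; intros; apply H; right; auto).
  destruct (p x); simpl; lra.
Qed.

Fixpoint harm (n : nat) : R := match n with O => 0 | S m => harm m + / INR (S m) end.

Lemma harm_le_S n : harm n <= harm (S n).
Proof. change (harm (S n)) with (harm n + / INR (S n)). assert (0 < / INR (S n)) by pos. lra. Qed.

Lemma harm_ge0 n : 0 <= harm n.
Proof. induction n; [simpl; lra|]. pose proof (harm_le_S n). lra. Qed.

Lemma harm_ln n : harm n <= 1 + ln (INR n + 1).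
Proof.
  destruct n as [|n]; [simpl; rewrite Rplus_0_l, ln_1; lra|].
  assert (H : harm (S n) <= 1 + ln (INR (S n))).
  { induction n as [|n IH]; [simpl; rewrite ln_1; lra|].
    change (harm (S (S n))) with (harm (S n) + / INR (S (S n))).
    rewrite (S_INR (S n)). set (x := INR (S n)) in *.
    assert (Hx : 0 < x) by (apply lt_0_INR; lia).
    assert (L : ln x - ln (x + 1) <= - / (x + 1)).
    { rewrite <- ln_div by lra.
      pose proof (exp_ineq1_le (ln (x / (x + 1)))) as E.
      rewrite exp_ln in E by pos.
      replace (x / (x + 1)) with (1 - / (x + 1)) in E at 2 by (field; lra). lra. }
    lra. }
  assert (ln (INR (S n)) <= ln (INR (S n) + 1)) by (apply ln_le; [apply lt_0_INR; lia|lra]).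
  lra.
Qed.

(** The integers of the range above [z] have distinct positive distances from [z]. If [z] lies
    inside the range, elements are dropped from the left until it lies below. *)
Lemma harm_right n : forall lo z, rsum (zrange lo n) (fun x => if Z_lt_dec z x then / IZR (x - z) else 0) <= harm n.
Proof.
  assert (Hcons : forall lo n, zrange lo (S n) = lo :: zrange (lo + 1) n).
  { intros lo m. unfold zrange. simpl. f_equal; [lia|]. rewrite <- seq_shift, map_map.
    apply map_ext. intros; lia. }
  assert (Hd : forall n lo z, (z < lo)%Z -> rsum (zrange lo n) (fun x => if Z_lt_dec z x then / IZR (x - z) else 0) <= harm n).
  { clear n. induction n as [|n IH]; intros lo z Hz; [simpl; lra|].
    replace (zrange lo (S n)) with (zrange lo n ++ [(lo + Z.of_nat n)%Z]).
    2:{ unfold zrange. rewrite seq_S, map_app. reflexivity. }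
    rewrite rsum_app. simpl rsum. change (harm (S n)) with (harm n + / INR (S n)). specialize (IH lo z Hz).
    destruct (Z_lt_dec z (lo + Z.of_nat n)); [|lia].
    assert (/ IZR (lo + Z.of_nat n - z) <= / INR (S n)).
    { rewrite INR_IZR_INZ. apply Rinv_le_contravar; [apply IZR_lt; lia|apply IZR_le; lia]. }
    lra. }
  induction n as [|n IH]; intros lo z; [simpl; lra|].
  destruct (Z_lt_dec z lo) as [Hz|Hz]; [apply Hd, Hz|].
  rewrite Hcons. simpl rsum. destruct (Z_lt_dec z lo); [lia|].
  rewrite Rplus_0_l. eapply Rle_trans; [apply IH|apply harm_le_S].
Qed.

Lemma harm_left n lo z : rsum (zrange lo n) (fun x => if Z_lt_dec x z then / IZR (z - x) else 0) <= harm n.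
Proof.
  eapply Rle_trans; [|apply (harm_right n (- (lo + Z.of_nat n - 1)) (- z))].
  apply (rsum_inj Z.eq_dec _ _ Z.opp).
  - apply NoDup_zrange.
  - apply NoDup_zrange.
  - intros; lia.
  - intros x Hx. apply In_zrange in Hx. apply In_zrange. lia.
  - intros y _. destruct (Z_lt_dec (- z) y); [|lra]. left. apply Rinv_0_lt_compat, IZR_lt. lia.
  - intros x _. destruct (Z_lt_dec x z), (Z_lt_dec (- z) (- x)); try lia; [|lra].
    replace (- x - - z)%Z with (z - x)%Z by lia. lra.
Qed.

Lemma harm_two lo n z : rsum (zrange lo n) (fun x => if Z.eq_dec x z then 0 else / IZR (Z.abs (x - z))) <= 2 * harm n.
Proof.
  replace (2 * harm n) with (harm n + harm n) by ring.
  eapply Rle_trans; [|apply Rplus_le_compat; [apply (harm_right n lo z)|apply (harm_left n lo z)]].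
  rewrite <- rsum_plus. apply rsum_le. intros x _.
  destruct (Z.eq_dec x z), (Z_lt_dec z x), (Z_lt_dec x z); try lia; try lra.
  - replace (Z.abs (x - z)) with (x - z)%Z by lia. lra.
  - replace (Z.abs (x - z)) with (z - x)%Z by lia. lra.
Qed.

(** * The weight of a matrix and the correlation of two weights *)

(** What is left of f(z) e(-mu z) dz beside f at the new point: den^k from modularity, den^(-2) from
    the differential, and the exponential at the image point. *)
Definition Wf (k mu : nat) (A B C D y v : R) : Complex.C :=
  (den C D v y ^ k / (den C D v y ^ 2) * E mu (mob A B C D (pt v y)))%C.

(** A bound for |Wf| when the denominator is of size S. The exponential is at most exp(2 pi) because
    image points have height at most 1/mu. *)
Definition Gb (k : nat) (S : R) : R := (7 * S) ^ k / S ^ 2 * exp (2 * PI).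

Lemma Gb_pos k S : 0 < S -> 0 < Gb k S.
Proof.
  intros H. unfold Gb. apply Rmult_lt_0_compat; [|apply exp_pos].
  apply Rdiv_lt_0_compat; apply pow_lt; lra.
Qed.

Lemma Cconj_den c d v y : Cconj (den c d v y) = den c d v (- y).
Proof. rewrite !den_parts. apply Ceq; simpl; ring. Qed.

Lemma Im_mob a b c d v y : a * d - b * c = 1 -> c * v + d <> 0 ->
  Im (mob a b c d (pt v y)) = y / Cmod (den c d v y) ^ 2.
Proof.
  intros Hdet Hn.
  unfold mob. rewrite Im_mobius; [reflexivity|exact Hdet|]. apply (den_nz c d v y Hn).
Qed.

Lemma Wf_cont k mu A B C D y v : A * D - B * C = 1 -> C * v + D <> 0 -> Cc (Wf k mu A B C D y) v.
Proof.
  intros Hdet Hn. unfold Wf, Cdiv. apply Cc_mult; [apply Cc_mult|].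
  - eapply Dc_Cc, Dc_pow, Dc_den.
  - eapply Dc_Cc, Dc_inv; [apply Dc_pow, Dc_den|].
    simpl. rewrite Cmult_1_r. apply Cmult_neq_0; apply den_nz, Hn.
  - eapply Dc_Cc, Dc_E, Dc_mob; assumption.
Qed.

Lemma frame_bounds k mu A B C D S y v : (1 <= mu)%nat -> 0 < S -> A * D - B * C = 1 ->
  0 <= y -> INR mu * y <= S ^ 2 ->
  S <= C * v + D <= 6 * S -> Rabs C * y <= S ->
  Cmod (den C D v y) <= 7 * S /\ Cmod (E mu (mob A B C D (pt v y))) <= exp (2 * PI) /\
  Cmod (Wf k mu A B C D y v) <= Gb k S.
Proof.
  intros Hmu HS Hdet Hy Hy2 H Hc.
  assert (H7 : Cmod (den C D v y) <= 7 * S).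
  { via Cmod_le_sum. rewrite den_parts. unfold Re, Im; simpl.
    rewrite Rabs_mult, (Rabs_right y), (Rabs_right (C * v + D)) by lra. lra. }
  assert (H1 : S <= Cmod (den C D v y)).
  { eapply Rle_trans; [|apply Cmod_den_ge]. rewrite Rabs_right; lra. }
  assert (HE : Cmod (E mu (mob A B C D (pt v y))) <= exp (2 * PI)).
  { rewrite Cmod_E, Im_mob by (auto; lra). apply exp_le_mono. rewrite <- (Rmult_1_r (2 * PI)) at 2.
    rewrite Rmult_assoc. apply Rmult_le_compat_l; [pose proof PI_RGT_0; lra|].
    assert (S ^ 2 <= Cmod (den C D v y) ^ 2) by arith.
    assert (0 < S ^ 2) by pos.
    set (N := Cmod (den C D v y) ^ 2) in *.
    replace (INR mu * (y / N)) with (INR mu * y / N) by (unfold Rdiv; ring).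
    apply Rmult_le_reg_r with N; [lra|].
    unfold Rdiv. rewrite Rmult_assoc, Rinv_l by lra. lra. }
  split; [exact H7|]. split; [exact HE|].
  unfold Wf. rewrite Cmod_mult. unfold Gb. apply Rmult_le_compat; [apply Cmod_ge_0|apply Cmod_ge_0| |exact HE].
  unfold Cdiv. rewrite Cmod_mult. apply Rmult_le_compat; [apply Cmod_ge_0|apply Cmod_ge_0|apply Cmod_pow_le, H7|].
  apply Cmod_inv_le; [pos|]. rewrite Cmod_pow. apply pow_incr; lra.
Qed.

(** Conjugating a denominator replaces y by -y, so the product of a weight with a conjugate weight
    has the shape treated by [vdc]. *)
Lemma pair_vdc k mu A B C D A' B' C' D' S y l h sg m :
  (1 <= k)%nat -> (1 <= mu)%nat -> 0 < S -> 0 < m -> l <= h -> (sg = 1 \/ sg = -1) ->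
  A * D - B * C = 1 -> A' * D' - B' * C' = 1 ->
  0 <= y -> INR mu * y <= S ^ 2 ->
  Rabs C * y <= S -> Rabs C' * y <= S ->
  (forall v, l <= v <= h -> S <= C * v + D <= 6 * S) ->
  (forall v, l <= v <= h -> S <= C' * v + D' <= 6 * S) ->
  (Rabs C + Rabs C') * (h - l) <= 72 * S ->
  (forall v, l <= v <= h -> m <= sg * ((C - C') * v + (D - D'))) ->
  Cmod (CInt (fun v => Wf k mu A B C D y v * Cconj (Wf k mu A' B' C' D' y v))%C l h) <=
  ((INR k + 1) * 72 + 3) * Gb k S ^ 2 * (S ^ 3 / (INR mu * m)).
Proof.
  intros Hk Hmu HS Hm0 Hlh Hsg Hdet Hdet' Hy0 Hy2 Hy Hy' HP HQ Hlen Hm.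
  assert (Hmr : 1 <= INR mu) by (apply (le_INR 1); exact Hmu).
  set (F := fun v => (E mu (mob A B C D (pt v y)) * Cconj (E mu (mob A' B' C' D' (pt v y))))%C).
  assert (E1 : CInt (fun v => Wf k mu A B C D y v * Cconj (Wf k mu A' B' C' D' y v))%C l h =
    CInt (fun v => den C D v y ^ k / (den C D v y ^ 2) * (den C' D' v (- y) ^ k / (den C' D' v (- y) ^ 2)) * F v)%C l h).
  { apply CInt_ext; [exact Hlh|]. intros v Hv. unfold Wf, F.
    rewrite Cmult_conj, Cdiv_conj, !Cpow_conj, Cconj_den.
    - ring.
    - assert (S <= C' * v + D' <= 6 * S) by (apply HQ; lra).
      simpl. rewrite Cmult_1_r. apply Cmult_neq_0; apply den_nz; apply Rgt_not_eq; lra. }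
  rewrite E1.
  via (vdc k (INR mu) C D y C' D' (- y) 1 sg l h S m 72 (exp (2 * PI) ^ 2) F).
  - exact Hk. - lra. - exact HS. - exact Hm0. - lra. - left; apply pow_lt, exp_pos. - exact Hlh. - left; reflexivity. - exact Hsg.
  - intros v Hv. specialize (HP v Hv). lra.
  - intros v Hv. specialize (HQ v Hv). lra.
  - intros v Hv. apply (frame_bounds k mu A B C D S y v Hmu HS Hdet Hy0 Hy2 (HP v Hv) Hy).
  - intros v Hv. rewrite <- Cconj_den, Cmod_conj. apply (frame_bounds k mu A' B' C' D' S y v Hmu HS Hdet' Hy0 Hy2 (HQ v Hv) Hy').
  - exact Hlen.
  - exact Hm.
  - intros v Hv. specialize (HP v Hv). specialize (HQ v Hv).
    assert (N1 : C * v + D <> 0) by pos.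
    assert (N2 : C' * v + D' <> 0) by pos.
    eapply Dc_eq.
    + apply Dc_mult; [apply Dc_E, Dc_mob; assumption|apply Dc_conj, Dc_E, Dc_mob; assumption].
    + unfold F. rewrite <- Cconj_den.
      pose proof (den_nz C D v y N1) as M1. pose proof (den_nz C' D' v y N2) as M2.
      set (P := den C D v y) in *. set (Q := den C' D' v y) in *.
      set (e1 := E mu (mob A B C D (pt v y))). set (e2 := E mu (mob A' B' C' D' (pt v y))).
      assert (M3 : Cconj Q <> 0%C) by (intros E0; apply M2; rewrite <- (Cconj_conj Q), E0; apply Ceq; simpl; ring).
      clearbody P Q e1 e2.
      rewrite !Cmult_conj, Cinv_conj, Cmult_conj by (apply Cmult_neq_0; assumption).
      simpl.
      replace (Cconj (RtoC (2 * PI))) with (RtoC (2 * PI)) by (apply Ceq; simpl; ring).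
      replace (Cconj Ci) with (- Ci)%C by (apply Ceq; simpl; ring).
      replace (Cconj (RtoC (- INR mu))) with (- RtoC (INR mu))%C by (apply Ceq; simpl; ring).
      replace (RtoC (- INR mu)) with (- RtoC (INR mu))%C by (apply Ceq; simpl; ring).
      field. split; assumption.
  - intros v Hv. unfold F. rewrite Cmod_mult, Cmod_conj. simpl. rewrite Rmult_1_r.
    apply Rmult_le_compat; try apply Cmod_ge_0;
    [apply (frame_bounds k mu A B C D S y v Hmu HS Hdet Hy0 Hy2 (HP v Hv) Hy)|apply (frame_bounds k mu A' B' C' D' S y v Hmu HS Hdet' Hy0 Hy2 (HQ v Hv) Hy')].
  - right. unfold Gb. rewrite pow_mult. 
    replace (((7 * S) ^ 2) ^ k) with (((7 * S) ^ k) ^ 2) by (rewrite <- !pow_mult; f_equal; lia).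
    field. repeat split; apply Rgt_not_eq; lra.
Qed.

Definition mo (a b c d : Z) (v : R) : R := (IZR a * v + IZR b) / (IZR c * v + IZR d).

Definition mo_inv (a b c d : Z) (u : R) : R := (IZR d * u - IZR b) / (IZR a - IZR c * u).

Lemma det_IZR (a b c d : Z) : (a * d - b * c = 1)%Z -> IZR a * IZR d - IZR b * IZR c = 1.
Proof. intros H. rewrite <- !mult_IZR, <- minus_IZR, H. reflexivity. Qed.

Lemma mo_diff a b c d v w : (a * d - b * c = 1)%Z -> IZR c * v + IZR d <> 0 -> IZR c * w + IZR d <> 0 ->
  mo a b c d w - mo a b c d v = (w - v) / ((IZR c * w + IZR d) * (IZR c * v + IZR d)).
Proof.
  intros Hd Hv Hw. apply det_IZR in Hd. unfold mo.
  replace (w - v) with ((IZR a * IZR d - IZR b * IZR c) * (w - v)) by (rewrite Hd; ring).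
  field. split; assumption.
Qed.

Lemma mo_inv_diff a b c d u w : (a * d - b * c = 1)%Z -> IZR a - IZR c * u <> 0 -> IZR a - IZR c * w <> 0 ->
  mo_inv a b c d w - mo_inv a b c d u = (w - u) / ((IZR a - IZR c * w) * (IZR a - IZR c * u)).
Proof.
  intros Hd Hv Hw. apply det_IZR in Hd. unfold mo_inv.
  replace (w - u) with ((IZR a * IZR d - IZR b * IZR c) * (w - u)) by (rewrite Hd; ring).
  field. split; assumption.
Qed.

Lemma mo_mo_inv a b c d u : (a * d - b * c = 1)%Z -> IZR a - IZR c * u <> 0 ->
  mo a b c d (mo_inv a b c d u) = u /\ IZR c * mo_inv a b c d u + IZR d = / (IZR a - IZR c * u).
Proof.
  intros Hd Hu. apply det_IZR in Hd.
  assert (H2 : IZR c * mo_inv a b c d u + IZR d = / (IZR a - IZR c * u)).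
  { unfold mo_inv. rewrite <- (Rmult_1_l (/ (IZR a - IZR c * u))), <- Hd. field. exact Hu. }
  split; [|exact H2]. unfold mo. rewrite H2. unfold mo_inv.
  transitivity ((IZR a * IZR d - IZR b * IZR c) * u); [field; exact Hu|rewrite Hd; ring].
Qed.

Lemma mo_inv_mo a b c d v : (a * d - b * c = 1)%Z -> IZR c * v + IZR d <> 0 ->
  mo_inv a b c d (mo a b c d v) = v /\ IZR a - IZR c * mo a b c d v = / (IZR c * v + IZR d).
Proof.
  intros Hd Hu. apply det_IZR in Hd.
  assert (H2 : IZR a - IZR c * mo a b c d v = / (IZR c * v + IZR d)).
  { unfold mo. rewrite <- (Rmult_1_l (/ (IZR c * v + IZR d))), <- Hd. field. exact Hu. }
  split; [|exact H2]. unfold mo_inv. rewrite H2. unfold mo.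
  transitivity ((IZR a * IZR d - IZR b * IZR c) * v); [field; exact Hu|rewrite Hd; ring].
Qed.

(** Control for two successive substitutions: the inner denominator is of size 1 and the outer one
    of size S, so that the product matrix again has a denominator of size S. *)
Definition frame (q r a b c d : Z) (S v : R) : Prop :=
  / 3 <= IZR c * v + IZR d <= 1 /\ 3 * S <= IZR q * mo a b c d v + IZR r <= 6 * S.

Lemma frame_nz q r a b c d S v : frame q r a b c d S v -> IZR c * v + IZR d <> 0.
Proof. intros [H _]. apply Rgt_not_eq. lra. Qed.

Lemma inv_range x : / 3 <= x <= 1 -> 1 <= / x <= 3.
Proof.
  intros H. split.
  - rewrite <- Rinv_1. apply Rinv_le_contravar; lra.
  - replace 3 with (/ / 3) by field. apply Rinv_le_contravar; lra.
Qed.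

(** Denominators multiply. The leading coefficient of the product is c(qu + r) + q(a - cu), and a -
    cu is the inverse of the inner denominator. *)
Lemma frame_full (q r a b c d : Z) S v : (a * d - b * c = 1)%Z -> (0 < c)%Z -> 0 < S ->
  Rabs (IZR q) <= 12 * S -> frame q r a b c d S v ->
  S <= IZR (q * a + r * c) * v + IZR (q * b + r * d) <= 6 * S /\
  Rabs (IZR (q * a + r * c)) <= 6 * S * (IZR c + 6).
Proof.
  intros Hd Hc HS Hq HF. pose proof (frame_nz _ _ _ _ _ _ _ _ HF) as Hn. destruct HF as [H1 H2].
  destruct (mo_inv_mo a b c d v Hd Hn) as [_ Hac].
  assert (Hc0 : 0 < IZR c) by arith.
  split.
  - replace (IZR (q * a + r * c) * v + IZR (q * b + r * d)) with
      ((IZR c * v + IZR d) * (IZR q * mo a b c d v + IZR r)).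
    2:{ rewrite !plus_IZR, !mult_IZR. unfold mo. field. exact Hn. }
    nra.
  - replace (IZR (q * a + r * c)) with
      (IZR c * (IZR q * mo a b c d v + IZR r) + IZR q * (IZR a - IZR c * mo a b c d v)).
    2:{ rewrite !plus_IZR, !mult_IZR. ring. }
    rewrite Hac. pose proof (inv_range _ H1) as Hi.
    via Rabs_triang. rewrite !Rabs_mult.
    rewrite (Rabs_right (IZR c)), (Rabs_right (IZR q * _ + _)), (Rabs_right (/ _)) by lra.
    assert (IZR c * (IZR q * mo a b c d v + IZR r) <= IZR c * (6 * S)) by arith.
    assert (Rabs (IZR q) * / (IZR c * v + IZR d) <= 12 * S * 3) by arith.
    lra.
Qed.

Definition Wj (k mu : nat) (p s q r a b c d : Z) (y v : R) : Complex.C :=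
  Wf k mu (IZR (p * a + s * c)) (IZR (p * b + s * d)) (IZR (q * a + r * c)) (IZR (q * b + r * d)) y v.

Lemma det_full (p s q r a b c d : Z) : (p * r - s * q = 1)%Z -> (a * d - b * c = 1)%Z ->
  IZR (p * a + s * c) * IZR (q * b + r * d) - IZR (p * b + s * d) * IZR (q * a + r * c) = 1.
Proof.
  intros H1 H2. apply det_IZR.
  replace ((p * a + s * c) * (q * b + r * d) - (p * b + s * d) * (q * a + r * c))%Z
    with ((p * r - s * q) * (a * d - b * c))%Z by ring.
  rewrite H1, H2. reflexivity.
Qed.

(** The constant of [vdc] for K0 = 72. *)
Definition Wbd (k : nat) : R := (INR k + 1) * 72 + 3.

(* Writing tau' = rho tau with rho = (al be; N de), the difference of the two
   denominators is [-(c v + d) (e1 u + e2)] at [u = tau v]. *)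
Definition e1_ (q r a b c d a' b' c' d' : Z) : Z := (q * (a' * d - b' * c - 1) + r * (c' * d - d' * c))%Z.
Definition e2_ (q r a b c d a' b' c' d' : Z) : Z := (q * (b' * a - a' * b) + r * (d' * a - c' * b - 1))%Z.

Lemma den_difference q r a b c d a' b' c' d' v : (a * d - b * c = 1)%Z -> IZR c * v + IZR d <> 0 ->
  (IZR (q * a + r * c) - IZR (q * a' + r * c')) * v + (IZR (q * b + r * d) - IZR (q * b' + r * d')) =
  - ((IZR c * v + IZR d) * (IZR (e1_ q r a b c d a' b' c' d') * mo a b c d v + IZR (e2_ q r a b c d a' b' c' d'))).
Proof.
  intros Hd Hn.
  replace ((IZR c * v + IZR d) * (IZR (e1_ q r a b c d a' b' c' d') * mo a b c d v + IZR (e2_ q r a b c d a' b' c' d')))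
    with (IZR (e1_ q r a b c d a' b' c' d') * (IZR a * v + IZR b) + IZR (e2_ q r a b c d a' b' c' d') * (IZR c * v + IZR d))
    by (unfold mo; field; exact Hn).
  assert (E1 : (e1_ q r a b c d a' b' c' d' * a + e2_ q r a b c d a' b' c' d' * c =
    (q * a' + r * c') - (q * a + r * c))%Z).
  { unfold e1_, e2_. transitivity ((a * d - b * c) * (q * a' + r * c') - (q * a + r * c))%Z; [ring|rewrite Hd; ring]. }
  assert (E2 : (e1_ q r a b c d a' b' c' d' * b + e2_ q r a b c d a' b' c' d' * d =
    (q * b' + r * d') - (q * b + r * d))%Z).
  { unfold e1_, e2_. transitivity ((a * d - b * c) * (q * b' + r * d') - (q * b + r * d))%Z; [ring|rewrite Hd; ring]. }
  apply (f_equal IZR) in E1. apply (f_equal IZR) in E2.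
  rewrite plus_IZR, minus_IZR, !mult_IZR in E1, E2.
  transitivity (- ((IZR (q * a' + r * c') - IZR (q * a + r * c)) * v + (IZR (q * b' + r * d') - IZR (q * b + r * d)))); [ring|].
  rewrite <- E1, <- E2. ring.
Qed.

Section Pair.
Context (k mu : nat) (p s q r a b c d a' b' c' d' : Z) (S : R).
Context (Hk : (1 <= k)%nat) (Hmu : (1 <= mu)%nat) (HS : 0 < S)
  (H0 : (p * r - s * q = 1)%Z) (Hd : (a * d - b * c = 1)%Z) (Hd' : (a' * d' - b' * c' = 1)%Z)
  (Hq : Rabs (IZR q) <= 12 * S) (Hc : (3 <= c)%Z) (Hc' : (3 <= c')%Z)
  (Hcm : 6 * (IZR c + 6) * S ^ 2 <= INR mu) (Hcm' : 6 * (IZR c' + 6) * S ^ 2 <= INR mu).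
Let y := S ^ 2 / INR mu.
Let W := Wj k mu p s q r a b c d y.
Let W' := Wj k mu p s q r a' b' c' d' y.

Lemma y_ge0 : 0 <= y.
Proof. apply Rdiv_le_0_compat; [apply pow_le; lra|apply lt_0_INR; lia]. Qed.

Lemma mu_y : INR mu * y <= S ^ 2.
Proof. right. unfold y. field. apply Rgt_not_eq, lt_0_INR. lia. Qed.

Lemma small_im (z : Z) C0 : 6 * (IZR z + 6) * S ^ 2 <= INR mu -> C0 <= 6 * S * (IZR z + 6) -> C0 * y <= S.
Proof.
  intros H1 H2. assert (Hm : 1 <= INR mu) by (apply (le_INR 1); exact Hmu).
  assert (Hy : 0 < y) by (apply Rdiv_lt_0_compat; [apply pow_lt; lra|lra]).
  apply Rle_trans with (6 * S * (IZR z + 6) * y); [apply Rmult_le_compat_r; lra|].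
  unfold y. apply Rmult_le_reg_r with (INR mu); [lra|].
  replace (6 * S * (IZR z + 6) * (S ^ 2 / INR mu) * INR mu) with (6 * (IZR z + 6) * S ^ 2 * S) by (field; lra).
  rewrite (Rmult_comm S (INR mu)). apply Rmult_le_compat_r; lra.
Qed.

Lemma pair_trivial lo hi : lo <= hi -> 
  (forall v, lo <= v <= hi -> frame q r a b c d S v) -> (forall v, lo <= v <= hi -> frame q r a' b' c' d' S v) ->
  Cmod (CInt (fun v => W v * Cconj (W' v))%C lo hi) <= Gb k S ^ 2 * (hi - lo).
Proof.
  intros Hlh HF HF'. 
  pose proof (det_full _ _ _ _ _ _ _ _ H0 Hd) as D1. pose proof (det_full _ _ _ _ _ _ _ _ H0 Hd') as D2.
  assert (B1 : forall v, lo <= v <= hi -> Cmod (W v) <= Gb k S /\ Cc W v).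
  { intros v Hv. destruct (frame_full q r a b c d S v Hd ltac:(lia) HS Hq (HF v Hv)) as [G1 G2].
    split.
    - apply (frame_bounds k mu _ _ _ _ S y v Hmu HS D1 y_ge0 mu_y G1). apply (small_im c); assumption.
    - apply Wf_cont; [exact D1|apply Rgt_not_eq; lra]. }
  assert (B2 : forall v, lo <= v <= hi -> Cmod (W' v) <= Gb k S /\ Cc W' v).
  { intros v Hv. destruct (frame_full q r a' b' c' d' S v Hd' ltac:(lia) HS Hq (HF' v Hv)) as [G1 G2].
    split.
    - apply (frame_bounds k mu _ _ _ _ S y v Hmu HS D2 y_ge0 mu_y G1). apply (small_im c'); assumption.
    - apply Wf_cont; [exact D2|apply Rgt_not_eq; lra]. }
  eapply Rle_trans; [apply CInt_bound with (M := Gb k S ^ 2)|lra].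
  - exact Hlh.
  - apply ex_CInt_le; [exact Hlh|]. intros v Hv. apply Cc_mult; [apply B1, Hv|apply Cc_conj, B2, Hv].
  - intros v Hv. rewrite Cmod_mult, Cmod_conj. simpl. rewrite Rmult_1_r.
    apply Rmult_le_compat; try apply Cmod_ge_0; [apply B1|apply B2]; exact Hv.
Qed.

(** By [den_difference] the denominators differ by (cv + d)(e1 u + e2) up to sign. At distance [th]
    from the zero of the linear form, |e1 u + e2| is at least E0 th, and cv + d >= 1/3. *)
Lemma pair_far lo hi sg E0 th : lo <= hi -> hi - lo <= 2 / IZR c -> hi - lo <= 2 / IZR c' ->
  (forall v, lo <= v <= hi -> frame q r a b c d S v) -> (forall v, lo <= v <= hi -> frame q r a' b' c' d' S v) ->
  0 < E0 -> E0 <= Rabs (IZR (e1_ q r a b c d a' b' c' d')) -> 0 < th -> (sg = 1 \/ sg = -1) ->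
  (forall v, lo <= v <= hi -> th <= sg * (mo a b c d v -
     - IZR (e2_ q r a b c d a' b' c' d') / IZR (e1_ q r a b c d a' b' c' d'))) ->
  Cmod (CInt (fun v => W v * Cconj (W' v))%C lo hi) <= Gb k S ^ 2 * (Wbd k * (y * S * 3 / (E0 * th))).
Proof.
  intros Hlh Hl1 Hl2 HF HF' HE HEe Hth Hsg Hu.
  pose proof (det_full _ _ _ _ _ _ _ _ H0 Hd) as D1. pose proof (det_full _ _ _ _ _ _ _ _ H0 Hd') as D2.
  set (e1 := e1_ q r a b c d a' b' c' d') in *. set (e2 := e2_ q r a b c d a' b' c' d') in *.
  assert (He1 : IZR e1 <> 0) by (intros E1; rewrite E1, Rabs_R0 in HEe; lra).
  assert (Hl : lo <= lo <= hi) by lra.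
  destruct (frame_full q r a b c d S lo Hd ltac:(lia) HS Hq (HF lo Hl)) as [_ G2].
  destruct (frame_full q r a' b' c' d' S lo Hd' ltac:(lia) HS Hq (HF' lo Hl)) as [_ G2'].
  assert (C3 : 3 <= IZR c) by (apply IZR_le; exact Hc). assert (C3' : 3 <= IZR c') by (apply IZR_le; exact Hc').
  (* 6S(z + 6) * 2/z = 12S(1 + 6/z) <= 36S for z >= 3. Both matrices together give the 72 in
     [pair_vdc]. *)
  assert (L36 : forall z, 3 <= IZR z -> hi - lo <= 2 / IZR z -> 6 * S * (IZR z + 6) * (hi - lo) <= 36 * S).
  { intros z Hz Hlz. apply Rle_trans with (6 * S * (IZR z + 6) * (2 / IZR z)).
    - apply Rmult_le_compat_l; [|exact Hlz]. apply Rmult_le_pos; lra.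
    - apply Rmult_le_reg_r with (IZR z); [lra|].
      replace (6 * S * (IZR z + 6) * (2 / IZR z) * IZR z) with (12 * S * (IZR z + 6)) by (field; lra). nra. }
  set (sg1 := if Rle_dec 0 (IZR e1) then - sg else sg).
  via (pair_vdc k mu _ _ _ _ _ _ _ _ S y lo hi sg1 (E0 * th / 3) Hk Hmu HS).
  - apply Rdiv_lt_0_compat; [apply Rmult_lt_0_compat; assumption|lra].
  - exact Hlh.
  - unfold sg1. destruct (Rle_dec 0 (IZR e1)); destruct Hsg; lra.
  - exact D1.
  - exact D2.
  - exact y_ge0.
  - exact mu_y.
  - apply (small_im c); assumption.
  - apply (small_im c'); assumption.
  - intros v Hv. apply (frame_full q r a b c d S v Hd ltac:(lia) HS Hq (HF v Hv)).
  - intros v Hv. apply (frame_full q r a' b' c' d' S v Hd' ltac:(lia) HS Hq (HF' v Hv)).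
  - pose proof (L36 c C3 Hl1). pose proof (L36 c' C3' Hl2).
    apply Rle_trans with ((6 * S * (IZR c + 6) + 6 * S * (IZR c' + 6)) * (hi - lo)); [|lra].
    apply Rmult_le_compat_r; lra.
  - intros v Hv. pose proof (HF v Hv) as HFv. pose proof (frame_nz _ _ _ _ _ _ _ _ HFv) as Hn.
    rewrite (den_difference q r a b c d a' b' c' d' v Hd Hn). fold e1 e2.
    specialize (Hu v Hv). destruct HFv as [[H1 _] _].
    set (w := mo a b c d v - - IZR e2 / IZR e1) in *.
    replace (IZR e1 * mo a b c d v + IZR e2) with (IZR e1 * w) by (unfold w; field; exact He1).
    replace (sg1 * - ((IZR c * v + IZR d) * (IZR e1 * w))) with ((IZR c * v + IZR d) * (Rabs (IZR e1) * (sg * w))).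
    2:{ unfold sg1. destruct (Rle_dec 0 (IZR e1)); [rewrite Rabs_right by lra|rewrite Rabs_left by lra]; ring. }
    assert (E0 * th <= Rabs (IZR e1) * (sg * w)) by arith.
    assert (0 < E0 * th) by arith.
    replace (E0 * th / 3) with (/ 3 * (E0 * th)) by field.
    apply Rmult_le_compat; lra.
  - right. unfold Wbd, y. assert (1 <= INR mu) by (apply (le_INR 1); exact Hmu). field. lra.
Qed.

Lemma W_cont v : frame q r a b c d S v -> Cc W v.
Proof.
  intros HF. destruct (frame_full q r a b c d S v Hd ltac:(lia) HS Hq HF) as [G1 _].
  apply Wf_cont; [apply (det_full p s); assumption|apply Rgt_not_eq; lra].
Qed.

Lemma W'_cont v : frame q r a' b' c' d' S v -> Cc W' v.
Proof.
  intros HF. destruct (frame_full q r a' b' c' d' S v Hd' ltac:(lia) HS Hq HF) as [G1 _].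
  apply Wf_cont; [apply (det_full p s); assumption|apply Rgt_not_eq; lra].
Qed.

(** The piece within [th] of the zero is estimated trivially and the two outer pieces by [pair_far].
    The cuts are made in the variable u and carried back by the inverse substitution, which does not
    expand lengths since a - cu >= 1. *)
Lemma pair_near lo hi E0 th : lo <= hi -> hi - lo <= 2 / IZR c -> hi - lo <= 2 / IZR c' ->
  (forall v, lo <= v <= hi -> frame q r a b c d S v) -> (forall v, lo <= v <= hi -> frame q r a' b' c' d' S v) ->
  0 < E0 -> E0 <= Rabs (IZR (e1_ q r a b c d a' b' c' d')) -> 0 < th ->
  Cmod (CInt (fun v => W v * Cconj (W' v))%C lo hi) <=
    Gb k S ^ 2 * (2 * th + 2 * (Wbd k * (y * S * 3 / (E0 * th)))).
Proof.
  intros Hlh Hl1 Hl2 HF HF' HE HEe Hth.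
  set (ur := - IZR (e2_ q r a b c d a' b' c' d') / IZR (e1_ q r a b c d a' b' c' d')).
  assert (Hy : 0 < y) by (apply Rdiv_lt_0_compat; [apply pow_lt; lra|apply lt_0_INR; lia]).
  assert (HG : 0 < Gb k S ^ 2) by (apply pow_lt, Gb_pos, HS).
  assert (HWb : 0 < Wbd k) by (unfold Wbd; pose proof (pos_INR k); lra).
  assert (HT : 0 < Gb k S ^ 2 * (Wbd k * (y * S * 3 / (E0 * th)))).
  { apply Rmult_lt_0_compat; [exact HG|]. apply Rmult_lt_0_compat; [exact HWb|].
    apply Rdiv_lt_0_compat; [|apply Rmult_lt_0_compat; assumption].
    assert (0 < y * S) by arith. lra. }
  set (T := Gb k S ^ 2 * (Wbd k * (y * S * 3 / (E0 * th)))) in *.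
  set (ulo := mo a b c d lo). set (uhi := mo a b c d hi).
  assert (Hnz : forall v, lo <= v <= hi -> IZR c * v + IZR d <> 0) by (intros v Hv; eapply frame_nz, HF, Hv).
  assert (Hp : forall v, lo <= v <= hi -> 0 < IZR c * v + IZR d).
  { intros v Hv. destruct (HF v Hv) as [[Hx _] _]. lra. }
  assert (Hmono : forall v w, lo <= v <= hi -> lo <= w <= hi -> v <= w -> mo a b c d v <= mo a b c d w).
  { intros v w Hv Hw Hvw. apply Rminus_le_0. rewrite mo_diff by auto.
    apply Rdiv_le_0_compat; [lra|]. apply Rmult_lt_0_compat; auto. }
  assert (Hu : ulo <= uhi) by (apply Hmono; lra).
  assert (Hac : forall u, ulo <= u <= uhi -> 1 <= IZR a - IZR c * u).
  { intros u Hu1. destruct (mo_inv_mo a b c d hi Hd (Hnz hi ltac:(lra))) as [_ Hh]. fold uhi in Hh.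
    destruct (HF hi ltac:(lra)) as [Hx _]. apply inv_range in Hx. rewrite <- Hh in Hx.
    assert (0 < IZR c) by arith.
    assert (IZR c * u <= IZR c * uhi) by arith. lra. }
  assert (Hvv : forall u w, ulo <= u -> u <= w -> w <= uhi ->
     0 <= mo_inv a b c d w - mo_inv a b c d u <= w - u).
  { intros u w H1 H2 H3. pose proof (Hac u ltac:(lra)). pose proof (Hac w ltac:(lra)).
    rewrite mo_inv_diff by (auto; apply Rgt_not_eq; lra).
    assert (1 <= (IZR a - IZR c * w) * (IZR a - IZR c * u)) by nra.
    split; [apply Rdiv_le_0_compat; lra|].
    apply Rmult_le_reg_r with ((IZR a - IZR c * w) * (IZR a - IZR c * u)); [lra|].
    unfold Rdiv. rewrite Rmult_assoc, Rinv_l by (apply Rgt_not_eq; lra). nra. }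
  assert (Elo : mo_inv a b c d ulo = lo) by (apply mo_inv_mo; auto; apply Hnz; lra).
  assert (Ehi : mo_inv a b c d uhi = hi) by (apply mo_inv_mo; auto; apply Hnz; lra).
  (* The zero may lie outside the interval. Clamping leaves at most three pieces, some possibly
     empty, and [A5], [A6] say that a nonempty outer piece keeps its distance from the zero. *)
  set (u1 := Rmax ulo (Rmin uhi (ur - th))). set (u2 := Rmax ulo (Rmin uhi (ur + th))).
  assert (Hu1 : ulo <= u1 /\ u1 <= u2 /\ u2 <= uhi /\ u2 - u1 <= 2 * th /\
     (ulo < u1 -> u1 <= ur - th) /\ (u2 < uhi -> ur + th <= u2)).
  { unfold u1, u2, Rmax, Rmin. repeat (destruct (Rle_dec _ _)); lra. }
  clearbody u1 u2. destruct Hu1 as (A1 & A2 & A3 & A4 & A5 & A6).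
  set (v1 := mo_inv a b c d u1). set (v2 := mo_inv a b c d u2).
  pose proof (Hvv ulo u1 ltac:(lra) A1 ltac:(lra)) as B1. pose proof (Hvv u1 u2 A1 A2 A3) as B2.
  pose proof (Hvv u2 uhi ltac:(lra) A3 ltac:(lra)) as B3.
  rewrite Elo in B1. rewrite Ehi in B3. fold v1 in B1, B2. fold v2 in B2, B3.
  assert (M1 : mo a b c d v1 = u1) by (apply mo_mo_inv; [exact Hd|apply Rgt_not_eq; pose proof (Hac u1 ltac:(lra)); lra]).
  assert (M2 : mo a b c d v2 = u2) by (apply mo_mo_inv; [exact Hd|apply Rgt_not_eq; pose proof (Hac u2 ltac:(lra)); lra]).
  assert (Hex : forall x z, lo <= x -> x <= z -> z <= hi ->
    @ex_RInt C_R_NormedModule (fun v => W v * Cconj (W' v))%C x z).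
  { intros x z Hx Hxz Hz. apply ex_CInt_le; [exact Hxz|]. intros v Hv.
    apply Cc_mult; [apply W_cont, HF; lra|apply Cc_conj, W'_cont, HF'; lra]. }
  rewrite <- (CInt_Chasles _ lo v1 hi) by (apply Hex; lra).
  rewrite <- (CInt_Chasles _ v1 v2 hi) by (apply Hex; lra).
  assert (I1 : Cmod (CInt (fun v => W v * Cconj (W' v))%C lo v1) <= T).
  { destruct (Rle_lt_dec v1 lo) as [Hv1|Hv1].
    - replace v1 with lo by lra. rewrite CInt_point, Cmod_0. lra.
    - apply (pair_far lo v1 (-1) E0 th); try (intros; first [apply HF|apply HF']; lra); try lra.
      intros v Hv. fold ur. assert (ulo < u1) by arith.
      assert (mo a b c d v <= mo a b c d v1) by (apply Hmono; lra). rewrite M1 in *. specialize (A5 H). lra. }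
  assert (I3 : Cmod (CInt (fun v => W v * Cconj (W' v))%C v2 hi) <= T).
  { destruct (Rle_lt_dec hi v2) as [Hv1|Hv1].
    - replace v2 with hi by lra. rewrite CInt_point, Cmod_0. lra.
    - apply (pair_far v2 hi 1 E0 th); try (intros; first [apply HF|apply HF']; lra); try lra.
      intros v Hv. fold ur. assert (u2 < uhi) by arith.
      assert (mo a b c d v2 <= mo a b c d v) by (apply Hmono; lra). rewrite M2 in *. specialize (A6 H). lra. }
  assert (I2 : Cmod (CInt (fun v => W v * Cconj (W' v))%C v1 v2) <= Gb k S ^ 2 * (v2 - v1)).
  { apply pair_trivial; [lra| |]; intros; [apply HF|apply HF']; lra. }
  assert (I2' : Gb k S ^ 2 * (v2 - v1) <= Gb k S ^ 2 * (2 * th)) by arith.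
  via Cmod_triangle. eapply Rle_trans; [apply Rplus_le_compat_l, Cmod_triangle|].
  fold T. unfold T in *. lra.
Qed.

End Pair.

(** * The matrices tau' tau^-1: their sizes and their number *)

Definition quad : Type := (Z * Z * Z * Z)%type.

Definition quad_dec (x y : quad) : {x = y} + {x <> y}.
Proof. repeat decide equality. Defined.

(* The entries (N, al, de, be) of tau' tau^-1 = (al be; N de). *)
Definition rho_of (a b c d a' b' c' d' : Z) : quad :=
  (c' * d - d' * c, a' * d - b' * c, d' * a - c' * b, b' * a - a' * b)%Z.

Definition qN (x : quad) : Z := fst (fst (fst x)).
Definition qal (x : quad) : Z := snd (fst (fst x)).
Definition qde (x : quad) : Z := snd (fst x).
Definition qbe (x : quad) : Z := snd x.

(** The coefficients [e1_] and [e2_] expressed through rho alone: the zero of the difference of the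
    denominators, seen in the variable u, is the same for all pairs with the same rho. *)
Definition eone (q r : Z) (x : quad) : Z := (q * (qal x - 1) + r * qN x)%Z.
Definition etwo (q r : Z) (x : quad) : Z := (q * qbe x + r * (qde x - 1))%Z.

(** What an overlap of two arcs says about rho: the automorphy factors of rho and of its inverse lie
    between 1/3 and 3 somewhere on [0, W]. Only this enters the count. *)
Definition admissible (W : R) (x : quad) : Prop :=
  (qal x * qde x - qbe x * qN x = 1)%Z /\
  exists u u', 0 <= u <= W /\ 0 <= u' <= W /\ / 3 <= IZR (qN x) * u + IZR (qde x) <= 3 /\
    / 3 <= IZR (qal x) - IZR (qN x) * u' <= 3.

(** With X = cv + d and X' = c'v + d', the automorphy factors of rho and its inverse are X'/X and
    X/X', and N = c'X - cX'. The last part rests on e1 = N(qu' + r) + q(X/X' - 1), where the first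
    term dominates once |N| is large against |q|/S. *)
Lemma rho_facts q r a b c d a' b' c' d' S v : (a * d - b * c = 1)%Z -> (a' * d' - b' * c' = 1)%Z ->
  (0 < c)%Z -> (0 < c')%Z -> 0 < S -> frame q r a b c d S v -> frame q r a' b' c' d' S v ->
  let x := rho_of a b c d a' b' c' d' in
  / 3 <= IZR (qN x) * mo a b c d v + IZR (qde x) <= 3 /\
  / 3 <= IZR (qal x) - IZR (qN x) * mo a' b' c' d' v <= 3 /\
  (qal x * qde x - qbe x * qN x = 1)%Z /\
  Rabs (IZR (qN x)) <= Rmax (IZR c) (IZR c') /\
  (4 * Rabs (IZR q) <= Rabs (IZR (qN x)) * (3 * S) ->
     Rabs (IZR (qN x)) * (3 * S) / 2 <= Rabs (IZR (eone q r x))).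
Proof.
  intros Hd Hd' Hc Hc' HS HF HF' x.
  pose proof (frame_nz _ _ _ _ _ _ _ _ HF) as Hn. pose proof (frame_nz _ _ _ _ _ _ _ _ HF') as Hn'.
  destruct HF as [F1 F2]. destruct HF' as [F1' F2'].
  set (X := IZR c * v + IZR d) in *. set (X' := IZR c' * v + IZR d') in *.
  pose proof (det_IZR _ _ _ _ Hd) as Rd. pose proof (det_IZR _ _ _ _ Hd') as Rd'.
  assert (EX : IZR (qN x) * mo a b c d v + IZR (qde x) = X' / X).
  { unfold x, qN, qde, rho_of; simpl. rewrite !minus_IZR, !mult_IZR. unfold mo, X', X in *.
    transitivity ((IZR a * IZR d - IZR b * IZR c) * (IZR c' * v + IZR d') / (IZR c * v + IZR d)); [field; exact Hn|].
    rewrite Rd. field. exact Hn. }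
  assert (EA : IZR (qal x) - IZR (qN x) * mo a' b' c' d' v = X / X').
  { unfold x, qN, qal, rho_of; simpl. rewrite !minus_IZR, !mult_IZR. unfold mo, X', X in *.
    transitivity ((IZR a' * IZR d' - IZR b' * IZR c') * (IZR c * v + IZR d) / (IZR c' * v + IZR d')); [field; exact Hn'|].
    rewrite Rd'. field. exact Hn'. }
  assert (Q1 : / 3 <= X' / X <= 3).
  { split; [apply Rmult_le_reg_r with X|apply Rmult_le_reg_r with X]; try lra;
    unfold Rdiv; rewrite (Rmult_assoc X'), Rinv_l by exact Hn; lra. }
  assert (Q2 : / 3 <= X / X' <= 3).
  { split; [apply Rmult_le_reg_r with X'|apply Rmult_le_reg_r with X']; try lra;
    unfold Rdiv; rewrite (Rmult_assoc X), Rinv_l by exact Hn'; lra. }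
  rewrite EX. split; [exact Q1|]. rewrite EA. split; [exact Q2|].
  split; [|split].
  - unfold x, qN, qal, qde, qbe, rho_of; simpl.
    transitivity ((a * d - b * c) * (a' * d' - b' * c'))%Z; [ring|rewrite Hd, Hd'; reflexivity].
  - assert (Hc0 : 0 < IZR c) by arith. assert (Hc0' : 0 < IZR c') by arith.
    replace (IZR (qN x)) with (IZR c' * X - IZR c * X').
    2:{ unfold x, qN, rho_of, X, X'; simpl. rewrite !minus_IZR, !mult_IZR. ring. }
    assert (0 <= IZR c' * X <= IZR c') by nra. assert (0 <= IZR c * X' <= IZR c) by nra.
    pose proof (Rmax_l (IZR c) (IZR c')). pose proof (Rmax_r (IZR c) (IZR c')).
    apply Rabs_le. lra.
  - intros Hbig.
    replace (IZR (eone q r x)) with (IZR (qN x) * (IZR q * mo a' b' c' d' v + IZR r) + IZR q * (X / X' - 1)).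
    2:{ rewrite <- EA. unfold eone. rewrite !plus_IZR, !mult_IZR, minus_IZR. ring. }
    assert (A1 : Rabs (IZR q * (X / X' - 1)) <= Rabs (IZR q) * 2).
    { rewrite Rabs_mult. apply Rmult_le_compat_l; [apply Rabs_pos|]. apply Rabs_le. lra. }
    assert (A2 : Rabs (IZR (qN x)) * (3 * S) <= Rabs (IZR (qN x) * (IZR q * mo a' b' c' d' v + IZR r))).
    { rewrite Rabs_mult. apply Rmult_le_compat_l; [apply Rabs_pos|]. rewrite Rabs_right; lra. }
    pose proof (Rabs_triang_inv (IZR (qN x) * (IZR q * mo a' b' c' d' v + IZR r)) (- (IZR q * (X / X' - 1)))) as T.
    rewrite Rabs_Ropp in T.
    replace (IZR (qN x) * (IZR q * mo a' b' c' d' v + IZR r) - - (IZR q * (X / X' - 1)))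
      with (IZR (qN x) * (IZR q * mo a' b' c' d' v + IZR r) + IZR q * (X / X' - 1)) in T by ring. lra.
Qed.

(** For given N the entry [de] lies in an interval of length 3 + |N| W. Given [de] as well,
    determinant 1 fixes [al] modulo N, which leaves about W choices, and then [be] is determined. *)
Lemma count_admissible (l : list quad) (N : Z) (W : R) : NoDup l -> 0 <= W -> (N <> 0)%Z ->
  (forall x, In x l -> qN x = N /\ admissible W x) ->
  INR (length l) <= (Rabs (IZR N) * W + 4) * (W + 4).
Proof.
  intros Hl HW HN H.
  assert (HN1 : 1 <= Rabs (IZR N)).
  { rewrite <- abs_IZR. apply (IZR_le 1). lia. }
  set (n := Rabs (IZR N)) in *.
  assert (Hnu : forall u, 0 <= u <= W -> - (n * W) <= IZR N * u <= n * W).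
  { intros u Hu. apply Rabs_le_between. rewrite Rabs_mult, (Rabs_right u) by lra. fold n.
    apply Rmult_le_compat_l; lra. }
  assert (Hnu2 : forall u, 0 <= u <= W -> (0 <= IZR N -> 0 <= IZR N * u) /\ (IZR N <= 0 -> IZR N * u <= 0)).
  { intros u Hu. split; intros; nra. }
  (* The intervals for [de] and [al] stretch in opposite directions, according to the sign of N. *)
  set (x0 := if Rle_dec 0 (IZR N) then / 3 - n * W else / 3).
  set (x1 := if Rle_dec 0 (IZR N) then / 3 else / 3 - n * W).
  apply (length_fiber Z.eq_dec l qde).
  - lra.
  - replace (n * W + 4) with ((3 + n * W) + 1) by ring. apply (count_interval _ x0).
    + apply NoDup_nodup.
    + assert (0 <= n * W) by pos. lra.
    + intros z Hz. apply nodup_In, in_map_iff in Hz. destruct Hz as (x & <- & Hx).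
      destruct (H x Hx) as [EN [_ (u & u' & Hu & Hu' & B1 & _)]]. rewrite EN in B1.
      destruct (Hnu u Hu). destruct (Hnu2 u Hu) as [P1 P2]. unfold x0.
      destruct (Rle_dec 0 (IZR N)) as [Hs|Hs]; [specialize (P1 Hs)|assert (Hs2 : IZR N <= 0) by lra; specialize (P2 Hs2)]; lra.
  - intros de. set (fl := filter _ l).
    assert (Hfl : forall x, In x fl -> In x l /\ qde x = de).
    { intros x Hx. unfold fl in Hx. apply filter_In in Hx. destruct Hx as [Hx1 Hx2].
      destruct (Z.eq_dec (qde x) de); [auto|discriminate]. }
    assert (Hnd : NoDup fl) by (apply NoDup_filter; exact Hl).
    clearbody fl.
    rewrite <- (length_map qal).
    apply Rle_trans with ((3 + n * W) / IZR (Z.abs N) + 1).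
    + apply (count_congruent _ x1).
      * apply NoDup_map_NoDup_ForallPairs; [|exact Hnd].
        intros x y Hx Hy Exy. destruct (Hfl x Hx) as [Lx Dx]. destruct (Hfl y Hy) as [Ly Dy].
        destruct (H x Lx) as [Nx [Ux _]]. destruct (H y Ly) as [Ny [Uy _]].
        rewrite Nx, Dx in Ux. rewrite Ny, Dy in Uy.
        destruct x as [[[x1' x2] x3] x4], y as [[[y1 y2] y3] y4].
        unfold qN, qal, qde, qbe in *; simpl in *. subst.
        assert (x4 = y4) by nia. subst. reflexivity.
      * assert (0 <= n * W) by pos. lra.
      * lia.
      * intros z Hz. apply in_map_iff in Hz. destruct Hz as (x & <- & Hx).
        destruct (Hfl x Hx) as [Lx Dx].
        destruct (H x Lx) as [EN [_ (u & u' & Hu & Hu' & _ & B1)]]. rewrite EN in B1.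
        destruct (Hnu u' Hu'). destruct (Hnu2 u' Hu') as [P1 P2]. unfold x1.
        destruct (Rle_dec 0 (IZR N)) as [Hs|Hs]; [specialize (P1 Hs)|assert (Hs2 : IZR N <= 0) by lra; specialize (P2 Hs2)]; lra.
      * intros z w Hz Hw. apply in_map_iff in Hz. destruct Hz as (x & <- & Hx).
        apply in_map_iff in Hw. destruct Hw as (y & <- & Hy).
        destruct (Hfl x Hx) as [Lx Dx]. destruct (Hfl y Hy) as [Ly Dy].
        destruct (H x Lx) as [Nx [Ux _]]. destruct (H y Ly) as [Ny [Uy _]].
        rewrite Nx, Dx in Ux. rewrite Ny, Dy in Uy.
        apply Z.divide_abs_l.
        exists (qal x * (qbe x - qbe y) - (qal x - qal y) * qbe x)%Z.
        transitivity ((qal x - qal y) * (qal x * de - qbe x * N) - qal x * ((qal x * de - qbe x * N) - (qal y * de - qbe y * N)))%Z; [rewrite Ux, Uy; ring|ring].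
    + rewrite abs_IZR. fold n. unfold Rdiv. rewrite Rmult_plus_distr_r.
      replace (n * W * / n) with W by (field; lra).
      assert (3 * / n <= 3 * 1) by (apply Rmult_le_compat_l; [lra|]; rewrite <- Rinv_1; apply Rinv_le_contravar; lra).
      lra.
Qed.

Definition critical (q r : Z) (x : quad) : R := - IZR (etwo q r x) / IZR (eone q r x).

(** Bound for one correlation in terms of rho and of the arc (c, a). The integer [z] measures in
    units of 1/c how far the arc is from the critical point; for 0 <= z <= 4 the two may meet. If N
    is too small for the lower bound on e1, only the length of the interval is used. *)
Definition Bd (k : nat) (q r : Z) (S y : R) (x : quad) (c a : Z) : R :=
  let N := Rabs (IZR (qN x)) in
  if Rle_dec (4 * Rabs (IZR q)) (N * (3 * S)) then
    let z := (a - Zfloor (IZR c * critical q r x))%Z in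
    if andb (0 <=? z)%Z (z <=? 4)%Z then Gb k S ^ 2 * ((2 + 4 * Wbd k) * sqrt (y / N))
    else Gb k S ^ 2 * (Wbd k * (10 * y * IZR c / (N * IZR (Z.abs z))))
  else Gb k S ^ 2 * (2 / IZR c).

Lemma Wbd_pos k : 0 < Wbd k.
Proof. unfold Wbd. pose proof (pos_INR k). lra. Qed.

Lemma Bd_ge0 k q r S y x c a : 0 < S -> 0 < y -> (0 < c)%Z -> (qN x <> 0)%Z -> 0 <= Bd k q r S y x c a.
Proof.
  intros HS Hy Hc HN. unfold Bd.
  pose proof (pow_lt _ 2 (Gb_pos k S HS)) as HG. pose proof (Wbd_pos k) as HW.
  assert (Hc0 : 0 < IZR c) by arith.
  assert (HN0 : 0 < Rabs (IZR (qN x))) by (apply Rabs_pos_lt, not_0_IZR, HN).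
  destruct (Rle_dec _ _); [destruct (andb _ _) eqn:Hz|]; apply Rmult_le_pos; try lra.
  - apply Rmult_le_pos; [lra|apply sqrt_pos].
  - apply Rmult_le_pos; [lra|]. apply Rdiv_le_0_compat.
    + apply Rmult_le_pos; lra.
    + apply Rmult_lt_0_compat; [exact HN0|]. apply IZR_lt.
      destruct (Z.eq_dec (a - Zfloor (IZR c * critical q r x)) 0) as [E|E]; [rewrite E in Hz; discriminate|lia].
  - apply Rdiv_le_0_compat; lra.
Qed.

Lemma rsum_single {I} (dec : forall x y : I, {x = y} + {x <> y}) (l : list I) y A : NoDup l -> 0 <= A ->
  rsum l (fun x => if dec x y then A else 0) <= A.
Proof.
  intros Hl HA. induction Hl as [|x l Hx Hl IH]; simpl; [exact HA|].
  destruct (dec x y) as [->|]; [|lra].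
  rewrite (rsum_ext l _ (fun _ => 0)), rsum_0; [lra|].
  intros z Hz. destruct (dec z y); [subst; contradiction|reflexivity].
Qed.

(** The total of [Bd] over the arcs of one denominator: five arcs near the critical point and a
    harmonic sum over the others. *)
Definition Bsum (k : nat) (q : Z) (S y : R) (N : Z) (c : R) (h : R) (W : R) : R :=
  let n := Rabs (IZR N) in
  if Rle_dec (4 * Rabs (IZR q)) (n * (3 * S)) then
    Gb k S ^ 2 * (5 * ((2 + 4 * Wbd k) * sqrt (y / n)) + Wbd k * (20 * y * c * h / n))
  else Gb k S ^ 2 * (2 * W).

Lemma Bd_sum k q r S y x c lo n W : 0 < S -> 0 < y -> (0 < c)%Z -> (qN x <> 0)%Z -> INR n = IZR c * W ->
  rsum (zrange lo n) (Bd k q r S y x c) <= Bsum k q S y (qN x) (IZR c) (harm n) W.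
Proof.
  intros HS Hy Hc HN Hn. unfold Bd, Bsum.
  pose proof (pow_lt _ 2 (Gb_pos k S HS)) as HG. pose proof (Wbd_pos k) as HW.
  assert (Hc0 : 0 < IZR c) by arith.
  assert (HN0 : 0 < Rabs (IZR (qN x))) by (apply Rabs_pos_lt, not_0_IZR, HN).
  set (N := Rabs (IZR (qN x))) in *. set (G := Gb k S ^ 2) in *.
  destruct (Rle_dec _ _) as [Hb|Hb].
  - set (z0 := Zfloor (IZR c * critical q r x)). set (A := G * ((2 + 4 * Wbd k) * sqrt (y / N))).
    assert (HA : 0 <= A).
    { unfold A. apply Rmult_le_pos; [lra|]. apply Rmult_le_pos; [lra|apply sqrt_pos]. }
    set (A2 := G * (Wbd k * (10 * y * IZR c / N))).
    assert (HA2 : 0 <= A2).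
    { unfold A2. apply Rmult_le_pos; [lra|]. apply Rmult_le_pos; [lra|]. apply Rdiv_le_0_compat; [|exact HN0].
      apply Rmult_le_pos; lra. }
    apply Rle_trans with (rsum (zrange lo n) (fun a => rsum [0;1;2;3;4]%Z (fun i => if Z.eq_dec a (z0 + i) then A else 0)
      + A2 * (if Z.eq_dec a z0 then 0 else / IZR (Z.abs (a - z0))))).
    + apply rsum_le. intros a _.
      assert (H5 : 0 <= rsum [0;1;2;3;4]%Z (fun i => if Z.eq_dec a (z0 + i) then A else 0)).
      { apply rsum_ge0. intros i _. destruct (Z.eq_dec _ _); lra. }
      assert (H6 : 0 <= A2 * (if Z.eq_dec a z0 then 0 else / IZR (Z.abs (a - z0)))).
      { apply Rmult_le_pos; [exact HA2|]. destruct (Z.eq_dec a z0); [lra|]. left. apply Rinv_0_lt_compat, IZR_lt. lia. }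
      destruct (andb _ _) eqn:Hz.
      * fold A. apply andb_prop in Hz. destruct Hz as [Hz1 Hz2]. apply Z.leb_le in Hz1, Hz2.
        assert (A <= rsum [0;1;2;3;4]%Z (fun i => if Z.eq_dec a (z0 + i) then A else 0)); [|lra].
        simpl. repeat destruct (Z.eq_dec _ _); try lra; lia.
      * destruct (Z.eq_dec a z0) as [->|Hne].
        { rewrite Z.sub_diag in Hz. discriminate. }
        replace (G * (Wbd k * (10 * y * IZR c / (N * IZR (Z.abs (a - z0)))))) with (A2 * / IZR (Z.abs (a - z0))); [lra|].
        unfold A2. field. split; [apply Rgt_not_eq, IZR_lt; lia|lra].
    + rewrite rsum_plus, rsum_swap, rsum_scal.
      pose proof (harm_two lo n z0) as Hh.
      assert (H5 : rsum [0;1;2;3;4]%Z (fun i => rsum (zrange lo n) (fun a => if Z.eq_dec a (z0 + i) then A else 0)) <= 5 * A).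
      { eapply Rle_trans; [apply rsum_le_const with (c := A)|simpl; lra].
        intros i _. apply rsum_single; [apply NoDup_zrange|exact HA]. }
      apply (Rmult_le_compat_l A2) in Hh; [|exact HA2].
      replace (G * (5 * ((2 + 4 * Wbd k) * sqrt (y / N)) + Wbd k * (20 * y * IZR c * harm n / N)))
        with (5 * A + A2 * (2 * harm n)) by (unfold A, A2; field; lra).
      lra.
  - rewrite rsum_const, length_zrange, Hn. right. field. lra.
Qed.

Lemma pair_Bd (k mu : nat) (p s q r a b c d a' b' c' d' : Z) (S lo hi : R) :
  (1 <= k)%nat -> (1 <= mu)%nat -> 0 < S -> (p * r - s * q = 1)%Z -> (a * d - b * c = 1)%Z ->
  (a' * d' - b' * c' = 1)%Z -> Rabs (IZR q) <= 12 * S -> (3 <= c)%Z -> (3 <= c')%Z ->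
  6 * (IZR c + 6) * S ^ 2 <= INR mu -> 6 * (IZR c' + 6) * S ^ 2 <= INR mu ->
  lo <= hi -> hi - lo <= 2 / IZR c -> hi - lo <= 2 / IZR c' ->
  (forall v, lo <= v <= hi -> frame q r a b c d S v) -> (forall v, lo <= v <= hi -> frame q r a' b' c' d' S v) ->
  let x := rho_of a b c d a' b' c' d' in let y := S ^ 2 / INR mu in
  (qN x <> 0)%Z ->
  Cmod (CInt (fun v => Wj k mu p s q r a b c d y v * Cconj (Wj k mu p s q r a' b' c' d' y v))%C lo hi)
    <= Bd k q r S y x c a.
Proof.
  intros Hk Hmu HS H0 Hd Hd' Hq Hc Hc' Hcm Hcm' Hlh Hl1 Hl2 HF HF' x y HN.
  assert (Hy : 0 < y) by (apply Rdiv_lt_0_compat; [apply pow_lt; lra|apply lt_0_INR; lia]).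
  assert (HN0 : 0 < Rabs (IZR (qN x))) by (apply Rabs_pos_lt, not_0_IZR, HN).
  destruct (rho_facts q r a b c d a' b' c' d' S lo Hd Hd' ltac:(lia) ltac:(lia) HS (HF lo ltac:(lra)) (HF' lo ltac:(lra)))
    as (_ & _ & _ & _ & Hbig).
  fold x in Hbig.
  pose proof (pow_lt _ 2 (Gb_pos k S HS)) as HG.
  assert (Hc0 : 3 <= IZR c) by (apply IZR_le; exact Hc).
  unfold Bd. set (N := Rabs (IZR (qN x))) in *.
  destruct (Rle_dec _ _) as [Hb|Hb].
  2:{ eapply Rle_trans; [apply (pair_trivial k mu p s q r a b c d a' b' c' d' S); assumption|].
      apply Rmult_le_compat_l; lra. }
  specialize (Hbig Hb).
  assert (HE : 0 < N * (3 * S) / 2) by arith.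
  destruct (andb _ _) eqn:Hz.
  (* The choice th = sqrt(y/N) balances the trivial part 2 th against the outer parts, which are of
     order y/(N th). *)
  - assert (Hth : 0 < sqrt (y / N)) by arith.
    eapply Rle_trans; [apply (pair_near k mu p s q r a b c d a' b' c' d' S Hk Hmu HS H0 Hd Hd' Hq Hc Hc' Hcm Hcm' lo hi
      (N * (3 * S) / 2) (sqrt (y / N))); assumption|].
    apply Rmult_le_compat_l; [lra|]. right.
    fold y. set (th := sqrt (y / N)) in *.
    assert (Ht2 : th * th = y / N) by (apply sqrt_sqrt; left; apply Rdiv_lt_0_compat; assumption).
    replace (y * S * 3 / (N * (3 * S) / 2 * th)) with (2 * (y / N) / th) by (field; lra).
    rewrite <- Ht2. field. lra.
  - set (ur := critical q r x) in *. set (z := (a - Zfloor (IZR c * ur))%Z) in *.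
    destruct (Zfloor_bound (IZR c * ur)) as [Z1 Z2].
    assert (Hz1 : 1 <= IZR (Z.abs z)) by (apply (IZR_le 1); lia).
    assert (Hfr : forall v, lo <= v <= hi -> IZR (a - 3) <= IZR c * mo a b c d v <= IZR (a - 1)).
    { intros v Hv. specialize (HF v Hv). pose proof (frame_nz _ _ _ _ _ _ _ _ HF) as Hn.
      destruct (mo_inv_mo a b c d v Hd Hn) as [_ He]. destruct HF as [HF1 _]. apply inv_range in HF1.
      rewrite <- He in HF1. rewrite !minus_IZR. lra. }
    assert (Hzr : IZR z = IZR a - IZR (Zfloor (IZR c * ur))) by (unfold z; apply minus_IZR).
    (* On the arc, cu lies in [a - 3, a - 1]. Multiplied by c, the distance to the critical point
       exceeds z - 4 >= z/5 when z >= 5, and exceeds |z| when z < 0. *)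
    set (th := IZR (Z.abs z) / (5 * IZR c)).
    assert (Hth : 0 < th) by (apply Rdiv_lt_0_compat; lra).
    set (sg := if Z_lt_dec z 0 then -1 else 1).
    via (pair_far k mu p s q r a b c d a' b' c' d' S Hk Hmu HS H0 Hd Hd' Hq Hc Hc' Hcm Hcm' lo hi
      sg (N * (3 * S) / 2) th); try assumption.
    + unfold sg. destruct (Z_lt_dec z 0); auto.
    + intros v Hv. specialize (Hfr v Hv). rewrite !minus_IZR in Hfr.
      change (- IZR (e2_ q r a b c d a' b' c' d') / IZR (e1_ q r a b c d a' b' c' d')) with ur.
      set (u := mo a b c d v) in *.
      assert (Hth2 : IZR c * th = IZR (Z.abs z) / 5) by (unfold th; field; lra).
      apply Rmult_le_reg_l with (IZR c); [lra|]. rewrite Hth2.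
      unfold sg. destruct (Z_lt_dec z 0) as [Hz0|Hz0].
      * rewrite Z.abs_neq, opp_IZR in * by lia. nra.
      * assert (5 <= IZR z) by (apply IZR_le; lia). rewrite Z.abs_eq in * by lia. nra.
    + apply Rmult_le_compat_l; [lra|]. right. fold y. unfold th. field. repeat split; try lra.
Qed.

(** * Arcs around fractions with prime denominator *)

(** The inverse of [a] modulo [c], found by search. The default 0 is never reached when [c] is a
    prime not dividing [a]. *)
Definition dinv (c a : Z) : Z :=
  match find (fun d => ((a * d - 1) mod c =? 0)%Z) (zrange 0 (Z.to_nat c)) with Some d => d | None => 0%Z end.

Definition bco (c a : Z) : Z := ((a * dinv c a - 1) / c)%Z.

Lemma dinv_spec c a : prime c -> ~ (c | a)%Z ->
  (0 <= dinv c a < c)%Z /\ (a * dinv c a - bco c a * c = 1)%Z.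
Proof.
  intros Hc Ha. assert (Hc1 : (1 < c)%Z) by (destruct Hc; assumption).
  assert (H : (0 <= dinv c a < c)%Z /\ ((a * dinv c a - 1) mod c = 0)%Z).
  { unfold dinv. destruct (find _ _) as [d|] eqn:Hf.
    - apply find_some in Hf. destruct Hf as [H1 H2]. apply In_zrange in H1. apply Z.eqb_eq in H2. lia.
    - exfalso. destruct (rel_prime_bezout _ _ (prime_rel_prime c Hc a Ha)) as [u v Huv].
      assert (Hin : In (v mod c)%Z (zrange 0 (Z.to_nat c))).
      { apply In_zrange. pose proof (Z.mod_pos_bound v c). lia. }
      pose proof (find_none _ _ Hf _ Hin) as Hn. apply Z.eqb_neq in Hn. apply Hn.
      rewrite Zminus_mod, Zmult_mod_idemp_r, <- Zminus_mod.
      replace (a * v - 1)%Z with (- u * c)%Z by lia. apply Z_mod_mult. }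
  destruct H as [H1 H2]. split; [exact H1|].
  unfold bco. pose proof (Z_div_mod_eq_full (a * dinv c a - 1) c) as E. lia.
Qed.

(* [a] runs over residues prime to [c]; the last arc, for [a = c + 1], is twice as long since [a = c] is left out. *)
Definition arcs (c : Z) : list Z := zrange 2 (Z.to_nat (c - 2)) ++ [(c + 1)%Z].
Definition arc_lo (c a : Z) : R := if Z.eq_dec a (c + 1) then IZR (c - 2) / IZR c else IZR (a - 2) / IZR c.
Definition arc_hi (c a : Z) : R := IZR (a - 1) / IZR c.

Lemma In_arcs c a : (3 <= c)%Z -> In a (arcs c) -> (2 <= a <= c + 1)%Z /\ a <> c.
Proof.
  intros Hc H. unfold arcs in H. apply in_app_or in H. destruct H as [H|[<-|[]]].
  - apply In_zrange in H. lia.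
  - lia.
Qed.

Lemma NoDup_arcs c : NoDup (arcs c).
Proof.
  unfold arcs. apply NoDup_app; [apply NoDup_zrange|constructor; [intros []|constructor]|].
  intros a Ha [<-|[]]. apply In_zrange in Ha. lia.
Qed.

(** The clamp [cl] cuts the tiling of [0, 1] down to [x1, x2]. The function [h] is left general so
    that it can be an integral from a base point, both for [Phi] and for the diagonal terms. *)
Lemma arcs_tile c x1 x2 (h : R -> C) : (3 <= c)%Z -> 0 <= x1 -> x1 <= x2 -> x2 <= 1 ->
  let cl x := Rmax x1 (Rmin x2 x) in
  csum (arcs c) (fun a => h (cl (arc_hi c a)) - h (cl (arc_lo c a)))%C = (h x2 - h x1)%C.
Proof.
  intros Hc H0 H1 H2 cl. unfold arcs. rewrite csum_app. cbn [csum].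
  assert (Hc0 : 0 < IZR c) by arith.
  assert (Ht : forall n, (Z.of_nat n <= c - 2)%Z ->
    csum (zrange 2 n) (fun a => h (cl (arc_hi c a)) - h (cl (arc_lo c a)))%C =
    (h (cl (INR n / IZR c)%R) - h (cl 0))%C).
  { induction n as [|n IH]; intros Hn.
    - simpl. replace (0 / IZR c) with 0 by (field; lra). ring.
    - replace (zrange 2 (S n)) with (zrange 2 n ++ [(2 + Z.of_nat n)%Z]).
      2:{ unfold zrange. rewrite seq_S, map_app. reflexivity. }
      rewrite csum_app, IH by lia. cbn [csum].
      unfold arc_lo, arc_hi. destruct (Z.eq_dec _ _); [lia|].
      replace (IZR (2 + Z.of_nat n - 1)) with (INR (S n)) by (rewrite INR_IZR_INZ; f_equal; lia).
      replace (IZR (2 + Z.of_nat n - 2)) with (INR n) by (rewrite INR_IZR_INZ; f_equal; lia). ring. }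
  rewrite Ht by lia. unfold arc_lo at 1, arc_hi at 1. destruct (Z.eq_dec _ _); [|lia].
  replace (INR (Z.to_nat (c - 2))) with (IZR (c - 2)) by (rewrite INR_IZR_INZ; f_equal; lia).
  replace (IZR (c + 1 - 1) / IZR c) with 1 by (replace (c + 1 - 1)%Z with c by lia; field; lra).
  replace (cl 0) with x1 by (unfold cl, Rmax, Rmin; repeat destruct (Rle_dec _ _); lra).
  replace (cl 1) with x2 by (unfold cl, Rmax, Rmin; repeat destruct (Rle_dec _ _); lra).
  ring.
Qed.

Definition ulo (x1 x2 : R) (j : Z * Z) : R := Rmax x1 (Rmin x2 (arc_lo (fst j) (snd j))).
Definition uhi (x1 x2 : R) (j : Z * Z) : R := Rmax x1 (Rmin x2 (arc_hi (fst j) (snd j))).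
Definition dj (j : Z * Z) : Z := dinv (fst j) (snd j).
Definition bj (j : Z * Z) : Z := bco (fst j) (snd j).
Definition vlo (x1 x2 : R) (j : Z * Z) : R := mo_inv (snd j) (bj j) (fst j) (dj j) (ulo x1 x2 j).
Definition vhi (x1 x2 : R) (j : Z * Z) : R := mo_inv (snd j) (bj j) (fst j) (dj j) (uhi x1 x2 j).

(** A discarded arc contributes nothing, because its two clamped ends coincide. *)
Definition jlist (Pr : list Z) (x1 x2 : R) : list (Z * Z) :=
  filter (fun j => if Rlt_dec (ulo x1 x2 j) (uhi x1 x2 j) then true else false)
    (flat_map (fun c => map (pair c) (arcs c)) Pr).

Lemma NoDup_flat_pair {I J} (l : list I) (g : I -> list J) : NoDup l -> (forall c, NoDup (g c)) ->
  NoDup (flat_map (fun c => map (pair c) (g c)) l).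
Proof.
  intros Hl Hg. induction Hl as [|x l Hx Hl IH]; simpl; [constructor|].
  apply NoDup_app; [|exact IH|].
  - apply Injective_map_NoDup; [intros u v E; inversion E; reflexivity|apply Hg].
  - intros z Hz Hz'. apply in_map_iff in Hz. destruct Hz as (w & <- & _).
    apply in_flat_map in Hz'. destruct Hz' as (y & Hy & Hy').
    apply in_map_iff in Hy'. destruct Hy' as (w' & E & _). inversion E; subst. contradiction.
Qed.

Lemma mo_shift a b c d t v : IZR c * v + IZR d <> 0 -> mo (a + c * t) (b + d * t) c d v = mo a b c d v + IZR t.
Proof. intros H. unfold mo. rewrite !plus_IZR, !mult_IZR. field. exact H. Qed.

(** An arc lies to the left of a/c, at distances between 1/c and 3/c, so 1 <= a - cu <= 3. Hence cv
    + d = 1/(a - cu) lies in [1/3, 1], and 0 <= d < c puts v in [-1, 1]. A prime c leaves no other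
    residues than a = c to avoid. *)
Lemma In_jlist Pr x1 x2 j : (forall c, In c Pr -> prime c /\ (3 <= c)%Z) ->
  0 <= x1 -> x1 <= x2 -> x2 <= 1 -> In j (jlist Pr x1 x2) ->
  let c := fst j in let a := snd j in let b := bj j in let d := dj j in
  In c Pr /\ (3 <= c)%Z /\ (2 <= a <= c + 1)%Z /\ (a * d - b * c = 1)%Z /\ (0 <= d < c)%Z /\
  x1 <= ulo x1 x2 j /\ ulo x1 x2 j < uhi x1 x2 j /\ uhi x1 x2 j <= x2 /\
  vlo x1 x2 j < vhi x1 x2 j /\ vhi x1 x2 j - vlo x1 x2 j <= 2 / IZR c /\
  mo a b c d (vlo x1 x2 j) = ulo x1 x2 j /\ mo a b c d (vhi x1 x2 j) = uhi x1 x2 j /\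
  forall v, vlo x1 x2 j <= v <= vhi x1 x2 j ->
    / 3 <= IZR c * v + IZR d <= 1 /\ ulo x1 x2 j <= mo a b c d v <= uhi x1 x2 j /\ -1 <= v <= 1.
Proof.
  intros HPr H0 H1 H2 Hj c a b d. unfold jlist in Hj. apply filter_In in Hj. destruct Hj as [Hj Hlt].
  destruct (Rlt_dec (ulo x1 x2 j) (uhi x1 x2 j)) as [Hu|]; [clear Hlt|discriminate].
  apply in_flat_map in Hj. destruct Hj as (c0 & Hc0 & Hj). apply in_map_iff in Hj. destruct Hj as (a0 & Ej & Ha0).
  assert (Ec : c = c0) by (unfold c; rewrite <- Ej; reflexivity).
  assert (Ea : a = a0) by (unfold a; rewrite <- Ej; reflexivity).
  rewrite <- Ec in *. rewrite <- Ea in *.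
  destruct (HPr c Hc0) as [Hp Hc3]. destruct (In_arcs c a Hc3 Ha0) as [Ha1 Ha2].
  assert (Hca : ~ (c | a)%Z).
  { intros [w Hw]. assert (w = 1 \/ w <= 0 \/ 2 <= w)%Z by lia. destruct H as [->|[H|H]]; nia. }
  destruct (dinv_spec c a Hp Hca) as [Hd Hdet].
  change (dinv c a) with d in *. change (bco c a) with b in *.
  assert (HcR : 3 <= IZR c) by (apply IZR_le; exact Hc3).
  set (lo := arc_lo c a). set (hi := arc_hi c a).
  assert (Hhi : IZR c * hi = IZR a - 1) by (unfold hi, arc_hi; rewrite minus_IZR; field; lra).
  assert (Hlo : IZR a - 3 <= IZR c * lo).
  { unfold lo, arc_lo. destruct (Z.eq_dec a (c + 1)) as [E|E].
    - rewrite E, plus_IZR, minus_IZR. right. field. lra.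
    - rewrite minus_IZR. replace (IZR c * ((IZR a - 2) / IZR c)) with (IZR a - 2) by (field; lra). lra. }
  assert (Hcl : x1 <= ulo x1 x2 j /\ uhi x1 x2 j <= x2 /\ lo <= ulo x1 x2 j /\ uhi x1 x2 j <= hi).
  { revert Hu. unfold ulo, uhi. fold c a lo hi. unfold Rmax, Rmin. repeat destruct (Rle_dec _ _); lra. }
  destruct Hcl as (C1 & C2 & C3 & C4).
  set (ul := ulo x1 x2 j) in *. set (uh := uhi x1 x2 j) in *.
  assert (Hr : forall u, ul <= u <= uh -> 1 <= IZR a - IZR c * u <= 3).
  { intros u Hu1. assert (IZR c * lo <= IZR c * u) by arith.
    assert (IZR c * u <= IZR c * hi) by arith. lra. }
  pose proof (Hr ul ltac:(lra)) as Hrl. pose proof (Hr uh ltac:(lra)) as Hrh.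
  destruct (mo_mo_inv a b c d ul Hdet ltac:(pos)) as [M1 M2].
  destruct (mo_mo_inv a b c d uh Hdet ltac:(pos)) as [M3 M4].
  change (mo_inv a b c d ul) with (vlo x1 x2 j) in *. change (mo_inv a b c d uh) with (vhi x1 x2 j) in *.
  set (vl := vlo x1 x2 j) in *. set (vh := vhi x1 x2 j) in *.
  assert (Hdv : 0 < vh - vl <= uh - ul).
  { unfold vh, vl. change (vhi x1 x2 j) with (mo_inv a b c d uh). change (vlo x1 x2 j) with (mo_inv a b c d ul).
    rewrite mo_inv_diff by pos.
    assert (1 <= (IZR a - IZR c * uh) * (IZR a - IZR c * ul)) by nra.
    split; [pos|].
    apply Rmult_le_reg_r with ((IZR a - IZR c * uh) * (IZR a - IZR c * ul)); [lra|].
    unfold Rdiv. rewrite Rmult_assoc, Rinv_l by pos. nra. }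
  assert (Hlen : uh - ul <= 2 / IZR c).
  { apply Rmult_le_reg_l with (IZR c); [lra|]. replace (IZR c * (2 / IZR c)) with 2 by (field; lra). lra. }
  assert (Hv : forall v, vl <= v <= vh -> / 3 <= IZR c * v + IZR d <= 1).
  { intros v Hv. assert (IZR c * vl <= IZR c * v) by arith.
    assert (IZR c * v <= IZR c * vh) by arith.
    assert (/ 3 <= / (IZR a - IZR c * ul)) by (apply Rinv_le_contravar; lra).
    assert (/ (IZR a - IZR c * uh) <= 1) by (rewrite <- Rinv_1; apply Rinv_le_contravar; lra). lra. }
  repeat (split; [first [assumption|lia|lra]|]).
  intros v Hvv. pose proof (Hv v Hvv) as Hx. pose proof (Hv vl ltac:(lra)) as Hxl. pose proof (Hv vh ltac:(lra)) as Hxh.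
  split; [exact Hx|]. split.
  - rewrite <- M1, <- M3. split; apply Rminus_le_0; rewrite mo_diff by pos;
      (apply Rdiv_le_0_compat; [lra|pos]).
  - assert (Hd0 : 0 <= IZR d) by arith. assert (Hd1 : IZR d <= IZR c) by (apply IZR_le; lia).
    split; apply Rmult_le_reg_l with (IZR c); lra.
Qed.

Lemma rsum_pairs {I J} (l : list I) (g : I -> list J) (h : I * J -> R) :
  rsum (flat_map (fun c => map (pair c) (g c)) l) h = rsum l (fun c => rsum (g c) (fun x => h (c, x))).
Proof. rewrite rsum_flat_map. apply rsum_ext. intros c _. apply rsum_map. Qed.

Lemma rsum_filter_eq {I} (p : I -> bool) (l : list I) g : (forall x, In x l -> p x = false -> g x = 0) ->
  rsum l g = rsum (filter p l) g.
Proof.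
  induction l as [|x l IH]; intros H; simpl; [reflexivity|].
  rewrite IH by (intros; apply H; [right|]; assumption).
  destruct (p x) eqn:E; simpl; [reflexivity|]. rewrite (H x (or_introl eq_refl) E). ring.
Qed.

Lemma Cmod_ip_csum {I I'} (l : list I) (l' : list I') (p q p' q' : R) (g : I -> R -> C) (g' : I' -> R -> C) :
  (forall x v, In x l -> p <= v <= q -> Cc (g x) v) -> (forall x v, In x l' -> p' <= v <= q' -> Cc (g' x) v) ->
  Cmod (ip p q p' q' (fun v => csum l (fun x => g x v)) (fun v => csum l' (fun x => g' x v))) <=
  rsum l (fun x => rsum l' (fun x' => Cmod (ip p q p' q' (g x) (g' x')))).
Proof.
  intros H H'. unfold ip. destruct (Rle_dec (Rmax p p') (Rmin q q')) as [Hl|Hl].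
  - assert (E : CInt (fun v => csum l (fun x => g x v) * Cconj (csum l' (fun x => g' x v)))%C (Rmax p p') (Rmin q q') =
      csum l (fun x => csum l' (fun x' => CInt (fun v => g x v * Cconj (g' x' v))%C (Rmax p p') (Rmin q q')))).
    { apply is_CInt_unique. eapply is_RInt_ext; [intros v _; symmetry; apply csum_mul_conj|].
      apply (is_CInt_csum l (fun x v => csum l' (fun y => g x v * Cconj (g' y v))%C)). intros x Hx.
      apply (is_CInt_csum l' (fun y v => g x v * Cconj (g' y v))%C). intros y Hy.
      apply CInt_correct, ex_CInt_le; [exact Hl|]. intros v Hv.
      pose proof (Rmax_l p p'); pose proof (Rmax_r p p'); pose proof (Rmin_l q q'); pose proof (Rmin_r q q').
      apply Cc_mult; [apply H; [exact Hx|lra]|apply Cc_conj, H'; [exact Hy|lra]]. }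
    rewrite E. apply Cmod_csum_le. intros x Hx. apply Cmod_csum_le. intros; lra.
  - rewrite Cmod_0. apply rsum_ge0. intros. apply rsum_ge0. intros. lra.
Qed.

(** The W translates of one arc: u + t = (1 t; 0 1) u changes only the upper row of the matrix, so
    all translates live on the same v-interval. *)
Definition Wsum (k mu : nat) (p s q r : Z) (y : R) (W : nat) (j : Z * Z) (v : R) : Complex.C :=
  csum (zrange 0 W) (fun t => Wj k mu p s q r (snd j + fst j * t) (bj j + dj j * t) (fst j) (dj j) y v).

Lemma csum_filter_eq {I} (p : I -> bool) (l : list I) (g : I -> C) : (forall x, In x l -> p x = false -> g x = 0%C) ->
  csum l g = csum (filter p l) g.
Proof.
  induction l as [|x l IH]; intros H; simpl; [reflexivity|].
  rewrite IH by (intros; apply H; [right|]; assumption).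
  destruct (p x) eqn:E; simpl; [reflexivity|]. rewrite (H x (or_introl eq_refl) E). ring.
Qed.

Lemma csum_0 {I} (l : list I) : csum l (fun _ => 0%C) = 0%C.
Proof. induction l as [|x l IH]; simpl; [reflexivity|]. rewrite IH. ring. Qed.

Lemma csum_swap {I J} (l : list I) (l' : list J) (g : I -> J -> C) :
  csum l (fun x => csum l' (fun y => g x y)) = csum l' (fun y => csum l (fun x => g x y)).
Proof.
  induction l as [|x l IH]; simpl; [symmetry; apply csum_0|]. rewrite IH, csum_plus. reflexivity.
Qed.

Lemma csum_const {I} (l : list I) (z : C) : csum l (fun _ => z) = (RtoC (INR (length l)) * z)%C.
Proof.
  induction l as [|x l IH]; cbn [csum length]; [simpl; ring|]. rewrite IH, S_INR, RtoC_plus. ring.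
Qed.

Lemma csum_pairs {I J} (l : list I) (g : I -> list J) (h : I * J -> C) :
  csum (flat_map (fun c => map (pair c) (g c)) l) h = csum l (fun c => csum (g c) (fun x => h (c, x))).
Proof. rewrite csum_flat_map. apply csum_ext. intros c _. apply csum_map. Qed.

(** The factor 1 is the derivative of the horizontal path; it is kept so that the integrand matches
    [path_series]. *)
Definition Phi (mu : nat) (f : C -> C) (x : R) : C := (f (pt x (/ INR mu)) * (E mu (pt x (/ INR mu)) * 1))%C.

Definition link_const (k mu : nat) (B : R) : R :=
  4 * B * Rpower 37 (INR k / 2) * exp (2 * PI) * (Rpower (INR mu) (INR k / 2) / INR mu).

(** * Averaging over primes: the off-diagonal terms *)

Section Second.
Context (k mu : nat) (p s q r : Z) (S : R) (Pr : list Z) (P W : nat) (x1 x2 : R).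
Context (Hk : (1 <= k)%nat) (Hmu : (1 <= mu)%nat) (HS : 0 < S) (H0 : (p * r - s * q = 1)%Z)
  (Hq : Rabs (IZR q) <= 12 * S) (HPd : NoDup Pr)
  (HPr : forall c, In c Pr -> prime c /\ (3 <= c)%Z) (HP2 : forall c, In c Pr -> IZR c <= 2 * INR P)
  (HP1 : (1 <= P)%nat)
  (HW : (1 <= W)%nat) (Hx0 : 0 <= x1) (Hx12 : x1 <= x2) (Hx2 : x2 <= 1)
  (Hfr : forall u t, x1 <= u <= x2 -> (0 <= t < Z.of_nat W)%Z -> 3 * S <= IZR q * (u + IZR t) + IZR r <= 6 * S)
  (Hsm : 12 * (INR P + 3) * S ^ 2 <= INR mu).
Let y := S ^ 2 / INR mu.
(** This keeps the off-diagonal terms at the size of the diagonal ones, and thereby decides how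
    large P may be. *)
Context (Hcond : INR W ^ 2 * INR P ^ 3 * y <= 1).
Let J := jlist Pr x1 x2.
Let X := flat_map (fun j => map (pair j) (zrange 0 W)) J.
Let lo := vlo x1 x2.
Let hi := vhi x1 x2.
Let xa (x : Z * Z * Z) : Z := (snd (fst x) + fst (fst x) * snd x)%Z.
Let xb (x : Z * Z * Z) : Z := (bj (fst x) + dj (fst x) * snd x)%Z.
Let xc (x : Z * Z * Z) : Z := fst (fst x).
Let xd (x : Z * Z * Z) : Z := dj (fst x).
Let rho x x' := rho_of (xa x) (xb x) (xc x) (xd x) (xa x') (xb x') (xc x') (xd x').
Let Wx (x : Z * Z * Z) := Wj k mu p s q r (xa x) (xb x) (xc x) (xd x) y.
Let ipx x x' := ip (lo (fst x)) (hi (fst x)) (lo (fst x')) (hi (fst x')) (Wx x) (Wx x').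

Definition In_J j (H : In j J) := In_jlist Pr x1 x2 j HPr Hx0 Hx12 Hx2 H.

Lemma y_pos : 0 < y.
Proof. apply Rdiv_lt_0_compat; [apply pow_lt; lra|apply lt_0_INR; lia]. Qed.

Lemma In_X x : In x X <-> In (fst x) J /\ (0 <= snd x < Z.of_nat W)%Z.
Proof.
  unfold X. rewrite in_flat_map. split.
  - intros (j & Hj & Hx). apply in_map_iff in Hx. destruct Hx as (t & <- & Ht). apply In_zrange in Ht. simpl. split; [exact Hj|lia].
  - intros [H1 H2]. exists (fst x). split; [exact H1|]. apply in_map_iff. exists (snd x).
    split; [destruct x; reflexivity|]. apply In_zrange. lia.
Qed.

Lemma NoDup_J : NoDup J.
Proof. apply NoDup_filter, NoDup_flat_pair; [exact HPd|apply NoDup_arcs]. Qed.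

Lemma NoDup_X : NoDup X.
Proof. apply NoDup_flat_pair; [exact NoDup_J|]. intros; apply NoDup_zrange. Qed.

Lemma X_det x : In x X -> (xa x * xd x - xb x * xc x = 1)%Z.
Proof.
  intros Hx. apply In_X in Hx. destruct Hx as [Hj _]. destruct (In_J _ Hj) as (_ & _ & _ & H & _).
  unfold xa, xb, xc, xd. rewrite <- H. ring.
Qed.

Lemma X_frame x v : In x X -> lo (fst x) <= v <= hi (fst x) -> frame q r (xa x) (xb x) (xc x) (xd x) S v.
Proof.
  intros Hx Hv. apply In_X in Hx. destruct Hx as [Hj Ht].
  destruct (In_J _ Hj) as (_ & _ & _ & _ & _ & A1 & _ & A2 & _ & _ & _ & _ & A3).
  destruct (A3 v Hv) as (B1 & B2 & _).
  split; [exact B1|]. unfold xa, xb, xc, xd. rewrite mo_shift by (apply Rgt_not_eq; lra).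
  apply Hfr; [lra|exact Ht].
Qed.

Lemma X_u x v : In x X -> lo (fst x) <= v <= hi (fst x) -> 0 <= mo (xa x) (xb x) (xc x) (xd x) v <= INR W.
Proof.
  intros Hx Hv. apply In_X in Hx. destruct Hx as [Hj Ht].
  destruct (In_J _ Hj) as (_ & _ & _ & _ & _ & A1 & _ & A2 & _ & _ & _ & _ & A3).
  destruct (A3 v Hv) as (B1 & B2 & _).
  unfold xa, xb, xc, xd. rewrite mo_shift by (apply Rgt_not_eq; lra).
  assert (0 <= IZR (snd x)) by arith.
  assert (IZR (snd x) <= INR W - 1).
  { rewrite INR_IZR_INZ, <- minus_IZR. apply IZR_le. lia. }
  lra.
Qed.

Lemma X_small x : In x X -> (3 <= xc x)%Z /\ 6 * (IZR (xc x) + 6) * S ^ 2 <= INR mu /\ IZR (xc x) <= 2 * INR P.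
Proof.
  intros Hx. apply In_X in Hx. destruct Hx as [Hj _].
  destruct (In_J _ Hj) as (A1 & A2 & _). split; [exact A2|].
  pose proof (HP2 _ A1) as H2. split; [|exact H2].
  eapply Rle_trans; [|exact Hsm]. apply Rmult_le_compat_r; [apply pow2_ge_0|].
  change (xc x) with (fst (fst x)). lra.
Qed.

(** N = 0 forces c = c', then d = d', and finally a = a' modulo c. So the case N = 0, where the
    bounds in terms of |N| break down, occurs only between translates of one arc, and these belong
    to the diagonal. *)
Lemma X_N0 x x' : In x X -> In x' X -> fst x <> fst x' -> (qN (rho x x') <> 0)%Z.
Proof.
  intros Hx Hx' Hne E0. apply Hne.
  apply In_X in Hx. apply In_X in Hx'. destruct Hx as [Hj _]. destruct Hx' as [Hj' _].
  destruct (In_J _ Hj) as (_ & A2 & A3 & A4 & _). destruct (In_J _ Hj') as (_ & A2' & A3' & A4' & _).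
  unfold rho, rho_of, qN in E0; simpl in E0. unfold xa, xb, xc, xd in *.
  destruct x as [[c a] t]. destruct x' as [[c' a'] t']. cbn [fst snd] in *.
  set (d := dj (c, a)) in *. set (d' := dj (c', a')) in *. set (b := bj (c, a)) in *. set (b' := bj (c', a')) in *.
  assert (V1 : (c | c')%Z).
  { exists (a * d' - b * c')%Z. transitivity (c' * (a * d - b * c) - a * (c' * d - d' * c))%Z; [rewrite A4, E0; ring|ring]. }
  assert (V2 : (c' | c)%Z).
  { exists (a' * d - b' * c)%Z. transitivity (c * (a' * d' - b' * c') + a' * (c' * d - d' * c))%Z; [rewrite A4', E0; ring|ring]. }
  assert (Ec : c = c') by (apply Z.divide_antisym_nonneg; first [assumption|lia]). subst c'.
  assert (Ed : d = d') by (apply Z.mul_reg_l with c; [lia|rewrite (Z.mul_comm c d'); lia]).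
  assert (V3 : (c | a - a')%Z).
  { exists (a * (b - b') - b * (a - a'))%Z. clearbody d d' b b'. subst d'.
    transitivity ((a - a') * (a * d - b * c) - a * ((a * d - b * c) - (a' * d - b' * c)))%Z; [rewrite A4, A4'; ring|ring]. }
  (* Both numbers lie in [2, c + 1], a complete set of residues modulo c. *)
  assert (a = a').
  { destruct V3 as [w Hw]. assert (w = 0 \/ w <= -1 \/ 1 <= w)%Z by lia. destruct H as [->|[H|H]]; nia. }
  subst. reflexivity.
Qed.

Definition meets (x x' : Z * Z * Z) : bool :=
  if Rle_dec (Rmax (lo (fst x)) (lo (fst x'))) (Rmin (hi (fst x)) (hi (fst x'))) then true else false.
Definition pdec (i j : Z * Z) : {i = j} + {i <> j}.
Proof. repeat decide equality. Defined.
Definition good (x x' : Z * Z * Z) : bool := if pdec (fst x) (fst x') then false else meets x x'.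

Lemma good_spec x x' : In x X -> In x' X -> good x x' = true ->
  (qN (rho x x') <> 0)%Z /\ admissible (INR W) (rho x x') /\ Rabs (IZR (qN (rho x x'))) <= 2 * INR P /\
  Cmod (ipx x x') <= Bd k q r S y (rho x x') (xc x) (xa x).
Proof.
  intros Hx Hx' Hg. unfold good in Hg. destruct (pdec (fst x) (fst x')) as [|Hne]; [discriminate|].
  unfold meets in Hg. destruct (Rle_dec _ _) as [Hl|]; [clear Hg|discriminate].
  pose proof (X_N0 x x' Hx Hx' Hne) as HN. split; [exact HN|].
  pose proof (X_det x Hx) as D. pose proof (X_det x' Hx') as D'.
  destruct (X_small x Hx) as (C3 & Cm & C2). destruct (X_small x' Hx') as (C3' & Cm' & C2').
  pose proof (Rmax_l (lo (fst x)) (lo (fst x'))) as M1. pose proof (Rmax_r (lo (fst x)) (lo (fst x'))) as M2.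
  pose proof (Rmin_l (hi (fst x)) (hi (fst x'))) as M3. pose proof (Rmin_r (hi (fst x)) (hi (fst x'))) as M4.
  set (l := Rmax (lo (fst x)) (lo (fst x'))) in *. set (h := Rmin (hi (fst x)) (hi (fst x'))) in *.
  assert (F1 : forall v, l <= v <= h -> frame q r (xa x) (xb x) (xc x) (xd x) S v) by (intros; apply X_frame; [exact Hx|lra]).
  assert (F2 : forall v, l <= v <= h -> frame q r (xa x') (xb x') (xc x') (xd x') S v) by (intros; apply X_frame; [exact Hx'|lra]).
  destruct (rho_facts q r _ _ _ _ _ _ _ _ S l D D' ltac:(lia) ltac:(lia) HS (F1 l ltac:(lra)) (F2 l ltac:(lra)))
    as (G1 & G2 & G3 & G4 & _). fold (rho x x') in G1, G2, G3, G4.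
  split; [|split].
  - split; [exact G3|]. exists (mo (xa x) (xb x) (xc x) (xd x) l), (mo (xa x') (xb x') (xc x') (xd x') l).
    split; [apply X_u; [exact Hx|lra]|]. split; [apply X_u; [exact Hx'|lra]|]. split; assumption.
  - eapply Rle_trans; [exact G4|]. apply Rmax_lub; assumption.
  - unfold ipx, ip. fold l h. destruct (Rle_dec l h) as [_|]; [|contradiction].
    apply pair_Bd; try assumption.
    + apply In_X in Hx. destruct Hx as [Hj _]. destruct (In_J _ Hj) as (_ & _ & _ & _ & _ & _ & _ & _ & _ & A3 & _).
      fold (lo (fst x)) (hi (fst x)) in A3. change (fst (fst x)) with (xc x) in A3. lra.
    + apply In_X in Hx'. destruct Hx' as [Hj _]. destruct (In_J _ Hj) as (_ & _ & _ & _ & _ & _ & _ & _ & _ & A3 & _).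
      fold (lo (fst x')) (hi (fst x')) in A3. change (fst (fst x')) with (xc x') in A3. lra.
Qed.

(** tau' = rho tau recovers the first column of tau', and a + ct with 2 <= a <= c + 1 recovers both
    a and t. *)
Lemma good_inj x x' x'' : In x X -> In x' X -> In x'' X -> rho x x' = rho x x'' -> x' = x''.
Proof.
  intros Hx Hx' Hx'' E0.
  pose proof (X_det x Hx) as D.
  assert (E1 : (xc x' = xc x'')%Z).
  { transitivity (qN (rho x x') * xa x + qde (rho x x') * xc x)%Z.
    - unfold rho, rho_of, qN, qde; simpl. transitivity ((xa x * xd x - xb x * xc x) * xc x')%Z; [rewrite D; ring|ring].
    - rewrite E0. unfold rho, rho_of, qN, qde; simpl. transitivity ((xa x * xd x - xb x * xc x) * xc x'')%Z; [ring|rewrite D; ring]. }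
  assert (E2 : (xa x' = xa x'')%Z).
  { transitivity (qal (rho x x') * xa x + qbe (rho x x') * xc x)%Z.
    - unfold rho, rho_of, qal, qbe; simpl. transitivity ((xa x * xd x - xb x * xc x) * xa x')%Z; [rewrite D; ring|ring].
    - rewrite E0. unfold rho, rho_of, qal, qbe; simpl. transitivity ((xa x * xd x - xb x * xc x) * xa x'')%Z; [ring|rewrite D; ring]. }
  apply In_X in Hx'. apply In_X in Hx''. destruct Hx' as [Hj' Ht']. destruct Hx'' as [Hj'' Ht''].
  destruct (In_J _ Hj') as (_ & A2 & A3 & _). destruct (In_J _ Hj'') as (_ & A2' & A3' & _).
  unfold xa, xc in *. destruct x' as [[c a] t], x'' as [[c' a'] t']. cbn [fst snd] in *. subst c'.
  assert (t = t') by nia. subst t'. assert (a = a') by lia. subst. reflexivity.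
Qed.

Definition rhos : list quad :=
  nodup quad_dec (flat_map (fun x => map (rho x) (filter (good x) X)) X).

Lemma In_rhos z : In z rhos -> exists x x', In x X /\ In x' X /\ good x x' = true /\ z = rho x x'.
Proof.
  intros H. apply nodup_In, in_flat_map in H. destruct H as (x & Hx & H).
  apply in_map_iff in H. destruct H as (x' & <- & H). apply filter_In in H. exists x, x'. tauto.
Qed.

(** For one c the numbers a + ct are distinct and lie in [2, cW + 1], so arcs and translates merge
    into one range of integers. Nonnegativity allows the range to be filled up. *)
Lemma sum_X_le (g : Z -> Z -> R) : (forall c a, (3 <= c)%Z -> 0 <= g c a) ->
  rsum X (fun x => g (xc x) (xa x)) <= rsum Pr (fun c => rsum (zrange 2 (Z.to_nat c * W)) (g c)).
Proof.
  intros Hg. apply Rle_trans with (rsum (flat_map (fun c => map (pair c) (zrange 2 (Z.to_nat c * W))) Pr)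
    (fun z => g (fst z) (snd z))).
  2:{ rewrite (rsum_pairs Pr). right. reflexivity. }
  apply (rsum_inj pdec _ _ (fun x => (xc x, xa x))).
  - exact NoDup_X.
  - apply NoDup_flat_pair; [exact HPd|]. intros; apply NoDup_zrange.
  - intros x' x'' Hx' Hx'' E0. inversion E0 as [[E1 E2]].
    apply In_X in Hx'. apply In_X in Hx''. destruct Hx' as [Hj' Ht']. destruct Hx'' as [Hj'' Ht''].
    destruct (In_J _ Hj') as (_ & A2 & A3 & _). destruct (In_J _ Hj'') as (_ & A2' & A3' & _).
    unfold xa, xc in *. destruct x' as [[c a] t], x'' as [[c' a'] t']. cbn [fst snd] in *. subst c'.
    assert (t = t') by nia. subst t'. assert (a = a') by lia. subst. reflexivity.
  - intros x Hx. apply In_X in Hx. destruct Hx as [Hj Ht]. destruct (In_J _ Hj) as (A1 & A2 & A3 & _).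
    apply in_flat_map. exists (xc x). split; [exact A1|]. apply in_map. apply In_zrange.
    unfold xa, xc. nia.
  - intros z Hz. apply in_flat_map in Hz. destruct Hz as (c & Hc & Hz). apply in_map_iff in Hz.
    destruct Hz as (w & <- & _). apply Hg. apply (HPr c Hc).
  - intros; simpl; lra.
Qed.

(** For fixed [x] the map x' -> rho x x' is injective, so the inner sum is at most the sum of [Bd]
    over all rho that occur. After the exchange of sums rho, and with it the critical point, is
    fixed while the arc runs, and [Bd_sum] applies. *)
Lemma off_to_rhos : rsum X (fun x => rsum X (fun x' => if pdec (fst x) (fst x') then 0 else Cmod (ipx x x'))) <=
  rsum rhos (fun z => INR (length Pr) * Bsum k q S y (qN z) (2 * INR P) (harm (2 * P * W)) (INR W)).
Proof.
  pose proof y_pos as Hy.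
  apply Rle_trans with (rsum X (fun x => rsum rhos (fun z => Bd k q r S y z (xc x) (xa x)))).
  - apply rsum_le. intros x Hx. rewrite (rsum_filter_eq (good x)).
    2:{ intros x' Hx' Hg. destruct (pdec (fst x) (fst x')) as [|Hne] eqn:Ep; [reflexivity|].
        unfold good in Hg. rewrite Ep in Hg. unfold meets in Hg. unfold ipx, ip.
        destruct (Rle_dec _ _); [discriminate|]. apply Cmod_0. }
    apply (rsum_inj quad_dec _ _ (rho x)).
    + apply NoDup_filter, NoDup_X.
    + apply NoDup_nodup.
    + intros x' x'' H' H''. apply filter_In in H'. apply filter_In in H''. apply good_inj; tauto.
    + intros x' H'. apply nodup_In, in_flat_map. exists x. split; [exact Hx|]. apply in_map, H'.
    + intros z Hz. destruct (In_rhos z Hz) as (w & w' & Hw & Hw' & Hg & ->).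
      apply Bd_ge0; [exact HS|exact Hy| |apply good_spec; assumption].
      destruct (X_small x Hx); lia.
    + intros x' H'. apply filter_In in H'. destruct H' as [Hx' Hg].
      destruct (pdec (fst x) (fst x')) as [E0|Hne]; [unfold good in Hg; destruct (pdec (fst x) (fst x')); [discriminate|contradiction]|].
      apply good_spec; assumption.
  - rewrite rsum_swap. apply rsum_le. intros z Hz.
    destruct (In_rhos z Hz) as (w & w' & Hw & Hw' & Hg & Ez).
    assert (HN : (qN z <> 0)%Z) by (rewrite Ez; apply good_spec; assumption).
    eapply Rle_trans; [apply (sum_X_le (fun c a => Bd k q r S y z c a)); intros; apply Bd_ge0; try assumption; lia|].
    rewrite <- (rsum_const Pr). apply rsum_le. intros c Hc. destruct (HPr c Hc) as [_ Hc3]. pose proof (HP2 c Hc) as Hc2.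
    eapply Rle_trans; [apply (Bd_sum k q r S y z c 2 _ (INR W)); try assumption; [lia|]|].
    { rewrite mult_INR, INR_IZR_INZ, Z2Nat.id by lia. reflexivity. }
    unfold Bsum. pose proof (pow_lt _ 2 (Gb_pos k S HS)) as HG. pose proof (Wbd_pos k) as HWb.
    assert (HN0 : 0 < Rabs (IZR (qN z))) by (apply Rabs_pos_lt, not_0_IZR, HN).
    destruct (Rle_dec _ _); [|lra].
    apply Rmult_le_compat_l; [lra|]. apply Rplus_le_compat_l. apply Rmult_le_compat_l; [lra|].
    apply Rmult_le_compat_r; [left; apply Rinv_0_lt_compat; exact HN0|].
    assert (Hh : harm (Z.to_nat c * W) <= harm (2 * P * W)).
    { assert (Hm : forall m n, (m <= n)%nat -> harm m <= harm n).
      { intros m n Hmn. induction Hmn; [lra|]. eapply Rle_trans; [exact IHHmn|apply harm_le_S]. }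
      apply Hm. apply Nat.mul_le_mono_r. apply INR_le. rewrite mult_INR, INR_IZR_INZ, Z2Nat.id by lia. simpl. lra. }
    pose proof (harm_ge0 (Z.to_nat c * W)).
    assert (0 < IZR c) by arith.
    apply Rmult_le_compat; try assumption.
    + apply Rmult_le_pos; lra.
    + apply Rmult_le_compat_l; lra.
Qed.

Definition off_const : R := Wbd k * (30000 * (1 + harm (2 * P * W))).

(** The number of rho with a given N against the bound for each of them. The first term stems from
    large N, where the count |N| W^2 meets sqrt(y/|N|); the second one from the finitely many small
    N. *)
Lemma count_times_Bsum N : (N <> 0)%Z -> Rabs (IZR N) <= 2 * INR P ->
  (Rabs (IZR N) * INR W + 4) * (INR W + 4) * Bsum k q S y N (2 * INR P) (harm (2 * P * W)) (INR W) <=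
  Gb k S ^ 2 * (INR W * (Wbd k * (1 + harm (2 * P * W))) * (1500 * (INR W * sqrt (2 * INR P * y)))
    + (if Z_lt_dec (Z.abs N) 16 then 20000 * INR W else 0)).
Proof.
  intros HN HNP. pose proof y_pos as Hy.
  pose proof (pow_lt _ 2 (Gb_pos k S HS)) as HG. pose proof (harm_ge0 (2 * P * W)) as Hh.
  assert (HWb : 75 <= Wbd k) by (unfold Wbd; pose proof (pos_INR k); lra).
  assert (HW1 : 1 <= INR W) by (apply (le_INR 1); exact HW).
  assert (HP1' : 1 <= INR P) by (apply (le_INR 1); exact HP1).
  assert (HN1 : 1 <= Rabs (IZR N)) by (rewrite <- abs_IZR; apply (IZR_le 1); lia).
  assert (HNa : Rabs (IZR N) = IZR (Z.abs N)) by (symmetry; apply abs_IZR).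
  set (n := Rabs (IZR N)) in *. set (h := harm (2 * P * W)) in *. set (w := INR W) in *.
  assert (Hcnt : 0 <= (n * w + 4) * (w + 4) <= 25 * (n * w ^ 2)).
  { assert (0 <= n * w + 4 <= 5 * (n * w)) by nra.
    split; [apply Rmult_le_pos; lra|].
    replace (25 * (n * w ^ 2)) with (5 * (n * w) * (5 * w)) by ring. apply Rmult_le_compat; lra. }
  assert (Hmain : 0 <= w * (Wbd k * (1 + h)) * (1500 * (w * sqrt (2 * INR P * y)))) by arith.
  unfold Bsum. fold n. destruct (Rle_dec (4 * Rabs (IZR q)) (n * (3 * S))) as [Hb|Hb].
  - set (rt := sqrt (y / n)).
    assert (Hrt : 0 < rt) by (apply sqrt_lt_R0, Rdiv_lt_0_compat; lra).
    assert (Hr2 : rt * rt = y / n) by (apply sqrt_sqrt; left; apply Rdiv_lt_0_compat; lra).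
    assert (Hrn : n * rt <= sqrt (2 * INR P * y)).
    { rewrite <- (sqrt_square (n * rt)) by (apply Rmult_le_pos; lra). apply sqrt_le_1_alt.
      replace (n * rt * (n * rt)) with (n * (n * (rt * rt))) by ring. rewrite Hr2.
      replace (n * (n * (y / n))) with (n * y) by (field; lra). apply Rmult_le_compat_r; lra. }
    (* A consequence of [Hcond], by which the harmonic part of [Bsum] is no larger, up to [h], than
       the part near the critical point. *)
    assert (HPy : rt * INR P <= 1).
    { apply Rsqr_incr_0_var; [|lra]. unfold Rsqr. replace (rt * INR P * (rt * INR P)) with (rt * rt * INR P ^ 2) by ring.
      rewrite Hr2. apply Rle_trans with (w ^ 2 * INR P ^ 3 * y); [|lra].
      assert (y / n <= y) by (apply Rmult_le_reg_r with n; [lra|]; unfold Rdiv; rewrite Rmult_assoc, Rinv_l by lra; nra).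
      apply Rle_trans with (y * INR P ^ 2); [apply Rmult_le_compat_r; [apply pow2_ge_0|assumption]|].
      replace (w ^ 2 * INR P ^ 3 * y) with (y * INR P ^ 2 * (w ^ 2 * INR P)) by ring.
      rewrite <- (Rmult_1_r (y * INR P ^ 2)) at 1. apply Rmult_le_compat_l.
      - apply Rmult_le_pos; [lra|apply pow2_ge_0].
      - nra. }
    assert (HB : 5 * ((2 + 4 * Wbd k) * rt) + Wbd k * (20 * y * (2 * INR P) * h / n) <= 60 * (Wbd k * (1 + h)) * rt).
    { replace (20 * y * (2 * INR P) * h / n) with (40 * h * (rt * INR P) * rt) by
        (replace (40 * h * (rt * INR P) * rt) with (40 * h * INR P * (rt * rt)) by ring; rewrite Hr2; field; lra).
      assert (40 * h * (rt * INR P) * rt <= 40 * h * 1 * rt).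
      { apply Rmult_le_compat_r; [lra|]. apply Rmult_le_compat_l; lra. }
      assert (Wbd k * (40 * h * (rt * INR P) * rt) <= Wbd k * (40 * h * 1 * rt)) by arith.
      assert (0 <= Wbd k * (h * rt)) by arith.
      assert (75 * rt <= Wbd k * rt) by arith.
      lra. }
    set (Bx := 5 * ((2 + 4 * Wbd k) * rt) + Wbd k * (20 * y * (2 * INR P) * h / n)) in *.
    assert (HBx0 : 0 <= 60 * (Wbd k * (1 + h)) * rt) by arith.
    replace ((n * w + 4) * (w + 4) * (Gb k S ^ 2 * Bx)) with (Gb k S ^ 2 * ((n * w + 4) * (w + 4) * Bx)) by ring.
    apply Rmult_le_compat_l; [lra|].
    apply Rle_trans with (25 * (n * w ^ 2) * (60 * (Wbd k * (1 + h)) * rt)).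
    + apply Rle_trans with ((n * w + 4) * (w + 4) * (60 * (Wbd k * (1 + h)) * rt)).
      * apply Rmult_le_compat_l; [apply Hcnt|exact HB].
      * apply Rmult_le_compat_r; [exact HBx0|apply Hcnt].
    + replace (25 * (n * w ^ 2) * (60 * (Wbd k * (1 + h)) * rt)) with
        (w * (Wbd k * (1 + h)) * (1500 * (w * (n * rt)))) by ring.
      assert (0 <= (if Z_lt_dec (Z.abs N) 16 then 20000 * w else 0)) by (destruct (Z_lt_dec _ _); lra).
      assert (w * (Wbd k * (1 + h)) * (1500 * (w * (n * rt))) <= w * (Wbd k * (1 + h)) * (1500 * (w * sqrt (2 * INR P * y)))); [|lra].
      apply Rmult_le_compat_l; [apply Rmult_le_pos; [lra|apply Rmult_le_pos; lra]|].
      apply Rmult_le_compat_l; [lra|]. apply Rmult_le_compat_l; lra.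
  (* Small N: |q| <= 12S gives n < 16. As n >= 1 also |q| > 3S/4, and |q|(W - 1) <= 3S then gives W
     <= 5, so the trivial bound is good enough. *)
  - assert (Hn16 : n < 16) by nra.
    rewrite HNa in Hn16. apply lt_IZR in Hn16. destruct (Z_lt_dec (Z.abs N) 16) as [_|]; [|contradiction].
    assert (Hq4 : 3 * S < 4 * Rabs (IZR q)) by nra.
    assert (Hw5 : w <= 5).
    { pose proof (Hfr x1 0%Z ltac:(lra) ltac:(lia)) as F1.
      pose proof (Hfr x1 (Z.of_nat W - 1)%Z ltac:(lra) ltac:(lia)) as F2.
      rewrite minus_IZR, <- INR_IZR_INZ in F2. fold w in F2.
      assert (F3 : Rabs (IZR q * (w - 1)) <= 3 * S) by (apply Rabs_le; lra).
      rewrite Rabs_mult, (Rabs_right (w - 1)) in F3 by lra.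
      destruct (Rle_lt_dec w 5) as [|Hlt]; [assumption|exfalso].
      assert (Rabs (IZR q) * 4 <= Rabs (IZR q) * (w - 1)) by arith. lra. }
    apply lt_IZR in Hn16 || idtac.
    assert (Hn16' : n <= 16) by arith.
    replace ((n * w + 4) * (w + 4) * (Gb k S ^ 2 * (2 * w))) with (Gb k S ^ 2 * ((n * w + 4) * (w + 4) * 2 * w)) by ring.
    apply Rmult_le_compat_l; [lra|].
    assert ((n * w + 4) * (w + 4) * 2 * w <= 20000 * w); [|lra].
    apply Rmult_le_compat_r; [lra|]. 
    assert (n * w ^ 2 <= 16 * 25) by arith. lra.
Qed.

Lemma off_bound : rsum X (fun x => rsum X (fun x' => if pdec (fst x) (fst x') then 0 else Cmod (ipx x x'))) <=
  INR (length Pr) * (Gb k S ^ 2 * (INR W * off_const)).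
Proof.
  eapply Rle_trans; [exact off_to_rhos|].
  rewrite rsum_scal. apply Rmult_le_compat_l; [apply pos_INR|].
  pose proof y_pos as Hy.
  pose proof (pow_lt _ 2 (Gb_pos k S HS)) as HG. pose proof (harm_ge0 (2 * P * W)) as Hh.
  assert (HWb : 75 <= Wbd k) by (unfold Wbd; pose proof (pos_INR k); lra).
  assert (HW1 : 1 <= INR W) by (apply (le_INR 1); exact HW).
  assert (HP1' : 1 <= INR P) by (apply (le_INR 1); exact HP1).
  set (L := remove Z.eq_dec 0%Z (zrange (- 2 * Z.of_nat P) (4 * P + 1))).
  assert (HL : forall N, In N L -> (N <> 0)%Z /\ Rabs (IZR N) <= 2 * INR P).
  { intros N HN. apply in_remove in HN. destruct HN as [H1 H2]. apply In_zrange in H1. split; [exact H2|].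
    rewrite INR_IZR_INZ, <- mult_IZR. apply Rabs_le. rewrite <- opp_IZR. split; apply IZR_le; lia. }
  apply Rle_trans with (rsum L (fun N => (Rabs (IZR N) * INR W + 4) * (INR W + 4) *
     Bsum k q S y N (2 * INR P) (harm (2 * P * W)) (INR W))).
  { apply (rsum_fiber Z.eq_dec rhos L qN (fun N => Bsum k q S y N (2 * INR P) (harm (2 * P * W)) (INR W))
      (fun N => (Rabs (IZR N) * INR W + 4) * (INR W + 4))).
    - apply NoDup_remove_dec, NoDup_zrange.
    - intros z Hz. destruct (In_rhos z Hz) as (x & x' & Hx & Hx' & Hg & ->).
      destruct (good_spec x x' Hx Hx' Hg) as (A1 & _ & A3 & _). apply in_in_remove; [exact A1|].
      apply In_zrange. apply Rabs_le_between in A3. rewrite INR_IZR_INZ, <- mult_IZR, <- opp_IZR in A3.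
      destruct A3 as [A3 A4]. apply le_IZR in A3, A4. lia.
    - intros N HN. destruct (HL N HN) as [HN0 _]. unfold Bsum.
      assert (0 < Rabs (IZR N)) by (apply Rabs_pos_lt, not_0_IZR, HN0).
      destruct (Rle_dec _ _); apply Rmult_le_pos; try lra.
      apply Rplus_le_le_0_compat.
      + apply Rmult_le_pos; [lra|]. apply Rmult_le_pos; [lra|apply sqrt_pos].
      + apply Rmult_le_pos; [lra|]. apply Rdiv_le_0_compat; [|assumption].
        apply Rmult_le_pos; [|exact Hh]. apply Rmult_le_pos; lra.
    - intros N HN. destruct (HL N HN) as [HN0 _]. apply count_admissible; [|lra|exact HN0|].
      + apply NoDup_filter, NoDup_nodup.
      + intros z Hz. apply filter_In in Hz. destruct Hz as [Hz Hz2].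
        destruct (Z.eq_dec (qN z) N) as [E0|]; [|discriminate]. split; [exact E0|].
        destruct (In_rhos z Hz) as (x & x' & Hx & Hx' & Hg & ->). apply good_spec; assumption. }
  eapply Rle_trans; [apply rsum_le; intros N HN; destruct (HL N HN); apply count_times_Bsum; assumption|].
  rewrite rsum_scal. apply Rmult_le_compat_l; [lra|]. rewrite rsum_plus, rsum_const.
  assert (Hlen : INR (length L) <= 5 * INR P).
  { apply Rle_trans with (INR (4 * P + 1)).
    - apply le_INR. rewrite <- (length_zrange (- 2 * Z.of_nat P) (4 * P + 1)). unfold L. 
      apply Nat.lt_le_incl, remove_length_lt. apply In_zrange. lia.
    - rewrite plus_INR, mult_INR. replace (INR 4) with 4 by (simpl; ring). replace (INR 1) with 1 by reflexivity. lra. }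
  assert (H31 : rsum L (fun N => if Z_lt_dec (Z.abs N) 16 then 20000 * INR W else 0) <= 31 * (20000 * INR W)).
  { apply Rle_trans with (rsum L (fun N => rsum (zrange (-15) 31) (fun i => if Z.eq_dec N i then 20000 * INR W else 0))).
    - apply rsum_le. intros N _.
      assert (Hge : 0 <= rsum (zrange (-15) 31) (fun i => if Z.eq_dec N i then 20000 * INR W else 0)).
      { apply rsum_ge0. intros i _. destruct (Z.eq_dec N i); lra. }
      destruct (Z_lt_dec (Z.abs N) 16) as [Hl|]; [|exact Hge].
      rewrite (rsum_remove Z.eq_dec _ _ N); [|apply NoDup_zrange|apply In_zrange; lia].
      destruct (Z.eq_dec N N) as [_|]; [|congruence].
      assert (0 <= rsum (remove Z.eq_dec N (zrange (-15) 31)) (fun i => if Z.eq_dec N i then 20000 * INR W else 0)); [|lra].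
      apply rsum_ge0. intros i _. destruct (Z.eq_dec N i); lra.
    - rewrite rsum_swap. eapply Rle_trans; [apply rsum_le_const with (c := 20000 * INR W)|].
      + intros i _. apply (rsum_single Z.eq_dec); [apply NoDup_remove_dec, NoDup_zrange|lra].
      + rewrite length_zrange. apply Rmult_le_compat_r; [lra|]. rewrite INR_IZR_INZ. apply IZR_le. lia. }
  unfold off_const. set (h := harm (2 * P * W)) in *. set (w := INR W) in *.
  (* Summation over |N| <= 2P costs a factor P, and [Hcond] is exactly what bounds W P^(3/2)
     y^(1/2). *)
  assert (Hsq : w * INR P * sqrt (2 * INR P * y) <= 2).
  { apply Rsqr_incr_0_var; [|lra]. unfold Rsqr.
    replace (w * INR P * sqrt (2 * INR P * y) * (w * INR P * sqrt (2 * INR P * y)))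
      with (w ^ 2 * INR P ^ 2 * (sqrt (2 * INR P * y) * sqrt (2 * INR P * y))) by ring.
    rewrite sqrt_sqrt by (apply Rmult_le_pos; lra).
    replace (w ^ 2 * INR P ^ 2 * (2 * INR P * y)) with (2 * (w ^ 2 * INR P ^ 3 * y)) by ring. lra. }
  assert (Hc : 0 <= w * (Wbd k * (1 + h))) by arith.
  assert (M1 : INR (length L) * (w * (Wbd k * (1 + h)) * (1500 * (w * sqrt (2 * INR P * y)))) <=
    w * (Wbd k * (1 + h)) * 15000).
  { apply Rle_trans with (5 * INR P * (w * (Wbd k * (1 + h)) * (1500 * (w * sqrt (2 * INR P * y))))).
    - apply Rmult_le_compat_r; [|exact Hlen]. apply Rmult_le_pos; [exact Hc|].
      apply Rmult_le_pos; [lra|]. apply Rmult_le_pos; [lra|apply sqrt_pos].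
    - replace (5 * INR P * (w * (Wbd k * (1 + h)) * (1500 * (w * sqrt (2 * INR P * y))))) with
        (w * (Wbd k * (1 + h)) * (7500 * (w * INR P * sqrt (2 * INR P * y)))) by ring.
      apply Rmult_le_compat_l; [exact Hc|lra]. }
  assert (M2 : 75 * w <= w * (Wbd k * (1 + h))).
  { rewrite (Rmult_comm 75). apply Rmult_le_compat_l; [lra|]. rewrite <- (Rmult_1_r 75). apply Rmult_le_compat; lra. }
  replace (w * (Wbd k * (30000 * (1 + h)))) with (w * (Wbd k * (1 + h)) * 30000) by ring.
  lra.
Qed.

Lemma J_times_W : INR (length J) <= INR (length Pr) * (2 * INR P).
Proof.
  unfold J, jlist.
  apply Rle_trans with (INR (length (flat_map (fun c => map (pair c) (arcs c)) Pr))).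
  { apply le_INR. clear. induction (flat_map _ _) as [|x l IH]; simpl; [lia|]. destruct (Rlt_dec _ _); simpl; lia. }
  rewrite <- (Rmult_1_r (INR (length (flat_map _ _)))), <- rsum_const, rsum_pairs, <- rsum_const.
  apply rsum_le. intros c Hc. rewrite rsum_const, Rmult_1_r. destruct (HPr c Hc) as [_ Hc3].
  eapply Rle_trans; [|apply (HP2 c Hc)]. unfold arcs. rewrite length_app, length_zrange. simpl length.
  rewrite INR_IZR_INZ. apply IZR_le. lia.
Qed.

(** The diagonal bound [D0] is left open because it is obtained in two ways: trivially when W = 1,
    and by squaring out the sum over translates otherwise. *)
Lemma second_quad D0 :
  rsum J (fun j => Re (ip (lo j) (hi j) (lo j) (hi j) (Wsum k mu p s q r y W j) (Wsum k mu p s q r y W j))) <= D0 ->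
  Re (csum J (fun j => csum J (fun j' => ip (lo j) (hi j) (lo j') (hi j')
     (Wsum k mu p s q r y W j) (Wsum k mu p s q r y W j')))) <= D0 + INR (length Pr) * (Gb k S ^ 2 * (INR W * off_const)).
Proof.
  intros HD.
  assert (Hcont : forall j t v, In j J -> In t (zrange 0 W) -> lo j <= v <= hi j ->
    Cc (Wj k mu p s q r (snd j + fst j * t) (bj j + dj j * t) (fst j) (dj j) y) v).
  { intros j t v Hj Ht Hv. assert (Hx : In (j, t) X) by (apply In_X; apply In_zrange in Ht; simpl; split; [exact Hj|lia]).
    pose proof (X_det (j, t) Hx) as D. pose proof (X_frame (j, t) v Hx Hv) as F. destruct (X_small (j, t) Hx) as [C3 _].
    destruct (frame_full q r _ _ _ _ S v D ltac:(lia) HS Hq F) as [G1 _].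
    apply Wf_cont; [apply (det_full p s q r (xa (j, t)) (xb (j, t)) (xc (j, t)) (xd (j, t))); assumption|].
    apply Rgt_not_eq. unfold xa, xb, xc, xd in G1. cbn [fst snd] in G1. lra. }
  assert (HRe : forall (l : list (Z * Z)) g, Re (csum l g) = rsum l (fun x => Re (g x))).
  { intros l g. induction l as [|x l IH]; [reflexivity|]. cbn [csum rsum]. rewrite <- IH. reflexivity. }
  rewrite HRe.
  apply Rle_trans with (rsum J (fun j => Re (ip (lo j) (hi j) (lo j) (hi j) (Wsum k mu p s q r y W j) (Wsum k mu p s q r y W j)) +
    rsum J (fun j' => if pdec j j' then 0 else Cmod (ip (lo j) (hi j) (lo j') (hi j') (Wsum k mu p s q r y W j) (Wsum k mu p s q r y W j'))))).
  { apply rsum_le. intros j Hj. rewrite HRe. rewrite (rsum_remove pdec J _ j NoDup_J Hj).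
    apply Rplus_le_compat_l. rewrite (rsum_remove pdec J (fun j' => if pdec j j' then _ else _) j NoDup_J Hj).
    destruct (pdec j j) as [_|]; [|congruence]. rewrite Rplus_0_l.
    apply rsum_le. intros j' Hj'. apply in_remove in Hj'. destruct Hj' as [_ Hne].
    destruct (pdec j j'); [congruence|]. eapply Rle_trans; [apply Rle_abs|apply Re_le_Cmod]. }
  rewrite rsum_plus. apply Rplus_le_compat; [exact HD|].
  eapply Rle_trans; [|exact off_bound].
  unfold X. rewrite rsum_pairs. apply rsum_le. intros j Hj.
  apply Rle_trans with (rsum J (fun j' => rsum (zrange 0 W) (fun t => rsum (zrange 0 W) (fun t' =>
     if pdec j j' then 0 else Cmod (ipx (j, t) (j', t')))))).
  - apply rsum_le. intros j' Hj'. destruct (pdec j j') as [_|Hne].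
    + apply rsum_ge0. intros; apply rsum_ge0; intros; lra.
    + apply Cmod_ip_csum; intros; apply Hcont; assumption.
  - rewrite rsum_swap. apply rsum_le. intros t Ht. rewrite rsum_pairs. apply Rle_refl.
Qed.

(** Multiplied by the number of primes, the integral becomes one sum over all arcs; [link] moves
    each arc to height y, and duality on [-1, 1], of length 2, bounds the sum. Division by the
    number of primes leaves the gain. *)
Lemma second_level f A B D0 : modform k f A -> bounded_by k f B -> (1 <= length Pr)%nat -> 0 <= D0 ->
  rsum J (fun j => Re (ip (lo j) (hi j) (lo j) (hi j) (Wsum k mu p s q r y W j) (Wsum k mu p s q r y W j))) <= D0 ->
  Cmod (csum (zrange 0 W) (fun t => CInt (Phi mu f) (mo p s q r (x1 + IZR t)) (mo p s q r (x2 + IZR t)))) <=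
  B * Rpower y (- (INR k / 2)) * sqrt ((D0 + INR (length Pr) * (Gb k S ^ 2 * (INR W * off_const))) * 2) / INR (length Pr)
  + 2 * INR P * INR W * link_const k mu B.
Proof.
  intros Hf Hb HU HD0 HD.
  pose proof y_pos as Hy. pose proof (Wbd_pos k) as HWb0.
  pose proof (pow_lt _ 2 (Gb_pos k S HS)) as HG. pose proof (harm_ge0 (2 * P * W)) as Hh.
  assert (HW1 : 1 <= INR W) by (apply (le_INR 1); exact HW).
  assert (HU1 : 1 <= INR (length Pr)) by (apply (le_INR 1); exact HU).
  assert (Hmu1 : 1 <= INR mu) by (apply (le_INR 1); exact Hmu).
  set (U := INR (length Pr)) in *.
  set (T := D0 + U * (Gb k S ^ 2 * (INR W * off_const))).
  assert (HT : 0 < T).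
  { unfold T. assert (0 < U * (Gb k S ^ 2 * (INR W * off_const))); [|lra].
    apply Rmult_lt_0_compat; [lra|]. apply Rmult_lt_0_compat; [lra|]. apply Rmult_lt_0_compat; [lra|].
    unfold off_const. apply Rmult_lt_0_compat; lra. }
  set (LC := link_const k mu B).
  set (sg := fun t u => mo p s q r (u + IZR t)).
  set (I := csum (zrange 0 W) (fun t => CInt (Phi mu f) (sg t x1) (sg t x2))).
  change (Cmod I <= B * Rpower y (- (INR k / 2)) * sqrt (T * 2) / U + 2 * INR P * INR W * LC).
  assert (Hpos : forall x : R, 0 < Im (pt x (/ INR mu))) by (intros x; simpl; apply Rinv_0_lt_compat; lra).
  assert (HPhi : forall x, Cc (Phi mu f) x).
  { intros x. apply Cc_mult.
    - apply (mf_Cc k f A (fun x => pt x (/ INR mu)) x Hf); [eapply Dc_Cc, Dc_hline|apply Hpos].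
    - apply Cc_mult; [|apply Cc_const]. eapply Dc_Cc, (Dc_E mu (fun x => pt x (/ INR mu))), Dc_hline. }
  assert (Hex : forall a b, @ex_RInt C_R_NormedModule (Phi mu f) a b) by (intros; apply ex_CInt; intros; apply HPhi).
  set (HI := fun j t => CInt (Phi mu f) (sg t (ulo x1 x2 j)) (sg t (uhi x1 x2 j))).
  (* Every prime reproduces the same [I]; this repetition is what the averaging exploits. *)
  assert (E1 : (RtoC U * I)%C = csum J (fun j => csum (zrange 0 W) (HI j))).
  { unfold U. rewrite <- csum_const. unfold J, jlist. rewrite <- csum_filter_eq.
    - rewrite csum_pairs. apply csum_ext. intros c Hc. destruct (HPr c Hc) as [_ Hc3]. unfold I.
      rewrite csum_swap. apply csum_ext. intros t _.
      pose proof (arcs_tile c x1 x2 (fun u => CInt (Phi mu f) 0 (sg t u)) Hc3 Hx0 Hx12 Hx2) as HA. cbv beta zeta in HA.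
      assert (HB : forall u w, (CInt (Phi mu f) 0 (sg t w) - CInt (Phi mu f) 0 (sg t u))%C = CInt (Phi mu f) (sg t u) (sg t w)).
      { intros u w. rewrite <- (CInt_Chasles (Phi mu f) 0 (sg t u) (sg t w)) by apply Hex. ring. }
      rewrite HB in HA. rewrite <- HA. apply csum_ext. intros a _. rewrite HB. reflexivity.
    - intros j Hj Hp. destruct (Rlt_dec (ulo x1 x2 j) (uhi x1 x2 j)) as [|Hn]; [discriminate|].
      apply in_flat_map in Hj. destruct Hj as (c & Hc & Hj). apply in_map_iff in Hj. destruct Hj as (a & <- & Ha).
      destruct (HPr c Hc) as [_ Hc3]. destruct (In_arcs c a Hc3 Ha) as [Ha1 Ha2].
      assert (Hlh : arc_lo c a <= arc_hi c a).
      { unfold arc_lo, arc_hi. assert (0 < / IZR c) by arith.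
        destruct (Z.eq_dec a (c + 1)); apply Rmult_le_compat_r; try lra; apply IZR_le; lia. }
      assert (E0 : ulo x1 x2 (c, a) = uhi x1 x2 (c, a)).
      { revert Hn. unfold ulo, uhi. cbn [fst snd]. unfold Rmax, Rmin. repeat destruct (Rle_dec _ _); lra. }
      rewrite <- (csum_0 (zrange 0 W)). apply csum_ext. intros t _. unfold HI. rewrite E0. apply CInt_point. }
  set (fw := fun v => f (pt v y)).
  set (VJ := csum J (fun j => CInt (fun v => fw v * Wsum k mu p s q r y W j v)%C (lo j) (hi j))).
  assert (Hfc : forall v, Cc fw v).
  { intros v. apply (mf_Cc k f A (fun v => pt v y) v Hf); [eapply Dc_Cc, Dc_hline|]. simpl. exact Hy. }
  assert (Hjt : forall j t, In j J -> In t (zrange 0 W) -> 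
     (forall v, lo j <= v <= hi j -> Cc (Wj k mu p s q r (snd j + fst j * t) (bj j + dj j * t) (fst j) (dj j) y) v) /\
     Cmod (HI j t - CInt (fun v => fw v * Wj k mu p s q r (snd j + fst j * t) (bj j + dj j * t) (fst j) (dj j) y v)%C (lo j) (hi j))%C <= LC).
  { intros j t Hj Ht. assert (Hx : In (j, t) X) by (apply In_X; apply In_zrange in Ht; simpl; split; [exact Hj|lia]).
    pose proof (X_det (j, t) Hx) as D. pose proof (fun v => X_frame (j, t) v Hx) as F. destruct (X_small (j, t) Hx) as (C3 & C6 & _).
    change (xc (j, t)) with (fst j) in *. change (xa (j, t)) with (snd j + fst j * t)%Z in *.
    change (xb (j, t)) with (bj j + dj j * t)%Z in *. change (xd (j, t)) with (dj j) in *. cbn [fst] in F.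
    destruct (In_J j Hj) as (_ & _ & _ & _ & _ & _ & _ & _ & L1 & _ & L2 & L3 & L4).
    fold (lo j) (hi j) in L1, L4. fold (lo j) in L2. fold (hi j) in L3.
    assert (FF : forall v, lo j <= v <= hi j -> _) by
      (intros v Hv; exact (frame_full q r _ _ _ _ S v D ltac:(lia) HS Hq (F v Hv))).
    split.
    - intros v Hv. destruct (FF v Hv) as [G1 _]. apply Wf_cont; [apply det_full; assumption|apply Rgt_not_eq; lra].
    - set (a := (snd j + fst j * t)%Z) in *. set (b := (bj j + dj j * t)%Z) in *. set (c := fst j) in *. set (d := dj j) in *.
      assert (Hdz : ((p * a + s * c) * (q * b + r * d) - (p * b + s * d) * (q * a + r * c) = 1)%Z).
      { transitivity ((p * r - s * q) * (a * d - b * c))%Z; [ring|rewrite H0, D; reflexivity]. }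
      destruct (link k f A B mu _ _ _ _ 1 (lo j) (hi j) S Hf Hb Hdz Hmu ltac:(lra) HS ltac:(left; reflexivity)) as [_ HL].
      + intros v Hv. rewrite Rmult_1_l. apply FF, Hv.
      + apply (small_im mu S Hmu HS c); [exact C6|]. apply (FF (lo j)). lra.
      + assert (Esg : forall v, lo j <= v <= hi j -> 
          (IZR (p * a + s * c) * v + IZR (p * b + s * d)) / (IZR (q * a + r * c) * v + IZR (q * b + r * d)) =
          sg t (mo (snd j) (bj j) c d v)).
        { intros v Hv. destruct (FF v Hv) as [G1 _]. destruct (L4 v Hv) as [G2 _].
          unfold sg. rewrite <- mo_shift by (apply Rgt_not_eq; lra). fold a b.
          assert (G3 : IZR q * (IZR a * v + IZR b) + IZR r * (IZR c * v + IZR d) <> 0).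
          { apply Rgt_not_eq. rewrite !plus_IZR, !mult_IZR in G1. lra. }
          unfold mo. rewrite !plus_IZR, !mult_IZR. field. split; [apply Rgt_not_eq; lra|exact G3]. }
        rewrite !Esg in HL by lra. fold (lo j) in L2. rewrite L2, L3 in HL. exact HL. }
  (* One [link_const] is paid for each arc and translate, and there are at most 2PU arcs. *)
  assert (E2 : Cmod (RtoC U * I - VJ)%C <= U * (2 * INR P) * (INR W * LC)).
  { assert (HLC : 0 <= LC).
    { unfold LC, link_const. destruct Hb as [HB _]. repeat apply Rmult_le_pos; try lra; try (left; apply exp_pos).
      left; apply Rinv_0_lt_compat; lra. }
    rewrite E1. unfold VJ. rewrite <- csum_minus.
    apply Rle_trans with (rsum J (fun _ => INR W * LC)).
    - apply Cmod_csum_le. intros j Hj.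
      replace (CInt (fun v => fw v * Wsum k mu p s q r y W j v)%C (lo j) (hi j)) with
        (csum (zrange 0 W) (fun t => CInt (fun v => fw v * Wj k mu p s q r (snd j + fst j * t) (bj j + dj j * t) (fst j) (dj j) y v)%C (lo j) (hi j))).
      + rewrite <- csum_minus. eapply Rle_trans; [apply Cmod_csum_le with (h := fun _ => LC)|].
        * intros t Ht. apply Hjt; assumption.
        * rewrite rsum_const, length_zrange. lra.
      + symmetry. apply is_CInt_unique. unfold Wsum.
        eapply is_RInt_ext; [intros v _; apply csum_mult_l|].
        apply (is_CInt_csum (zrange 0 W) (fun t v => fw v * Wj k mu p s q r (snd j + fst j * t) (bj j + dj j * t) (fst j) (dj j) y v)%C).
        intros t Ht. apply CInt_correct. destruct (In_J j Hj) as (_ & _ & _ & _ & _ & _ & _ & _ & L1 & _).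
        apply ex_CInt_le; [unfold lo, hi; lra|]. intros v Hv. apply Cc_mult; [apply Hfc|]. apply Hjt; assumption.
    - rewrite rsum_const. apply Rmult_le_compat_r; [apply Rmult_le_pos; lra|apply J_times_W]. }
  assert (E3 : Cmod VJ <= B * Rpower y (- (INR k / 2)) * sqrt (T * (1 - -1))).
  { apply (dual_bound J lo hi (Wsum k mu p s q r y W) fw (-1) 1).
    - lra.
    - destruct Hb as [HB _]. apply Rmult_le_pos; [lra|left; apply exp_pos].
    - exact HT.
    - intros j Hj. destruct (In_J j Hj) as (_ & _ & _ & _ & _ & _ & _ & _ & L1 & _ & _ & _ & L4).
      fold (lo j) (hi j) in L1, L4. destruct (L4 (lo j) ltac:(lra)) as (_ & _ & V1). destruct (L4 (hi j) ltac:(lra)) as (_ & _ & V2). lra.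
    - intros j Hj v Hv. unfold Wsum.
      assert (Hl : forall l, incl l (zrange 0 W) ->
        Cc (fun v => csum l (fun t => Wj k mu p s q r (snd j + fst j * t) (bj j + dj j * t) (fst j) (dj j) y v)) v).
      { induction l as [|t l IH]; intros Hl; simpl; [apply Cc_const|].
        apply Cc_plus; [apply Hjt; [exact Hj|apply Hl; left; reflexivity|exact Hv]|].
        apply IH. intros z Hz. apply Hl. right. exact Hz. }
      apply Hl, incl_refl.
    - intros v _. apply Hfc.
    - intros v _. destruct Hb as [HB Hb']. unfold fw. apply mf_bound_at; [exact Hy|simpl; lra|]. apply Hb'. simpl. exact Hy.
    - apply second_quad, HD. }
  replace (1 - -1) with 2 in E3 by ring.
  assert (E4 : U * Cmod I <= B * Rpower y (- (INR k / 2)) * sqrt (T * 2) + U * (2 * INR P) * (INR W * LC)).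
  { replace (U * Cmod I) with (Cmod (RtoC U * I)%C) by (rewrite Cmod_mult, Cmod_R, Rabs_right by lra; reflexivity).
    replace (RtoC U * I)%C with (VJ + (RtoC U * I - VJ))%C by ring.
    via Cmod_triangle. lra. }
  apply Rmult_le_reg_l with U; [lra|].
  replace (U * (B * Rpower y (- (INR k / 2)) * sqrt (T * 2) / U + 2 * INR P * INR W * LC)) with
    (B * Rpower y (- (INR k / 2)) * sqrt (T * 2) + U * (2 * INR P) * (INR W * LC)) by (field; lra).
  exact E4.
Qed.

End Second.

(** * Sums over integer translates *)

Lemma rsum_seq_S n (g : nat -> R) : rsum (seq 0 (S n)) g = rsum (seq 0 n) g + g n.
Proof. rewrite seq_S, rsum_app. simpl. ring. Qed.

Lemma csum_seq_S n (g : nat -> C) : csum (seq 0 (S n)) g = (csum (seq 0 n) g + g n)%C.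
Proof. rewrite seq_S, csum_app. simpl. ring. Qed.

Lemma rsum_seq_rev n (g : nat -> R) : rsum (seq 0 n) (fun i => g (n - 1 - i)%nat) = rsum (seq 0 n) g.
Proof.
  induction n as [|n IH]; [reflexivity|].
  symmetry. rewrite rsum_seq_S, <- IH. symmetry. rewrite <- cons_seq, <- seq_shift. cbn [rsum]. rewrite rsum_map.
  replace (S n - 1 - 0)%nat with n by lia. rewrite Rplus_comm. f_equal.
  apply rsum_ext. intros i Hi. apply in_seq in Hi. f_equal. lia.
Qed.

(** Symmetry folds the two triangles together. The index [h] stands for the lag [S h], so h = 0 is
    the first off-diagonal. *)
Lemma double_sum_by_lag (F : nat -> nat -> R) T : (forall i j, F i j = F j i) ->
  rsum (seq 0 T) (fun i => rsum (seq 0 T) (F i)) =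
  rsum (seq 0 T) (fun i => F i i) + 2 * rsum (seq 0 T) (fun h => rsum (seq 0 (T - 1 - h)) (fun i => F i (i + S h)%nat)).
Proof.
  intros HF. induction T as [|T IH]; [simpl; ring|].
  assert (E1 : rsum (seq 0 (S T)) (fun i => rsum (seq 0 (S T)) (F i)) =
    rsum (seq 0 T) (fun i => rsum (seq 0 T) (F i)) + 2 * rsum (seq 0 T) (fun i => F i T) + F T T).
  { rewrite rsum_seq_S. rewrite (rsum_ext _ _ (fun i => rsum (seq 0 T) (F i) + F i T)) by (intros; apply rsum_seq_S).
    rewrite rsum_plus, rsum_seq_S. rewrite (rsum_ext _ (F T) (fun i => F i T)) by (intros; apply HF). ring. }
  assert (E2 : rsum (seq 0 (S T)) (fun h => rsum (seq 0 (S T - 1 - h)) (fun i => F i (i + S h)%nat)) =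
    rsum (seq 0 T) (fun h => rsum (seq 0 (T - 1 - h)) (fun i => F i (i + S h)%nat)) + rsum (seq 0 T) (fun i => F i T)).
  { rewrite rsum_seq_S. replace (S T - 1 - T)%nat with 0%nat by lia. cbn [seq rsum]. rewrite Rplus_0_r.
    rewrite <- (rsum_seq_rev T (fun i => F i T)), <- rsum_plus. apply rsum_ext. intros h Hh. apply in_seq in Hh.
    replace (S T - 1 - h)%nat with (S (T - 1 - h)) by lia. rewrite rsum_seq_S. f_equal. f_equal. lia. }
  rewrite E1, E2, IH, rsum_seq_S. ring.
Qed.

(** The outer weight at height 0, on the real line itself. The points actually needed lie slightly
    above and are reached by a slowly varying factor. *)
Definition g0 (k mu : nat) (p s q r : Z) (u : R) : Complex.C := Wf k mu (IZR p) (IZR s) (IZR q) (IZR r) 0 u.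

Definition Asum (k mu : nat) (p s q r : Z) (T : nat) (u : R) : Complex.C :=
  csum (seq 0 T) (fun t => g0 k mu p s q r (u + INR t)).

Lemma g0_shift k mu p s q r (h : nat) u :
  g0 k mu p s q r (u + INR h) = g0 k mu p (s + p * Z.of_nat h) q (r + q * Z.of_nat h) u.
Proof.
  unfold g0, Wf, mob. rewrite !plus_IZR, !mult_IZR, <- !INR_IZR_INZ.
  assert (E1 : forall a b : Z, (RtoC (IZR a) * pt (u + INR h) 0 + RtoC (IZR b))%C =
    (RtoC (IZR a) * pt u 0 + RtoC (IZR b + IZR a * INR h)%R)%C).
  { intros a b. unfold pt, Cmult, Cplus, RtoC; simpl. apply Ceq; simpl; ring. }
  unfold den. rewrite !E1. reflexivity.
Qed.

Section Fold.
Context (k mu : nat) (p s q r : Z) (S : R) (W : nat).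
Context (Hk : (1 <= k)%nat) (Hmu : (1 <= mu)%nat) (HS : 0 < S) (H0 : (p * r - s * q = 1)%Z)
  (Hq0 : (q <> 0)%Z) (HW : (1 <= W)%nat)
  (Hfr : forall u, 0 <= u <= INR W -> 3 * S <= IZR q * u + IZR r <= 6 * S).
Let g := g0 k mu p s q r.
Let A := Asum k mu p s q r.
(** The resonance length: the phase derivative mu/(qu + r)^2 changes by about mu |q|/S^3 in a unit
    step, hence by about 1 after [Rres] steps. *)
Definition Rres : R := S ^ 3 / (INR mu * Rabs (IZR q)).
Definition fold_const : R := Gb k S ^ 2 * (INR W + 2 * (Wbd k * Rres * harm W)).

Lemma det0 : IZR p * IZR r - IZR s * IZR q = 1.
Proof. apply det_IZR. exact H0. Qed.

Lemma q_abs : 1 <= Rabs (IZR q) /\ Rabs (IZR q) * INR W <= 3 * S.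
Proof.
  split; [rewrite <- abs_IZR; apply (IZR_le 1); lia|].
  pose proof (pos_INR W).
  pose proof (Hfr 0 ltac:(lra)) as F1. pose proof (Hfr (INR W) ltac:(lra)) as F2.
  rewrite <- (Rabs_right (INR W)) by lra. rewrite <- Rabs_mult. apply Rabs_le. lra.
Qed.

Lemma g_cont u : 0 <= u <= INR W -> Cc g u.
Proof. intros Hu. specialize (Hfr u Hu). apply Wf_cont; [exact det0|pos]. Qed.

Lemma g_bound u : 0 <= u <= INR W -> Cmod (g u) <= Gb k S.
Proof.
  intros Hu. specialize (Hfr u Hu). apply frame_bounds; try assumption.
  - exact det0. - lra. - rewrite Rmult_0_r. apply pow2_ge_0. - lra. - rewrite Rmult_0_r. lra.
Qed.

(** A translate by h has the same leading coefficient q, so the denominators differ by the constant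
    qh, which gives the decay 1/h. *)
Lemma corr_bound h n : (1 <= h)%nat -> (n + h <= W)%nat ->
  Cmod (CInt (fun u => g u * Cconj (g (u + INR h)%R))%C 0 (INR n)) <= Gb k S ^ 2 * (Wbd k * Rres / INR h).
Proof.
  intros Hh Hn. pose proof q_abs as [Q1 Q2]. pose proof det0 as D.
  assert (Hh1 : 1 <= INR h) by (apply (le_INR 1); exact Hh).
  assert (Hn1 : INR n + INR h <= INR W) by (rewrite <- plus_INR; apply le_INR; exact Hn).
  assert (Hn0 : 0 <= INR n) by arith.
  assert (Hmu1 : 1 <= INR mu) by (apply (le_INR 1); exact Hmu).
  assert (E1 : CInt (fun u => g u * Cconj (g (u + INR h)%R))%C 0 (INR n) =
    CInt (fun u => Wf k mu (IZR p) (IZR s) (IZR q) (IZR r) 0 u *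
      Cconj (Wf k mu (IZR p) (IZR (s + p * Z.of_nat h)) (IZR q) (IZR (r + q * Z.of_nat h)) 0 u))%C 0 (INR n)).
  { apply CInt_ext; [exact Hn0|]. intros u _. unfold g. rewrite g0_shift. reflexivity. }
  rewrite E1. 
  set (sg := if Rle_dec 0 (IZR q) then -1 else 1).
  via (pair_vdc k mu _ _ _ _ _ _ _ _ S 0 0 (INR n) sg (Rabs (IZR q) * INR h)).
  - exact Hk. - exact Hmu. - exact HS. - apply Rmult_lt_0_compat; lra. - exact Hn0.
  - unfold sg. destruct (Rle_dec 0 (IZR q)); lra.
  - exact D.
  - rewrite !plus_IZR, !mult_IZR, <- !INR_IZR_INZ. rewrite <- D. ring.
  - lra. - rewrite Rmult_0_r. apply pow2_ge_0. - lra. - lra.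
  - intros v Hv. specialize (Hfr v ltac:(lra)). lra.
  - intros v Hv. rewrite plus_IZR, mult_IZR, <- INR_IZR_INZ. specialize (Hfr (v + INR h) ltac:(lra)). lra.
  - assert (Rabs (IZR q) * INR n <= Rabs (IZR q) * INR W) by arith. lra.
  - intros v Hv. rewrite plus_IZR, mult_IZR, <- INR_IZR_INZ. right. unfold sg.
    destruct (Rle_dec 0 (IZR q)); [rewrite Rabs_right by lra|rewrite Rabs_left by lra]; ring.
  - right. unfold Wbd, Rres. field. repeat split; lra.
Qed.

Lemma A_cont T u : (T <= W)%nat -> 0 <= u <= 1 -> Cc (A T) u.
Proof.
  intros HT Hu. unfold A, Asum. induction T as [|T IH]; [apply Cc_const|].
  eapply Cc_ext; [intros t; symmetry; apply csum_seq_S|].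
  apply Cc_plus; [apply IH; lia|].
  apply (continuous_comp (fun t => t + INR T) g).
  - apply (@ex_derive_continuous R_AbsRing R_NormedModule). auto_derive. exact I.
  - apply g_cont. pose proof (pos_INR T). assert (INR T + 1 <= INR W) by (rewrite <- S_INR; apply le_INR; lia). lra.
Qed.

(** The square is expanded. For a fixed lag the unit integrals over successive translates join to
    one integral over [0, n], to which [corr_bound] applies; the lags then form a harmonic sum. *)
Lemma fold_bound T : (T <= W)%nat -> RInt (fun u => Cmod (A T u) ^ 2) 0 1 <= fold_const.
Proof.
  intros HT.
  assert (HTW : INR T <= INR W) by (apply le_INR; exact HT).
  assert (Hsh : forall t u, (t < T)%nat -> 0 <= u <= 1 -> 0 <= u + INR t <= INR W).
  { intros t u Ht Hu. pose proof (pos_INR t). assert (INR t + 1 <= INR T) by (rewrite <- S_INR; apply le_INR; lia). lra. }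
  assert (Hgc : forall t u, (t < T)%nat -> 0 <= u <= 1 -> Cc (fun u => g (u + INR t)%R) u).
  { intros t u Ht Hu. apply (continuous_comp (fun x => x + INR t) g).
    - apply (@ex_derive_continuous R_AbsRing R_NormedModule). auto_derive. exact I.
    - apply g_cont, Hsh; assumption. }
  set (F := fun i j => RInt (fun u => Re (g (u + INR i)%R * Cconj (g (u + INR j)%R))%C) 0 1).
  assert (HexI : forall i j, (i < T)%nat -> (j < T)%nat ->
    @ex_RInt C_R_NormedModule (fun u => g (u + INR i)%R * Cconj (g (u + INR j)%R))%C 0 1).
  { intros i j Hi Hj. apply ex_CInt_le; [lra|]. intros u Hu. apply Cc_mult; [apply Hgc; assumption|apply Cc_conj, Hgc; assumption]. }
  assert (HFC : forall i j, (i < T)%nat -> (j < T)%nat ->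
    F i j = Re (CInt (fun u => g (u + INR i)%R * Cconj (g (u + INR j)%R))%C 0 1)).
  { intros i j Hi Hj. apply is_RInt_unique. apply (is_CInt_fst _ 0 1). apply CInt_correct, HexI; assumption. }
  assert (HR : forall l (h : nat -> C), Re (csum l h) = rsum l (fun x => Re (h x))).
  { intros l h. induction l as [|x l IH]; [reflexivity|]. cbn [csum rsum]. rewrite <- IH. reflexivity. }
  assert (E1 : RInt (fun u => Cmod (A T u) ^ 2) 0 1 = rsum (seq 0 T) (fun i => rsum (seq 0 T) (F i))).
  { apply is_RInt_unique.
    assert (H : @is_RInt C_R_NormedModule (fun u => A T u * Cconj (A T u))%C 0 1
      (csum (seq 0 T) (fun i => csum (seq 0 T) (fun j => CInt (fun u => g (u + INR i)%R * Cconj (g (u + INR j)%R))%C 0 1)))).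
    { eapply is_RInt_ext; [intros u _; symmetry; apply csum_mul_conj|].
      apply (is_CInt_csum (seq 0 T) (fun i u => csum (seq 0 T) (fun j => g (u + INR i)%R * Cconj (g (u + INR j)%R)))%C).
      intros i Hi. apply (is_CInt_csum (seq 0 T) (fun j u => g (u + INR i)%R * Cconj (g (u + INR j)%R))%C).
      intros j Hj. apply in_seq in Hi, Hj. apply CInt_correct, HexI; lia. }
    apply is_CInt_fst in H.
    evar_last; [eapply is_RInt_ext; [|exact H]|].
    - intros u _. change (Re (A T u * Cconj (A T u))%C = Cmod (A T u) ^ 2). apply Re_mul_conj.
    - etransitivity; [apply HR|]. apply rsum_ext. intros i Hi. etransitivity; [apply HR|].
      apply rsum_ext. intros j Hj. apply in_seq in Hi, Hj. symmetry. apply HFC; lia. }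
  rewrite E1. rewrite (double_sum_by_lag F).
  2:{ intros i j. apply RInt_ext. intros u _.
      set (a := g (u + INR i)). set (b := g (u + INR j)). unfold Re, Cmult, Cconj. simpl. ring. }
  pose proof (pow_lt _ 2 (Gb_pos k S HS)) as HG.
  assert (HR0 : 0 <= Rres).
  { unfold Rres. apply Rdiv_le_0_compat; [pos|]. pose proof q_abs. apply Rmult_lt_0_compat; [apply lt_0_INR; lia|lra]. }
  pose proof (Wbd_pos k) as HWb.
  assert (Hdiag : rsum (seq 0 T) (fun i => F i i) <= INR W * Gb k S ^ 2).
  { eapply Rle_trans; [apply rsum_le_const with (c := Gb k S ^ 2)|rewrite length_seq; apply Rmult_le_compat_r; lra].
    intros i Hi. apply in_seq in Hi. rewrite HFC by lia. via Rle_abs. via Re_le_Cmod.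
    eapply Rle_trans; [apply CInt_bound with (M := Gb k S ^ 2)|lra].
    - lra.
    - apply HexI; lia.
    - intros u Hu. rewrite Cmod_mult, Cmod_conj. simpl. rewrite Rmult_1_r.
      apply Rmult_le_compat; try apply Cmod_ge_0; apply g_bound, Hsh; auto; lia. }
  assert (Hlag : forall h n, (n + suc h <= T)%nat -> rsum (seq 0 n) (fun i => F i (i + suc h)%nat) =
    Re (CInt (fun u => g u * Cconj (g (u + INR (suc h))%R))%C 0 (INR n))).
  { intros h. induction n as [|n IH]; intros Hn.
    - change (INR 0) with 0. rewrite CInt_point. reflexivity.
    - rewrite rsum_seq_S, IH by lia. rewrite HFC by lia.
      assert (Hexh : forall a b, 0 <= a -> a <= b -> b <= INR (suc n) ->
        @ex_RInt C_R_NormedModule (fun u => g u * Cconj (g (u + INR (suc h))%R))%C a b).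
      { intros a b Ha Hab Hb. assert (INR (suc n) + INR (suc h) <= INR W) by (rewrite <- plus_INR; apply le_INR; lia).
        pose proof (pos_INR (suc h)).
        apply ex_CInt_le; [exact Hab|]. intros u Hu. apply Cc_mult; [apply g_cont; lra|]. apply Cc_conj.
        apply (continuous_comp (fun x => x + INR (suc h)) g); [|apply g_cont; lra].
        apply (@ex_derive_continuous R_AbsRing R_NormedModule). auto_derive. exact I. }
      pose proof (pos_INR n) as Hn0. pose proof (S_INR n) as HSn.
      rewrite <- (CInt_Chasles _ 0 (INR n) (INR (suc n))) by (apply Hexh; lra).
      rewrite <- re_plus. f_equal. f_equal.
      set (G := fun w => (g w * Cconj (g (w + INR (suc h))%R))%C) in *.
      transitivity (CInt (fun u => G (u + INR n)) 0 1).
      + apply CInt_ext; [lra|]. intros u _. unfold G. f_equal. f_equal. f_equal. rewrite plus_INR. ring.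
      + rewrite CInt_comp_shift by (apply Hexh; lra). f_equal; rewrite ?HSn; ring. }
  assert (Hoff : rsum (seq 0 T) (fun h => rsum (seq 0 (T - 1 - h)) (fun i => F i (i + suc h)%nat)) <=
    Gb k S ^ 2 * (Wbd k * Rres * harm W)).
  { apply Rle_trans with (rsum (seq 0 T) (fun h => Gb k S ^ 2 * (Wbd k * Rres) * / INR (suc h))).
    - apply rsum_le. intros h Hh. apply in_seq in Hh. rewrite Hlag by lia.
      via Rle_abs. via Re_le_Cmod.
      eapply Rle_trans; [apply corr_bound; lia|]. right. unfold Rdiv. ring.
    - rewrite rsum_scal. replace (Gb k S ^ 2 * (Wbd k * Rres * harm W)) with (Gb k S ^ 2 * (Wbd k * Rres) * harm W) by ring.
      apply Rmult_le_compat_l; [apply Rmult_le_pos; [lra|pos]|].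
      clear -HT. assert (E : forall n, rsum (seq 0 n) (fun h => / INR (suc h)) = harm n).
      { induction n as [|n IH]; [reflexivity|]. rewrite rsum_seq_S, IH. reflexivity. }
      rewrite E. induction HT; [lra|]. eapply Rle_trans; [exact IHHT|apply harm_le_S]. }
  unfold fold_const. lra.
Qed.
End Fold.

(** * Partial summation with slowly varying factors *)

Lemma Dc_lipschitz f df a b M : a <= b -> (forall x, a <= x <= b -> Dc f x (df x)) ->
  (forall x, a <= x <= b -> Cc df x) -> (forall x, a <= x <= b -> Cmod (df x) <= M) ->
  Cmod (f b - f a)%C <= M * (b - a).
Proof.
  intros Hab H1 H2 H3. rewrite <- (is_CInt_unique _ _ _ _ (CInt_FTC f df a b Hab H1 H2)).
  apply CInt_bound; [exact Hab|apply ex_CInt_le; assumption|exact H3].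
Qed.

Lemma rsum_cauchy {I} (l : list I) g : rsum l g ^ 2 <= INR (length l) * rsum l (fun x => g x ^ 2).
Proof.
  induction l as [|x l IH]; [simpl; lra|]. cbn [rsum length]. rewrite S_INR.
  set (n := INR (length l)) in *. assert (Hn : 0 <= n) by apply pos_INR.
  set (s := rsum l g) in *. set (s2 := rsum l (fun x => g x ^ 2)) in *.
  assert (2 * g x * s <= n * g x ^ 2 + s2); [|nra].
  destruct (Req_dec n 0) as [E|E].
  - rewrite E in *. assert (0 <= s2) by (apply rsum_ge0; intros; apply pow2_ge_0). nra.
  - assert (H : 0 <= (n * g x - s) ^ 2) by arith.
    apply Rmult_le_reg_l with n; [lra|]. nra.
Qed.

Lemma abel_sum (a ph : nat -> C) W :
  csum (seq 0 (S W)) (fun t => ph t * a t)%C =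
  (ph W * csum (seq 0 (S W)) a - csum (seq 0 W) (fun t => (ph (S t) - ph t) * csum (seq 0 (S t)) a))%C.
Proof.
  induction W as [|W IH]; [simpl; ring|].
  rewrite csum_seq_S, IH. rewrite (csum_seq_S W (fun t => (ph (S t) - ph t) * csum (seq 0 (S t)) a)%C).
  rewrite (csum_seq_S (S W) a). ring.
Qed.

(** What survives of the partial sums after Abel summation and Cauchy-Schwarz: the full sum and the
    mean square of the partial ones. *)
Definition abel_sq (a : nat -> C) (W : nat) : R :=
  Cmod (csum (seq 0 W) a) ^ 2 + rsum (seq 0 W) (fun T => Cmod (csum (seq 0 T) a) ^ 2) / INR W.

Lemma abel_bound (a ph : nat -> C) W V : (1 <= W)%nat -> 0 <= V ->
  (forall t, (t < W)%nat -> Cmod (ph t) <= V) ->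
  (forall t, (S t < W)%nat -> Cmod (ph (S t) - ph t)%C <= V / INR W) ->
  Cmod (csum (seq 0 W) (fun t => ph t * a t)%C) ^ 2 <= 2 * V ^ 2 * abel_sq a W.
Proof.
  intros HW HV H1 H2. destruct W as [|W']; [lia|]. set (W := S W') in *.
  assert (HWp : 0 < INR W) by arith.
  set (A := fun T => Cmod (csum (seq 0 T) a)).
  assert (HA : forall T, 0 <= A T) by (intros; apply Cmod_ge_0).
  assert (B : Cmod (csum (seq 0 W) (fun t => ph t * a t)%C) <= V * (A W + rsum (seq 0 W) A / INR W)).
  { unfold W. rewrite abel_sum. unfold Cminus. via Cmod_triangle. rewrite Cmod_opp, Cmod_mult.
    rewrite Rmult_plus_distr_l. apply Rplus_le_compat.
    - apply Rmult_le_compat_r; [apply Cmod_ge_0|]. apply H1. unfold W. lia.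
    - apply Rle_trans with (rsum (seq 0 W') (fun t => V / INR W * A (S t))).
      + apply Cmod_csum_le. intros t Ht. apply in_seq in Ht. rewrite Cmod_mult.
        apply Rmult_le_compat_r; [apply Cmod_ge_0|]. apply H2. unfold W. lia.
      + rewrite rsum_scal. fold W.
        assert (E : rsum (seq 0 W') (fun t => A (S t)) <= rsum (seq 0 W) A).
        { unfold W. rewrite <- cons_seq, <- seq_shift. cbn [rsum]. rewrite rsum_map. specialize (HA 0%nat). lra. }
        replace (V * (rsum (seq 0 W) A / INR W)) with (V / INR W * rsum (seq 0 W) A) by (field; lra).
        apply Rmult_le_compat_l; [|exact E]. apply Rdiv_le_0_compat; lra. }
  assert (C2 : (rsum (seq 0 W) A / INR W) ^ 2 <= rsum (seq 0 W) (fun T => A T ^ 2) / INR W).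
  { pose proof (rsum_cauchy (seq 0 W) A) as Hc. rewrite length_seq in Hc.
    apply Rmult_le_reg_r with (INR W ^ 2); [pos|].
    replace ((rsum (seq 0 W) A / INR W) ^ 2 * INR W ^ 2) with (rsum (seq 0 W) A ^ 2) by (field; lra).
    replace (rsum (seq 0 W) (fun T => A T ^ 2) / INR W * INR W ^ 2) with (INR W * rsum (seq 0 W) (fun T => A T ^ 2)) by (field; lra).
    exact Hc. }
  unfold abel_sq. change (Cmod (csum (seq 0 W) a)) with (A W).
  change (rsum (seq 0 W) (fun T => Cmod (csum (seq 0 T) a) ^ 2)) with (rsum (seq 0 W) (fun T => A T ^ 2)).
  apply Rle_trans with ((V * (A W + rsum (seq 0 W) A / INR W)) ^ 2).
  - apply pow_incr. split; [apply Cmod_ge_0|exact B].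
  - set (m := rsum (seq 0 W) A / INR W) in *.
    replace ((V * (A W + m)) ^ 2) with (V ^ 2 * (A W + m) ^ 2) by ring.
    replace (2 * V ^ 2 * (A W ^ 2 + rsum (seq 0 W) (fun T => A T ^ 2) / INR W)) with
      (V ^ 2 * (2 * (A W ^ 2 + rsum (seq 0 W) (fun T => A T ^ 2) / INR W))) by ring.
    apply Rmult_le_compat_l; [apply pow2_ge_0|]. 
    assert (0 <= (A W - m) ^ 2) by arith. nra.
Qed.

(* [g(u + w) / g(u)] as a function of [x = q u + r], with [zeta = q w]. *)
Definition ratio (k mu : nat) (w zeta : C) (x : R) : C :=
  let D := (1 + zeta / RtoC x)%C in
  (D ^ k / D ^ 2 * e (RtoC (- INR mu) * w / (RtoC x * (RtoC x + zeta))))%C.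

(** The ratio times its logarithmic derivative in x. *)
Definition dratio (k mu : nat) (w zeta : C) (x : R) : C :=
  (ratio k mu w zeta x * (RtoC (INR k - 2) * (- zeta / (RtoC x * (RtoC x + zeta))) +
    RtoC (2 * PI) * Ci * RtoC (INR mu) * w * (2 * RtoC x + zeta) / ((RtoC x * (RtoC x + zeta)) * (RtoC x * (RtoC x + zeta)))))%C.

(** 1 + zeta/x has modulus between 2/3 and 2, whence 2^k and (3/2)^2 <= 3; the argument of [e] has
    modulus at most 6, whence exp(12 pi). *)
Definition ratio_const (k : nat) : R := 2 ^ k * 3 * exp (12 * PI).

Section Ratio.
Context (k mu : nat) (w zeta : C) (S : R).
Context (Hk : (1 <= k)%nat) (HS : 0 < S) (Hz : Cmod zeta <= S) (Hw : INR mu * Cmod w <= 36 * S ^ 2).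

Lemma xz_bounds x : 3 * S <= x <= 6 * S -> 2 * S <= Cmod (RtoC x + zeta)%C /\ Cmod (RtoC x + zeta)%C <= 7 * S /\
  (RtoC x + zeta)%C <> 0%C /\ RtoC x <> 0%C /\ 6 * S ^ 2 <= Cmod (RtoC x * (RtoC x + zeta))%C.
Proof.
  intros Hx.
  assert (H1 : 2 * S <= Cmod (RtoC x + zeta)%C).
  { pose proof (Cmod_sub_ge (RtoC x) (- zeta)%C) as H. rewrite Cmod_R, Cmod_opp, Rabs_right in H by lra.
    replace (RtoC x - - zeta)%C with (RtoC x + zeta)%C in H by ring. lra. }
  assert (H2 : Cmod (RtoC x + zeta)%C <= 7 * S).
  { via Cmod_triangle. rewrite Cmod_R, Rabs_right by lra. lra. }
  split; [exact H1|]. split; [exact H2|]. split; [|split].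
  - apply Cmod_gt_0. lra.
  - intros E. apply RtoC_inj in E. lra.
  - rewrite Cmod_mult, Cmod_R, Rabs_right by lra.
    replace (6 * S ^ 2) with (3 * S * (2 * S)) by ring. apply Rmult_le_compat; lra.
Qed.

Lemma ratio_deriv x : 3 * S <= x <= 6 * S -> Dc (ratio k mu w zeta) x (dratio k mu w zeta x).
Proof.
  intros Hx. destruct (xz_bounds x Hx) as (_ & _ & N1 & N2 & _).
  assert (HD : (1 + zeta / RtoC x)%C <> 0%C).
  { intros E. apply N1. replace (RtoC x + zeta)%C with (RtoC x * (1 + zeta / RtoC x))%C by (field; exact N2). rewrite E. ring. }
  assert (DX : Dc (fun t => RtoC t) x 1%C) by apply Dc_id.
  assert (DD : Dc (fun t => 1 + zeta / RtoC t)%C x (- zeta / (RtoC x * RtoC x))%C).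
  { eapply Dc_eq.
    - apply Dc_plus; [apply Dc_const|]. unfold Cdiv. apply Dc_mult; [apply Dc_const|]. apply Dc_inv; [exact DX|exact N2].
    - simpl. field. exact N2. }
  unfold ratio, dratio. destruct k as [|k']; [lia|].
  eapply Dc_eq.
  - apply Dc_mult.
    + unfold Cdiv. apply Dc_mult; [apply Dc_pow, DD|]. apply Dc_inv; [apply Dc_pow, DD|]. apply Cpow_nz, HD.
    + apply Dc_e. unfold Cdiv. apply Dc_mult; [apply Dc_const|].
      apply Dc_inv; [|apply Cmult_neq_0; assumption].
      apply Dc_mult; [exact DX|]. apply Dc_plus; [exact DX|apply Dc_const].
  - cbv beta. unfold ratio.
    set (D := (1 + zeta / RtoC x)%C) in *. change (1 + zeta * / RtoC x)%C with D.
    set (ee := e _). change (RtoC (- INR mu) * w * / (RtoC x * (RtoC x + zeta)))%C with (RtoC (- INR mu) * w / (RtoC x * (RtoC x + zeta)))%C.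
    fold ee.
    assert (EP : (RtoC x + zeta)%C = (RtoC x * D)%C) by (unfold D; field; exact N2).
    rewrite !EP. rewrite S_INR. simpl Nat.pred. rewrite !Cpow_S.
    replace (RtoC (INR k' + 1 - 2)) with (RtoC (INR k') - 1)%C by (rewrite RtoC_minus, RtoC_plus; ring).
    rewrite RtoC_plus.
    replace (INR 2) with 2 by (simpl; ring).
    replace (RtoC (- INR mu)) with (- RtoC (INR mu))%C by (rewrite RtoC_opp; reflexivity).
    assert (Ez : zeta = (RtoC x * (D - 1))%C) by (unfold D; field; exact N2).
    clearbody D ee. rewrite Ez. simpl. 
    generalize (D ^ k')%C (RtoC (INR k')) (RtoC (INR mu)) (RtoC (2 * PI)). intros.
    field. split; assumption.
Qed.

Lemma ratio_bound x : 3 * S <= x <= 6 * S -> Cmod (ratio k mu w zeta x) <= ratio_const k.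
Proof.
  intros Hx. destruct (xz_bounds x Hx) as (B1 & B2 & N1 & N2 & B3).
  unfold ratio, ratio_const. set (D := (1 + zeta / RtoC x)%C).
  assert (Hzx : Cmod (zeta / RtoC x)%C <= / 3).
  { rewrite Cmod_div by exact N2. rewrite Cmod_R, Rabs_right by lra.
    apply Rmult_le_reg_r with x; [lra|]. unfold Rdiv. rewrite Rmult_assoc, Rinv_l by lra. lra. }
  assert (D1 : Cmod D <= 2).
  { unfold D. via Cmod_triangle. rewrite Cmod_1. lra. }
  assert (D2 : 2 / 3 <= Cmod D).
  { pose proof (Cmod_sub_ge 1%C (- (zeta / RtoC x))%C) as H. rewrite Cmod_1, Cmod_opp in H.
    replace (1 - - (zeta / RtoC x))%C with D in H by (unfold D; ring). lra. }
  rewrite Cmod_mult. apply Rmult_le_compat; try apply Cmod_ge_0.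
  - unfold Cdiv. rewrite Cmod_mult. apply Rmult_le_compat; try apply Cmod_ge_0.
    + apply Cmod_pow_le, D1.
    + replace 3 with (/ (/ 3)) by field. apply Cmod_inv_le; [lra|]. rewrite Cmod_pow.
      apply Rle_trans with ((2 / 3) ^ 2); [lra|apply pow_incr; lra].
  - rewrite Cmod_e. apply exp_le_mono.
    set (z := (RtoC (- INR mu) * w / (RtoC x * (RtoC x + zeta)))%C).
    assert (Cmod z <= 6).
    { unfold z. assert (NN : (RtoC x * (RtoC x + zeta))%C <> 0%C) by (apply Cmult_neq_0; assumption).
      rewrite Cmod_div by exact NN. rewrite Cmod_mult, Cmod_R, Rabs_Ropp, (Rabs_right (INR mu)) by (apply Rle_ge, pos_INR).
      assert (0 < S ^ 2) by pos.
      apply Rmult_le_reg_r with (Cmod (RtoC x * (RtoC x + zeta))%C); [lra|].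
      unfold Rdiv at 1. rewrite Rmult_assoc, Rinv_l by lra. lra. }
    pose proof (Im_le_Cmod z) as Hi. apply Rabs_le_between in Hi. pose proof PI_RGT_0. nra.
Qed.

Lemma dratio_bound x : 3 * S <= x <= 6 * S -> Cmod (dratio k mu w zeta x) <= ratio_const k * ((INR k + 106) / S).
Proof.
  intros Hx. destruct (xz_bounds x Hx) as (B1 & B2 & N1 & N2 & B3).
  assert (NN : (RtoC x * (RtoC x + zeta))%C <> 0%C) by (apply Cmult_neq_0; assumption).
  assert (HS2 : 0 < S ^ 2) by pos.
  unfold dratio. rewrite Cmod_mult. apply Rmult_le_compat; try apply Cmod_ge_0; [apply ratio_bound, Hx|].
  set (Q := (RtoC x * (RtoC x + zeta))%C) in *. set (q0 := Cmod Q) in *.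
  via Cmod_triangle. 
  (* The exponential contributes 2 pi * 36 * 13/36 = 26 pi, which is at most 104; the powers
     contribute k + 2. *)
  replace ((INR k + 106) / S) with ((INR k + 2) / S + 104 / S) by (field; lra).
  pose proof (pos_INR k) as Hk0.
  apply Rplus_le_compat.
  - rewrite Cmod_mult, Cmod_R, Cmod_div by exact NN. rewrite Cmod_opp. fold q0.
    assert (A1 : Rabs (INR k - 2) <= INR k + 2) by (apply Rabs_le; lra).
    assert (A2 : Cmod zeta / q0 <= / S).
    { apply Rmult_le_reg_r with q0; [lra|]. unfold Rdiv. rewrite Rmult_assoc, Rinv_l by lra.
      apply Rmult_le_reg_l with S; [exact HS|]. replace (S * (/ S * q0)) with q0 by (field; lra). nra. }
    unfold Rdiv at 2. apply Rmult_le_compat; try assumption; [apply Rabs_pos|].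
    apply Rdiv_le_0_compat; [apply Cmod_ge_0|lra].
  - rewrite Cmod_div by (apply Cmult_neq_0; exact NN). rewrite !Cmod_mult, !Cmod_R, Cmod_Ci. fold q0.
    rewrite (Rabs_right (2 * PI)) by (pose proof PI_RGT_0; lra). rewrite (Rabs_right (INR mu)) by (apply Rle_ge, pos_INR).
    assert (A1 : Cmod (2 * RtoC x + zeta)%C <= 13 * S).
    { via Cmod_triangle. rewrite <- RtoC_mult, Cmod_R, Rabs_right by lra. lra. }
    pose proof (Cmod_ge_0 (2 * RtoC x + zeta)%C).
    assert (A2 : INR mu * Cmod w * Cmod (2 * RtoC x + zeta)%C <= 36 * S ^ 2 * (13 * S)) by arith.
    assert (A3 : 36 * S ^ 4 <= q0 * q0) by arith.
    pose proof PI_4 as P4. pose proof PI_RGT_0.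
    replace (2 * PI * 1 * INR mu * Cmod w * Cmod (2 * RtoC x + zeta)%C) with
      (2 * PI * (INR mu * Cmod w * Cmod (2 * RtoC x + zeta)%C)) by ring.
    assert (HS4 : 0 < S ^ 4) by pos.
    apply Rmult_le_reg_r with (q0 * q0); [lra|]. unfold Rdiv at 1. rewrite Rmult_assoc, Rinv_l by pos.
    apply Rle_trans with (2 * PI * (36 * S ^ 2 * (13 * S))); [rewrite Rmult_1_r; apply Rmult_le_compat_l; lra|].
    apply Rle_trans with (104 / S * (36 * S ^ 4)); [|apply Rmult_le_compat_l; [pos|exact A3]].
    replace (104 / S * (36 * S ^ 4)) with (3744 * S ^ 3) by (field; lra).
    replace (2 * PI * (36 * S ^ 2 * (13 * S))) with (936 * PI * S ^ 3) by ring.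
    apply Rmult_le_compat_r; [pos|]. lra.
Qed.
End Ratio.

(** [g0] continued to complex arguments. *)
Definition gz (k mu : nat) (p s q r : Z) (z : C) : C :=
  let d := (RtoC (IZR q) * z + RtoC (IZR r))%C in
  (d ^ k / d ^ 2 * E mu (mob (IZR p) (IZR s) (IZR q) (IZR r) z))%C.

(** With X = qx + r and zeta = qw, the image points differ by w/(X(X + zeta)) because the
    determinant is 1, and the denominators differ by the factor 1 + zeta/X. *)
Lemma gz_ratio k mu p s q r x (w : C) : (p * r - s * q = 1)%Z -> IZR q * x + IZR r <> 0 ->
  (RtoC (IZR q * x + IZR r) + RtoC (IZR q) * w)%C <> 0%C ->
  gz k mu p s q r (RtoC x + w) = (ratio k mu w (RtoC (IZR q) * w) (IZR q * x + IZR r) * g0 k mu p s q r x)%C.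
Proof.
  intros Hd Hx Hxw. apply det_IZR in Hd.
  assert (Hxc : RtoC (IZR q * x + IZR r) <> 0%C) by (intros E0; apply RtoC_inj in E0; contradiction).
  unfold gz, ratio, g0, Wf.
  assert (E1 : den (IZR q) (IZR r) x 0 = RtoC (IZR q * x + IZR r)) by (rewrite den_parts; apply Ceq; simpl; ring).
  rewrite E1.
  assert (E2 : (RtoC (IZR q) * (RtoC x + w) + RtoC (IZR r))%C = (RtoC (IZR q * x + IZR r) + RtoC (IZR q) * w)%C)
    by (rewrite RtoC_plus, RtoC_mult; ring).
  rewrite E2.
  set (X := RtoC (IZR q * x + IZR r)) in *. set (ze := (RtoC (IZR q) * w)%C) in *.
  assert (EP : (X + ze)%C = (X * (1 + ze / X))%C) by (field; exact Hxc).
  assert (EM : mob (IZR p) (IZR s) (IZR q) (IZR r) (RtoC x + w) =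
    (mob (IZR p) (IZR s) (IZR q) (IZR r) (pt x 0) + w / (X * (X + ze)))%C).
  { unfold mob. rewrite E2. 
    assert (E3 : (RtoC (IZR q) * pt x 0 + RtoC (IZR r))%C = X) by (exact E1). rewrite E3.
    replace (pt x 0) with (RtoC x) by reflexivity.
    assert (E4 : (RtoC (IZR p) * (RtoC x + w) + RtoC (IZR s))%C = (RtoC (IZR p) * RtoC x + RtoC (IZR s) + RtoC (IZR p) * w)%C) by ring.
    rewrite E4.
    assert (E5 : (RtoC (IZR p) * X - RtoC (IZR q) * (RtoC (IZR p) * RtoC x + RtoC (IZR s)))%C = 1%C).
    { unfold X. rewrite RtoC_plus, RtoC_mult.
      transitivity (RtoC (IZR p * IZR r - IZR s * IZR q)); [rewrite RtoC_minus, !RtoC_mult; ring|rewrite Hd; reflexivity]. }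
    transitivity ((RtoC (IZR p) * RtoC x + RtoC (IZR s)) / X + 
      (RtoC (IZR p) * X - RtoC (IZR q) * (RtoC (IZR p) * RtoC x + RtoC (IZR s))) * w / (X * (X + ze)))%C.
    - unfold ze in *. field. split; [exact Hxw|exact Hxc].
    - rewrite E5. field. split; [exact Hxw|exact Hxc]. }
  rewrite EM. unfold E. rewrite Cmult_plus_distr_l, e_add.
  replace (RtoC (- INR mu) * (w / (X * (X + ze))))%C with (RtoC (- INR mu) * w / (X * (X + ze)))%C by (unfold Cdiv; ring).
  rewrite EP. rewrite !Cpow_mult_l. rewrite <- EP.
  assert (HD : (1 + ze / X)%C <> 0%C) by (intros E0; apply Hxw; rewrite EP, E0; ring).
  pose proof (Cpow_nz _ 2 HD). pose proof (Cpow_nz _ 2 Hxc).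
  set (D2 := ((1 + ze / X) ^ 2)%C) in *. set (X2 := (X ^ 2)%C) in *.
  set (D1 := ((1 + ze / X) ^ k)%C). set (X1 := (X ^ k)%C).
  set (e1 := e _). set (e2 := e _). clearbody D1 D2 X1 X2 e1 e2. field. split; assumption.
Qed.

(** The factor 3 comes from |q| <= 3S/W: one step in t moves qu + r by q, while [ratio] has a
    derivative of order 1/S. *)
Definition weight_const (k : nat) : R := 3 * (INR k + 106) * ratio_const k.

Lemma ratio_const_pos k : 0 < ratio_const k.
Proof.
  unfold ratio_const. apply Rmult_lt_0_compat; [|apply exp_pos]. apply Rmult_lt_0_compat; [|lra]. apply pow_lt; lra.
Qed.

Lemma weight_const_ge k : ratio_const k <= weight_const k.
Proof.
  unfold weight_const. pose proof (ratio_const_pos k). pose proof (pos_INR k).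
  rewrite <- (Rmult_1_l (ratio_const k)) at 1. apply Rmult_le_compat_r; lra.
Qed.

(** A majorant that is free of the shift [w], and therefore common to the diagonal terms, to the
    direct estimate and to the resonant one. *)
Definition hfun (k mu : nat) (p s q r : Z) (W : nat) (u : R) : R :=
  abel_sq (fun t => g0 k mu p s q r (u + INR t)) W.

Lemma hfun_ge0 k mu p s q r W u : (1 <= W)%nat -> 0 <= hfun k mu p s q r W u.
Proof.
  intros HW. unfold hfun, abel_sq. apply Rplus_le_le_0_compat; [apply pow2_ge_0|].
  apply Rdiv_le_0_compat; [|apply lt_0_INR; lia]. apply rsum_ge0. intros. apply pow2_ge_0.
Qed.

Lemma in_range (W : nat) u t : 0 <= u <= 1 -> (t < W)%nat -> 0 <= u + INR t <= INR W.
Proof.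
  intros Hu Ht. pose proof (pos_INR t). assert (INR t + 1 <= INR W) by (rewrite <- S_INR; apply le_INR; lia). lra.
Qed.

Section Shifted.
Context (k mu : nat) (p s q r : Z) (S : R) (W : nat).
Context (Hk : (1 <= k)%nat) (Hmu : (1 <= mu)%nat) (HS : 0 < S) (H0 : (p * r - s * q = 1)%Z)
  (Hq0 : (q <> 0)%Z) (HW : (1 <= W)%nat)
  (Hfr : forall u, 0 <= u <= INR W -> 3 * S <= IZR q * u + IZR r <= 6 * S).

Lemma lipschitz_weights (w : C) u : 0 <= u <= 1 -> Cmod (RtoC (IZR q) * w) <= S -> INR mu * Cmod w <= 36 * S ^ 2 ->
  let ph := fun t : nat => ratio k mu w (RtoC (IZR q) * w) (IZR q * (u + INR t) + IZR r) in
  (forall t, (t < W)%nat -> Cmod (ph t) <= weight_const k) /\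
  (forall t, (suc t < W)%nat -> Cmod (ph (suc t) - ph t)%C <= weight_const k / INR W).
Proof.
  intros Hu Hz Hw ph. assert (HWp : 0 < INR W) by arith.
  split.
  - intros t Ht. eapply Rle_trans; [|apply weight_const_ge]. apply (ratio_bound k mu w _ S HS Hz Hw).
    apply Hfr, in_range; assumption.
  - intros t Ht.
    destruct (q_abs k mu q r S W Hk Hmu Hq0 HW Hfr) as [Q1 Q2].
    pose proof (Hfr _ (in_range W u t Hu ltac:(lia))) as F1. pose proof (Hfr _ (in_range W u _ Hu Ht)) as F2.
    set (x := IZR q * (u + INR t) + IZR r) in *. set (x' := IZR q * (u + INR (suc t)) + IZR r) in *.
    assert (Exx : x' - x = IZR q) by (unfold x', x; rewrite S_INR; ring).
    pose proof (ratio_const_pos k) as HR. pose proof (pos_INR k).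
    assert (HL : forall a b, 3 * S <= a -> a <= b -> b <= 6 * S ->
      Cmod (ratio k mu w (RtoC (IZR q) * w) b - ratio k mu w (RtoC (IZR q) * w) a)%C <= ratio_const k * ((INR k + 106) / S) * (b - a)).
    { intros a b Ha Hab Hb. apply (Dc_lipschitz _ (dratio k mu w (RtoC (IZR q) * w))); [exact Hab| | |].
      - intros y Hy. apply (ratio_deriv k mu w _ S Hk HS Hz); lra.
      - intros y Hy. assert (Hy2 : 3 * S <= y <= 6 * S) by lra.
        destruct (xz_bounds _ S HS Hz y Hy2) as (_ & _ & N1 & N2 & _).
        assert (DX : Dc (fun t => RtoC t) y 1%C) by apply Dc_id.
        assert (DP : Dc (fun t => RtoC t * (RtoC t + RtoC (IZR q) * w))%C y _)
          by (apply Dc_mult; [exact DX|apply Dc_plus; [exact DX|apply Dc_const]]).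
        unfold dratio. apply Cc_mult; [exact (Dc_Cc _ _ _ (ratio_deriv k mu w _ S Hk HS Hz y Hy2))|].
        apply Cc_plus.
        + apply Cc_mult; [apply Cc_const|]. unfold Cdiv. apply Cc_mult; [apply Cc_const|].
          eapply Dc_Cc, Dc_inv; [exact DP|apply Cmult_neq_0; assumption].
        + unfold Cdiv. apply Cc_mult.
          * apply Cc_mult; [apply Cc_const|]. apply Cc_plus; [apply Cc_mult; [apply Cc_const|exact (Dc_Cc _ _ _ DX)]|apply Cc_const].
          * eapply Dc_Cc, Dc_inv; [apply Dc_mult; exact DP|].
            apply Cmult_neq_0; apply Cmult_neq_0; assumption.
      - intros y Hy. apply (dratio_bound k mu w _ S HS Hz Hw). lra. }
    assert (HQ : Rabs (IZR q) <= 3 * S / INR W).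
    { apply Rmult_le_reg_r with (INR W); [exact HWp|]. replace (3 * S / INR W * INR W) with (3 * S) by (field; lra). exact Q2. }
    assert (HB : ratio_const k * ((INR k + 106) / S) * Rabs (IZR q) <= weight_const k / INR W).
    { replace (weight_const k / INR W) with (ratio_const k * ((INR k + 106) / S) * (3 * S / INR W)) by (unfold weight_const; field; lra).
      apply Rmult_le_compat_l; [|exact HQ]. apply Rmult_le_pos; [lra|]. apply Rdiv_le_0_compat; lra. }
    unfold ph. fold x x'. eapply Rle_trans; [|exact HB].
    destruct (Rle_dec x x') as [Hle|Hle].
    + replace (Rabs (IZR q)) with (x' - x) by (rewrite <- Exx, Rabs_right by lra; reflexivity). apply HL; lra.
    + replace (Rabs (IZR q)) with (- (x' - x)) by (rewrite <- Exx, Rabs_left by lra; reflexivity).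
      replace (ratio k mu w (RtoC (IZR q) * w) x' - ratio k mu w (RtoC (IZR q) * w) x)%C with
        (- (ratio k mu w (RtoC (IZR q) * w) x - ratio k mu w (RtoC (IZR q) * w) x'))%C by ring.
      rewrite Cmod_opp. replace (- (x' - x)) with (x - x') by ring. apply HL; lra.
Qed.

Lemma gz_as_weight (w : C) u t : 0 <= u <= 1 -> (t < W)%nat -> Cmod (RtoC (IZR q) * w) <= S ->
  gz k mu p s q r (RtoC (u + INR t) + w) =
  (ratio k mu w (RtoC (IZR q) * w) (IZR q * (u + INR t) + IZR r) * g0 k mu p s q r (u + INR t))%C.
Proof.
  intros Hu Ht Hz. pose proof (Hfr _ (in_range W u t Hu Ht)) as F.
  apply gz_ratio; [exact H0|pos|].
  apply (xz_bounds _ S HS Hz); exact F.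
Qed.

Lemma shifted_sum (w : C) u : 0 <= u <= 1 -> Cmod (RtoC (IZR q) * w) <= S -> INR mu * Cmod w <= 36 * S ^ 2 ->
  Cmod (csum (seq 0 W) (fun t => gz k mu p s q r (RtoC (u + INR t) + w))) ^ 2 <= 2 * weight_const k ^ 2 * hfun k mu p s q r W u.
Proof.
  intros Hu Hz Hw. destruct (lipschitz_weights w u Hu Hz Hw) as [L1 L2].
  rewrite (csum_ext _ _ (fun t => ratio k mu w (RtoC (IZR q) * w) (IZR q * (u + INR t) + IZR r) * g0 k mu p s q r (u + INR t))%C).
  2:{ intros t Ht. apply in_seq in Ht. apply gz_as_weight; [exact Hu|lia|exact Hz]. }
  apply (abel_bound (fun t => g0 k mu p s q r (u + INR t)) (fun t : nat => ratio k mu w (RtoC (IZR q) * w) (IZR q * (u + INR t) + IZR r))).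
  - exact HW.
  - pose proof (weight_const_ge k). pose proof (ratio_const_pos k). lra.
  - exact L1.
  - exact L2.
Qed.

Lemma Asq_cont T u : (T <= W)%nat -> 0 <= u <= 1 -> continuous (fun u => Cmod (Asum k mu p s q r T u) ^ 2) u.
Proof.
  intros HT Hu. simpl. apply (continuous_mult (fun u => Cmod (Asum k mu p s q r T u)) (fun u => Cmod (Asum k mu p s q r T u) * 1)).
  - apply Cc_Cmod, (A_cont k mu p s q r S W Hk Hmu HS H0 HW Hfr); assumption.
  - apply (continuous_mult (fun u => Cmod (Asum k mu p s q r T u)) (fun _ => 1)); [|apply continuous_const].
    apply Cc_Cmod, (A_cont k mu p s q r S W Hk Hmu HS H0 HW Hfr); assumption.
Qed.

Lemma hfun_cont u : 0 <= u <= 1 -> continuous (hfun k mu p s q r W) u.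
Proof.
  intros Hu. unfold hfun, abel_sq.
  assert (Hl : forall l, (forall T, In T l -> (T <= W)%nat) ->
    continuous (fun u => rsum l (fun T => Cmod (Asum k mu p s q r T u) ^ 2)) u).
  { induction l as [|T l IH]; intros Hl; cbn [rsum]; [apply continuous_const|].
    apply (continuous_plus (fun u => Cmod (Asum k mu p s q r T u) ^ 2)).
    - apply Asq_cont; [apply Hl; left; reflexivity|exact Hu].
    - apply IH. intros; apply Hl; right; assumption. }
  apply (continuous_plus (fun u => Cmod (Asum k mu p s q r W u) ^ 2)
    (fun u => rsum (seq 0 W) (fun T => Cmod (Asum k mu p s q r T u) ^ 2) / INR W)).
  - apply Asq_cont; [lia|exact Hu].
  - apply (continuous_mult (fun u => rsum (seq 0 W) (fun T => Cmod (Asum k mu p s q r T u) ^ 2)) (fun _ => / INR W)); [|apply continuous_const].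
    apply Hl. intros T HT. apply in_seq in HT. lia.
Qed.

Lemma hfun_int : RInt (hfun k mu p s q r W) 0 1 <= 2 * fold_const k mu q S W.
Proof.
  assert (HWp : 0 < INR W) by arith.
  set (I := fun T => RInt (fun u => Cmod (Asum k mu p s q r T u) ^ 2) 0 1).
  assert (Hex : forall T, (T <= W)%nat -> is_RInt (fun u => Cmod (Asum k mu p s q r T u) ^ 2) 0 1 (I T)).
  { intros T HT. apply (@RInt_correct R_CompleteNormedModule). apply ex_RInt_cont; [lra|]. intros u Hu. apply Asq_cont; assumption. }
  assert (HI : forall T, (T <= W)%nat -> I T <= fold_const k mu q S W).
  { intros T HT. apply (fold_bound k mu p s q r S W); assumption. }
  assert (Hs : forall l, (forall T, In T l -> (T <= W)%nat) ->
    is_RInt (fun u => rsum l (fun T => Cmod (Asum k mu p s q r T u) ^ 2)) 0 1 (rsum l I)).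
  { induction l as [|T l IH]; intros Hl; cbn [rsum].
    - evar_last; [apply is_RInt_const|]. unfold scal; simpl. unfold mult; simpl. ring.
    - apply (@is_RInt_plus R_NormedModule); [apply Hex, Hl; left; reflexivity|apply IH; intros; apply Hl; right; assumption]. }
  assert (HH : is_RInt (hfun k mu p s q r W) 0 1 (I W + / INR W * rsum (seq 0 W) I)).
  { apply (@is_RInt_ext R_NormedModule (fun u => plus (Cmod (Asum k mu p s q r W u) ^ 2) (scal (/ INR W) (rsum (seq 0 W) (fun T => Cmod (Asum k mu p s q r T u) ^ 2))))).
    - intros u _. unfold hfun, abel_sq, plus, scal; simpl. unfold mult; simpl. unfold Asum, Rdiv. ring.
    - apply (@is_RInt_plus R_NormedModule); [apply Hex; lia|]. apply (@is_RInt_scal R_NormedModule).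
      apply Hs. intros T HT. apply in_seq in HT. lia. }
  rewrite (is_RInt_unique _ _ _ _ HH).
  assert (rsum (seq 0 W) I <= INR W * fold_const k mu q S W).
  { eapply Rle_trans; [apply rsum_le_const with (c := fold_const k mu q S W)|rewrite length_seq; lra].
    intros T HT. apply in_seq in HT. apply HI. lia. }
  assert (/ INR W * rsum (seq 0 W) I <= fold_const k mu q S W).
  { apply Rmult_le_reg_l with (INR W); [exact HWp|]. rewrite <- Rmult_assoc, Rinv_r by lra. lra. }
  pose proof (HI W ltac:(lia)). lra.
Qed.

End Shifted.

(** * The diagonal terms of the quadratic form *)

Definition diag_const (k : nat) : R := (2 ^ k * 9) ^ 2 * (2 * weight_const k ^ 2).

Lemma csum_RtoC {I} (l : list I) (g : I -> R) : csum l (fun x => RtoC (g x)) = RtoC (rsum l g).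
Proof. induction l as [|x l IH]; [reflexivity|]. cbn [csum rsum]. rewrite IH, RtoC_plus. reflexivity. Qed.

Lemma csum_zrange0 n (g : Z -> C) : csum (zrange 0 n) g = csum (seq 0 n) (fun t => g (Z.of_nat t)).
Proof. unfold zrange. rewrite csum_map. apply csum_ext. intros; f_equal. Qed.

Section Diag.
Context (k mu : nat) (p s q r : Z) (S : R) (Pr : list Z) (P W : nat).
Context (Hk : (1 <= k)%nat) (Hmu : (1 <= mu)%nat) (HS : 0 < S) (H0 : (p * r - s * q = 1)%Z)
  (Hq0 : (q <> 0)%Z) (HW : (1 <= W)%nat) (Hq : Rabs (IZR q) <= 12 * S)
  (Hfr : forall u, 0 <= u <= INR W -> 3 * S <= IZR q * u + IZR r <= 6 * S)
  (H108 : 108 * S ^ 2 <= INR mu).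
Let y := S ^ 2 / INR mu.

Lemma y_facts : 0 < y /\ INR mu * y = S ^ 2 /\ Rabs (IZR q) * (9 * y) <= S.
Proof.
  assert (Hm : 1 <= INR mu) by (apply (le_INR 1); exact Hmu).
  assert (Hy : 0 < y) by (apply Rdiv_lt_0_compat; [apply pow_lt; lra|lra]).
  assert (Hmy : INR mu * y = S ^ 2) by (unfold y; field; lra).
  split; [exact Hy|]. split; [exact Hmy|].
  apply Rle_trans with (12 * S * (9 * y)); [apply Rmult_le_compat_r; lra|].
  assert (108 * y <= 1); [|nra].
  apply Rmult_le_reg_l with (INR mu); [lra|]. replace (INR mu * (108 * y)) with (108 * (INR mu * y)) by ring. rewrite Hmy. lra.
Qed.

Context (HPd : NoDup Pr) (HPr : forall c, In c Pr -> prime c /\ (3 <= c)%Z)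
  (HP2 : forall c, In c Pr -> IZR c <= 2 * INR P) (Hsm : 12 * (INR P + 3) * S ^ 2 <= INR mu).
Let J := jlist Pr 0 1.

(** The inner matrix sends v + iy to u + w with u real and |w| <= 9y. In the denominators of the
    product matrices the factor [dn] = c(v + iy) + d is common to all translates, and what is left
    is the sum of [gz] over the translates of u + w. *)
Lemma Wsum_sq j v : In j J -> vlo 0 1 j <= v <= vhi 0 1 j ->
  Cmod (Wsum k mu p s q r y W j v) ^ 2 <= diag_const k * hfun k mu p s q r W (mo (snd j) (bj j) (fst j) (dj j) v).
Proof.
  intros Hj Hv. destruct y_facts as (Hy & Hmy & Hqy).
  destruct (In_jlist Pr 0 1 j HPr ltac:(lra) ltac:(lra) ltac:(lra) Hj) as (A1 & A2 & _ & A4 & _ & U1 & _ & U2 & _ & _ & _ & _ & A5).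
  destruct (A5 v Hv) as (B1 & B2 & _).
  set (c := fst j) in *. set (a := snd j) in *. set (b := bj j) in *. set (d := dj j) in *.
  assert (Hcv : IZR c * v + IZR d <> 0) by arith.
  set (u := mo a b c d v) in *.
  set (dn := den (IZR c) (IZR d) v y).
  assert (Hdn : dn <> 0%C) by (apply den_nz; exact Hcv).
  set (w := (Ci * RtoC y / (dn * RtoC (IZR c * v + IZR d)))%C).
  assert (Ez : mob (IZR a) (IZR b) (IZR c) (IZR d) (pt v y) = (RtoC u + w)%C).
  { pose proof (mob_diff (IZR a) (IZR b) (IZR c) (IZR d) v y (det_IZR _ _ _ _ A4) Hcv) as H. fold dn in H. fold w in H.
    unfold u, mo. rewrite <- H. ring. }
  assert (Hd3 : / 3 <= Cmod dn).
  { eapply Rle_trans; [|apply Cmod_den_ge]. rewrite Rabs_right; lra. }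
  assert (Hd2 : Cmod dn <= 2).
  { via Cmod_le_sum. unfold dn. rewrite den_parts. unfold Re, Im; simpl.
    assert (Hm : 1 <= INR mu) by (apply (le_INR 1); exact Hmu).
    assert (H3 : 3 <= IZR c) by (apply IZR_le; exact A2). pose proof (HP2 c A1) as HP.
    rewrite (Rabs_right (IZR c * v + IZR d)) by lra. rewrite Rabs_right by (apply Rle_ge, Rmult_le_pos; lra).
    assert (IZR c * y <= 1); [|lra].
    apply Rmult_le_reg_l with (INR mu); [lra|]. replace (INR mu * (IZR c * y)) with (IZR c * (INR mu * y)) by ring. rewrite Hmy.
    nra. }
  (* 9 = 3 * 3, because both |dn| and cv + d are at least 1/3. *)
  assert (Hw : Cmod w <= 9 * y).
  { unfold w. rewrite Cmod_div by (apply Cmult_neq_0; [exact Hdn|intros E0; apply RtoC_inj in E0; lra]).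
    rewrite !Cmod_mult, Cmod_Ci, !Cmod_R, Rabs_right, (Rabs_right (IZR c * v + IZR d)) by lra.
    assert (/ 9 <= Cmod dn * (IZR c * v + IZR d)) by arith.
    rewrite Rmult_1_l. apply Rmult_le_reg_r with (Cmod dn * (IZR c * v + IZR d)); [lra|].
    unfold Rdiv. rewrite Rmult_assoc, Rinv_l by lra. nra. }
  assert (EW : Wsum k mu p s q r y W j v =
    (dn ^ k / dn ^ 2 * csum (seq 0 W) (fun t => gz k mu p s q r (RtoC (u + INR t) + w)))%C).
  { unfold Wsum. rewrite csum_zrange0, <- csum_mult_l. apply csum_ext. intros t Ht.
    fold c a b d. unfold Wj, Wf, gz.
    set (z := (RtoC (u + INR t) + w)%C).
    assert (Ez2 : (RtoC (IZR (a + c * Z.of_nat t)) * pt v y + RtoC (IZR (b + d * Z.of_nat t)))%C = (dn * z)%C).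
    { unfold z. rewrite RtoC_plus. replace (RtoC u + RtoC (INR t) + w)%C with (mob (IZR a) (IZR b) (IZR c) (IZR d) (pt v y) + RtoC (INR t))%C by (rewrite Ez; ring).
      unfold mob. change (RtoC (IZR c) * pt v y + RtoC (IZR d))%C with dn.
      rewrite !plus_IZR, !mult_IZR, <- !INR_IZR_INZ, !RtoC_plus, !RtoC_mult.
      transitivity (RtoC (IZR a) * pt v y + RtoC (IZR b) + dn * RtoC (INR t))%C; [unfold dn, den; ring|field; exact Hdn]. }
    assert (L : forall m n : Z, (RtoC (IZR (m * (a + c * Z.of_nat t) + n * c)) * pt v y + RtoC (IZR (m * (b + d * Z.of_nat t) + n * d)))%C =
      (dn * (RtoC (IZR m) * z + RtoC (IZR n)))%C).
    { intros m n. transitivity (RtoC (IZR m) * (RtoC (IZR (a + c * Z.of_nat t)) * pt v y + RtoC (IZR (b + d * Z.of_nat t))) + RtoC (IZR n) * dn)%C.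
      - unfold dn, den. repeat first [rewrite plus_IZR | rewrite mult_IZR | rewrite RtoC_plus | rewrite RtoC_mult]. ring.
      - rewrite Ez2. ring. }
    unfold mob. unfold den at 1 2. rewrite !L.
    set (qz := (RtoC (IZR q) * z + RtoC (IZR r))%C). set (pz := (RtoC (IZR p) * z + RtoC (IZR s))%C).
    assert (Hqz : qz <> 0%C).
    { assert (Eq : qz = (RtoC (IZR q * (u + INR t) + IZR r) + RtoC (IZR q) * w)%C) by (unfold qz, z; repeat first [rewrite RtoC_plus | rewrite RtoC_mult]; ring).
      rewrite Eq. apply (xz_bounds _ S HS).
      - rewrite Cmod_mult, Cmod_R. eapply Rle_trans; [|exact Hqy]. apply Rmult_le_compat_l; [apply Rabs_pos|exact Hw].
      - apply Hfr. apply (in_range W u t); [lra|apply in_seq in Ht; lia]. }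
    replace (dn * pz / (dn * qz))%C with (pz / qz)%C by (field; split; assumption).
    rewrite !Cpow_mult_l. pose proof (Cpow_nz _ 2 Hqz). pose proof (Cpow_nz _ 2 Hdn).
    set (e1 := E mu _). generalize (dn ^ k)%C (qz ^ k)%C. intros. set (d2 := (dn ^ 2)%C) in *. set (q2 := (qz ^ 2)%C) in *.
    clearbody d2 q2 e1. field. split; assumption. }
  rewrite EW, Cmod_mult, Rpow_mult_distr. unfold diag_const. rewrite Rmult_assoc. apply Rmult_le_compat; try apply pow2_ge_0.
  - apply pow_incr. split; [apply Cmod_ge_0|]. unfold Cdiv. rewrite Cmod_mult. apply Rmult_le_compat; try apply Cmod_ge_0.
    + apply Cmod_pow_le, Hd2.
    + replace 9 with (/ (/ 9)) by field. apply Cmod_inv_le; [lra|]. rewrite Cmod_pow.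
      apply Rle_trans with ((/ 3) ^ 2); [lra|apply pow_incr; lra].
  - apply (shifted_sum k mu p s q r S W); try assumption.
    + lra.
    + rewrite Cmod_mult, Cmod_R. eapply Rle_trans; [|exact Hqy]. apply Rmult_le_compat_l; [apply Rabs_pos|exact Hw].
    + rewrite <- Hmy. nra.
Qed.

Lemma Wsum_cont j v : In j J -> vlo 0 1 j <= v <= vhi 0 1 j -> Cc (Wsum k mu p s q r y W j) v.
Proof.
  intros Hj Hv.
  destruct (In_jlist Pr 0 1 j HPr ltac:(lra) ltac:(lra) ltac:(lra) Hj) as (A1 & A2 & _ & A4 & _ & U1 & _ & U2 & _ & _ & _ & _ & A5).
  destruct (A5 v Hv) as (B1 & B2 & _). unfold Wsum.
  assert (Hl : forall l, incl l (zrange 0 W) ->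
    Cc (fun v => csum l (fun t => Wj k mu p s q r (snd j + fst j * t) (bj j + dj j * t) (fst j) (dj j) y v)) v).
  { induction l as [|t l IH]; intros Hl; cbn [csum]; [apply Cc_const|].
    apply Cc_plus; [|apply IH; intros z Hz; apply Hl; right; exact Hz].
    assert (Ht : In t (zrange 0 W)) by (apply Hl; left; reflexivity). apply In_zrange in Ht.
    assert (D : ((snd j + fst j * t) * dj j - (bj j + dj j * t) * fst j = 1)%Z) by arith.
    assert (F : frame q r (snd j + fst j * t) (bj j + dj j * t) (fst j) (dj j) S v).
    { split; [exact B1|]. rewrite mo_shift by (apply Rgt_not_eq; lra). apply Hfr.
      assert (0 <= IZR t) by arith.
      assert (IZR t + 1 <= INR W) by (rewrite INR_IZR_INZ, <- plus_IZR; apply IZR_le; lia). lra. }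
    destruct (frame_full q r _ _ _ _ S v D ltac:(lia) HS Hq F) as [G1 _].
    apply Wf_cont; [apply det_full; assumption|apply Rgt_not_eq; lra]. }
  apply Hl, incl_refl.
Qed.

Lemma hfun_sub (l h : R) : 0 <= l -> l <= h -> h <= 1 -> ex_RInt (hfun k mu p s q r W) l h.
Proof.
  intros H1 H2 H3. apply ex_RInt_cont; [exact H2|]. intros u Hu. apply (hfun_cont k mu p s q r S W); try assumption. lra.
Qed.

(** Change of variables from v to u: du = dv/(cv + d)^2 >= dv, since cv + d <= 1 on the arc. *)
Lemma diag_one j : In j J ->
  Re (ip (vlo 0 1 j) (vhi 0 1 j) (vlo 0 1 j) (vhi 0 1 j) (Wsum k mu p s q r y W j) (Wsum k mu p s q r y W j)) <=
  diag_const k * RInt (hfun k mu p s q r W) (ulo 0 1 j) (uhi 0 1 j).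
Proof.
  intros Hj.
  destruct (In_jlist Pr 0 1 j HPr ltac:(lra) ltac:(lra) ltac:(lra) Hj)
    as (A1 & A2 & _ & A4 & _ & U1 & U3 & U2 & V1 & _ & E1 & E2 & A5).
  set (lo := vlo 0 1 j) in *. set (hi := vhi 0 1 j) in *.
  set (a := snd j) in *. set (b := bj j) in *. set (c := fst j) in *. set (d := dj j) in *.
  unfold ip. rewrite Rmax_left, Rmin_left by lra. destruct (Rle_dec lo hi) as [_|]; [|lra].
  set (Wv := Wsum k mu p s q r y W j).
  assert (HC : @is_RInt C_R_NormedModule (fun v => Wv v * Cconj (Wv v))%C lo hi (CInt (fun v => Wv v * Cconj (Wv v))%C lo hi)).
  { apply CInt_correct, ex_CInt_le; [lra|]. intros v Hv. apply Cc_mult; [apply Wsum_cont; assumption|apply Cc_conj, Wsum_cont; assumption]. }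
  apply is_CInt_fst in HC. change (fst ?z) with (Re z) in HC.
  assert (HC2 : is_RInt (fun v => Cmod (Wv v) ^ 2) lo hi (Re (CInt (fun v => Wv v * Cconj (Wv v))%C lo hi))).
  { eapply is_RInt_ext; [|exact HC]. intros v _. apply Re_mul_conj. }
  set (dg := fun v => / (IZR c * v + IZR d) ^ 2).
  assert (Hpos : forall v, lo <= v <= hi -> / 3 <= IZR c * v + IZR d <= 1) by (intros v Hv; apply A5, Hv).
  pose proof (is_RInt_comp (hfun k mu p s q r W) (mo a b c d) dg lo hi) as HS1.
  rewrite Rmin_left, Rmax_right in HS1 by lra. rewrite E1, E2 in HS1.
  assert (HS2 : is_RInt (fun v => scal (dg v) (hfun k mu p s q r W (mo a b c d v))) lo hi (RInt (hfun k mu p s q r W) (ulo 0 1 j) (uhi 0 1 j))).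
  { apply HS1.
    - intros v Hv. apply (hfun_cont k mu p s q r S W); try assumption. destruct (A5 v Hv) as (_ & B2 & _). lra.
    - intros v Hv. pose proof (Hpos v Hv) as Hp. assert (Hn : IZR c * v + IZR d <> 0) by arith. split.
      + unfold mo, dg. auto_derive; [exact Hn|]. apply det_IZR in A4.
        transitivity ((IZR a * IZR d - IZR b * IZR c) / (IZR c * v + IZR d) ^ 2); [field; exact Hn|rewrite A4; field; exact Hn].
      + unfold dg. apply (@ex_derive_continuous R_AbsRing R_NormedModule). auto_derive.
        apply Rmult_integral_contrapositive_currified; [exact Hn|]. rewrite Rmult_1_r. exact Hn. }
  apply (is_RInt_le _ _ lo hi _ _ ltac:(lra) HC2 (is_RInt_scal _ _ _ (diag_const k) _ HS2)).
  intros v Hv. eapply Rle_trans; [apply Wsum_sq; [exact Hj|unfold lo, hi in *; lra]|].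
  unfold scal; simpl; unfold mult; simpl. fold a b c d.
  assert (Hdc : 0 <= diag_const k) by (unfold diag_const; apply Rmult_le_pos; [apply pow2_ge_0|]; apply Rmult_le_pos; [lra|apply pow2_ge_0]).
  apply Rmult_le_compat_l; [exact Hdc|].
  pose proof (hfun_ge0 k mu p s q r W (mo a b c d v) HW) as Hh. pose proof (Hpos v ltac:(lra)) as Hp.
  rewrite <- (Rmult_1_l (hfun _ _ _ _ _ _ _ _)) at 1. apply Rmult_le_compat_r; [exact Hh|].
  unfold dg. rewrite <- Rinv_1. apply Rinv_le_contravar; [apply pow_lt; lra|]. nra.
Qed.

(** For each prime the arcs tile [0, 1], so the integrals of [hfun] add up to the full integral,
    once per prime. *)
Lemma diag_bound :
  rsum J (fun j => Re (ip (vlo 0 1 j) (vhi 0 1 j) (vlo 0 1 j) (vhi 0 1 j) (Wsum k mu p s q r y W j) (Wsum k mu p s q r y W j))) <=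
  INR (length Pr) * (diag_const k * (2 * fold_const k mu q S W)).
Proof.
  assert (Hdc : 0 <= diag_const k) by (unfold diag_const; apply Rmult_le_pos; [apply pow2_ge_0|]; apply Rmult_le_pos; [lra|apply pow2_ge_0]).
  eapply Rle_trans; [apply rsum_le; intros j Hj; apply diag_one, Hj|].
  set (H := hfun k mu p s q r W). 
  assert (Harc : forall c a, (3 <= c)%Z -> In a (arcs c) -> 0 <= ulo 0 1 (c, a) /\ ulo 0 1 (c, a) <= uhi 0 1 (c, a) /\ uhi 0 1 (c, a) <= 1).
  { intros c a Hc Ha. destruct (In_arcs c a Hc Ha) as [Ha1 Ha2].
    assert (Hlh : arc_lo c a <= arc_hi c a).
    { unfold arc_lo, arc_hi. assert (0 < / IZR c) by arith.
      destruct (Z.eq_dec a (c + 1)); apply Rmult_le_compat_r; try lra; apply IZR_le; lia. }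
    unfold ulo, uhi. cbn [fst snd]. unfold Rmax, Rmin. repeat destruct (Rle_dec _ _); lra. }
  unfold J, jlist. via rsum_filter_le.
  - intros j Hj. apply in_flat_map in Hj. destruct Hj as (c & Hc & Hj). apply in_map_iff in Hj. destruct Hj as (a & <- & Ha).
    destruct (HPr c Hc) as [_ Hc3]. destruct (Harc c a Hc3 Ha) as (B1 & B2 & B3).
    apply Rmult_le_pos; [exact Hdc|]. apply RInt_ge_0; [exact B2|apply hfun_sub; assumption|].
    intros u Hu. apply hfun_ge0, HW.
  - rewrite rsum_pairs, <- rsum_const. apply rsum_le. intros c Hc. destruct (HPr c Hc) as [_ Hc3].
    rewrite rsum_scal. apply Rmult_le_compat_l; [exact Hdc|].
    assert (E1 : rsum (arcs c) (fun a => RInt H (ulo 0 1 (c, a)) (uhi 0 1 (c, a))) = RInt H 0 1).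
    { apply RtoC_inj. rewrite <- csum_RtoC.
      pose proof (arcs_tile c 0 1 (fun u => RtoC (RInt H 0 u)) Hc3 ltac:(lra) ltac:(lra) ltac:(lra)) as HT. cbv beta zeta in HT.
      assert (E0 : RInt H 0 0 = 0) by (rewrite RInt_point; reflexivity). rewrite E0 in HT.
      transitivity (RtoC (RInt H 0 1) - RtoC 0)%C; [rewrite <- HT|ring].
      apply csum_ext. intros a Ha. destruct (Harc c a Hc3 Ha) as (B1 & B2 & B3). rewrite <- RtoC_minus. f_equal.
      change (Rmax 0 (Rmin 1 (arc_hi c a))) with (uhi 0 1 (c, a)). change (Rmax 0 (Rmin 1 (arc_lo c a))) with (ulo 0 1 (c, a)).
      rewrite <- (RInt_Chasles H 0 (ulo 0 1 (c, a)) (uhi 0 1 (c, a))) by (apply hfun_sub; lra).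
      generalize (RInt H 0 (ulo 0 1 (c, a))) (RInt H (ulo 0 1 (c, a)) (uhi 0 1 (c, a))). intros A B.
      change (@eq R B (Rminus (Rplus A B) A)). unfold Rminus. rewrite (Rplus_comm A B), Rplus_assoc, Rplus_opp_r, Rplus_0_r. reflexivity. }
    rewrite E1. apply (hfun_int k mu p s q r S W); assumption.
Qed.

End Diag.

(** * A single matrix without averaging, and the resonant case *)

Lemma abs_le_sqr_int (G : R -> C) (H : R -> R) T0 : (forall u, 0 <= u <= 1 -> Cc G u) ->
  (forall u, 0 <= u <= 1 -> Cmod (G u) ^ 2 <= H u) -> ex_RInt H 0 1 -> RInt H 0 1 <= T0 -> 0 < T0 ->
  RInt (fun u => Cmod (G u)) 0 1 <= sqrt T0.
Proof.
  intros HG HH Hex HT HT0. pose proof (sqrt_lt_R0 _ HT0) as Hs. set (s := sqrt T0) in *.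
  assert (Hs2 : s * s = T0) by (apply sqrt_sqrt; lra).
  assert (E1 : is_RInt (fun u => Cmod (G u)) 0 1 (RInt (fun u => Cmod (G u)) 0 1)).
  { apply (@RInt_correct R_CompleteNormedModule). apply ex_RInt_cont; [lra|]. intros u Hu. apply Cc_Cmod, HG, Hu. }
  assert (E2 : is_RInt (fun u => plus (scal (/ (2 * s)) (H u)) (s / 2)) 0 1 (plus (scal (/ (2 * s)) (RInt H 0 1)) (scal (1 - 0) (s / 2)))).
  { apply (@is_RInt_plus R_NormedModule); [|apply (@is_RInt_const R_NormedModule)].
    apply (@is_RInt_scal R_NormedModule). apply (@RInt_correct R_CompleteNormedModule), Hex. }
  apply Rle_trans with (/ (2 * s) * RInt H 0 1 + (1 - 0) * (s / 2)).
  - refine (is_RInt_le _ _ 0 1 _ _ ltac:(lra) E1 E2 _). intros u Hu.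
    change (Cmod (G u) <= / (2 * s) * H u + s / 2). specialize (HH u ltac:(lra)).
    apply Rmult_le_reg_l with (2 * s); [lra|].
    replace (2 * s * (/ (2 * s) * H u + s / 2)) with (H u + s * s) by (field; lra).
    assert (0 <= (Cmod (G u) - s) ^ 2) by arith. nra.
  - assert (/ (2 * s) * RInt H 0 1 <= / (2 * s) * T0) by (apply Rmult_le_compat_l; [left; apply Rinv_0_lt_compat; lra|exact HT]).
    assert (/ (2 * s) * T0 = s / 2) by (rewrite <- Hs2; field; lra). lra.
Qed.

Definition gzsum (k mu : nat) (p s q r : Z) (y : R) (W : nat) (v : R) : Complex.C :=
  csum (seq 0 W) (fun t => gz k mu p s q r (RtoC (v + INR t) + Ci * RtoC y)).

Lemma gz_Wf k mu p s q r y v (t : nat) : gz k mu p s q r (RtoC (v + INR t) + Ci * RtoC y) =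
  Wf k mu (IZR p) (IZR (s + p * Z.of_nat t)) (IZR q) (IZR (r + q * Z.of_nat t)) y v.
Proof.
  assert (L : forall m n : Z, (RtoC (IZR m) * (RtoC (v + INR t) + Ci * RtoC y) + RtoC (IZR n))%C =
    (RtoC (IZR m) * pt v y + RtoC (IZR (n + m * Z.of_nat t)))%C).
  { intros m n. rewrite plus_IZR, mult_IZR, <- INR_IZR_INZ. unfold pt, Cmult, Cplus, RtoC, Ci; simpl. apply Ceq; simpl; ring. }
  unfold gz, Wf, mob, den. rewrite !L. reflexivity.
Qed.

Lemma Dc_Wf k mu A B C D y v : (1 <= k)%nat -> A * D - B * C = 1 -> C * v + D <> 0 ->
  Dc (Wf k mu A B C D y) v (Wf k mu A B C D y v *
    (RtoC (INR k - 2) * RtoC C / den C D v y - RtoC (2 * PI) * Ci * RtoC (INR mu) / (den C D v y * den C D v y)))%C.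
Proof.
  intros Hk Hdet Hn. pose proof (den_nz C D v y Hn) as HP. destruct k as [|k']; [lia|].
  unfold Wf, Cdiv. eapply Dc_eq.
  - apply Dc_mult; [apply Dc_mult|].
    + apply Dc_pow, Dc_den.
    + apply Dc_inv; [apply Dc_pow, Dc_den|]. apply Cpow_nz, HP.
    + apply Dc_E, Dc_mob; assumption.
  - cbv beta. set (P := den C D v y) in *. set (ee := E mu _). clearbody P ee.
    rewrite S_INR. simpl Nat.pred. rewrite !Cpow_S.
    replace (RtoC (INR k' + 1 - 2)) with (RtoC (INR k') - 1)%C by (rewrite RtoC_minus, RtoC_plus; ring).
    rewrite RtoC_plus. replace (INR 2) with 2 by (simpl; ring).
    replace (RtoC (- INR mu)) with (- RtoC (INR mu))%C by (rewrite RtoC_opp; reflexivity).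
    simpl. generalize (P ^ k')%C (RtoC (INR k')) (RtoC (INR mu)) (RtoC (2 * PI)) (RtoC C). intros.
    field. exact HP.
Qed.

Section Path.
Context (k mu : nat) (p s q r : Z) (S Sy : R) (W : nat).
Context (Hk : (1 <= k)%nat) (Hmu : (1 <= mu)%nat) (HS : 0 < S) (H0 : (p * r - s * q = 1)%Z)
  (Hq0 : (q <> 0)%Z) (HW : (1 <= W)%nat) (Hq : Rabs (IZR q) <= 12 * S)
  (Hfr : forall u, 0 <= u <= INR W -> 3 * S <= IZR q * u + IZR r <= 6 * S)
  (HSy : 0 < Sy <= 6 * S)
  (HSf : forall u, 0 <= u <= INR W -> Sy <= IZR q * u + IZR r <= 6 * Sy)
  (H108 : 36 * (Rabs (IZR q) * S) <= INR mu).
(** Two sizes are kept apart: [S] measures the denominators inside the weights, while [Sy] only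
    fixes the height. They agree in the direct estimate; in the resonant one [Sy] is tuned so that y
    is exactly 1/n0. *)
Let y := Sy ^ 2 / INR mu.
Let w := (Ci * RtoC y)%C.

Lemma path_y : 0 < y /\ INR mu * y = Sy ^ 2 /\ Rabs (IZR q) * y <= S /\ Rabs (IZR q) * y <= Sy.
Proof.
  assert (Hm : 1 <= INR mu) by (apply (le_INR 1); exact Hmu).
  assert (Hy : 0 < y) by (apply Rdiv_lt_0_compat; [apply pow_lt; lra|lra]).
  assert (Hmy : INR mu * y = Sy ^ 2) by (unfold y; field; lra).
  pose proof (Rabs_pos (IZR q)) as Hqp.
  split; [exact Hy|]. split; [exact Hmy|].
  split; apply Rmult_le_reg_l with (INR mu); try lra;
    replace (INR mu * (Rabs (IZR q) * y)) with (Rabs (IZR q) * (INR mu * y)) by ring; rewrite Hmy.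
  - assert (Sy ^ 2 <= (6 * S) ^ 2) by arith.
    assert (Rabs (IZR q) * Sy ^ 2 <= Rabs (IZR q) * (6 * S) ^ 2) by arith.
    assert (36 * (Rabs (IZR q) * S) * S <= INR mu * S) by arith.
    lra.
  - assert (Rabs (IZR q) * Sy <= Rabs (IZR q) * (6 * S)) by arith.
    assert (Rabs (IZR q) * Sy * Sy <= INR mu * Sy) by arith. lra.
Qed.

Lemma w_bounds : Cmod (RtoC (IZR q) * w) <= S /\ INR mu * Cmod w <= 36 * S ^ 2.
Proof.
  destruct path_y as (Hy & Hmy & Hqy & _).
  assert (Ew : Cmod w = y) by (unfold w; rewrite Cmod_mult, Cmod_Ci, Cmod_R, Rabs_right by lra; ring).
  rewrite Cmod_mult, Cmod_R, Ew. split; [exact Hqy|]. rewrite Hmy.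
  replace (36 * S ^ 2) with ((6 * S) ^ 2) by ring. apply pow_incr; lra.
Qed.

Lemma gz_cont v t : 0 <= v <= 1 -> (t < W)%nat -> Cc (fun v => gz k mu p s q r (RtoC (v + INR t) + w)) v.
Proof.
  intros Hv Ht. eapply Cc_ext; [intros v'; symmetry; apply gz_Wf|].
  apply Wf_cont.
  - rewrite !plus_IZR, !mult_IZR. rewrite <- (det_IZR _ _ _ _ H0). ring.
  - rewrite plus_IZR, mult_IZR, <- INR_IZR_INZ. pose proof (Hfr _ (in_range W v t Hv Ht)). apply Rgt_not_eq. lra.
Qed.

Lemma gzsum_cont v : 0 <= v <= 1 -> Cc (gzsum k mu p s q r y W) v.
Proof.
  intros Hv. unfold gzsum.
  assert (Hl : forall l, incl l (seq 0 W) -> Cc (fun v => csum l (fun t => gz k mu p s q r (RtoC (v + INR t) + w))) v).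
  { induction l as [|t l IH]; intros Hl; cbn [csum]; [apply Cc_const|].
    apply Cc_plus; [|apply IH; intros z Hz; apply Hl; right; exact Hz].
    apply gz_cont; [exact Hv|]. assert (Ht : In t (seq 0 W)) by (apply Hl; left; reflexivity). apply in_seq in Ht. lia. }
  apply Hl, incl_refl.
Qed.

(** f has period 1, so the W unit intervals can be laid over [0, 1], where their weights add up to
    [gzsum]. *)
Lemma fold_path f A B : modform k f A -> bounded_by k f B ->
  Cmod (CInt (Phi mu f) (mo p s q r 0) (mo p s q r (INR W)) -
    CInt (fun v => f (pt v y) * gzsum k mu p s q r y W v)%C 0 1)%C <= link_const k mu B.
Proof.
  intros Hf Hb. destruct path_y as (Hy & Hmy & Hqy & Hqy').
  assert (Hfc : forall v, Cc (fun v => f (pt v y)) v).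
  { intros v. apply (mf_Cc k f A (fun v => pt v y) v Hf); [eapply Dc_Cc, Dc_hline|]. simpl. exact Hy. }
  set (F := fun v => (f (pt v y) * Wf k mu (IZR p) (IZR s) (IZR q) (IZR r) y v)%C).
  assert (HFc : forall v, 0 <= v <= INR W -> Cc F v).
  { intros v Hv. apply Cc_mult; [apply Hfc|]. apply Wf_cont; [exact (det_IZR _ _ _ _ H0)|].
    pose proof (Hfr v Hv). apply Rgt_not_eq. lra. }
  assert (Hper : forall v (t : nat), f (pt (v + INR t) y) = f (pt v y)).
  { intros v t. pose proof (mf_modular _ _ _ Hf 1%Z (Z.of_nat t) 0%Z 1%Z ltac:(lia) (pt v y) Hy) as HM.
    rewrite <- INR_IZR_INZ in HM.
    replace ((RtoC 1 * pt v y + RtoC (INR t)) / (RtoC 0 * pt v y + RtoC 1))%C with (pt (v + INR t) y) in HM.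
    - rewrite HM. replace (RtoC 0 * pt v y + RtoC 1)%C with (RtoC 1) by ring. rewrite Cpow_1_l. ring.
    - replace (RtoC 0 * pt v y + RtoC 1)%C with (RtoC 1) by ring. unfold pt. apply Ceq; simpl; field. }
  assert (ES : forall n, (n <= W)%nat -> CInt F 0 (INR n) =
    csum (seq 0 n) (fun t => CInt (fun v => f (pt v y) * gz k mu p s q r (RtoC (v + INR t) + w))%C 0 1)).
  { induction n as [|n IH]; intros Hn.
    - change (INR 0) with 0. apply CInt_point.
    - assert (HnW : INR (suc n) <= INR W) by (apply le_INR; exact Hn). pose proof (pos_INR n) as Hn0. rewrite S_INR in HnW.
      rewrite csum_seq_S, <- IH by lia. rewrite S_INR.
      rewrite <- (CInt_Chasles F 0 (INR n) (INR n + 1)) by (apply ex_CInt_le; [lra|]; intros v Hv; apply HFc; lra).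
      f_equal. transitivity (CInt (fun v => F (v + INR n)) 0 1).
      + rewrite CInt_comp_shift by (apply ex_CInt_le; [lra|]; intros v Hv; apply HFc; lra). f_equal; ring.
      + apply CInt_ext; [lra|]. intros v _. unfold F. rewrite Hper. f_equal. unfold w. rewrite gz_Wf.
        unfold Wf, den, mob. rewrite !plus_IZR, !mult_IZR, <- !INR_IZR_INZ.
        assert (L : forall m n0 : R, (RtoC m * pt (v + INR n) y + RtoC n0)%C = (RtoC m * pt v y + RtoC (n0 + m * INR n))%C).
        { intros m n0. unfold pt, Cmult, Cplus, RtoC; simpl. apply Ceq; simpl; ring. }
        rewrite !L. reflexivity. }
  replace (CInt (fun v => f (pt v y) * gzsum k mu p s q r y W v)%C 0 1) with (CInt F 0 (INR W)).
  2:{ rewrite ES by lia. symmetry. apply is_CInt_unique. unfold gzsum. eapply is_RInt_ext; [intros v _; apply csum_mult_l|].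
      apply (is_CInt_csum (seq 0 W) (fun t v => f (pt v y) * gz k mu p s q r (RtoC (v + INR t) + w))%C).
      intros t Ht. apply in_seq in Ht. apply CInt_correct, ex_CInt_le; [lra|]. intros v Hv.
      apply Cc_mult; [apply Hfc|apply gz_cont; [exact Hv|lia]]. }
  apply (link k f A B mu p s q r 1 0 (INR W) Sy Hf Hb H0 Hmu (pos_INR W) ltac:(lra) ltac:(left; reflexivity)).
  - intros v Hv. rewrite Rmult_1_l. apply HSf, Hv.
  - exact Hqy'.
Qed.

Definition fold_sq : R := 2 * (fold_const k mu q S W).

Lemma fold_sq_pos : 0 < fold_sq.
Proof.
  unfold fold_sq, fold_const. pose proof (pow_lt _ 2 (Gb_pos k S HS)) as HG.
  assert (HW1 : 1 <= INR W) by (apply (le_INR 1); exact HW).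
  assert (0 <= Rres mu q S).
  { unfold Rres. pose proof (q_abs k mu q r S W Hk Hmu Hq0 HW Hfr). apply Rdiv_le_0_compat; [apply pow_le; lra|].
    apply Rmult_lt_0_compat; [apply lt_0_INR; lia|lra]. }
  pose proof (harm_ge0 W). pose proof (Wbd_pos k).
  assert (0 <= Wbd k * Rres mu q S * harm W) by arith.
  apply Rmult_lt_0_compat; [lra|]. apply Rmult_lt_0_compat; lra.
Qed.

Lemma hfun_scaled C0 : 0 <= C0 -> ex_RInt (fun u => C0 * hfun k mu p s q r W u) 0 1 /\
  RInt (fun u => C0 * hfun k mu p s q r W u) 0 1 <= C0 * fold_sq.
Proof.
  intros HC.
  assert (Hex : ex_RInt (hfun k mu p s q r W) 0 1).
  { apply ex_RInt_cont; [lra|]. intros u Hu. apply (hfun_cont k mu p s q r S W); assumption. }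
  assert (E : is_RInt (fun u => scal C0 (hfun k mu p s q r W u)) 0 1 (scal C0 (RInt (hfun k mu p s q r W) 0 1))).
  { apply (@is_RInt_scal R_NormedModule). apply (@RInt_correct R_CompleteNormedModule), Hex. }
  split; [eexists; exact E|]. 
  apply Rle_trans with (C0 * RInt (hfun k mu p s q r W) 0 1).
  - right. apply is_RInt_unique, E.
  - apply Rmult_le_compat_l; [exact HC|]. apply (hfun_int k mu p s q r S W); assumption.
Qed.

(** The supremum of f at height y times the mean of |gzsum|: all cancellation comes from the sum
    over translates. *)
Lemma fold_direct f A B : modform k f A -> bounded_by k f B ->
  Cmod (CInt (Phi mu f) (mo p s q r 0) (mo p s q r (INR W))) <=
  B * Rpower y (- (INR k / 2)) * sqrt (2 * weight_const k ^ 2 * fold_sq) + link_const k mu B.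
Proof.
  intros Hf Hb. destruct path_y as (Hy & Hmy & Hqy & Hqy'). destruct w_bounds as [Hw1 Hw2].
  pose proof (fold_path f A B Hf Hb) as HP. pose proof fold_sq_pos as HF.
  pose proof (weight_const_ge k). pose proof (ratio_const_pos k).
  set (I := CInt (Phi mu f) (mo p s q r 0) (mo p s q r (INR W))) in *. set (I2 := CInt _ 0 1) in *.
  replace I with (I2 + (I - I2))%C by ring. via Cmod_triangle.
  apply Rplus_le_compat; [|exact HP].
  assert (HC0 : 0 < 2 * weight_const k ^ 2) by arith.
  destruct (hfun_scaled _ (Rlt_le _ _ HC0)) as [E1 E2].
  assert (HL1 : RInt (fun u => Cmod (gzsum k mu p s q r y W u)) 0 1 <= sqrt (2 * weight_const k ^ 2 * fold_sq)).
  { apply (abs_le_sqr_int _ (fun u => 2 * weight_const k ^ 2 * hfun k mu p s q r W u)); try assumption.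
    - intros; apply gzsum_cont; assumption.
    - intros u Hu. apply (shifted_sum k mu p s q r S W); assumption.
    - apply Rmult_lt_0_compat; assumption. }
  set (M := B * Rpower y (- (INR k / 2))).
  assert (HM : 0 <= M) by (destruct Hb; apply Rmult_le_pos; [lra|left; apply exp_pos]).
  assert (Hfc : forall v, Cc (fun v => f (pt v y)) v).
  { intros v. apply (mf_Cc k f A (fun v => pt v y) v Hf); [eapply Dc_Cc, Dc_hline|]. simpl. exact Hy. }
  apply Rle_trans with (M * RInt (fun u => Cmod (gzsum k mu p s q r y W u)) 0 1); [|apply Rmult_le_compat_l; assumption].
  unfold I2. apply (CInt_le _ (fun u => M * Cmod (gzsum k mu p s q r y W u)) 0 1).
  - lra.
  - apply ex_CInt_le; [lra|]. intros v Hv. apply Cc_mult; [apply Hfc|apply gzsum_cont, Hv].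
  - apply (@is_RInt_scal R_NormedModule (fun u => Cmod (gzsum k mu p s q r y W u)) 0 1 M).
    apply (@RInt_correct R_CompleteNormedModule), ex_RInt_cont; [lra|]. intros u Hu. apply Cc_Cmod, gzsum_cont, Hu.
  - intros u Hu. rewrite Cmod_mult. apply Rmult_le_compat_r; [apply Cmod_ge_0|].
    destruct Hb as [HB Hb']. apply mf_bound_at; [exact Hy|simpl; lra|]. apply Hb'. simpl. exact Hy.
Qed.

(** The resonant case: the phase derivative mu/(qu + r)^2 stays within 2 of the integer [n0] over
    all W translates, so the weights oscillate like e(-n0 v). *)
Context (n0 : nat) (Hn0 : (1 <= n0)%nat) (Hyn : y = / INR n0)
  (Hres : forall u, 0 <= u <= INR W -> Rabs (INR n0 - INR mu / (IZR q * u + IZR r) ^ 2) <= 2)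
  (HWR : INR W <= Rres mu q S).

(** The logarithmic derivative of e(n0 z) gz(z) as a function of x = qu + r. *)
Definition psi (x : R) : C :=
  (RtoC (2 * PI) * Ci * (RtoC (INR n0) - RtoC (INR mu) / ((RtoC x + RtoC (IZR q) * w) * (RtoC x + RtoC (IZR q) * w)))
   + RtoC (INR k - 2) * RtoC (IZR q) / (RtoC x + RtoC (IZR q) * w))%C.

Definition dpsi (x : R) : C :=
  (RtoC (2 * PI) * Ci * (2 * RtoC (INR mu) / ((RtoC x + RtoC (IZR q) * w) * (RtoC x + RtoC (IZR q) * w) * (RtoC x + RtoC (IZR q) * w)))
   - RtoC (INR k - 2) * RtoC (IZR q) / ((RtoC x + RtoC (IZR q) * w) * (RtoC x + RtoC (IZR q) * w)))%C.

Definition psi_const : R := 3 * INR k + 400.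

Lemma q_small : 1 <= Rabs (IZR q) /\ Rabs (IZR q) * INR W <= 3 * S /\ Rabs (IZR q) <= 3 * S.
Proof.
  destruct (q_abs k mu q r S W Hk Hmu Hq0 HW Hfr) as [Q1 Q2].
  assert (HW1 : 1 <= INR W) by (apply (le_INR 1); exact HW).
  split; [exact Q1|]. split; [exact Q2|]. nra.
Qed.

Lemma psi_bound u : 0 <= u <= INR W -> Cmod (psi (IZR q * u + IZR r)) <= psi_const.
Proof.
  intros Hu. destruct w_bounds as [Hw1 Hw2]. destruct path_y as (Hy & Hmy & _).
  pose proof (Hfr u Hu) as F. specialize (Hres u Hu). set (x := IZR q * u + IZR r) in *.
  destruct (xz_bounds _ S HS Hw1 x F) as (B1 & B2 & N1 & N2 & B3).
  destruct q_small as (Q1 & _ & Q3). pose proof (pos_INR k) as Hk0. pose proof PI_RGT_0. pose proof PI_4.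
  unfold psi, psi_const. set (P := (RtoC x + RtoC (IZR q) * w)%C) in *.
  via Cmod_triangle.
  replace (3 * INR k + 400) with (390 + (3 * INR k + 10)) by ring. apply Rplus_le_compat.
  - rewrite !Cmod_mult, Cmod_R, Cmod_Ci, Rabs_right by lra.
    assert (HD : Cmod (RtoC (INR n0) - RtoC (INR mu) / (P * P))%C <= 2 + 39).
    (* The hypothesis on [n0] concerns the real point x. Passing to P = x + zeta with zeta = qw
       costs mu |zeta| |2x + zeta|/|xP|^2 <= 3 * 36 * 13/36 = 39. *)
    { replace (RtoC (INR n0) - RtoC (INR mu) / (P * P))%C with
        (RtoC (INR n0 - INR mu / x ^ 2) + RtoC (INR mu) * (RtoC (IZR q) * w) * (2 * RtoC x + RtoC (IZR q) * w) / ((RtoC x * P) * (RtoC x * P)))%C.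
      2:{ rewrite RtoC_minus, RtoC_div, RtoC_pow by (apply pow_nonzero; lra). unfold P in *. simpl. field.
          split; assumption. }
      via Cmod_triangle. rewrite Cmod_R. apply Rplus_le_compat; [exact Hres|].
      assert (NN : (RtoC x * P)%C <> 0%C) by (apply Cmult_neq_0; assumption).
      rewrite Cmod_div by (apply Cmult_neq_0; exact NN). rewrite !(Cmod_mult (_ * _)%C), (Cmod_mult (RtoC (INR mu))), !Cmod_R.
      rewrite (Rabs_right (INR mu)) by (apply Rle_ge, pos_INR).
      set (q0 := Cmod (RtoC x * P)%C) in *.
      assert (A1 : Cmod (2 * RtoC x + RtoC (IZR q) * w)%C <= 13 * S).
      { via Cmod_triangle. rewrite <- RtoC_mult, Cmod_R, Rabs_right by lra. lra. }
      assert (A2 : INR mu * Cmod (RtoC (IZR q) * w)%C <= 3 * S * (36 * S ^ 2)).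
      { rewrite Cmod_mult, Cmod_R. replace (INR mu * (Rabs (IZR q) * Cmod w)) with (Rabs (IZR q) * (INR mu * Cmod w)) by ring.
        apply Rmult_le_compat; try lra. apply Rmult_le_pos; [apply pos_INR|apply Cmod_ge_0]. }
      assert (A3 : 36 * S ^ 4 <= q0 * q0) by arith.
      assert (HS4 : 0 < S ^ 4) by arith.
      apply Rmult_le_reg_r with (q0 * q0); [lra|]. unfold Rdiv. rewrite Rmult_assoc, Rinv_l by (apply Rgt_not_eq; lra).
      rewrite Rmult_1_r. apply Rle_trans with (3 * S * (36 * S ^ 2) * (13 * S)).
      - apply Rmult_le_compat; try assumption; [|apply Cmod_ge_0]. apply Rmult_le_pos; [apply pos_INR|apply Cmod_ge_0].
      - replace (3 * S * (36 * S ^ 2) * (13 * S)) with (39 * (36 * S ^ 4)) by ring. lra. }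
    replace 390 with (2 * 4 * 1 * 41 + 62) by ring.
    assert (2 * PI * 1 * Cmod (RtoC (INR n0) - RtoC (INR mu) / (P * P))%C <= 2 * 4 * 1 * 41); [|lra].
    pose proof (Cmod_ge_0 (RtoC (INR n0) - RtoC (INR mu) / (P * P))%C). apply Rmult_le_compat; lra.
  - rewrite Cmod_div by exact N1. rewrite Cmod_mult, !Cmod_R.
    apply Rmult_le_reg_r with (Cmod P); [lra|]. unfold Rdiv. rewrite Rmult_assoc, Rinv_l, Rmult_1_r by lra.
    assert (A1 : Rabs (INR k - 2) <= INR k + 2) by (apply Rabs_le; lra).
    apply Rle_trans with ((INR k + 2) * (3 * S)); [apply Rmult_le_compat; try apply Rabs_pos; lra|]. nra.
Qed.

Lemma psi_deriv x : 3 * S <= x <= 6 * S -> Dc psi x (dpsi x).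
Proof.
  intros F. destruct w_bounds as [Hw1 Hw2].
  destruct (xz_bounds _ S HS Hw1 x F) as (_ & _ & N1 & N2 & _).
  assert (DP : Dc (fun t => RtoC t + RtoC (IZR q) * w)%C x 1%C).
  { eapply Dc_eq; [apply Dc_plus; [apply Dc_id|apply Dc_const]|]. simpl. ring. }
  unfold psi, dpsi, Cdiv. eapply Dc_eq.
  - apply Dc_plus.
    + apply Dc_mult; [apply Dc_const|]. apply Dc_minus; [apply Dc_const|]. apply Dc_mult; [apply Dc_const|].
      apply Dc_inv; [apply Dc_mult; exact DP|apply Cmult_neq_0; exact N1].
    + apply Dc_mult; [apply Dc_const|]. apply Dc_inv; [exact DP|exact N1].
  - cbv beta. set (P := (RtoC x + RtoC (IZR q) * w)%C) in *. clearbody P.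
    field. exact N1.
Qed.

(** The main term moves by at most 2 mu |q|/S^3 = 2/Rres in one step, and W <= Rres turns this into
    2/W. *)
Lemma psi_step u t : 0 <= u <= 1 -> (suc t < W)%nat ->
  Cmod (psi (IZR q * (u + INR (suc t)) + IZR r) - psi (IZR q * (u + INR t) + IZR r))%C <= psi_const / INR W.
Proof.
  intros Hu Ht. destruct w_bounds as [Hw1 Hw2]. destruct q_small as (Q1 & Q2 & Q3).
  pose proof (Hfr _ (in_range W u t Hu ltac:(lia))) as F1. pose proof (Hfr _ (in_range W u _ Hu Ht)) as F2.
  set (x := IZR q * (u + INR t) + IZR r) in *. set (x' := IZR q * (u + INR (suc t)) + IZR r) in *.
  assert (Exx : x' - x = IZR q) by (unfold x', x; rewrite S_INR; ring).
  assert (HWp : 0 < INR W) by arith. pose proof (pos_INR k) as Hk0.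
  pose proof PI_RGT_0. pose proof PI_4. assert (Hmp : 0 <= INR mu) by arith.
  set (K := 2 * INR mu / S ^ 3 + (INR k + 2) * Rabs (IZR q) / (4 * S ^ 2)).
  assert (HS3 : 0 < S ^ 3) by arith. assert (HS2 : 0 < S ^ 2) by arith.
  assert (HL : forall a b, 3 * S <= a -> a <= b -> b <= 6 * S -> Cmod (psi b - psi a)%C <= K * (b - a)).
  { intros a b Ha Hab Hb. apply (Dc_lipschitz _ dpsi); [exact Hab| | |].
    - intros z Hz. apply psi_deriv. lra.
    - intros z Hz. destruct (xz_bounds _ S HS Hw1 z ltac:(lra)) as (_ & _ & N1 & _).
      assert (DP : Dc (fun t => RtoC t + RtoC (IZR q) * w)%C z 1%C).
      { eapply Dc_eq; [apply Dc_plus; [apply Dc_id|apply Dc_const]|]. simpl. ring. }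
      unfold dpsi, Cdiv. apply Cc_minus.
      + apply Cc_mult; [apply Cc_const|]. apply Cc_mult; [apply Cc_const|].
        eapply Dc_Cc, Dc_inv; [apply Dc_mult; [apply Dc_mult|]; exact DP|]. apply Cmult_neq_0; [apply Cmult_neq_0|]; exact N1.
      + apply Cc_mult; [apply Cc_const|]. eapply Dc_Cc, Dc_inv; [apply Dc_mult; exact DP|]. apply Cmult_neq_0; exact N1.
    - intros z Hz. destruct (xz_bounds _ S HS Hw1 z ltac:(lra)) as (B1 & _ & N1 & _).
      unfold dpsi. set (P := (RtoC z + RtoC (IZR q) * w)%C) in *.
      unfold Cminus. via Cmod_triangle. rewrite Cmod_opp. unfold K. 
      assert (NN : (P * P)%C <> 0%C) by (apply Cmult_neq_0; exact N1).
      assert (P2 : 4 * S ^ 2 <= Cmod (P * P)%C).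
      { rewrite Cmod_mult. replace (4 * S ^ 2) with (2 * S * (2 * S)) by ring. apply Rmult_le_compat; lra. }
      assert (P3 : 8 * S ^ 3 <= Cmod (P * P * P)%C).
      { rewrite Cmod_mult. replace (8 * S ^ 3) with (4 * S ^ 2 * (2 * S)) by ring. apply Rmult_le_compat; lra. }
      apply Rplus_le_compat.
      + rewrite !Cmod_mult, Cmod_R, Cmod_Ci, Rabs_right by lra. rewrite Cmod_div by (apply Cmult_neq_0; assumption).
        rewrite Cmod_mult, !Cmod_R, Rabs_right, (Rabs_right (INR mu)) by lra.
        apply Rmult_le_reg_r with (Cmod (P * P * P)%C); [lra|].
        replace (2 * PI * 1 * (2 * INR mu / Cmod (P * P * P)%C) * Cmod (P * P * P)%C) with (4 * PI * INR mu) by (field; lra).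
        apply Rle_trans with (2 * INR mu / S ^ 3 * (8 * S ^ 3)); [replace (2 * INR mu / S ^ 3 * (8 * S ^ 3)) with (16 * INR mu) by (field; lra); nra|].
        apply Rmult_le_compat_l; [apply Rdiv_le_0_compat; lra|exact P3].
      + rewrite Cmod_div by exact NN. rewrite Cmod_mult, !Cmod_R.
        assert (A1 : Rabs (INR k - 2) <= INR k + 2) by (apply Rabs_le; lra).
        apply Rmult_le_compat.
        * apply Rmult_le_pos; apply Rabs_pos.
        * left; apply Rinv_0_lt_compat; lra.
        * apply Rmult_le_compat_r; [apply Rabs_pos|exact A1].
        * apply Rinv_le_contravar; lra. }
  assert (HB : K * Rabs (IZR q) <= psi_const / INR W).
  { assert (Hmu1 : 1 <= INR mu) by arith.
    assert (A1 : 2 * INR mu / S ^ 3 * Rabs (IZR q) <= 2 / INR W).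
    { replace (2 * INR mu / S ^ 3 * Rabs (IZR q)) with (2 * / Rres mu q S) by (unfold Rres; field; lra).
      apply Rmult_le_compat_l; [lra|]. apply Rinv_le_contravar; assumption. }
    assert (A2 : (INR k + 2) * Rabs (IZR q) / (4 * S ^ 2) * Rabs (IZR q) <= (INR k + 2) * 3 / INR W).
    { apply Rmult_le_reg_r with (INR W); [exact HWp|]. replace ((INR k + 2) * 3 / INR W * INR W) with ((INR k + 2) * 3) by (field; lra).
      replace ((INR k + 2) * Rabs (IZR q) / (4 * S ^ 2) * Rabs (IZR q) * INR W) with
        ((INR k + 2) * (Rabs (IZR q) * (Rabs (IZR q) * INR W) / (4 * S ^ 2))) by (field; lra).
      apply Rmult_le_compat_l; [lra|]. apply Rmult_le_reg_r with (4 * S ^ 2); [lra|].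
      unfold Rdiv. rewrite Rmult_assoc, Rinv_l, Rmult_1_r by lra.
      apply Rle_trans with (3 * S * (3 * S)); [apply Rmult_le_compat; try lra|nra].
      apply Rmult_le_pos; lra. }
    unfold K. rewrite Rmult_plus_distr_r. 
    apply Rle_trans with (2 / INR W + (INR k + 2) * 3 / INR W); [lra|].
    unfold psi_const. apply Rmult_le_reg_r with (INR W); [exact HWp|]. 
    replace ((2 / INR W + (INR k + 2) * 3 / INR W) * INR W) with (2 + (INR k + 2) * 3) by (field; lra).
    unfold Rdiv. rewrite Rmult_assoc, Rinv_l by lra. lra. }
  eapply Rle_trans; [|exact HB].
  destruct (Rle_dec x x') as [Hle|Hle].
  - replace (Rabs (IZR q)) with (x' - x) by (rewrite <- Exx, Rabs_right by lra; reflexivity). apply HL; lra.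
  - replace (Rabs (IZR q)) with (- (x' - x)) by (rewrite <- Exx, Rabs_left by lra; reflexivity).
    replace (psi x' - psi x)%C with (- (psi x - psi x'))%C by ring.
    rewrite Cmod_opp. replace (- (x' - x)) with (x - x') by ring. apply HL; lra.
Qed.

(** f gzsum is the product of f(z) e(-n0 z) and [Gsum]: the oscillation moves into an integrand of
    the original kind, with n0 for mu, and [Gsum] varies slowly in the mean. *)
Definition Gsum (v : R) : C := (e (RtoC (INR n0) * pt v y) * gzsum k mu p s q r y W v)%C.

Definition dGsum (v : R) : C :=
  (e (RtoC (INR n0) * pt v y) * csum (seq 0 W) (fun t =>
     psi (IZR q * (v + INR t) + IZR r) * gz k mu p s q r (RtoC (v + INR t) + w)))%C.

Lemma Gsum_deriv v : 0 <= v <= 1 -> Dc Gsum v (dGsum v).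
Proof.
  intros Hv. unfold Gsum, dGsum, gzsum.
  assert (HE : Dc (fun v => e (RtoC (INR n0) * pt v y)) v (RtoC (2 * PI) * Ci * RtoC (INR n0) * e (RtoC (INR n0) * pt v y))%C).
  { eapply Dc_eq; [apply (Dc_e (fun v => RtoC (INR n0) * pt v y)%C), Dc_mult; [apply Dc_const|apply Dc_hline]|]. simpl. ring. }
  assert (Hl : forall l, incl l (seq 0 W) -> Dc (fun v => e (RtoC (INR n0) * pt v y) * csum l (fun t => gz k mu p s q r (RtoC (v + INR t) + w)))%C v
    (e (RtoC (INR n0) * pt v y) * csum l (fun t => psi (IZR q * (v + INR t) + IZR r) * gz k mu p s q r (RtoC (v + INR t) + w)))%C).
  { induction l as [|t l IH]; intros Hl; cbn [csum].
    - eapply Dc_eq; [apply Dc_mult; [exact HE|apply Dc_const]|]. simpl. ring.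
    - assert (Ht : In t (seq 0 W)) by (apply Hl; left; reflexivity). apply in_seq in Ht.
      pose proof (Hfr _ (in_range W v t Hv ltac:(lia))) as F.
      apply (Dc_ext (fun v => e (RtoC (INR n0) * pt v y) * gz k mu p s q r (RtoC (v + INR t) + w) +
        e (RtoC (INR n0) * pt v y) * csum l (fun t => gz k mu p s q r (RtoC (v + INR t) + w)))%C); [intros; ring|].
      eapply Dc_eq; [apply Dc_plus; [|apply IH; intros z Hz; apply Hl; right; exact Hz]|].
      + apply Dc_mult; [exact HE|]. apply (Dc_ext (Wf k mu (IZR p) (IZR (s + p * Z.of_nat t)) (IZR q) (IZR (r + q * Z.of_nat t)) y)).
        * intros v'. symmetry. apply gz_Wf.
        * apply Dc_Wf; [exact Hk| |].
          -- rewrite !plus_IZR, !mult_IZR. rewrite <- (det_IZR _ _ _ _ H0). ring.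
          -- rewrite plus_IZR, mult_IZR, <- INR_IZR_INZ. apply Rgt_not_eq. lra.
      + cbv beta. rewrite <- gz_Wf. fold w.
        assert (EP : den (IZR q) (IZR (r + q * Z.of_nat t)) v y = (RtoC (IZR q * (v + INR t) + IZR r) + RtoC (IZR q) * w)%C).
        { rewrite den_parts, plus_IZR, mult_IZR, <- INR_IZR_INZ. unfold w. apply Ceq; simpl; ring. }
        rewrite EP. unfold psi. unfold Cdiv. ring. }
  apply Hl, incl_refl.
Qed.

Lemma dGsum_cont v : 0 <= v <= 1 -> Cc dGsum v.
Proof.
  intros Hv. unfold dGsum. apply Cc_mult.
  { eapply Dc_Cc, (Dc_e (fun v => RtoC (INR n0) * pt v y)%C), Dc_mult; [apply Dc_const|apply Dc_hline]. }
  assert (Hl : forall l, incl l (seq 0 W) -> Cc (fun v => csum l (fun t => psi (IZR q * (v + INR t) + IZR r) * gz k mu p s q r (RtoC (v + INR t) + w)))%C v).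
  { induction l as [|t l IH]; intros Hl; cbn [csum]; [apply Cc_const|].
    apply Cc_plus; [|apply IH; intros z Hz; apply Hl; right; exact Hz].
    assert (Ht : In t (seq 0 W)) by (apply Hl; left; reflexivity). apply in_seq in Ht.
    apply Cc_mult; [|apply gz_cont; [exact Hv|lia]].
    apply (continuous_comp (fun v => IZR q * (v + INR t) + IZR r) psi).
    - apply (@ex_derive_continuous R_AbsRing R_NormedModule). auto_derive. exact I.
    - eapply Dc_Cc, psi_deriv. apply Hfr, in_range; [exact Hv|lia]. }
  apply Hl, incl_refl.
Qed.

Lemma e_le1 v : Cmod (e (RtoC (INR n0) * pt v y)) <= 1.
Proof.
  rewrite Cmod_e, Im_scal. simpl. rewrite <- exp_0. apply exp_le_mono.
  destruct path_y as (Hy & _). pose proof PI_RGT_0.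
  assert (0 <= 2 * PI * (INR n0 * y)) by arith. lra.
Qed.

(** The outer 2 is that of [abel_bound]; the inner one comes from the product rule for increments of
    [psi] times [ratio]. *)
Definition dG_const : R := 2 * (2 * weight_const k * psi_const) ^ 2.

Lemma dGsum_sq u : 0 <= u <= 1 -> Cmod (dGsum u) ^ 2 <= dG_const * hfun k mu p s q r W u.
Proof.
  intros Hu. destruct w_bounds as [Hw1 Hw2].
  destruct (lipschitz_weights k mu q r S W Hk Hmu HS Hq0 HW Hfr w u Hu Hw1 Hw2) as [L1 L2].
  set (ph := fun t : nat => ratio k mu w (RtoC (IZR q) * w) (IZR q * (u + INR t) + IZR r)) in *.
  set (ps := fun t : nat => psi (IZR q * (u + INR t) + IZR r)).
  pose proof (weight_const_ge k) as W1. pose proof (ratio_const_pos k) as W2. pose proof (pos_INR k).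
  assert (Hpc : 0 < psi_const) by (unfold psi_const; lra).
  assert (HWp : 0 < INR W) by arith.
  assert (HV : 0 <= weight_const k * psi_const) by arith.
  assert (Hps : forall t, (t < W)%nat -> Cmod (ps t) <= psi_const) by (intros t Ht; apply psi_bound, in_range; assumption).
  apply Rle_trans with (Cmod (csum (seq 0 W) (fun t => (ps t * ph t) * g0 k mu p s q r (u + INR t))%C) ^ 2).
  - apply pow_incr. split; [apply Cmod_ge_0|]. unfold dGsum. rewrite Cmod_mult.
    rewrite (csum_ext (seq 0 W) _ (fun t => (ps t * ph t) * g0 k mu p s q r (u + INR t))%C).
    + set (cs := csum _ _). apply Rle_trans with (1 * Cmod cs); [|lra]. apply Rmult_le_compat_r; [apply Cmod_ge_0|apply e_le1].
    + intros t Ht. apply in_seq in Ht. rewrite (gz_as_weight k mu p s q r S W) by (try assumption; lia). unfold ps, ph. ring.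
  - unfold dG_const, hfun.
    apply (abel_bound (fun t => g0 k mu p s q r (u + INR t)) (fun t => ps t * ph t)%C W (2 * weight_const k * psi_const)).
    + exact HW.
    + lra.
    + intros t Ht. rewrite Cmod_mult. apply Rle_trans with (psi_const * weight_const k); [|lra].
      apply Rmult_le_compat; try apply Cmod_ge_0; [apply Hps, Ht|apply L1, Ht].
    + intros t Ht.
      replace (ps (suc t) * ph (suc t) - ps t * ph t)%C with
        ((ps (suc t) - ps t) * ph (suc t) + ps t * (ph (suc t) - ph t))%C by ring.
      via Cmod_triangle. rewrite !Cmod_mult.
      replace (2 * weight_const k * psi_const / INR W) with (psi_const / INR W * weight_const k + psi_const * (weight_const k / INR W)) by (field; lra).
      apply Rplus_le_compat; apply Rmult_le_compat; try apply Cmod_ge_0.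
      * apply psi_step; assumption.
      * apply L1, Ht.
      * apply Hps; lia.
      * apply L2, Ht.
Qed.

(** Integration by parts against the primitive of [Phi n0], which [Hm] bounds. [Gsum] is controlled
    only in the mean; its value at 1 is recovered as the integral of the derivative of v Gsum(v), at
    twice the cost, whence 3 = 2 + 1. *)
Lemma resonant f A B Hm : modform k f A -> bounded_by k f B -> 0 <= Hm ->
  (forall v, 0 <= v <= 1 -> Cmod (CInt (Phi n0 f) 0 v) <= Hm) ->
  Cmod (CInt (Phi mu f) (mo p s q r 0) (mo p s q r (INR W))) <=
  Hm * (3 * sqrt (dG_const * fold_sq)) + link_const k mu B.
Proof.
  intros Hf Hb HHm HH. destruct path_y as (Hy & Hmy & Hqy & Hqy'). destruct w_bounds as [Hw1 Hw2].
  pose proof (fold_path f A B Hf Hb) as HP. pose proof fold_sq_pos as HF.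
  pose proof (weight_const_ge k) as W1. pose proof (ratio_const_pos k) as W2. pose proof (pos_INR k).
  assert (Hpc : 1 <= psi_const) by (unfold psi_const; lra).
  set (I := CInt (Phi mu f) (mo p s q r 0) (mo p s q r (INR W))) in *. set (I2 := CInt _ 0 1) in HP.
  replace I with (I2 + (I - I2))%C by ring. via Cmod_triangle.
  apply Rplus_le_compat; [|exact HP].
  assert (Hpos : forall x : R, 0 < Im (pt x (/ INR n0))) by (intros x; simpl; rewrite <- Hyn; exact Hy).
  assert (HPhi : forall x, Cc (Phi n0 f) x).
  { intros x. apply Cc_mult.
    - apply (mf_Cc k f A (fun x => pt x (/ INR n0)) x Hf); [eapply Dc_Cc, Dc_hline|apply Hpos].
    - apply Cc_mult; [|apply Cc_const]. eapply Dc_Cc, (Dc_E n0 (fun x => pt x (/ INR n0))), Dc_hline. }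
  assert (Hex : forall a b, @ex_RInt C_R_NormedModule (Phi n0 f) a b) by (intros; apply ex_CInt; intros; apply HPhi).
  set (Hi := fun v => CInt (Phi n0 f) 0 v) in *.
  assert (HHi : forall v, Dc Hi v (Phi n0 f v)).
  { intros v. apply (@is_derive_RInt C_R_NormedModule (Phi n0 f) Hi 0 v); [|apply HPhi].
    apply filter_forall. intros x. apply CInt_correct, Hex. }
  assert (HGc : forall v, 0 <= v <= 1 -> Cc Gsum v) by (intros v Hv; eapply Dc_Cc, Gsum_deriv, Hv).
  assert (EI : I2 = (Hi 1%R * Gsum 1%R - CInt (fun v => Hi v * dGsum v)%C 0 1)%C).
  { pose proof (CInt_FTC (fun v => Hi v * Gsum v)%C (fun v => Phi n0 f v * Gsum v + Hi v * dGsum v)%C 0 1 ltac:(lra)) as HFT.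
    assert (HC1 : forall v, 0 <= v <= 1 -> Cc (fun v => Phi n0 f v * Gsum v)%C v) by (intros v Hv; apply Cc_mult; [apply HPhi|apply HGc, Hv]).
    assert (HC2 : forall v, 0 <= v <= 1 -> Cc (fun v => Hi v * dGsum v)%C v) by (intros v Hv; apply Cc_mult; [exact (Dc_Cc _ _ _ (HHi v))|apply dGsum_cont, Hv]).
    assert (HFT2 := is_CInt_unique _ _ _ _ (HFT ltac:(intros v Hv; apply Dc_mult; [apply HHi|apply Gsum_deriv, Hv])
      ltac:(intros v Hv; apply Cc_plus; [apply HC1, Hv|apply HC2, Hv]))).
    rewrite CInt_plus in HFT2 by (apply ex_CInt_le; [lra|assumption]).
    assert (E0 : Hi 0 = 0%C) by (unfold Hi; apply CInt_point).
    rewrite E0 in HFT2.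
    assert (EI2 : I2 = CInt (fun v => Phi n0 f v * Gsum v)%C 0 1).
    { unfold I2. apply CInt_ext; [lra|]. intros v _. unfold Phi, Gsum. rewrite <- Hyn. unfold E.
      replace (RtoC (- INR n0) * pt v y)%C with (- (RtoC (INR n0) * pt v y))%C by (rewrite RtoC_opp; ring).
      transitivity (f (pt v y) * (e (RtoC (INR n0) * pt v y) * e (- (RtoC (INR n0) * pt v y))) * gzsum k mu p s q r y W v)%C; [rewrite e_opp|]; ring. }
    rewrite EI2. transitivity ((CInt (fun v => Phi n0 f v * Gsum v)%C 0 1 + CInt (fun v => Hi v * dGsum v)%C 0 1) - CInt (fun v => Hi v * dGsum v)%C 0 1)%C; [ring|].
    rewrite HFT2. ring. }
  assert (EG : Gsum 1 = CInt (fun v => Gsum v + RtoC v * dGsum v)%C 0 1).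
  { symmetry. apply is_CInt_unique.
    pose proof (CInt_FTC (fun v => RtoC v * Gsum v)%C (fun v => 1 * Gsum v + RtoC v * dGsum v)%C 0 1 ltac:(lra)) as HFT.
    evar_last; [eapply is_RInt_ext; [|apply HFT]|].
    - intros v _. simpl. ring.
    - intros v Hv. apply Dc_mult; [apply Dc_id|apply Gsum_deriv, Hv].
    - intros v Hv. apply Cc_plus; [apply Cc_mult; [apply Cc_const|apply HGc, Hv]|].
      apply Cc_mult; [exact (Dc_Cc _ _ _ (Dc_id v))|apply dGsum_cont, Hv].
    - simpl. ring. }
  assert (HdG : 0 < dG_const) by (unfold dG_const; apply Rmult_lt_0_compat; [lra|apply pow_lt; nra]).
  destruct (hfun_scaled _ (Rlt_le _ _ HdG)) as [E1 E2].
  assert (HT0 : 0 < dG_const * fold_sq) by arith.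
  assert (L1 : RInt (fun u => Cmod (dGsum u)) 0 1 <= sqrt (dG_const * fold_sq)).
  { apply (abs_le_sqr_int _ (fun u => dG_const * hfun k mu p s q r W u)); try assumption.
    - intros; apply dGsum_cont; assumption.
    - apply dGsum_sq. }
  assert (L0 : RInt (fun u => Cmod (Gsum u)) 0 1 <= sqrt (dG_const * fold_sq)).
  { apply (abs_le_sqr_int _ (fun u => dG_const * hfun k mu p s q r W u)); try assumption.
    intros u Hu. apply Rle_trans with (2 * weight_const k ^ 2 * hfun k mu p s q r W u).
    - apply Rle_trans with (Cmod (gzsum k mu p s q r y W u) ^ 2).
      + apply pow_incr. split; [apply Cmod_ge_0|]. unfold Gsum. rewrite Cmod_mult.
        set (cs := gzsum _ _ _ _ _ _ _ _ _). apply Rle_trans with (1 * Cmod cs); [|lra]. apply Rmult_le_compat_r; [apply Cmod_ge_0|apply e_le1].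
      + apply (shifted_sum k mu p s q r S W); assumption.
    - apply Rmult_le_compat_r; [apply hfun_ge0, HW|]. unfold dG_const. apply Rmult_le_compat_l; [lra|]. apply pow_incr. nra. }
  set (sq := sqrt (dG_const * fold_sq)) in *.
  assert (exD : is_RInt (fun u => Cmod (dGsum u)) 0 1 (RInt (fun u => Cmod (dGsum u)) 0 1)).
  { apply (@RInt_correct R_CompleteNormedModule), ex_RInt_cont; [lra|]. intros u Hu. apply Cc_Cmod, dGsum_cont, Hu. }
  assert (exG : is_RInt (fun u => Cmod (Gsum u)) 0 1 (RInt (fun u => Cmod (Gsum u)) 0 1)).
  { apply (@RInt_correct R_CompleteNormedModule), ex_RInt_cont; [lra|]. intros u Hu. apply Cc_Cmod, HGc, Hu. }
  assert (B1 : Cmod (Gsum 1) <= 2 * sq).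
  { rewrite EG. eapply Rle_trans; [apply (CInt_le _ (fun u => plus (Cmod (Gsum u)) (Cmod (dGsum u))) 0 1); [lra| |exact (@is_RInt_plus R_NormedModule _ _ _ _ _ _ exG exD)|]|].
    - apply ex_CInt_le; [lra|]. intros v Hv. apply Cc_plus; [apply HGc, Hv|].
      apply Cc_mult; [exact (Dc_Cc _ _ _ (Dc_id v))|apply dGsum_cont, Hv].
    - intros v Hv. via Cmod_triangle. unfold plus; simpl. apply Rplus_le_compat_l.
      rewrite Cmod_mult, Cmod_R, Rabs_right by lra. apply Rle_trans with (1 * Cmod (dGsum v)); [|lra].
      apply Rmult_le_compat_r; [apply Cmod_ge_0|lra].
    - unfold plus; simpl. lra. }
  assert (B2 : Cmod (CInt (fun v => Hi v * dGsum v)%C 0 1) <= Hm * sq).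
  { eapply Rle_trans; [apply (CInt_le _ (fun u => scal Hm (Cmod (dGsum u))) 0 1); [lra| |exact (@is_RInt_scal R_NormedModule _ _ _ Hm _ exD)|]|].
    - apply ex_CInt_le; [lra|]. intros v Hv. apply Cc_mult; [exact (Dc_Cc _ _ _ (HHi v))|apply dGsum_cont, Hv].
    - intros v Hv. rewrite Cmod_mult. unfold scal; simpl; unfold mult; simpl. apply Rmult_le_compat_r; [apply Cmod_ge_0|apply HH, Hv].
    - unfold scal; simpl; unfold mult; simpl. apply Rmult_le_compat_l; assumption. }
  rewrite EI. unfold Cminus. via Cmod_triangle. rewrite Cmod_opp, Cmod_mult.
  assert (Cmod (Hi 1) * Cmod (Gsum 1) <= Hm * (2 * sq)) by (apply Rmult_le_compat; try apply Cmod_ge_0; [apply HH; lra|exact B1]).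
  lra.
Qed.

End Path.

(** * A lower bound for the number of primes *)

Module PrimeCount.
From mathcomp Require Import all_boot.
Local Open Scope nat_scope.

Definition odd_primes (m : nat) : seq nat := [seq p <- iota 3 (m - 2) | prime p].

(** By Legendre's formula the exponent of p is the sum of the carries [b k] in adding n to itself;
    each is at most 1, and none occurs once p^k exceeds 2n. *)
Lemma pow_logn_bin p n : prime p -> 0 < n -> p ^ logn p 'C(n.*2, n) <= n.*2.
Proof.
move=> pp n0.
have p1 := prime_gt1 pp.
have n20 : 0 < n.*2 by rewrite double_gt0.
have le2 : n <= n.*2 by rewrite -addnn leq_addl.
pose b k := nat_of_bool (p ^ k <= n %% p ^ k + n %% p ^ k).
have Eb k : n.*2 %/ p ^ k = (n %/ p ^ k).*2 + b k.
  by rewrite -addnn divnD ?expn_gt0 ?prime_gt0 // addnn.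
have E : logn p 'C(n.*2, n) = \sum_(1 <= k < n.*2.+1) b k.
  have H := bin_fact le2.
  rewrite -[X in (X - n)]addnn addnK in H.
  have H2 : logn p 'C(n.*2, n) + (logn p n`!).*2 = logn p (n.*2)`!.
    by rewrite -H !lognM ?muln_gt0 ?fact_gt0 ?bin_gt0 ?le2 // addnn.
  rewrite !logn_fact // in H2.
  have H3 : \sum_(1 <= k < n.+1) n %/ p ^ k = \sum_(1 <= k < n.*2.+1) n %/ p ^ k.
    rewrite [RHS](@big_cat_nat _ _ _ n.+1) //=.
    rewrite [X in _ = _ + X]big_nat_cond [X in _ = _ + X]big1 ?addn0 // => k /andP[/andP[h1 h2] _].
    apply: divn_small. apply: leq_trans (ltn_expl k p1). exact: ltnW.
  have H4 : \sum_(1 <= k < n.*2.+1) n.*2 %/ p ^ k =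
     \sum_(1 <= k < n.*2.+1) b k + (\sum_(1 <= k < n.*2.+1) n %/ p ^ k).*2.
    have -> : (\sum_(1 <= k < n.*2.+1) n %/ p ^ k).*2 = \sum_(1 <= k < n.*2.+1) (n %/ p ^ k).*2.
      by rewrite -mul2n big_distrr /=; apply: eq_bigr => i _; rewrite mul2n.
    rewrite -big_split /=. apply: eq_bigr => k _. by rewrite Eb addnC.
  rewrite H3 H4 in H2. by move/eqP: H2; rewrite eqn_add2r => /eqP.
set t := trunc_log p n.*2.
have tb : p ^ t <= n.*2 by apply: trunc_logP.
apply: leq_trans tb. rewrite leq_exp2l // E.
have tl : t <= n.*2.
  apply: leq_trans (_ : p ^ t <= _); first exact: ltnW (ltn_expl t p1).
  exact: trunc_logP.
rewrite (@big_cat_nat _ _ _ t.+1) //= [X in _ + X]big_nat_cond [X in _ + X]big1 ?addn0.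
  apply: leq_trans (_ : \sum_(1 <= k < t.+1) 1 <= _); last by rewrite sum_nat_const_nat muln1 subn1.
  by apply: leq_sum => k _; rewrite leq_b1.
move=> k /andP[/andP[h1 h2] _].
have : n.*2 %/ p ^ k = 0.
  apply: divn_small. apply: leq_trans (trunc_log_ltn _ p1) _. by rewrite leq_exp2l.
by rewrite Eb => /eqP; rewrite addn_eq0 => /andP[_ /eqP].
Qed.

(** Each prime power in the binomial coefficient is at most 2n. The additional factor is for the
    prime 2, which [odd_primes] leaves out. *)
Lemma bin_le_pow n : 0 < n -> 'C(n.*2, n) <= n.*2 ^ (size (odd_primes n.*2)).+1.
Proof.
move=> n0.
have c0 : 0 < 'C(n.*2, n) by rewrite bin_gt0 -addnn leq_addl.
have n20 : 0 < n.*2 by rewrite double_gt0.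
rewrite {1}(prod_prime_decomp c0) prime_decompE big_map /=.
apply: leq_trans (_ : \prod_(p <- primes 'C(n.*2, n)) n.*2 <= _).
  rewrite big_seq [X in _ <= X]big_seq. apply: leq_prod => p.
  rewrite mem_primes => /andP[pp _]. exact: pow_logn_bin.
rewrite big_const_seq count_predT iter_muln_1 leq_pexp2l //.
apply: leq_trans (_ : size (2 :: odd_primes n.*2) <= _) => //.
apply: uniq_leq_size; first exact: primes_uniq.
move=> p. rewrite mem_primes => /and3P[pp _ pd].
rewrite inE mem_filter pp /= mem_iota.
have p2 := prime_gt1 pp.
have ple : p <= n.*2.
  apply: (leq_trans _ (pow_logn_bin _ _ pp n0)). rewrite -{1}(expn1 p) leq_exp2l //.
  by rewrite -pfactor_dvdn ?expn1.
have n22 : 2 <= n.*2 by rewrite -[2]/(1.*2) leq_double.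
rewrite addnBA // addnC -addnBA // addn1 ltnS ple andbT.
by rewrite eq_sym -leq_eqVlt.
Qed.

Lemma central_bin_ge n : 2 ^ n <= 'C(n.*2, n).
Proof.
elim: n => [|n IH] //.
rewrite doubleS binS expnS mul2n -addnn. apply: leq_add.
  by apply: leq_trans IH _; rewrite binS leq_addl.
apply: leq_trans IH _. case: n => [|m] //. by rewrite [X in _ <= X]binS leq_addr.
Qed.

Lemma In_mem (x : nat) s : In x s -> x \in s.
Proof.
elim: s => [|y s IH] //= [->|/IH H]; rewrite inE ?eqxx // H orbT //.
Qed.

Lemma uniq_NoDup (s : seq nat) : uniq s -> NoDup s.
Proof.
elim: s => [|y s IH] /=; first by constructor.
move=> /andP[h1 /IH h2]. constructor => // /In_mem h3. by rewrite h3 in h1.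
Qed.

Lemma prime_Z p : prime p -> Znumtheory.prime (Z.of_nat p).
Proof.
move=> pp. apply/prime_alt. have p1 := prime_gt1 pp. split; first by move/ltP: p1; lia.
move=> n [n1 n2] [w Hw].
have Hd : Z.to_nat n %| p.
  apply/dvdnP. exists (Z.to_nat w). rewrite -[muln _ _]/(Nat.mul _ _).
  have w0 : (0 <= w)%Z by nia. 
  apply: Nat2Z.inj. by rewrite Nat2Z.inj_mul !Z2Nat.id //; lia.
have /primeP[_ H] := pp. have := H _ Hd. case/orP => /eqP; lia.
Qed.

Lemma expn_pow m n : m ^ n = Nat.pow m n.
Proof. elim: n => [|n IH] //. by rewrite expnS IH. Qed.

Lemma primes_up_to (n : nat) : Nat.le 1 n -> exists l : list nat, NoDup l /\
  (forall p, In p l -> Znumtheory.prime (Z.of_nat p) /\ Nat.le 3 p /\ Nat.le p (Nat.mul 2 n)) /\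
  Nat.le (Nat.pow 2 n) (Nat.pow (Nat.mul 2 n) (S (length l))).
Proof.
move=> n1. have n0 : 0 < n by apply/leP.
exists (odd_primes n.*2). split; last split.
- by apply: uniq_NoDup; rewrite filter_uniq // iota_uniq.
- move=> p /In_mem. rewrite mem_filter mem_iota => /andP[pp /andP[h1 h2]].
  split; first exact: prime_Z. move/leP: h1 => h1. split; first exact: h1.
  move/leP: h2. rewrite -mul2n -[addn _ _]/(Nat.add _ _) -[subn _ _]/(Nat.sub _ _) -[muln _ _]/(Nat.mul _ _). lia.
- rewrite -!expn_pow. apply/leP. rewrite -[Nat.mul _ _]/(muln 2 n) mul2n.
  exact: leq_trans (central_bin_ge n) (bin_le_pow n n0).
Qed.

End PrimeCount.

Lemma ln_le_Rpower x d : 0 < x -> 0 < d -> ln x <= Rpower x d / d.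
Proof.
  intros Hx Hd. pose proof (exp_ineq1_le (d * ln x)) as H. fold (Rpower x d) in H.
  apply Rmult_le_reg_l with d; [exact Hd|]. replace (d * (Rpower x d / d)) with (Rpower x d) by (field; lra). lra.
Qed.

Lemma two_pow_gt n : (3 <= n)%nat -> (2 * n < 2 ^ n)%nat.
Proof.
  intros H. induction H; [simpl; lia|]. cbn [Nat.pow]. lia.
Qed.

(** 2^n <= (2n)^(U+1) makes U at least of order n/log n, and the logarithm is absorbed into P0^d.
    All primes from 3 to 2P are taken, since only an upper bound on c is wanted. *)
Lemma many_primes (d : R) : 0 < d -> exists K, 0 < K /\ forall P0, 3 <= P0 ->
  exists (P : nat) (Pr : list Z), (1 <= P)%nat /\ INR P <= P0 /\ NoDup Pr /\
    (forall c, In c Pr -> prime c /\ (3 <= c)%Z) /\ (forall c, In c Pr -> IZR c <= 2 * INR P) /\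
    (1 <= length Pr)%nat /\ Rpower P0 (1 - d) <= K * INR (length Pr).
Proof.
  intros Hd. assert (Hln2 : 0 < ln 2) by (rewrite <- ln_1; apply ln_increasing; lra).
  exists (Rpower 2 d * 4 / (d * ln 2)). split.
  { apply Rdiv_lt_0_compat; [|apply Rmult_lt_0_compat; lra]. apply Rmult_lt_0_compat; [apply exp_pos|lra]. }
  intros P0 HP0. set (n := Z.to_nat (Zfloor P0)). destruct (Zfloor_bound P0) as [F1 F2].
  assert (Fz : (3 <= Zfloor P0)%Z) by (apply Zfloor_lub; lra).
  assert (En : INR n = IZR (Zfloor P0)) by (unfold n; rewrite INR_IZR_INZ, Z2Nat.id by lia; reflexivity).
  assert (Hn3 : (3 <= n)%nat) by (unfold n; lia).
  assert (Hn3r : 3 <= INR n) by (rewrite En; apply IZR_le; exact Fz).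
  destruct (PrimeCount.primes_up_to n ltac:(lia)) as (l & Hl1 & Hl2 & Hl3).
  exists n, (map Z.of_nat l). rewrite length_map.
  assert (HU : (1 <= length l)%nat).
  { destruct (length l) as [|u] eqn:E0; [|lia]. exfalso. pose proof (two_pow_gt n Hn3).
    rewrite Nat.pow_1_r in Hl3. change (Nat.mul 2 n) with (2 * n)%nat in *. change (le (Nat.pow 2 n) (Nat.mul 2 n)) in Hl3. lia. }
  split; [lia|]. split; [lra|]. split; [apply Injective_map_NoDup; [intros i j; lia|exact Hl1]|].
  split; [|split; [|split; [exact HU|]]].
  - intros c Hc. apply in_map_iff in Hc. destruct Hc as (p & <- & Hp). destruct (Hl2 p Hp) as (H1 & H2 & _).
    split; [exact H1|lia].
  - intros c Hc. apply in_map_iff in Hc. destruct Hc as (p & <- & Hp). destruct (Hl2 p Hp) as (_ & _ & H3).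
    apply le_INR in H3. rewrite mult_INR in H3. rewrite <- INR_IZR_INZ. simpl in H3. lra.
  - set (U := INR (length l)). assert (HU1 : 1 <= U) by (apply (le_INR 1); exact HU).
    set (N := 2 * INR n).
    assert (H1 : INR n * ln 2 <= (U + 1) * ln N).
    { apply le_INR in Hl3. rewrite !pow_INR, mult_INR in Hl3. replace (INR 2) with 2 in Hl3 by (simpl; ring).
      fold N in Hl3. apply ln_le in Hl3; [|apply pow_lt; lra].
      rewrite !ln_pow in Hl3 by (unfold N; lra). rewrite S_INR in Hl3. exact Hl3. }
    pose proof (ln_le_Rpower N d ltac:(unfold N; lra) Hd) as H2.
    assert (HN : 0 < Rpower N d) by apply exp_pos.
    assert (H3 : N * ln 2 * d <= 4 * U * Rpower N d).
    { assert (ln N * d <= Rpower N d) by (apply Rmult_le_reg_r with (/ d); [apply Rinv_0_lt_compat, Hd|];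
        rewrite Rmult_assoc, Rinv_r, Rmult_1_r by lra; exact H2).
      assert (0 <= ln N) by (rewrite <- ln_1; apply ln_le; unfold N; lra).
      assert ((U + 1) * ln N <= 2 * U * ln N) by (apply Rmult_le_compat_r; lra).
      assert (HN2 : N * ln 2 = 2 * (INR n * ln 2)) by (unfold N; ring).
      apply Rle_trans with (4 * U * ln N * d); [apply Rmult_le_compat_r; [lra|rewrite HN2; lra]|].
      rewrite (Rmult_assoc (4 * U)). apply Rmult_le_compat_l; lra. }
    assert (H4 : Rpower P0 (1 - d) <= N * (Rpower 2 d * / Rpower N d)).
    { unfold Rminus. rewrite Rpower_plus, Rpower_1 by lra. apply Rmult_le_compat; [lra|left; apply exp_pos|unfold N; lra|].
      rewrite Rpower_Ropp. unfold N. rewrite <- Rpower_mult_distr by lra.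
      replace (Rpower 2 d * / (Rpower 2 d * Rpower (INR n) d)) with (/ Rpower (INR n) d).
      - apply Rinv_le_contravar; [apply exp_pos|]. apply Rle_Rpower_l; lra.
      - field. split; apply Rgt_not_eq, exp_pos. }
    eapply Rle_trans; [exact H4|].
    apply Rmult_le_reg_r with (Rpower N d * (d * ln 2) / Rpower 2 d).
    { apply Rdiv_lt_0_compat; [|apply exp_pos]. apply Rmult_lt_0_compat; [exact HN|apply Rmult_lt_0_compat; lra]. }
    replace (N * (Rpower 2 d * / Rpower N d) * (Rpower N d * (d * ln 2) / Rpower 2 d)) with (N * ln 2 * d)
      by (field; split; apply Rgt_not_eq; [apply exp_pos|exact HN]).
    replace (Rpower 2 d * 4 / (d * ln 2) * U * (Rpower N d * (d * ln 2) / Rpower 2 d)) with (4 * U * Rpower N d)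
      by (field; repeat split; apply Rgt_not_eq; [apply exp_pos|lra|lra]).
    exact H3.
Qed.

(** * Size parameters and estimates uniform in the matrix *)

Lemma Rpower_pos x a : 0 < Rpower x a.
Proof. apply exp_pos. Qed.

Lemma Rpower_ge1 x a : 1 <= x -> 0 <= a -> 1 <= Rpower x a.
Proof. intros Hx Ha. rewrite <- (Rpower_O x) by lra. apply Rle_Rpower; lra. Qed.

Lemma Rpower_pow_n x a n : Rpower x a ^ n = Rpower x (INR n * a).
Proof. rewrite <- Rpower_pow by apply Rpower_pos. rewrite Rpower_mult. f_equal. ring. Qed.

Lemma Rpower_root x n : 0 < x -> (0 < n)%nat -> Rpower x (/ INR n) ^ n = x.
Proof.
  intros Hx Hn. rewrite Rpower_pow_n, Rinv_r by (apply not_0_INR; lia). apply Rpower_1, Hx.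
Qed.

Lemma Rpower_base_le C mu a : 1 <= C -> 1 <= mu -> 0 <= a -> forall x, 0 < x -> x <= C * mu ->
  Rpower x a <= Rpower C a * Rpower mu a.
Proof.
  intros HC Hmu Ha x Hx H. rewrite Rpower_mult_distr by lra. apply Rle_Rpower_l; lra.
Qed.

Lemma harm_le_Rpower d n x : 0 < d -> INR n + 1 <= x -> harm n <= (1 + / d) * Rpower x d.
Proof.
  intros Hd Hn. pose proof (pos_INR n) as Hn0.
  via harm_ln.
  pose proof (ln_le_Rpower (INR n + 1) d ltac:(lra) Hd) as H.
  assert (H1 : Rpower (INR n + 1) d <= Rpower x d) by (apply Rle_Rpower_l; lra).
  pose proof (Rpower_ge1 (INR n + 1) d ltac:(lra) ltac:(lra)) as H2.
  assert (Rpower (INR n + 1) d / d <= Rpower x d / d).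
  { apply Rmult_le_compat_r; [left; apply Rinv_0_lt_compat, Hd|exact H1]. }
  unfold Rdiv in *. lra.
Qed.

(** Up to a constant the trivial bound for the integral of [Phi] over the image of one unit
    interval: mu^(k/2) times the length S^(-2). *)
Definition Nrm (k mu : nat) (S : R) : R := Rpower (INR mu) (INR k / 2) / S ^ 2.

Lemma height_power k mu S : 0 < S -> (1 <= mu)%nat ->
  Rpower (S ^ 2 / INR mu) (- (INR k / 2)) = Rpower (INR mu) (INR k / 2) / S ^ k.
Proof.
  intros HS Hmu. assert (Hm : 0 < INR mu) by arith.
  rewrite <- (Rpower_pow k S HS). unfold Rpower, Rdiv. rewrite <- exp_Ropp, <- exp_plus. f_equal.
  rewrite ln_mult by (try apply pow_lt; try apply Rinv_0_lt_compat; lra). rewrite ln_pow, ln_Rinv by lra. simpl. field.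
Qed.

Lemma link_const_Nrm k mu B S : 0 < S -> (1 <= mu)%nat ->
  link_const k mu B = 4 * B * Rpower 37 (INR k / 2) * exp (2 * PI) * (Nrm k mu S / (INR mu / S ^ 2)).
Proof.
  intros HS Hmu. assert (Hm : 0 < INR mu) by arith. unfold link_const, Nrm. field.
  split; lra.
Qed.

Definition Gconst (k : nat) : R := 7 ^ k * exp (2 * PI).

Lemma Gb_height k mu S : 0 < S -> (1 <= mu)%nat ->
  Rpower (S ^ 2 / INR mu) (- (INR k / 2)) * Gb k S = Gconst k * Nrm k mu S.
Proof.
  intros HS Hmu. rewrite height_power by assumption. unfold Gb, Gconst, Nrm. rewrite Rpow_mult_distr. field.
  split; [lra|apply pow_nonzero; lra].
Qed.

Lemma sqrt_le_sq a b : 0 <= b -> a <= b ^ 2 -> sqrt a <= b.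
Proof. intros Hb H. rewrite <- (sqrt_pow2 b Hb). apply sqrt_le_1_alt, H. Qed.

(* With [X = mu / S^2 = t^6] and [om = v^6], primes up to about [t^2 / v^4] are used. *)
Lemma second_uniform k f A B (eps Kd : R) : modform k f A -> bounded_by k f B -> 0 < eps -> 0 <= Kd ->
  exists K, 0 < K /\ forall (mu : nat) (p s q r : Z) (S : R) (W : nat) (x1 x2 om t v : R),
  (1 <= mu)%nat -> / 12 <= S -> (p * r - s * q = 1)%Z -> Rabs (IZR q) <= 12 * S -> (1 <= W)%nat ->
  0 <= x1 -> x1 <= x2 -> x2 <= 1 ->
  (forall u tt, x1 <= u <= x2 -> (0 <= tt < Z.of_nat W)%Z -> 3 * S <= IZR q * (u + IZR tt) + IZR r <= 6 * S) ->
  INR W <= om -> INR W <= INR mu -> 1 <= v -> om = v ^ 6 -> 0 < t -> INR mu / S ^ 2 = t ^ 6 -> 3 * v ^ 4 <= t ^ 2 -> 5 <= t ^ 2 ->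
  (forall (Pr : list Z) (P : nat), NoDup Pr -> (forall c, In c Pr -> prime c /\ (3 <= c)%Z) ->
    (forall c, In c Pr -> IZR c <= 2 * INR P) -> 12 * (INR P + 3) * S ^ 2 <= INR mu ->
    rsum (jlist Pr x1 x2) (fun j => Re (ip (vlo x1 x2 j) (vhi x1 x2 j) (vlo x1 x2 j) (vhi x1 x2 j)
      (Wsum k mu p s q r (S ^ 2 / INR mu) W j) (Wsum k mu p s q r (S ^ 2 / INR mu) W j))) <=
    INR (length Pr) * (Gb k S ^ 2 * (Kd * Rpower (INR mu) eps * om))) ->
  Cmod (csum (zrange 0 W) (fun tt => CInt (Phi mu f) (mo p s q r (x1 + IZR tt)) (mo p s q r (x2 + IZR tt)))) <=
  K * (Nrm k mu S * (v ^ 5 / t) * Rpower (INR mu) eps).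
Proof.
  intros Hf Hb He HKd. destruct (many_primes eps He) as (Kp & HKp & HPrimes).
  assert (Hk : (1 <= k)%nat) by (pose proof (mf_weight _ _ _ Hf); lia).
  pose proof Hb as Hb0. destruct Hb0 as [HB _].
  set (Ch := (1 + / (eps / 2)) * Rpower 1000 (eps / 2)).
  assert (HCh : 0 < Ch).
  { apply Rmult_lt_0_compat; [|apply Rpower_pos]. assert (0 < / (eps / 2)) by arith. lra. }
  set (Cq := Kd + Wbd k * (30000 * (1 + Ch))).
  assert (HCq : 0 < Cq).
  { unfold Cq. pose proof (Wbd_pos k). assert (0 < Wbd k * (30000 * (1 + Ch))) by arith. lra. }
  set (Cu := Kp * Rpower 144 eps).
  assert (HCu : 0 < Cu) by (apply Rmult_lt_0_compat; [exact HKp|apply Rpower_pos]).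
  set (C1 := B * Gconst k * sqrt (2 * (Cq * Cu))).
  set (C2 := 4 * B * Rpower 37 (INR k / 2) * exp (2 * PI)).
  assert (HGc : 0 < Gconst k) by (apply Rmult_lt_0_compat; [apply pow_lt; lra|apply exp_pos]).
  assert (HC1 : 0 < C1).
  { unfold C1. apply Rmult_lt_0_compat; [apply Rmult_lt_0_compat; assumption|]. apply sqrt_lt_R0.
    apply Rmult_lt_0_compat; [lra|]. apply Rmult_lt_0_compat; assumption. }
  assert (HC2 : 0 < C2).
  { unfold C2. apply Rmult_lt_0_compat; [|apply exp_pos]. apply Rmult_lt_0_compat; [lra|apply Rpower_pos]. }
  exists (C1 + 2 * C2). split; [lra|].
  intros mu p s q r S W x1 x2 om t v Hmu HS12 H0 Hq HW Hx0 Hx12 Hx2 Hfr HWom HWmu Hv1 Hom Ht HX Htv Ht5 HD.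
  assert (HS : 0 < S) by lra. assert (Hm1 : 1 <= INR mu) by (apply (le_INR 1); exact Hmu).
  assert (HS2 : 0 < S ^ 2) by arith.
  assert (HW1 : 1 <= INR W) by (apply (le_INR 1); exact HW).
  assert (Hmu6 : INR mu = t ^ 6 * S ^ 2) by (rewrite <- HX; field; lra).
  assert (Hv4 : 1 <= v ^ 4) by arith.
  assert (Hv6 : 0 < v ^ 6) by arith.
  assert (Ht2 : 0 < t ^ 2) by arith.
  assert (Ht1 : 1 <= t) by nra.
  assert (HX144 : t ^ 6 <= 144 * INR mu).
  { rewrite Hmu6. assert (/ 144 <= S ^ 2) by arith.
    nra. }
  (* The largest size compatible with W^2 P^3 y <= 1, since y = t^(-6) and W <= om = v^6. *)
  set (P0 := t ^ 2 / v ^ 4).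
  assert (HP03 : 3 <= P0).
  { unfold P0. apply Rmult_le_reg_r with (v ^ 4); [lra|]. unfold Rdiv. rewrite Rmult_assoc, Rinv_l by lra. lra. }
  assert (HP0t : P0 <= t ^ 2).
  { unfold P0. apply Rmult_le_reg_r with (v ^ 4); [lra|]. unfold Rdiv. rewrite Rmult_assoc, Rinv_l by lra. nra. }
  assert (Ht26 : t ^ 2 <= t ^ 6) by (apply Rle_pow; [lra|lia]).
  destruct (HPrimes P0 HP03) as (P & Pr & HP1 & HPP & HPd & HPr & HP2 & HU & HUK).
  assert (HP1r : 1 <= INR P) by (apply (le_INR 1); exact HP1).
  set (U := INR (length Pr)) in *. assert (HU1 : 1 <= U) by (apply (le_INR 1); exact HU).
  assert (Hsm : 12 * (INR P + 3) * S ^ 2 <= INR mu).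
  { rewrite Hmu6. apply Rmult_le_compat_r; [lra|]. apply Rle_trans with (12 * (t ^ 2 + 3)); [nra|].
    replace (t ^ 6) with ((t ^ 2) ^ 3) by ring. set (z := t ^ 2) in *. nra. }
  assert (Hy : S ^ 2 / INR mu = / t ^ 6) by (rewrite Hmu6; field; split; lra).
  assert (Hcond : INR W ^ 2 * INR P ^ 3 * (S ^ 2 / INR mu) <= 1).
  { rewrite Hy. assert (Ht6 : 0 < t ^ 6) by arith. apply Rmult_le_reg_r with (t ^ 6); [exact Ht6|].
    rewrite Rmult_assoc, Rinv_l by lra. rewrite Rmult_1_r, Rmult_1_l.
    apply Rle_trans with (om ^ 2 * P0 ^ 3).
    - apply Rmult_le_compat; try (apply pow_le; lra); apply pow_incr; lra.
    - right. unfold P0. rewrite Hom. field. lra. }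
  specialize (HD Pr P HPd HPr HP2 Hsm). set (m := Rpower (INR mu) eps) in *.
  assert (Hm : 1 <= m) by (apply Rpower_ge1; lra).
  set (D0 := U * (Gb k S ^ 2 * (Kd * m * om))) in *.
  pose proof (pow_lt _ 2 (Gb_pos k S HS)) as HG.
  assert (Hom1 : 1 <= om) by lra.
  assert (HD0 : 0 <= D0).
  { unfold D0. apply Rmult_le_pos; [lra|]. apply Rmult_le_pos; [lra|]. apply Rmult_le_pos; [apply Rmult_le_pos|]; lra. }
  pose proof (second_level k mu p s q r S Pr P W x1 x2 Hk Hmu HS H0 Hq HPd HPr HP2 HP1 HW Hx0 Hx12 Hx2 Hfr Hsm Hcond f A B D0 Hf Hb HU HD0 HD) as HSL.
  fold U in HSL. eapply Rle_trans; [exact HSL|].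
  assert (Hh : harm (2 * P * W) <= Ch * m).
  { unfold Ch. eapply Rle_trans; [apply (harm_le_Rpower (eps / 2) _ (1000 * (INR mu * INR mu))); [lra|]|].
    - rewrite !mult_INR. replace (INR 2) with 2 by (simpl; ring).
      assert (INR P <= 144 * INR mu) by lra. assert (INR P * INR W <= 144 * INR mu * INR mu) by (apply Rmult_le_compat; lra). nra.
    - rewrite <- Rpower_mult_distr by nra. rewrite <- Rpower_mult_distr by lra. rewrite <- Rpower_plus.
      replace (eps / 2 + eps / 2) with eps by field. fold m. right. ring. }
  assert (HQ : D0 + U * (Gb k S ^ 2 * (INR W * off_const k P W)) <= U * (Gb k S ^ 2 * (Cq * m * om))).
  { unfold D0. rewrite <- Rmult_plus_distr_l, <- Rmult_plus_distr_l. apply Rmult_le_compat_l; [lra|]. apply Rmult_le_compat_l; [lra|].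
    unfold off_const, Cq. pose proof (Wbd_pos k) as HWb.
    assert (INR W * (Wbd k * (30000 * (1 + harm (2 * P * W)))) <= om * (Wbd k * (30000 * (1 + Ch) * m))).
    { apply Rmult_le_compat; try lra.
      - apply Rmult_le_pos; [lra|]. pose proof (harm_ge0 (2 * P * W)). lra.
      - apply Rmult_le_compat_l; [lra|]. lra. }
    lra. }
  assert (HUinv : / U <= Cu * m * (v ^ 4 / t ^ 2)).
  { assert (H1 : P0 <= Kp * U * Rpower P0 eps).
    { unfold Rminus in HUK. rewrite Rpower_plus, Rpower_1, Rpower_Ropp in HUK by lra.
      apply Rmult_le_reg_r with (/ Rpower P0 eps); [apply Rinv_0_lt_compat, Rpower_pos|].
      rewrite (Rmult_assoc (Kp * U)), Rinv_r by (apply Rgt_not_eq, Rpower_pos). lra. }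
    assert (H2 : Rpower P0 eps <= Rpower 144 eps * m) by (apply Rpower_base_le; lra).
    assert (H3 : P0 <= Cu * m * U).
    { eapply Rle_trans; [exact H1|]. unfold Cu. replace (Kp * Rpower 144 eps * m * U) with (Kp * U * (Rpower 144 eps * m)) by ring.
      apply Rmult_le_compat_l; [nra|exact H2]. }
    replace (v ^ 4 / t ^ 2) with (/ P0) by (unfold P0; field; split; lra).
    apply Rmult_le_reg_r with (U * P0); [apply Rmult_lt_0_compat; lra|].
    replace (/ U * (U * P0)) with P0 by (field; lra). replace (Cu * m * / P0 * (U * P0)) with (Cu * m * U) by (field; lra). exact H3. }
  assert (HN : 0 < Nrm k mu S) by (apply Rdiv_lt_0_compat; [apply Rpower_pos|exact HS2]).
  assert (Hv5 : 0 < v ^ 5 / t) by arith.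
  rewrite (Rmult_plus_distr_r C1). apply Rplus_le_compat.
  - set (T := D0 + U * (Gb k S ^ 2 * (INR W * off_const k P W))) in *.
    assert (HsT : sqrt (T * 2) / U <= Gb k S * (sqrt (2 * (Cq * Cu)) * (v ^ 5 / t) * m)).
    { apply Rmult_le_reg_r with U; [lra|]. unfold Rdiv at 1. rewrite Rmult_assoc, Rinv_l, Rmult_1_r by lra.
      pose proof (Gb_pos k S HS) as HGp.
      assert (Hsq0 : 0 <= sqrt (2 * (Cq * Cu))) by arith.
      apply sqrt_le_sq.
      { apply Rmult_le_pos; [|lra]. apply Rmult_le_pos; [lra|]. apply Rmult_le_pos; [apply Rmult_le_pos; lra|lra]. }
      replace ((Gb k S * (sqrt (2 * (Cq * Cu)) * (v ^ 5 / t) * m) * U) ^ 2) with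
        (Gb k S ^ 2 * (sqrt (2 * (Cq * Cu)) ^ 2 * (v ^ 5 / t) ^ 2 * m ^ 2) * U ^ 2) by ring.
      rewrite pow2_sqrt by (apply Rmult_le_pos; [lra|apply Rmult_le_pos; lra]).
      apply Rle_trans with (U * (Gb k S ^ 2 * (Cq * m * om)) * 2); [lra|].
      assert (H1 : 1 <= Cu * m * (v ^ 4 / t ^ 2) * U).
      { apply Rmult_le_reg_r with (/ U); [apply Rinv_0_lt_compat; lra|]. rewrite Rmult_assoc, Rinv_r by lra. lra. }
      replace (Gb k S ^ 2 * (2 * (Cq * Cu) * (v ^ 5 / t) ^ 2 * m ^ 2) * U ^ 2) with
        (U * (Gb k S ^ 2 * (Cq * m * om)) * 2 * (Cu * m * (v ^ 4 / t ^ 2) * U)) by (rewrite Hom; field; lra).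
      rewrite <- (Rmult_1_r (U * (Gb k S ^ 2 * (Cq * m * om)) * 2)) at 1. apply Rmult_le_compat_l; [|exact H1].
      apply Rmult_le_pos; [|lra]. apply Rmult_le_pos; [lra|]. apply Rmult_le_pos; [lra|]. apply Rmult_le_pos; [nra|lra]. }
    replace (B * Rpower (S ^ 2 / INR mu) (- (INR k / 2)) * sqrt (T * 2) / U) with (B * Rpower (S ^ 2 / INR mu) (- (INR k / 2)) * (sqrt (T * 2) / U)) by (unfold Rdiv; ring).
    assert (HH : 0 < Rpower (S ^ 2 / INR mu) (- (INR k / 2))) by arith.
    apply Rle_trans with (B * Rpower (S ^ 2 / INR mu) (- (INR k / 2)) * (Gb k S * (sqrt (2 * (Cq * Cu)) * (v ^ 5 / t) * m))).
    + apply Rmult_le_compat_l; [nra|exact HsT].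
    + right. unfold C1.
      transitivity (B * (Rpower (S ^ 2 / INR mu) (- (INR k / 2)) * Gb k S) * (sqrt (2 * (Cq * Cu)) * (v ^ 5 / t) * m)); [ring|].
      rewrite Gb_height by assumption. ring.
  - rewrite (link_const_Nrm k mu B S HS Hmu). fold C2. rewrite HX.
    assert (Ht6 : 0 < t ^ 6) by arith.
    assert (HPW : INR P * INR W / t ^ 6 <= v ^ 5 / t).
    { apply Rle_trans with (P0 * om / t ^ 6).
      - apply Rmult_le_compat_r; [left; apply Rinv_0_lt_compat, Ht6|]. apply Rmult_le_compat; lra.
      - unfold P0. rewrite Hom. replace (t ^ 2 / v ^ 4 * v ^ 6 / t ^ 6) with (v ^ 2 / t * / t ^ 3) by (field; split; lra).
        replace (v ^ 5 / t) with (v ^ 2 / t * v ^ 3) by (field; lra).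
        apply Rmult_le_compat_l; [apply Rdiv_le_0_compat; [apply pow_le; lra|lra]|].
        apply Rle_trans with 1; [|apply pow_R1_Rle; lra].
        rewrite <- Rinv_1. apply Rinv_le_contravar; [lra|]. apply pow_R1_Rle; lra. }
    replace (2 * INR P * INR W * (C2 * (Nrm k mu S / t ^ 6))) with (2 * C2 * Nrm k mu S * (INR P * INR W / t ^ 6)) by (field; lra).
    apply Rle_trans with (2 * C2 * Nrm k mu S * (v ^ 5 / t)).
    + apply Rmult_le_compat_l; [|exact HPW]. apply Rmult_le_pos; lra.
    + assert (0 <= 2 * C2 * Nrm k mu S * (v ^ 5 / t)) by arith.
      replace (2 * C2 * (Nrm k mu S * (v ^ 5 / t) * m)) with (2 * C2 * Nrm k mu S * (v ^ 5 / t) * m) by ring. nra.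
Qed.

(** For W = 1 no cancellation is required: each prime has fewer than c arcs, of length at most 2/c
    in v. *)
Lemma diag_trivial k mu p s q r S (Pr : list Z) (P : nat) x1 x2 :
  (1 <= k)%nat -> (1 <= mu)%nat -> 0 < S -> (p * r - s * q = 1)%Z -> Rabs (IZR q) <= 12 * S ->
  0 <= x1 -> x1 <= x2 -> x2 <= 1 -> (forall u, x1 <= u <= x2 -> 3 * S <= IZR q * u + IZR r <= 6 * S) ->
  (forall c, In c Pr -> prime c /\ (3 <= c)%Z) ->
  (forall c, In c Pr -> IZR c <= 2 * INR P) -> 12 * (INR P + 3) * S ^ 2 <= INR mu ->
  rsum (jlist Pr x1 x2) (fun j => Re (ip (vlo x1 x2 j) (vhi x1 x2 j) (vlo x1 x2 j) (vhi x1 x2 j)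
      (Wsum k mu p s q r (S ^ 2 / INR mu) 1 j) (Wsum k mu p s q r (S ^ 2 / INR mu) 1 j))) <=
  INR (length Pr) * (Gb k S ^ 2 * 2).
Proof.
  intros Hk Hmu HS H0 Hq Hx0 Hx12 Hx2 Hfr HPr HP2 Hsm.
  pose proof (pow_lt _ 2 (Gb_pos k S HS)) as HG.
  apply Rle_trans with (rsum (jlist Pr x1 x2) (fun j => Gb k S ^ 2 * (2 / IZR (fst j)))).
  - apply rsum_le. intros j Hj.
    destruct (In_jlist Pr x1 x2 j HPr Hx0 Hx12 Hx2 Hj) as (A1 & A2 & _ & A4 & _ & U1 & _ & U2 & V1 & V2 & _ & _ & A5).
    set (a := snd j) in *. set (b := bj j) in *. set (c := fst j) in *. set (d := dj j) in *.
    set (lo := vlo x1 x2 j) in *. set (hi := vhi x1 x2 j) in *.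
    via Rle_abs. via Re_le_Cmod.
    unfold ip. rewrite Rmax_left, Rmin_left by lra. destruct (Rle_dec lo hi) as [_|]; [|lra].
    assert (EW : forall v, Wsum k mu p s q r (S ^ 2 / INR mu) 1 j v = Wj k mu p s q r a b c d (S ^ 2 / INR mu) v).
    { intros v. unfold Wsum. cbn [zrange seq map csum]. fold a b c d.
      replace (0 + Z.of_nat 0)%Z with 0%Z by lia. rewrite !Z.mul_0_r, !Z.add_0_r. ring. }
    rewrite (CInt_ext _ (fun v => Wj k mu p s q r a b c d (S ^ 2 / INR mu) v * Cconj (Wj k mu p s q r a b c d (S ^ 2 / INR mu) v))%C)
      by (first [lra|intros v _; rewrite !EW; reflexivity]).
    assert (Hcm : 6 * (IZR c + 6) * S ^ 2 <= INR mu).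
    { eapply Rle_trans; [|exact Hsm]. apply Rmult_le_compat_r; [apply pow2_ge_0|]. pose proof (HP2 c A1). lra. }
    assert (HF : forall v, lo <= v <= hi -> frame q r a b c d S v).
    { intros v Hv. destruct (A5 v Hv) as (B1 & B2 & _). split; [exact B1|]. apply Hfr. lra. }
    eapply Rle_trans; [apply (pair_trivial k mu p s q r a b c d a b c d S); try assumption; lra|].
    apply Rmult_le_compat_l; lra.
  - unfold jlist. via rsum_filter_le.
    + intros j Hj. apply in_flat_map in Hj. destruct Hj as (c & Hc & Hj). apply in_map_iff in Hj. destruct Hj as (a & <- & Ha).
      destruct (HPr c Hc) as [_ Hc3]. cbn [fst]. apply Rmult_le_pos; [lra|]. apply Rdiv_le_0_compat; [lra|apply IZR_lt; lia].
    + rewrite rsum_pairs, <- rsum_const. apply rsum_le. intros c Hc. destruct (HPr c Hc) as [_ Hc3]. cbn [fst].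
      rewrite rsum_const. assert (Hc0 : 0 < IZR c) by arith.
      assert (INR (length (arcs c)) <= IZR c).
      { unfold arcs. rewrite length_app, length_zrange. simpl length. rewrite INR_IZR_INZ. apply IZR_le. lia. }
      replace (Gb k S ^ 2 * 2) with (IZR c * (Gb k S ^ 2 * (2 / IZR c))) by (field; lra).
      apply Rmult_le_compat_r; [|assumption]. apply Rmult_le_pos; [lra|]. apply Rdiv_le_0_compat; lra.
Qed.

Lemma Phi_cont k f A mu x : modform k f A -> (1 <= mu)%nat -> Cc (Phi mu f) x.
Proof.
  intros Hf Hmu. apply Cc_mult.
  - apply (mf_Cc k f A (fun x => pt x (/ INR mu)) x Hf); [eapply Dc_Cc, Dc_hline|].
    simpl. apply Rinv_0_lt_compat, lt_0_INR. lia.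
  - apply Cc_mult; [|apply Cc_const]. eapply Dc_Cc, (Dc_E mu (fun x => pt x (/ INR mu))), Dc_hline.
Qed.

Lemma Phi_trivial k f A B mu a b : modform k f A -> bounded_by k f B -> (1 <= mu)%nat -> a <= b ->
  Cmod (CInt (Phi mu f) a b) <= B * exp (2 * PI) * Rpower (INR mu) (INR k / 2) * (b - a).
Proof.
  intros Hf [HB Hb] Hmu Hab. assert (Hm : 0 < INR mu) by arith.
  apply CInt_bound; [exact Hab|apply ex_CInt_le; [exact Hab|intros; eapply Phi_cont; eassumption]|].
  intros x _. unfold Phi. rewrite !Cmod_mult, Cmod_1, Rmult_1_r, Cmod_E.
  assert (Hi : 0 < / INR mu) by arith.
  pose proof (mf_bound_at k f B (pt x (/ INR mu)) (/ INR mu) Hi ltac:(simpl; lra) (Hb (pt x (/ INR mu)) Hi)) as H1.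
  replace (Rpower (/ INR mu) (- (INR k / 2))) with (Rpower (INR mu) (INR k / 2)) in H1.
  2:{ unfold Rpower. rewrite ln_Rinv by exact Hm. f_equal. ring. }
  replace (2 * PI * INR mu * Im (pt x (/ INR mu))) with (2 * PI) by (simpl; field; lra).
  rewrite (Rmult_comm (B * exp (2 * PI))), <- Rmult_assoc, (Rmult_comm _ B).
  apply Rmult_le_compat_r; [left; apply exp_pos|exact H1].
Qed.

(** The case om = v = 1, on any subinterval of a unit interval; it serves end pieces and, with n0
    for mu, the resonant case. For t^2 < 5 there is no room for primes, and the trivial bound is
    already of the right order. *)
Lemma unit_bound k f A B (eps : R) : modform k f A -> bounded_by k f B -> 0 < eps ->
  exists K, 0 < K /\ forall (mu : nat) (p s q r : Z) (S x1 x2 t : R),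
  (1 <= mu)%nat -> / 12 <= S -> (p * r - s * q = 1)%Z -> Rabs (IZR q) <= 12 * S ->
  0 <= x1 -> x1 <= x2 -> x2 <= 1 ->
  (forall u, x1 <= u <= x2 -> 3 * S <= IZR q * u + IZR r <= 6 * S) -> 0 < t -> INR mu / S ^ 2 = t ^ 6 ->
  Cmod (CInt (Phi mu f) (mo p s q r x1) (mo p s q r x2)) <= K * (Nrm k mu S * (1 / t) * Rpower (INR mu) eps).
Proof.
  intros Hf Hb He. destruct (second_uniform k f A B eps 2 Hf Hb He ltac:(lra)) as (K1 & HK1 & HSU).
  assert (Hk : (1 <= k)%nat) by (pose proof (mf_weight _ _ _ Hf); lia).
  pose proof Hb as [HB _].
  set (K2 := B * exp (2 * PI)). assert (HK2 : 0 < K2) by (apply Rmult_lt_0_compat; [exact HB|apply exp_pos]).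
  exists (K1 + K2). split; [lra|].
  intros mu p s q r S x1 x2 t Hmu HS12 H0 Hq Hx0 Hx12 Hx2 Hfr Ht HX.
  assert (HS : 0 < S) by lra. assert (HS2 : 0 < S ^ 2) by arith.
  assert (Hm1 : 1 <= INR mu) by (apply (le_INR 1); exact Hmu).
  assert (Hm : 1 <= Rpower (INR mu) eps) by (apply Rpower_ge1; lra).
  assert (HN : 0 < Nrm k mu S) by (apply Rdiv_lt_0_compat; [apply Rpower_pos|exact HS2]).
  set (m := Rpower (INR mu) eps) in *.
  assert (Hpos : 0 < Nrm k mu S * (1 / t) * m) by arith.
  destruct (Rle_lt_dec 5 (t ^ 2)) as [Ht5|Ht5].
  - assert (HH : Cmod (CInt (Phi mu f) (mo p s q r x1) (mo p s q r x2)) <= K1 * (Nrm k mu S * (1 ^ 5 / t) * m)).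
    { pose proof (HSU mu p s q r S 1%nat x1 x2 1 t 1 Hmu HS12 H0 Hq ltac:(lia) Hx0 Hx12 Hx2) as H.
      cbn [zrange seq map csum] in H. replace (IZR (0 + Z.of_nat 0)) with 0 in H by reflexivity. rewrite !Rplus_0_r, Cplus_0_r in H.
      apply H; try lra; try assumption.
      - intros u tt Hu Htt. assert (tt = 0%Z) by lia. subst tt. replace (u + IZR 0) with u by ring. apply Hfr, Hu.
      - simpl. lra.
      - intros Pr P HPd HPr HP2 Hsm. eapply Rle_trans; [apply (diag_trivial k mu p s q r S Pr P x1 x2); assumption|].
        apply Rmult_le_compat_l; [apply pos_INR|]. apply Rmult_le_compat_l; [apply pow2_ge_0|]. fold m. lra. }
    rewrite pow1 in HH. eapply Rle_trans; [exact HH|]. apply Rmult_le_compat_r; lra.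
  - pose proof (Hfr x1 ltac:(lra)) as F1. pose proof (Hfr x2 ltac:(lra)) as F2.
    assert (Hdiff : 0 <= mo p s q r x2 - mo p s q r x1 <= / (9 * S ^ 2)).
    { rewrite mo_diff by (try assumption; apply Rgt_not_eq; lra).
      assert (H9 : 9 * S ^ 2 <= (IZR q * x2 + IZR r) * (IZR q * x1 + IZR r)) by arith.
      split; [apply Rdiv_le_0_compat; lra|].
      rewrite <- (Rmult_1_l (/ (9 * S ^ 2))). apply Rmult_le_compat; [lra|left; apply Rinv_0_lt_compat; lra|lra|].
      apply Rinv_le_contravar; lra. }
    eapply Rle_trans; [apply (Phi_trivial k f A B mu); try assumption; lra|]. fold K2.
    assert (Ht3 : t <= 3) by nra.
    assert (Hi3 : / 9 <= 1 / t).
    { unfold Rdiv. rewrite Rmult_1_l. apply Rinv_le_contravar; lra. }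
    apply Rle_trans with (K2 * Rpower (INR mu) (INR k / 2) * / (9 * S ^ 2)).
    + apply Rmult_le_compat_l; [|apply Hdiff]. apply Rmult_le_pos; [lra|left; apply Rpower_pos].
    + replace (K2 * Rpower (INR mu) (INR k / 2) * / (9 * S ^ 2)) with (K2 * (Nrm k mu S * / 9)) by (unfold Nrm; field; lra).
      assert (Nrm k mu S * / 9 <= Nrm k mu S * (1 / t)) by arith.
      assert (Nrm k mu S * (1 / t) <= Nrm k mu S * (1 / t) * m) by arith.
      apply Rle_trans with (K2 * (Nrm k mu S * (1 / t) * m)); [apply Rmult_le_compat_l; lra|].
      apply Rmult_le_compat_r; lra.
Qed.

Lemma Phi_ex k f A mu a b : modform k f A -> (1 <= mu)%nat -> ex_RInt (V := C_R_NormedModule) (Phi mu f) a b.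
Proof.
  intros Hf Hmu. destruct (Rle_dec a b) as [H|H].
  - apply ex_CInt_le; [exact H|]. intros x _. eapply Phi_cont; eassumption.
  - apply ex_RInt_swap, ex_CInt_le; [lra|]. intros x _. eapply Phi_cont; eassumption.
Qed.

Lemma Phi_telescope k f A mu p s q r W : modform k f A -> (1 <= mu)%nat ->
  csum (zrange 0 W) (fun tt => CInt (Phi mu f) (mo p s q r (0 + IZR tt)) (mo p s q r (1 + IZR tt))) =
  CInt (Phi mu f) (mo p s q r 0) (mo p s q r (INR W)).
Proof.
  intros Hf Hmu. rewrite csum_zrange0. induction W as [|W IH].
  - simpl. rewrite CInt_point. reflexivity.
  - rewrite csum_seq_S, IH, <- INR_IZR_INZ, Rplus_0_l, (Rplus_comm 1), <- S_INR.
    apply CInt_Chasles; eapply Phi_ex; eassumption.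
Qed.

Lemma fold_const_le k mu q S W om m Ch : 0 < S -> (1 <= mu)%nat -> q <> 0%Z -> 0 <= Ch -> 1 <= m ->
  harm W <= Ch * m -> INR W <= om ->
  fold_const k mu q S W <= Gb k S ^ 2 * ((1 + 2 * (Wbd k * Ch)) * m * (om + Rres mu q S)).
Proof.
  intros HS Hmu Hq HCh Hm Hh HW. unfold fold_const. apply Rmult_le_compat_l; [apply pow2_ge_0|].
  pose proof (Wbd_pos k) as HWb. pose proof (pos_INR W) as HW0.
  assert (HR : 0 <= Rres mu q S).
  { apply Rdiv_le_0_compat; [apply pow_le; lra|]. apply Rmult_lt_0_compat; [apply lt_0_INR; lia|].
    apply Rabs_pos_lt, IZR_neq, Hq. }
  set (R0 := Rres mu q S) in *. assert (HWC : 0 <= Wbd k * Ch) by arith.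
  assert (H1 : Wbd k * R0 * harm W <= Wbd k * R0 * (Ch * m)) by (apply Rmult_le_compat_l; [apply Rmult_le_pos; lra|exact Hh]).
  assert (H2 : om <= om * m) by nra.
  nra.
Qed.

Lemma fold_sqrt k mu q S W om m Ch Ca Cst z : 0 < S -> (1 <= mu)%nat -> q <> 0%Z -> 0 <= Ch -> 1 <= m ->
  harm W <= Ch * m -> INR W <= om -> 0 <= Cst -> 0 <= Ca -> 0 <= z -> om + Rres mu q S <= Ca * z ^ 2 ->
  sqrt (Cst * fold_sq k mu q S W) <= Gb k S * sqrt (Cst * (2 * (1 + 2 * (Wbd k * Ch)) * Ca)) * z * m.
Proof.
  intros HS Hmu Hq HCh Hm Hh HW HCst HCa Hz Hom.
  pose proof (Gb_pos k S HS) as HG. pose proof (Wbd_pos k) as HWb.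
  assert (HWC : 0 <= Wbd k * Ch) by arith.
  set (Cf := 1 + 2 * (Wbd k * Ch)) in *. assert (HCf : 0 < Cf) by (unfold Cf; lra).
  assert (Hpos : 0 <= Cst * (2 * Cf * Ca)) by arith.
  apply sqrt_le_sq.
  - apply Rmult_le_pos; [|lra]. apply Rmult_le_pos; [|lra]. apply Rmult_le_pos; [lra|apply sqrt_pos].
  - replace ((Gb k S * sqrt (Cst * (2 * Cf * Ca)) * z * m) ^ 2) with
      (Gb k S ^ 2 * sqrt (Cst * (2 * Cf * Ca)) ^ 2 * z ^ 2 * m ^ 2) by ring.
    rewrite pow2_sqrt by exact Hpos. unfold fold_sq.
    pose proof (fold_const_le k mu q S W om m Ch HS Hmu Hq HCh Hm Hh HW) as HF. fold Cf in HF.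
    apply Rle_trans with (Cst * (2 * (Gb k S ^ 2 * (Cf * m ^ 2 * (Ca * z ^ 2))))); [|right; ring].
    apply Rmult_le_compat_l; [exact HCst|]. apply Rmult_le_compat_l; [lra|].
    eapply Rle_trans; [exact HF|]. apply Rmult_le_compat_l; [apply pow2_ge_0|].
    apply Rle_trans with (Cf * m * (Ca * z ^ 2)).
    + apply Rmult_le_compat_l; [apply Rmult_le_pos; lra|exact Hom].
    + apply Rmult_le_compat_r; [apply Rmult_le_pos; [lra|apply pow2_ge_0]|]. apply Rmult_le_compat_l; [lra|]. nra.
Qed.

Lemma pow_le_inv a b n : 0 <= b -> (1 <= n)%nat -> a ^ n <= b ^ n -> a <= b.
Proof.
  intros Hb Hn H. destruct (Rle_lt_dec a b) as [|Hlt]; [assumption|]. exfalso.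
  assert (b ^ n < a ^ n); [|lra]. destruct n; [lia|]. clear H Hn. induction n; [simpl; lra|].
  change (b * b ^ suc n < a * a ^ suc n). apply Rmult_le_0_lt_compat; try lra. apply pow_le, Hb.
Qed.

(** Let xm be the least value of qu + r. Then n0 is the integer part of mu/xm^2 plus 1, and Sy =
    sqrt(mu/n0) stays below xm but not below S. Because W <= Rres, the quantity mu/(qu + r)^2 varies
    by at most 1. *)
Lemma resonance_data (mu : nat) (q r : Z) (S : R) (W : nat) :
  (1 <= mu)%nat -> 0 < S -> q <> 0%Z -> (1 <= W)%nat ->
  (forall u, 0 <= u <= INR W -> 3 * S <= IZR q * u + IZR r <= 6 * S) ->
  INR W <= Rres mu q S -> 2 * S ^ 2 <= INR mu ->
  exists (n0 : nat) (Sy : R), (1 <= n0)%nat /\ 0 < Sy <= 6 * S /\ Sy ^ 2 / INR mu = / INR n0 /\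
   (forall u, 0 <= u <= INR W -> Sy <= IZR q * u + IZR r <= 6 * Sy) /\
   (forall u, 0 <= u <= INR W -> Rabs (INR n0 - INR mu / (IZR q * u + IZR r) ^ 2) <= 2) /\
   INR mu / S ^ 2 <= 36 * INR n0 /\ INR n0 <= INR mu / S ^ 2.
Proof.
  intros Hmu HS Hq HW Hfr HR Hsm.
  assert (HW1 : 1 <= INR W) by (apply (le_INR 1); exact HW).
  assert (HS2 : 0 < S ^ 2) by arith.
  assert (Hqp : 0 < Rabs (IZR q)) by (apply Rabs_pos_lt, IZR_neq, Hq).
  assert (Hx : exists xm, 3 * S <= xm <= 6 * S /\ forall u, 0 <= u <= INR W -> xm <= IZR q * u + IZR r <= xm + Rabs (IZR q) * INR W).
  { destruct (Rle_lt_dec 0 (IZR q)) as [Hs|Hs].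
    - exists (IZR r). rewrite Rabs_pos_eq by exact Hs. split.
      + specialize (Hfr 0 ltac:(lra)). lra.
      + intros u Hu. nra.
    - exists (IZR q * INR W + IZR r). rewrite Rabs_left by exact Hs. split.
      + specialize (Hfr (INR W) ltac:(lra)). lra.
      + intros u Hu. nra. }
  destruct Hx as (xm & Hxm & Hx). set (Q := Rabs (IZR q)) in *.
  assert (HQW : INR mu * (Q * INR W) <= S ^ 3).
  { unfold Rres in HR. apply Rmult_le_compat_r with (r := INR mu * Q) in HR; [|nra].
    unfold Rdiv in HR. rewrite Rmult_assoc, Rinv_l in HR by (apply Rgt_not_eq; nra). lra. }
  assert (Hxm2 : 0 < xm ^ 2) by arith.
  destruct (nfloor_ex (INR mu / xm ^ 2)) as (n & Hn1 & Hn2); [apply Rdiv_le_0_compat; lra|].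
  set (n0 := suc n). assert (En0 : INR n0 = INR n + 1) by (unfold n0; apply S_INR).
  set (X := INR mu / S ^ 2).
  assert (HX2 : 2 <= X).
  { unfold X. apply Rmult_le_reg_r with (S ^ 2); [exact HS2|]. unfold Rdiv. rewrite Rmult_assoc, Rinv_l by lra. lra. }
  assert (HXm : INR mu = X * S ^ 2) by (unfold X; field; lra).
  assert (HXx : INR mu / xm ^ 2 <= X / 9).
  { unfold X. apply Rle_trans with (INR mu / (9 * S ^ 2)); [|right; field; lra].
    apply Rmult_le_compat_l; [lra|]. apply Rinv_le_contravar; [lra|]. nra. }
  assert (HXx2 : X / 36 <= INR mu / xm ^ 2).
  { unfold X. apply Rle_trans with (INR mu / (36 * S ^ 2)); [right; field; lra|].
    apply Rmult_le_compat_l; [lra|]. apply Rinv_le_contravar; [lra|]. nra. }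
  assert (Hsq : sqrt (INR mu / INR n0) ^ 2 = INR mu / INR n0) by (apply pow2_sqrt, Rdiv_le_0_compat; lra).
  pose proof (sqrt_lt_R0 (INR mu / INR n0) ltac:(apply Rdiv_lt_0_compat; lra)) as HSy0.
  set (Sy := sqrt (INR mu / INR n0)) in *.
  assert (HSyx : Sy <= xm).
  { unfold Sy. apply sqrt_le_sq; [lra|]. apply Rmult_le_reg_r with (INR n0 / xm ^ 2); [apply Rdiv_lt_0_compat; lra|].
    replace (INR mu / INR n0 * (INR n0 / xm ^ 2)) with (INR mu / xm ^ 2) by (field; lra).
    replace (xm ^ 2 * (INR n0 / xm ^ 2)) with (INR n0) by (field; lra). lra. }
  assert (HSS : S <= Sy).
  { apply pow_le_inv with 2%nat; [lra|lia|]. rewrite Hsq. apply Rmult_le_reg_r with (INR n0); [lra|].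
    unfold Rdiv. rewrite Rmult_assoc, Rinv_l, Rmult_1_r, HXm by lra. rewrite (Rmult_comm X). apply Rmult_le_compat_l; lra. }
  exists n0, Sy. repeat split; try lra; try lia.
  - rewrite Hsq. field. lra.
  - specialize (Hx u H). lra.
  - specialize (Hfr u H). lra.
  - intros u Hu. specialize (Hx u Hu). specialize (Hfr u Hu). set (x := IZR q * u + IZR r) in *.
    assert (Hx2 : 0 < x ^ 2) by arith.
    assert (HD : 0 <= INR mu / xm ^ 2 - INR mu / x ^ 2 <= 1).
    { replace (INR mu / xm ^ 2 - INR mu / x ^ 2) with (INR mu * ((x - xm) * (x + xm)) / (xm ^ 2 * x ^ 2)) by (field; split; lra).
      split.
      - apply Rdiv_le_0_compat; [|apply Rmult_lt_0_compat; lra]. apply Rmult_le_pos; [lra|]. apply Rmult_le_pos; lra.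
      - apply Rmult_le_reg_r with (xm ^ 2 * x ^ 2); [apply Rmult_lt_0_compat; lra|].
        unfold Rdiv. rewrite Rmult_assoc, Rinv_l by (apply Rgt_not_eq, Rmult_lt_0_compat; lra). rewrite Rmult_1_r, Rmult_1_l.
        apply Rle_trans with (S ^ 3 * (12 * S)).
        + rewrite <- Rmult_assoc. apply Rmult_le_compat; try lra; [apply Rmult_le_pos; lra|].
          eapply Rle_trans; [|exact HQW]. apply Rmult_le_compat_l; lra.
        + assert (9 * S ^ 2 <= xm ^ 2) by nra. assert (9 * S ^ 2 <= x ^ 2) by nra.
          apply Rle_trans with (9 * S ^ 2 * (9 * S ^ 2)); [|apply Rmult_le_compat; lra].
          replace (S ^ 3 * (12 * S)) with (12 * (S ^ 2 * S ^ 2)) by ring. nra. }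
    apply Rabs_le. lra.
Qed.

(** If t is bounded, or v is so large against t that no primes fit, folding alone suffices. If Rres
    <= om the diagonal is of order om and the average over primes applies. If Rres > om the weights
    resonate, and the loss of about sqrt(om + Rres), at most a constant times v^5, against the unit
    bound is affordable. *)
Lemma W_bound k f A B (eps C1 : R) : modform k f A -> bounded_by k f B -> 0 < eps -> 0 <= C1 ->
  exists K, 0 < K /\ forall (mu : nat) (p s q r : Z) (S : R) (W : nat) (om t v : R),
  (1 <= mu)%nat -> / 12 <= S -> (p * r - s * q = 1)%Z -> q <> 0%Z -> Rabs (IZR q) <= 12 * S -> (1 <= W)%nat ->
  36 * (Rabs (IZR q) * S) <= INR mu ->
  (forall u, 0 <= u <= INR W -> 3 * S <= IZR q * u + IZR r <= 6 * S) ->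
  INR W <= om -> om = v ^ 6 -> 1 <= v -> 0 < t -> INR mu / S ^ 2 = t ^ 6 -> 1 <= v * t -> Rres mu q S <= C1 * v ^ 10 ->
  Cmod (CInt (Phi mu f) (mo p s q r 0) (mo p s q r (INR W))) <= K * (Nrm k mu S * (v ^ 5 / t) * Rpower (INR mu) eps).
Proof.
  intros Hf Hb He HC1. set (d := eps / 2). assert (Hd : 0 < d) by (unfold d; lra).
  assert (Hk : (1 <= k)%nat) by (pose proof (mf_weight _ _ _ Hf); lia).
  destruct Hb as [HB Hb0]. assert (Hb : bounded_by k f B) by (split; assumption).
  set (Ch := (1 + / d) * Rpower 2 d).
  assert (HCh : 0 < Ch).
  { apply Rmult_lt_0_compat; [|apply Rpower_pos]. assert (0 < / d) by arith. lra. }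
  pose proof (Wbd_pos k) as HWb. assert (HWC : 0 < Wbd k * Ch) by arith.
  set (Cf := 1 + 2 * (Wbd k * Ch)).
  assert (Hdc : 0 <= diag_const k) by (apply Rmult_le_pos; [apply pow2_ge_0|pose proof (pow2_ge_0 (weight_const k)); lra]).
  destruct (second_uniform k f A B eps (diag_const k * (4 * Cf)) Hf Hb He ltac:(apply Rmult_le_pos; unfold Cf; lra)) as (Ks & HKs & HSU).
  destruct (unit_bound k f A B d Hf Hb Hd) as (Ku & HKu & HUB).
  assert (HGc : 0 < Gconst k) by (apply Rmult_lt_0_compat; [apply pow_lt; lra|apply exp_pos]).
  set (Cw := 2 * weight_const k ^ 2). assert (HCw : 0 <= Cw) by (pose proof (pow2_ge_0 (weight_const k)); unfold Cw; lra).
  set (Kf := fun Ca => B * Gconst k * sqrt (Cw * (2 * Cf * Ca))).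
  set (C2 := 4 * B * Rpower 37 (INR k / 2) * exp (2 * PI)).
  assert (HC2 : 0 < C2).
  { unfold C2. apply Rmult_lt_0_compat; [|apply exp_pos]. apply Rmult_lt_0_compat; [lra|apply Rpower_pos]. }
  assert (HdG : 0 <= dG_const k) by (pose proof (pow2_ge_0 (2 * weight_const k * psi_const k)); unfold dG_const; lra).
  set (Kr := 54 * Ku * Rpower 144 d * Gconst k * sqrt (dG_const k * (2 * Cf * (1 + C1)))).
  assert (HKf : forall Ca, 0 <= Kf Ca) by (intros Ca; apply Rmult_le_pos; [apply Rmult_le_pos; lra|apply sqrt_pos]).
  assert (HKr : 0 <= Kr).
  { apply Rmult_le_pos; [|apply sqrt_pos]. apply Rmult_le_pos; [|lra].
    apply Rmult_le_pos; [lra|left; apply Rpower_pos]. }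
  pose proof (HKf (5 * (1 + C1))) as HKf1. pose proof (HKf 2) as HKf2.
  exists (Ks + Kf (5 * (1 + C1)) + 2 * Kf 2 + Kr + C2). split; [lra|].
  intros mu p s q r S W om t v Hmu HS12 H0 Hq0 Hq HW H36 Hfr HWom Hom Hv Ht HX Hvt HR.
  assert (HS : 0 < S) by lra. assert (Hm1 : 1 <= INR mu) by (apply (le_INR 1); exact Hmu).
  assert (HS2 : 0 < S ^ 2) by arith.
  assert (HW1 : 1 <= INR W) by (apply (le_INR 1); exact HW).
  assert (Hq1 : 1 <= Rabs (IZR q)) by (rewrite <- abs_IZR; apply IZR_le; lia).
  assert (HWS : INR W <= 3 * S).
  { pose proof (Hfr 0 ltac:(lra)) as F1. pose proof (Hfr (INR W) ltac:(lra)) as F2.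
    assert (Rabs (IZR q) * INR W <= 3 * S).
    { destruct (Rle_lt_dec 0 (IZR q)); [rewrite Rabs_pos_eq by assumption|rewrite Rabs_left by assumption]; lra. }
    nra. }
  assert (HWmu : INR W <= INR mu) by nra.
  set (m := Rpower (INR mu) d). assert (Hm : 1 <= m) by (apply Rpower_ge1; lra).
  assert (Em : Rpower (INR mu) eps = m * m) by (unfold m; rewrite <- Rpower_plus; f_equal; unfold d; field).
  rewrite Em.
  assert (Hh : harm W <= Ch * m).
  { eapply Rle_trans; [apply (harm_le_Rpower d W (2 * INR mu) Hd); lra|].
    rewrite <- Rpower_mult_distr by lra. fold m. unfold Ch. right. ring. }
  pose proof (pow_lt _ 2 (Gb_pos k S HS)) as HG. pose proof (Gb_pos k S HS) as HGb.
  assert (HN : 0 < Nrm k mu S) by (apply Rdiv_lt_0_compat; [apply Rpower_pos|exact HS2]).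
  assert (Hv5 : 0 < v ^ 5 / t) by arith.
  set (T := Nrm k mu S * (v ^ 5 / t) * (m * m)).
  assert (Hmm : m <= m * m) by nra.
  assert (HT : Nrm k mu S * (v ^ 5 / t) * m <= T).
  { apply Rmult_le_compat_l; [apply Rmult_le_pos; lra|exact Hmm]. }
  assert (HT1 : Nrm k mu S * (v ^ 5 / t) <= T).
  { rewrite <- (Rmult_1_r (Nrm k mu S * (v ^ 5 / t))). apply Rmult_le_compat_l; [apply Rmult_le_pos; lra|nra]. }
  assert (HTp : 0 <= T) by arith.
  assert (HLC : link_const k mu B <= C2 * T).
  { rewrite (link_const_Nrm k mu B S HS Hmu), HX. fold C2. apply Rmult_le_compat_l; [lra|].
    eapply Rle_trans; [|exact HT1]. apply Rmult_le_compat_l; [lra|].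
    assert (Ht6 : 0 < t ^ 6) by arith.
    apply Rmult_le_reg_r with (t ^ 6); [exact Ht6|]. rewrite Rinv_l by lra.
    replace (v ^ 5 / t * t ^ 6) with ((v * t) ^ 5) by (field; lra). apply pow_R1_Rle, Hvt. }
  assert (HR0 : 0 <= Rres mu q S) by (apply Rdiv_le_0_compat; [apply pow_le; lra|apply Rmult_lt_0_compat; lra]).
  (* Folding with Sy = S. The number z stands for the square root of om + Rres and is chosen in each
     case. *)
  assert (Hfold : forall Ca z, 0 <= Ca -> 0 <= z -> om + Rres mu q S <= Ca * z ^ 2 ->
    Cmod (CInt (Phi mu f) (mo p s q r 0) (mo p s q r (INR W))) <= Kf Ca * (Nrm k mu S * z * m) + link_const k mu B).
  { intros Ca z HCa Hz Hz2.
    eapply Rle_trans; [apply (fold_direct k mu p s q r S S W) with (A := A) (B := B); try assumption; try lra|].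
    - intros u Hu. specialize (Hfr u Hu). lra.
    - apply Rplus_le_compat_r. fold Cw.
      pose proof (fold_sqrt k mu q S W om m Ch Ca Cw z HS Hmu Hq0 ltac:(lra) Hm Hh HWom HCw HCa Hz Hz2) as Hsq. fold Cf in Hsq.
      apply Rle_trans with (B * Rpower (S ^ 2 / INR mu) (- (INR k / 2)) * (Gb k S * sqrt (Cw * (2 * Cf * Ca)) * z * m)).
      + apply Rmult_le_compat_l; [|exact Hsq]. apply Rmult_le_pos; [lra|left; apply Rpower_pos].
      + right. unfold Kf. transitivity (B * (Rpower (S ^ 2 / INR mu) (- (INR k / 2)) * Gb k S) * sqrt (Cw * (2 * Cf * Ca)) * z * m); [ring|].
        rewrite Gb_height by assumption. ring. }
  assert (Hv610 : om <= v ^ 10) by (rewrite Hom; apply Rle_pow; [exact Hv|lia]).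
  assert (Hv10 : 0 < v ^ 10) by arith.
  destruct (Rle_lt_dec 5 (t ^ 2)) as [Ht5|Ht5].
  (* For bounded t the target v^5/t itself dominates sqrt(om + Rres). *)
  2:{ assert (Hz : om + Rres mu q S <= 5 * (1 + C1) * (v ^ 5 / t) ^ 2).
      { replace (5 * (1 + C1) * (v ^ 5 / t) ^ 2) with ((1 + C1) * v ^ 10 * (5 / t ^ 2)) by (field; lra).
        assert (1 <= 5 / t ^ 2).
        { apply Rmult_le_reg_r with (t ^ 2); [apply pow_lt, Ht|]. unfold Rdiv. rewrite Rmult_assoc, Rinv_l by (apply pow_nonzero; lra). lra. }
        assert (0 <= (1 + C1) * v ^ 10) by arith. nra. }
      pose proof (Hfold (5 * (1 + C1)) (v ^ 5 / t) ltac:(lra) (Rlt_le _ _ Hv5) Hz) as HF.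
      assert (Kf (5 * (1 + C1)) * (Nrm k mu S * (v ^ 5 / t) * m) <= Kf (5 * (1 + C1)) * T) by (apply Rmult_le_compat_l; assumption).
      assert (0 <= Ks * T) by arith. assert (0 <= Kf 2 * T) by arith.
      assert (0 <= Kr * T) by arith. lra. }
  assert (Ht6 : 125 <= t ^ 6).
  { replace (t ^ 6) with ((t ^ 2) ^ 3) by ring. replace 125 with (5 ^ 3) by ring. apply pow_incr. lra. }
  assert (HmuX : INR mu = t ^ 6 * S ^ 2) by (rewrite <- HX; field; lra).
  assert (H108 : 108 * S ^ 2 <= INR mu) by (rewrite HmuX; apply Rmult_le_compat_r; lra).
  destruct (Rle_lt_dec (Rres mu q S) om) as [HRom|HRom].
  - destruct (Rlt_le_dec (t ^ 2) (3 * v ^ 4)) as [Htv|Htv].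
    + assert (Hz : om + Rres mu q S <= 2 * (v ^ 3) ^ 2) by arith.
      pose proof (Hfold 2 (v ^ 3) ltac:(lra) ltac:(apply pow_le; lra) Hz) as HF.
      (* Primes do not fit when t^2 < 3 v^4; then t <= 2 v^2, and sqrt om = v^3 is at most twice the
         target. *)
      assert (Hv3 : v ^ 3 <= 2 * (v ^ 5 / t)).
      { assert (Htv2 : t <= 2 * v ^ 2).
        { apply pow_le_inv with 2%nat; [|lia|].
          - pose proof (pow2_ge_0 v). lra.
          - replace ((2 * v ^ 2) ^ 2) with (4 * v ^ 4) by ring. lra. }
        apply Rmult_le_reg_r with t; [exact Ht|]. replace (2 * (v ^ 5 / t) * t) with (v ^ 3 * (2 * v ^ 2)) by (field; lra).
        apply Rmult_le_compat_l; [apply pow_le; lra|exact Htv2]. }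
      assert (Nrm k mu S * v ^ 3 * m <= 2 * T).
      { eapply Rle_trans; [|apply Rmult_le_compat_l; [|exact HT]; lra].
        replace (2 * (Nrm k mu S * (v ^ 5 / t) * m)) with (Nrm k mu S * (2 * (v ^ 5 / t)) * m) by ring.
        apply Rmult_le_compat_r; [lra|]. apply Rmult_le_compat_l; lra. }
      assert (Kf 2 * (Nrm k mu S * v ^ 3 * m) <= Kf 2 * (2 * T)) by (apply Rmult_le_compat_l; assumption).
      assert (0 <= Ks * T) by arith. assert (0 <= Kf (5 * (1 + C1)) * T) by arith.
      assert (0 <= Kr * T) by arith. lra.
    + assert (HH : Cmod (CInt (Phi mu f) (mo p s q r 0) (mo p s q r (INR W))) <= Ks * T).
      { rewrite <- (Phi_telescope k f A mu p s q r W Hf Hmu). unfold T. rewrite <- Em.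
        apply (HSU mu p s q r S W 0 1 om t v); try assumption; try lra.
        - intros u tt Hu Htt. apply Hfr. assert (0 <= IZR tt) by arith.
          assert (IZR tt + 1 <= INR W) by (rewrite <- plus_IZR, INR_IZR_INZ; apply IZR_le; lia). lra.
        - intros Pr P HPd HPr HP2 Hsm.
          eapply Rle_trans; [apply (diag_bound k mu p s q r S Pr P W); assumption|].
          apply Rmult_le_compat_l; [apply pos_INR|]. rewrite Em.
          pose proof (fold_const_le k mu q S W om m Ch HS Hmu Hq0 ltac:(lra) Hm Hh HWom) as HF. fold Cf in HF.
          assert (HCf : 0 <= Cf) by (unfold Cf; lra).
          assert (HF2 : Cf * m * (om + Rres mu q S) <= Cf * (m * m) * (2 * om)).
          { apply Rmult_le_compat; try lra; [apply Rmult_le_pos; lra|]. apply Rmult_le_compat_l; lra. }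
          apply Rle_trans with (diag_const k * (2 * (Gb k S ^ 2 * (Cf * (m * m) * (2 * om))))); [|right; ring].
          apply Rmult_le_compat_l; [exact Hdc|]. apply Rmult_le_compat_l; [lra|].
          eapply Rle_trans; [exact HF|]. apply Rmult_le_compat_l; lra. }
      assert (0 <= C2 * T) by arith. assert (0 <= Kf 2 * T) by arith.
      assert (0 <= Kr * T) by arith. assert (0 <= Kf (5 * (1 + C1)) * T) by arith. lra.
  - destruct (resonance_data mu q r S W Hmu HS Hq0 HW Hfr ltac:(lra) ltac:(lra)) as (n0 & Sy & Hn0 & HSy & Hyn & HSf & Hres & HXn & HnX).
    rewrite HX in HXn, HnX. assert (Hn1 : 1 <= INR n0) by arith.
    (* The unit bound is applied to the identity matrix with S = 1/3, since 3S <= 1 <= 6S; there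
       mu/S^2 becomes 9 n0. *)
    set (t0 := Rpower (9 * INR n0) (/ INR 6)).
    assert (Ht0 : t0 ^ 6 = 9 * INR n0) by (apply Rpower_root; [lra|lia]).
    assert (Ht0p : 0 < t0) by apply Rpower_pos.
    assert (Htt0 : t <= 2 * t0).
    { apply pow_le_inv with 6%nat; [lra|lia|]. rewrite Rpow_mult_distr, Ht0. simpl. lra. }
    set (nk := Rpower (INR n0) (INR k / 2)). assert (Hnk : 0 < nk) by apply Rpower_pos.
    set (Hm0 := Ku * (nk * (18 / t) * (Rpower 144 d * m))).
    assert (Hit : 0 < 18 / t) by arith.
    pose proof (Rpower_pos 144 d) as H144.
    assert (HHm0 : 0 <= Hm0).
    { apply Rmult_le_pos; [lra|]. apply Rmult_le_pos; [apply Rmult_le_pos; lra|apply Rmult_le_pos; lra]. }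
    assert (HHm : forall x, 0 <= x <= 1 -> Cmod (CInt (Phi n0 f) 0 x) <= Hm0).
    { intros x Hx. pose proof (HUB n0 1%Z 0%Z 0%Z 1%Z (/ 3) 0 x t0 Hn0 ltac:(lra) ltac:(lia) ltac:(rewrite Rabs_R0; lra) ltac:(lra) ltac:(lra) ltac:(lra)) as HU.
      unfold mo in HU. replace ((1 * 0 + 0) / (0 * 0 + 1)) with 0 in HU by field. replace ((1 * x + 0) / (0 * x + 1)) with x in HU by field.
      eapply Rle_trans; [apply HU; [intros u Hu; lra|exact Ht0p|rewrite Ht0; field]|].
      apply Rmult_le_compat_l; [lra|]. apply Rmult_le_compat.
      - apply Rmult_le_pos; [|apply Rdiv_le_0_compat; lra]. left. apply Rdiv_lt_0_compat; [apply Rpower_pos|lra].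
      - left. apply Rpower_pos.
      - unfold Nrm. fold nk. replace (nk / (/ 3) ^ 2 * (1 / t0)) with (nk * (9 / t0)) by (field; lra).
        apply Rmult_le_compat_l; [lra|]. apply Rmult_le_reg_r with (t * t0); [apply Rmult_lt_0_compat; lra|].
        replace (9 / t0 * (t * t0)) with (9 * t) by (field; lra). replace (18 / t * (t * t0)) with (18 * t0) by (field; lra). lra.
      - apply Rpower_base_le; try lra. eapply Rle_trans; [exact HnX|]. rewrite HmuX.
        assert (/ 144 <= S ^ 2) by (replace (/ 144) with ((/ 12) ^ 2) by field; apply pow_incr; lra).
        replace (144 * (t ^ 6 * S ^ 2)) with (t ^ 6 * (144 * S ^ 2)) by ring. rewrite <- (Rmult_1_r (t ^ 6)) at 1. apply Rmult_le_compat_l; lra. }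
    pose proof (resonant k mu p s q r S Sy W Hk Hmu HS H0 Hq0 HW Hq Hfr HSy HSf H36 n0 Hn0 Hyn Hres ltac:(lra) f A B Hm0 Hf Hb HHm0 HHm) as HRS.
    assert (Hz : om + Rres mu q S <= (1 + C1) * (v ^ 5) ^ 2) by arith.
    pose proof (fold_sqrt k mu q S W om m Ch (1 + C1) (dG_const k) (v ^ 5) HS Hmu Hq0 ltac:(lra) Hm Hh HWom HdG ltac:(lra) ltac:(apply pow_le; lra) Hz) as Hsq.
    fold Cf in Hsq. set (sq := sqrt (dG_const k * (2 * Cf * (1 + C1)))) in *.
    assert (Hsq0 : 0 <= sq) by apply sqrt_pos.
    assert (HnG : nk * Gb k S <= Gconst k * Nrm k mu S).
    { rewrite <- Gb_height by assumption. apply Rmult_le_compat_r; [lra|].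
      replace (S ^ 2 / INR mu) with (/ (t ^ 6)) by (rewrite <- HX; field; lra).
      replace (Rpower (/ t ^ 6) (- (INR k / 2))) with (Rpower (t ^ 6) (INR k / 2)).
      2:{ unfold Rpower. rewrite ln_Rinv by lra. f_equal. ring. }
      apply Rle_Rpower_l; [apply Rdiv_le_0_compat; [apply pos_INR|lra]|lra]. }
    assert (HF : Hm0 * (3 * sqrt (dG_const k * fold_sq k mu q S W)) <= Kr * T).
    { apply Rle_trans with (Hm0 * (3 * (Gb k S * sq * v ^ 5 * m))).
      - apply Rmult_le_compat_l; [exact HHm0|]. apply Rmult_le_compat_l; [lra|exact Hsq].
      - replace (Hm0 * (3 * (Gb k S * sq * v ^ 5 * m))) with (nk * Gb k S * (54 * Ku * Rpower 144 d * sq * (v ^ 5 / t) * (m * m))) by (unfold Hm0; field; lra).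
        replace (Kr * T) with (Gconst k * Nrm k mu S * (54 * Ku * Rpower 144 d * sq * (v ^ 5 / t) * (m * m))) by (unfold Kr, T; fold sq; ring).
        apply Rmult_le_compat_r; [|exact HnG]. apply Rmult_le_pos; [|nra]. apply Rmult_le_pos; [|lra]. apply Rmult_le_pos; [|lra].
        apply Rmult_le_pos; lra. }
    assert (0 <= Kf 2 * T) by arith. assert (0 <= Ks * T) by arith.
    assert (0 <= Kf (5 * (1 + C1)) * T) by arith. lra.
Qed.

(** * Dissection at the fractions p/q *)

(** An integer shift of u is absorbed into the second column, so every piece can be moved to start
    in [0, 1]. *)
Lemma mo_precomp p s q r m x : mo p (s + p * m) q (r + q * m) x = mo p s q r (x + IZR m).
Proof. unfold mo. rewrite !plus_IZR, !mult_IZR. f_equal; ring. Qed.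

(* [rho = g^6] is the length of the interval and [n = mu^(1/6)]; the two parameters of [W_bound] are then [v = g l] and
   [t = 12^(1/3) n / l] with [l^3 = 12 S]. *)
Lemma piece_bound k f A B (eps : R) : modform k f A -> bounded_by k f B -> 0 < eps ->
  exists K, 0 < K /\ forall (mu : nat) (p s q r : Z) (S g n u1 u2 : R),
  (1 <= mu)%nat -> 0 < g <= 1 -> 0 < n -> n ^ 6 = INR mu -> 1 <= g ^ 3 * n ^ 2 ->
  (p * r - s * q = 1)%Z -> q <> 0%Z -> Rabs (IZR q) <= 12 * S -> 36 * (Rabs (IZR q) * S) <= INR mu -> 1 <= 12 * S * g ^ 3 ->
  u1 <= u2 -> u2 - u1 <= 144 * g ^ 6 * S ^ 2 ->
  3 * S <= IZR q * u1 + IZR r <= 6 * S -> 3 * S <= IZR q * u2 + IZR r <= 6 * S ->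
  Cmod (CInt (Phi mu f) (mo p s q r u1) (mo p s q r u2)) <= K * (Rpower (INR mu) (INR k / 2) * (g ^ 5 / n) * Rpower (INR mu) eps).
Proof.
  intros Hf Hb He.
  destruct (W_bound k f A B eps 1 Hf Hb He ltac:(lra)) as (Kw & HKw & HWB).
  destruct (unit_bound k f A B eps Hf Hb He) as (Ku & HKu & HUB).
  exists (144 * (2 * Ku + Kw)). split; [lra|].
  intros mu p s q r S g n u1 u2 Hmu Hg Hn Hn6 Hgn H0 Hq0 Hq H36 HSg Hu Hud Hf1 Hf2.
  assert (Hg3 : 0 < g ^ 3 <= 1) by arith.
  assert (HS12 : / 12 <= S) by nra. assert (HS : 0 < S) by lra.
  assert (Hm1 : 1 <= INR mu) by (apply (le_INR 1); exact Hmu).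
  assert (Hq1 : 1 <= Rabs (IZR q)) by (rewrite <- abs_IZR; apply IZR_le; lia).
  set (l := Rpower (12 * S) (/ INR 3)). set (c := Rpower 12 (/ INR 3)).
  assert (Hl3 : l ^ 3 = 12 * S) by (apply Rpower_root; [lra|lia]).
  assert (Hc3 : c ^ 3 = 12) by (apply Rpower_root; [lra|lia]).
  assert (Hl : 0 < l) by arith. assert (Hc : 0 < c) by arith.
  assert (Hc1 : 1 <= c) by arith.
  assert (Hv : 1 <= g * l).
  { apply pow_le_inv with 3%nat; [apply Rmult_le_pos; lra|lia|]. rewrite Rpow_mult_distr, Hl3. lra. }
  assert (Ht : 0 < c * n / l) by arith.
  set (v := g * l) in *. set (t := c * n / l) in *.
  assert (HtX : INR mu / S ^ 2 = t ^ 6).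
  { unfold t. replace ((c * n / l) ^ 6) with ((c ^ 3) ^ 2 * n ^ 6 / (l ^ 3) ^ 2) by (field; lra).
    rewrite Hc3, Hl3, Hn6. field. lra. }
  assert (Hgn1 : 1 <= g * n).
  { apply pow_le_inv with 2%nat; [apply Rmult_le_pos; lra|lia|].
    rewrite Rpow_mult_distr, pow1. nra. }
  assert (Hvt : 1 <= v * t) by (replace (v * t) with (g * n * c) by (unfold v, t; field; lra); nra).
  assert (Hom : 144 * g ^ 6 * S ^ 2 = v ^ 6).
  { unfold v. replace ((g * l) ^ 6) with (g ^ 6 * (l ^ 3) ^ 2) by ring. rewrite Hl3. ring. }
  (* Here the restriction g^3 n^2 >= 1, that is rho >= mu^(-2/3), enters: Rres <= l^9/n^6, whereas
     v^10 = l^9 g^9 (g l) and (g^3 n^2)^3 >= 1. *)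
  assert (HR : Rres mu q S <= 1 * v ^ 10).
  { unfold Rres. assert (HS3 : 0 < S ^ 3) by arith. assert (Hn60 : 0 < n ^ 6) by arith.
    apply Rle_trans with (S ^ 3 / n ^ 6).
    - apply Rmult_le_compat_l; [lra|]. apply Rinv_le_contravar; [exact Hn60|]. rewrite <- Hn6. nra.
    - apply Rmult_le_reg_r with (n ^ 6); [exact Hn60|]. unfold Rdiv. rewrite Rmult_assoc, Rinv_l by lra. rewrite Rmult_1_r, Rmult_1_l.
      apply Rle_trans with (l ^ 9).
      + replace (l ^ 9) with ((l ^ 3) ^ 3) by ring. rewrite Hl3, Rpow_mult_distr. nra.
      + unfold v. replace ((g * l) ^ 10 * n ^ 6) with (l ^ 9 * ((g ^ 3 * n ^ 2) ^ 3 * (g * l))) by ring.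
        rewrite <- (Rmult_1_r (l ^ 9)) at 1. apply Rmult_le_compat_l; [apply pow_le; lra|].
        assert (1 <= (g ^ 3 * n ^ 2) ^ 3) by (apply pow_R1_Rle, Hgn). fold v. nra. }
  set (T0 := Nrm k mu S * (v ^ 5 / t) * Rpower (INR mu) eps).
  set (T := Rpower (INR mu) (INR k / 2) * (g ^ 5 / n) * Rpower (INR mu) eps).
  pose proof (Rpower_pos (INR mu) eps) as Hme. pose proof (Rpower_pos (INR mu) (INR k / 2)) as Hmk.
  assert (HT : 0 < T).
  { apply Rmult_lt_0_compat; [|exact Hme]. apply Rmult_lt_0_compat; [exact Hmk|]. apply Rdiv_lt_0_compat; [apply pow_lt; lra|exact Hn]. }
  assert (HN : 0 < Nrm k mu S) by (apply Rdiv_lt_0_compat; [exact Hmk|apply pow_lt, HS]).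
  (* l^6/S^2 = 144, so S disappears and every dyadic range receives the same bound. *)
  assert (HT0 : T0 <= 144 * T).
  { assert (E0 : T0 = 144 * T * / c).
    { unfold T0, T, Nrm, v, t. replace ((g * l) ^ 5 / (c * n / l)) with (g ^ 5 * (l ^ 3) ^ 2 / (c * n)) by (field; lra).
      rewrite Hl3. field. lra. }
    rewrite E0. assert (/ c <= 1) by (rewrite <- Rinv_1; apply Rinv_le_contravar; lra). nra. }
  assert (HU : forall m x y, IZR m <= x -> x <= y -> y <= IZR m + 1 -> u1 <= x -> y <= u2 ->
     Cmod (CInt (Phi mu f) (mo p s q r x) (mo p s q r y)) <= Ku * T0).
  { intros m x y A1 A2 A3 A4 A5.
    assert (F : forall u, x - IZR m <= u <= y - IZR m -> 3 * S <= IZR q * u + IZR (r + q * m) <= 6 * S).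
    { intros u Hu'. rewrite plus_IZR, mult_IZR. destruct (Rle_lt_dec 0 (IZR q)); split; nra. }
    pose proof (HUB mu p (s + p * m)%Z q (r + q * m)%Z S (x - IZR m) (y - IZR m) t Hmu HS12 ltac:(nia) Hq ltac:(lra) ltac:(lra) ltac:(lra) F Ht HtX) as H.
    rewrite !mo_precomp in H. replace (x - IZR m + IZR m) with x in H by ring. replace (y - IZR m + IZR m) with y in H by ring.
    eapply Rle_trans; [exact H|]. apply Rmult_le_compat_l; [lra|]. unfold T0. apply Rmult_le_compat_r; [lra|]. apply Rmult_le_compat_l; [lra|].
    apply Rmult_le_compat_r; [left; apply Rinv_0_lt_compat, Ht|]. apply pow_R1_Rle, Hv. }
  assert (HT00 : 0 <= T0).
  { apply Rmult_le_pos; [|lra]. apply Rmult_le_pos; [lra|]. apply Rdiv_le_0_compat; [apply pow_le; lra|exact Ht]. }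
  enough (HH : Cmod (CInt (Phi mu f) (mo p s q r u1) (mo p s q r u2)) <= (2 * Ku + Kw) * T0).
  { eapply Rle_trans; [exact HH|]. rewrite (Rmult_comm 144), Rmult_assoc. apply Rmult_le_compat_l; [lra|exact HT0]. }
  (* The interval is cut at integers: the two end parts have length at most 1 and fall under [HU],
     the middle part consists of whole unit intervals. *)
  destruct (base_Int_part u1) as [B1 B2]. destruct (base_Int_part u2) as [B3 B4].
  set (m1 := Int_part u1) in *. set (m2 := Int_part u2) in *.
  assert (HKT : 0 <= Ku * T0 /\ 0 <= Kw * T0) by arith.
  destruct (Rle_lt_dec u2 (IZR m1 + 1)) as [Hc1u|Hc1u].
  - pose proof (HU m1 u1 u2 ltac:(lra) Hu Hc1u ltac:(lra) ltac:(lra)). lra.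
  - assert (Hm12 : (m1 + 1 <= m2)%Z).
    { assert (m1 < m2 + 1)%Z; [|assert (m1 <> m2); [intros E'; rewrite E' in *; lra|lia]].
      apply lt_IZR. rewrite plus_IZR. lra. }
    assert (Hmm : IZR m1 + 1 <= IZR m2) by (rewrite <- plus_IZR; apply IZR_le, Hm12).
    pose proof (HU m1 u1 (IZR m1 + 1) ltac:(lra) ltac:(lra) ltac:(lra) ltac:(lra) ltac:(lra)) as P1.
    pose proof (HU m2 (IZR m2) u2 ltac:(lra) ltac:(lra) ltac:(lra) ltac:(lra) ltac:(lra)) as P3.
    assert (P2 : Cmod (CInt (Phi mu f) (mo p s q r (IZR m1 + 1)) (mo p s q r (IZR m2))) <= Kw * T0).
    { destruct (Z.eq_dec (m1 + 1) m2) as [E'|E'].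
      - rewrite <- E', plus_IZR, CInt_point, Cmod_0. lra.
      - set (m := (m1 + 1)%Z). set (W := Z.to_nat (m2 - m)).
        assert (EW : INR W = IZR m2 - IZR m) by (unfold W; rewrite INR_IZR_INZ, Z2Nat.id, minus_IZR by lia; reflexivity).
        assert (Em : IZR m = IZR m1 + 1) by (unfold m; apply plus_IZR).
        assert (HW1 : (1 <= W)%nat) by arith.
        pose proof (HWB mu p (s + p * m)%Z q (r + q * m)%Z S W (v ^ 6) t v Hmu HS12 ltac:(nia) Hq0 Hq HW1 H36) as H.
        rewrite !mo_precomp in H. rewrite EW, Em in H. replace (0 + (IZR m1 + 1)) with (IZR m1 + 1) in H by ring.
        replace (IZR m2 - (IZR m1 + 1) + (IZR m1 + 1)) with (IZR m2) in H by ring.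
        apply H; try assumption; try reflexivity; try lra.
        intros u Hu'. rewrite plus_IZR, mult_IZR, Em. destruct (Rle_lt_dec 0 (IZR q)); split; nra. }
    rewrite <- (CInt_Chasles (Phi mu f) _ (mo p s q r (IZR m1 + 1))) by (eapply Phi_ex; eassumption).
    rewrite <- (CInt_Chasles (Phi mu f) (mo p s q r (IZR m1 + 1)) (mo p s q r (IZR m2))) by (eapply Phi_ex; eassumption).
    via Cmod_triangle.
    eapply Rle_trans; [apply Rplus_le_compat_l, Cmod_triangle|]. lra.
Qed.

Lemma Cmod_CInt_swap k f A mu a b : modform k f A -> (1 <= mu)%nat ->
  Cmod (CInt (Phi mu f) a b) = Cmod (CInt (Phi mu f) b a).
Proof.
  intros Hf Hmu. assert (H : (CInt (Phi mu f) a b + CInt (Phi mu f) b a = 0)%C).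
  { rewrite (CInt_Chasles (Phi mu f) a b a) by (eapply Phi_ex; eassumption). apply CInt_point. }
  replace (CInt (Phi mu f) a b) with (- CInt (Phi mu f) b a)%C; [apply Cmod_opp|].
  replace (CInt (Phi mu f) a b) with (CInt (Phi mu f) a b + CInt (Phi mu f) b a - CInt (Phi mu f) b a)%C by ring.
  rewrite H. ring.
Qed.

(* Here [x = p - q z] measures the distance to the cusp [p/q], and it is cut dyadically; [q u + r = 1/x] on the level [z = mo u]. *)
Lemma side_bound k f A B (eps : R) : modform k f A -> bounded_by k f B -> 0 < eps ->
  exists K, 0 < K /\ forall (N mu : nat) (p s q r : Z) (g n D x1 x2 : R),
  (1 <= mu)%nat -> 0 < g <= 1 -> 0 < n -> n ^ 6 = INR mu -> 1 <= g ^ 3 * n ^ 2 ->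
  (p * r - s * q = 1)%Z -> q <> 0%Z -> Rabs (IZR q) * g ^ 3 <= 1 ->
  0 < D <= 2 * g ^ 3 -> D <= 2 ^ N * (12 * Rabs (IZR q) / INR mu) ->
  0 <= x1 -> x1 <= x2 -> x2 <= D -> x2 - x1 <= Rabs (IZR q) * g ^ 6 ->
  Cmod (CInt (Phi mu f) ((IZR p - x1) / IZR q) ((IZR p - x2) / IZR q)) <=
    (INR N + 1) * (K * (Rpower (INR mu) (INR k / 2) * (g ^ 5 / n) * Rpower (INR mu) eps)).
Proof.
  intros Hf Hb He. destruct (piece_bound k f A B eps Hf Hb He) as (Kp & HKp & HP).
  pose proof Hb as [HB _]. set (Kt := 12 * (B * exp (2 * PI))).
  assert (HKt : 0 < Kt) by (apply Rmult_lt_0_compat; [lra|apply Rmult_lt_0_compat; [exact HB|apply exp_pos]]).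
  exists (Kp + Kt). split; [lra|].
  intros N mu p s q r g n D x1 x2 Hmu Hg Hn Hn6 Hgn H0 Hq0 Hqg.
  assert (Hm1 : 1 <= INR mu) by (apply (le_INR 1); exact Hmu).
  assert (Hq1 : 1 <= Rabs (IZR q)) by (rewrite <- abs_IZR; apply IZR_le; lia).
  assert (HqR : IZR q <> 0) by (apply IZR_neq, Hq0).
  set (Q := Rabs (IZR q)) in *.
  pose proof (Rpower_pos (INR mu) eps) as Hme0. pose proof (Rpower_pos (INR mu) (INR k / 2)) as Hmk.
  assert (Hme : 1 <= Rpower (INR mu) eps) by (apply Rpower_ge1; lra).
  set (T := Rpower (INR mu) (INR k / 2) * (g ^ 5 / n) * Rpower (INR mu) eps).
  assert (Hg5 : 0 < g ^ 5 / n) by arith.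
  assert (HT : 0 < T) by (apply Rmult_lt_0_compat; [apply Rmult_lt_0_compat; assumption|exact Hme0]).
  assert (HinvT : Rpower (INR mu) (INR k / 2) * / INR mu <= T).
  { apply Rle_trans with (Rpower (INR mu) (INR k / 2) * (g ^ 5 / n)).
    - apply Rmult_le_compat_l; [lra|]. rewrite <- Hn6.
      assert (Hn60 : 0 < n ^ 6) by arith. apply Rmult_le_reg_r with (n ^ 6); [exact Hn60|].
      rewrite Rinv_l by lra. replace (g ^ 5 / n * n ^ 6) with ((g * n) ^ 5) by (field; lra). apply pow_R1_Rle.
      apply pow_le_inv with 2%nat; [apply Rmult_le_pos; lra|lia|].
      rewrite Rpow_mult_distr, pow1. nra.
    - rewrite <- (Rmult_1_r (Rpower (INR mu) (INR k / 2) * (g ^ 5 / n))) at 1. apply Rmult_le_compat_l; [|exact Hme].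
      apply Rmult_le_pos; lra. }
  (* Within 12/mu of the cusp the trivial bound mu^(k/2)/mu is of the required size, because (g n)^5
     >= 1. *)
  assert (Htriv : forall y1 y2, 0 <= y1 -> y1 <= y2 -> y2 <= 12 * Q / INR mu ->
     Cmod (CInt (Phi mu f) ((IZR p - y1) / IZR q) ((IZR p - y2) / IZR q)) <= Kt * T).
  { intros y1 y2 A1 A2 A3.
    assert (Hlen : Rabs ((IZR p - y2) / IZR q - (IZR p - y1) / IZR q) <= 12 / INR mu).
    { replace ((IZR p - y2) / IZR q - (IZR p - y1) / IZR q) with ((y1 - y2) / IZR q) by (field; exact HqR).
      unfold Rdiv. rewrite Rabs_mult, Rabs_inv. fold Q. rewrite Rabs_left1 by lra.
      apply Rmult_le_reg_r with Q; [lra|]. rewrite Rmult_assoc, Rinv_l by lra. unfold Rdiv in A3.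
      replace (12 * / INR mu * Q) with (12 * Q * / INR mu) by ring. lra. }
    assert (HG : forall a b, Rabs (b - a) <= 12 / INR mu -> a <= b -> Cmod (CInt (Phi mu f) a b) <= Kt * T).
    { intros a b Hab Hle. eapply Rle_trans; [apply (Phi_trivial k f A B mu); assumption|].
      rewrite Rabs_pos_eq in Hab by lra. pose proof (exp_pos (2 * PI)) as Hep. unfold Kt.
      replace (12 * (B * exp (2 * PI)) * T) with (B * exp (2 * PI) * (12 * T)) by ring. rewrite Rmult_assoc.
      apply Rmult_le_compat_l; [apply Rmult_le_pos; lra|].
      apply Rle_trans with (Rpower (INR mu) (INR k / 2) * (12 / INR mu)); [apply Rmult_le_compat_l; lra|].
      unfold Rdiv. lra. }
    destruct (Rle_lt_dec ((IZR p - y1) / IZR q) ((IZR p - y2) / IZR q)); [apply HG; assumption|].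
    rewrite (Cmod_CInt_swap k f A) by assumption. apply HG; [rewrite Rabs_minus_sym; exact Hlen|lra]. }
  assert (HPT : 0 <= Kp * T /\ 0 <= Kt * T) by arith.
  revert D x1 x2. induction N as [|N IH]; intros D x1 x2 HD HDN Hx1 Hx12 Hx2 Hlen.
  - rewrite Rmult_1_l in HDN. pose proof (Htriv x1 x2 Hx1 Hx12 ltac:(lra)). simpl. lra.
  - destruct (Rle_lt_dec D (12 * Q / INR mu)) as [HDs|HDs].
    { pose proof (Htriv x1 x2 Hx1 Hx12 ltac:(lra)).
      assert (0 <= INR (suc N) * ((Kp + Kt) * T)) by arith. lra. }
    rewrite S_INR.
    assert (Hlow : forall y1 y2, 0 <= y1 -> y1 <= y2 -> y2 <= D / 2 -> y2 - y1 <= Q * g ^ 6 ->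
      Cmod (CInt (Phi mu f) ((IZR p - y1) / IZR q) ((IZR p - y2) / IZR q)) <= (INR N + 1) * ((Kp + Kt) * T)).
    { intros y1 y2 A1 A2 A3 A4. apply (IH (D / 2)); try assumption; [lra|]. simpl in HDN. lra. }
    assert (Hhigh : forall y1 y2, D / 2 <= y1 -> y1 <= y2 -> y2 <= D -> y2 - y1 <= Q * g ^ 6 ->
      Cmod (CInt (Phi mu f) ((IZR p - y1) / IZR q) ((IZR p - y2) / IZR q)) <= Kp * T).
    (* With S = 1/(3D) the values 1/y for y in [D/2, D] fill [3S, 6S]. *)
    { intros y1 y2 A1 A2 A3 A4. set (S := / (3 * D)).
      assert (HS : 0 < S) by (apply Rinv_0_lt_compat; lra). assert (HSD : S * D = / 3) by (unfold S; field; lra).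
      assert (H12 : 1 <= 12 * S * g ^ 3) by nra.
      assert (HQS : Q <= 12 * S).
      { apply Rmult_le_reg_r with (g ^ 3); lra. }
      assert (H36 : 36 * (Q * S) <= INR mu).
      { apply Rmult_lt_compat_r with (r := INR mu) in HDs; [|lra]. unfold Rdiv in HDs. rewrite Rmult_assoc, Rinv_l in HDs by lra.
        unfold S. apply Rmult_le_reg_r with D; [lra|]. replace (36 * (Q * / (3 * D)) * D) with (12 * Q * 1) by (field; lra). lra. }
      assert (Hinv : forall y, y1 <= y <= y2 -> 3 * S <= / y <= 6 * S).
      { intros y Hy. unfold S. split.
        - replace (3 * / (3 * D)) with (/ D) by (field; lra). apply Rinv_le_contravar; lra.
        - replace (6 * / (3 * D)) with (/ (D / 2)) by (field; lra). apply Rinv_le_contravar; lra. }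
      set (w := fun y => mo_inv p s q r ((IZR p - y) / IZR q)).
      assert (Ey : forall y, IZR p - IZR q * ((IZR p - y) / IZR q) = y) by (intros y; field; exact HqR).
      assert (Hw : forall y, y1 <= y <= y2 -> mo p s q r (w y) = (IZR p - y) / IZR q /\ 3 * S <= IZR q * w y + IZR r <= 6 * S).
      { intros y Hy. destruct (mo_mo_inv p s q r ((IZR p - y) / IZR q) H0) as [E1 E2]; [rewrite Ey; lra|].
        rewrite Ey in E2. split; [exact E1|]. unfold w. rewrite E2. apply Hinv, Hy. }
      assert (Hwd : w y2 - w y1 = (y1 - y2) / IZR q * (/ y2 * / y1)).
      { unfold w. rewrite mo_inv_diff by (try assumption; rewrite Ey; lra). rewrite !Ey. field. split; [|split]; lra. }
      assert (Hwa : Rabs (w y2 - w y1) <= 144 * g ^ 6 * S ^ 2).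
      { rewrite Hwd. unfold Rdiv. rewrite !Rabs_mult, !Rabs_inv. fold Q. rewrite (Rabs_left1 (y1 - y2)), (Rabs_pos_eq y2), (Rabs_pos_eq y1) by lra.
        apply Rle_trans with (g ^ 6 * (6 * S * (6 * S))); [|assert (0 < S ^ 2) by (apply pow_lt, HS); nra].
        pose proof (Hinv y1 ltac:(lra)) as I1. pose proof (Hinv y2 ltac:(lra)) as I2.
        apply Rmult_le_compat.
        - apply Rmult_le_pos; [lra|left; apply Rinv_0_lt_compat; lra].
        - apply Rmult_le_pos; lra.
        - apply Rmult_le_reg_r with Q; [lra|]. rewrite Rmult_assoc, Rinv_l by lra. lra.
        - apply Rmult_le_compat; lra. }
      destruct (Hw y1 ltac:(lra)) as [E1 F1]. destruct (Hw y2 ltac:(lra)) as [E2 F2]. rewrite <- E1, <- E2.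
      destruct (Rle_lt_dec (w y1) (w y2)) as [Hle|Hle].
      - rewrite Rabs_pos_eq in Hwa by lra. apply (HP mu p s q r S g n); assumption.
      - rewrite (Cmod_CInt_swap k f A) by assumption. rewrite Rabs_left in Hwa by lra.
        apply (HP mu p s q r S g n); try assumption; lra. }
    assert (HK : 0 <= (INR N + 1) * ((Kp + Kt) * T)) by arith.
    destruct (Rle_lt_dec x2 (D / 2)) as [H2|H2]; [|destruct (Rle_lt_dec (D / 2) x1) as [H1|H1]].
    + pose proof (Hlow x1 x2 Hx1 Hx12 H2 Hlen). lra.
    + pose proof (Hhigh x1 x2 H1 Hx12 Hx2 Hlen). lra.
    + rewrite <- (CInt_Chasles (Phi mu f) _ ((IZR p - D / 2) / IZR q)) by (eapply Phi_ex; eassumption).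
      via Cmod_triangle.
      pose proof (Hlow x1 (D / 2) Hx1 ltac:(lra) ltac:(lra) ltac:(lra)).
      pose proof (Hhigh (D / 2) x2 ltac:(lra) ltac:(lra) Hx2 ltac:(lra)). lra.
Qed.

Lemma log2_bound (eps : R) : 0 < eps -> exists K, 0 < K /\ forall mu : nat, (1 <= mu)%nat ->
  exists N : nat, INR mu <= 2 ^ N /\ INR N + 1 <= K * Rpower (INR mu) eps.
Proof.
  intros He. assert (Hl2 : 0 < ln 2) by (pose proof (ln_lt_2); lra).
  assert (Hie : 0 < / eps / ln 2) by arith.
  exists (2 + / eps / ln 2). split; [lra|].
  intros mu Hmu. assert (Hm1 : 1 <= INR mu) by (apply (le_INR 1); exact Hmu).
  assert (Hln : 0 <= ln (INR mu)) by (rewrite <- ln_1; apply ln_le; lra).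
  destruct (nfloor_ex (ln (INR mu) / ln 2)) as (n & Hn1 & Hn2); [apply Rdiv_le_0_compat; lra|].
  exists (suc n). rewrite S_INR. split.
  - rewrite <- (exp_ln (INR mu)) by lra. rewrite <- (exp_ln (2 ^ suc n)) by (apply pow_lt; lra).
    rewrite ln_pow, S_INR by lra. apply Rmult_lt_compat_r with (r := ln 2) in Hn2; [|exact Hl2].
    unfold Rdiv in Hn2. rewrite Rmult_assoc, Rinv_l in Hn2 by lra.
    left. apply exp_increasing. lra.
  - pose proof (ln_le_Rpower (INR mu) eps ltac:(lra) He) as H. pose proof (Rpower_ge1 (INR mu) eps Hm1 ltac:(lra)) as Hm.
    assert (INR n <= Rpower (INR mu) eps * (/ eps / ln 2)).
    { eapply Rle_trans; [exact Hn1|]. unfold Rdiv. rewrite <- Rmult_assoc. apply Rmult_le_compat_r; [left; apply Rinv_0_lt_compat, Hl2|exact H]. }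
    lra.
Qed.

(** Dirichlet approximation with denominators up to g^(-3): since b - a <= g^6 and q g^6 <= g^3, one
    has |qz - p| <= 2 g^3 throughout. Points to the right of p/q are treated with the negated
    matrix. *)
Lemma first_level k f A B (eps : R) : modform k f A -> bounded_by k f B -> 0 < eps ->
  exists K, 0 < K /\ forall (mu : nat) (g n a b : R),
  (1 <= mu)%nat -> 0 < g <= 1 -> 0 < n -> n ^ 6 = INR mu -> 1 <= g ^ 3 * n ^ 2 ->
  a <= b -> b - a <= g ^ 6 ->
  Cmod (CInt (Phi mu f) a b) <= K * (Rpower (INR mu) (INR k / 2) * (g ^ 5 / n) * Rpower (INR mu) eps).
Proof.
  intros Hf Hb He. destruct (side_bound k f A B (eps / 2) Hf Hb ltac:(lra)) as (Ks & HKs & HSB).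
  destruct (log2_bound (eps / 2) ltac:(lra)) as (Kl & HKl & HL).
  exists (2 * (Kl * Ks)). split; [apply Rmult_lt_0_compat; [lra|apply Rmult_lt_0_compat; assumption]|].
  intros mu g n a b Hmu Hg Hn Hn6 Hgn Hab Hlen.
  assert (Hm1 : 1 <= INR mu) by (apply (le_INR 1); exact Hmu).
  assert (Hg3 : 0 < g ^ 3 <= 1) by arith.
  destruct (nfloor_ex (/ g ^ 3)) as (n1 & Hn1 & Hn2); [left; apply Rinv_0_lt_compat; lra|].
  assert (Hn11 : (1 <= n1)%nat).
  { destruct n1; [|lia]. change (INR 0) with 0 in Hn2. assert (1 <= / g ^ 3) by (rewrite <- Rinv_1; apply Rinv_le_contravar; lra). lra. }
  destruct n1 as [|Q]; [lia|]. destruct (dirichlet Q a) as (p & s & q & r & H0 & Hq & Happ).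
  rewrite S_INR in Happ.
  assert (HqQ : 1 <= IZR q <= / g ^ 3).
  { split; [apply IZR_le; lia|]. eapply Rle_trans; [|exact Hn1]. rewrite INR_IZR_INZ. apply IZR_le. lia. }
  assert (Hqg : IZR q * g ^ 3 <= 1).
  { rewrite <- (Rinv_l (g ^ 3)) by lra. apply Rmult_le_compat_r; lra. }
  assert (Happ2 : Rabs (IZR q * a - IZR p) <= g ^ 3).
  { pose proof (Rabs_pos (IZR q * a - IZR p)). apply Rmult_le_reg_r with (/ g ^ 3); [apply Rinv_0_lt_compat; lra|].
    rewrite Rinv_r by lra. eapply Rle_trans; [|exact Happ]. apply Rmult_le_compat_l; lra. }
  apply Rabs_le_between in Happ2.
  assert (Hg6 : g ^ 6 = g ^ 3 * g ^ 3) by ring.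
  assert (Hqb : IZR q * (b - a) <= IZR q * g ^ 6) by arith.
  assert (Hqb2 : IZR q * g ^ 6 <= g ^ 3) by arith.
  destruct (HL mu Hmu) as (N & HN2 & HNK).
  set (m := Rpower (INR mu) (eps / 2)) in *. assert (Hm : 0 < m) by apply Rpower_pos.
  set (T0 := Rpower (INR mu) (INR k / 2) * (g ^ 5 / n)).
  assert (HT0 : 0 < T0).
  { apply Rmult_lt_0_compat; [apply Rpower_pos|]. apply Rdiv_lt_0_compat; [apply pow_lt; lra|exact Hn]. }
  replace (Rpower (INR mu) eps) with (m * m) by (unfold m; rewrite <- Rpower_plus; f_equal; field).
  (* 2^N >= mu and g <= 1 <= q, so N halvings bring the distance below 12q/mu, where the trivial
     bound takes over. *)
  assert (HDN : forall q' : Z, Rabs (IZR q') = IZR q -> 2 * g ^ 3 <= 2 ^ N * (12 * Rabs (IZR q') / INR mu)).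
  { intros q' ->. apply Rle_trans with (12 * IZR q); [lra|]. unfold Rdiv.
    replace (2 ^ N * (12 * IZR q * / INR mu)) with (12 * IZR q * (2 ^ N * / INR mu)) by ring.
    rewrite <- (Rmult_1_r (12 * IZR q)) at 1. apply Rmult_le_compat_l; [lra|].
    apply Rmult_le_reg_r with (INR mu); [lra|]. rewrite Rmult_assoc, Rinv_l by lra. lra. }
  assert (HNT : (INR N + 1) * (Ks * (T0 * m)) <= Kl * Ks * (T0 * (m * m))).
  { replace (Kl * Ks * (T0 * (m * m))) with (Kl * m * (Ks * (T0 * m))) by ring.
    apply Rmult_le_compat_r; [|exact HNK]. apply Rmult_le_pos; [lra|]. apply Rmult_le_pos; lra. }
  assert (HTT : 0 <= Kl * Ks * (T0 * (m * m))) by arith.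
  assert (HLeft : forall x y, a <= x -> x <= y -> y <= b -> IZR q * y <= IZR p ->
    Cmod (CInt (Phi mu f) x y) <= Kl * Ks * (T0 * (m * m))).
  { intros x y A1 A2 A3 A4. eapply Rle_trans; [|exact HNT]. rewrite (Cmod_CInt_swap k f A) by assumption.
    assert (Hqa : Rabs (IZR q) = IZR q) by (apply Rabs_pos_eq; lra).
    pose proof (HSB N mu p s q r g n (2 * g ^ 3) (IZR p - IZR q * y) (IZR p - IZR q * x) Hmu Hg Hn Hn6 Hgn H0 ltac:(lia)) as H.
    replace ((IZR p - (IZR p - IZR q * y)) / IZR q) with y in H by (field; lra).
    replace ((IZR p - (IZR p - IZR q * x)) / IZR q) with x in H by (field; lra).
    apply H; rewrite ?Hqa; try lra; [rewrite <- Hqa at 1; apply HDN, Hqa|nra|nra|].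
    replace (IZR p - IZR q * x - (IZR p - IZR q * y)) with (IZR q * (y - x)) by ring. apply Rmult_le_compat_l; lra. }
  assert (HRight : forall x y, a <= x -> x <= y -> y <= b -> IZR p <= IZR q * x ->
    Cmod (CInt (Phi mu f) x y) <= Kl * Ks * (T0 * (m * m))).
  { intros x y A1 A2 A3 A4. eapply Rle_trans; [|exact HNT].
    assert (Hqa : Rabs (IZR (- q)) = IZR q) by (rewrite opp_IZR, Rabs_Ropp; apply Rabs_pos_eq; lra).
    pose proof (HSB N mu (- p)%Z (- s)%Z (- q)%Z (- r)%Z g n (2 * g ^ 3) (IZR q * x - IZR p) (IZR q * y - IZR p) Hmu Hg Hn Hn6 Hgn ltac:(lia) ltac:(lia)) as H.
    replace ((IZR (- p) - (IZR q * x - IZR p)) / IZR (- q)) with x in H by (rewrite !opp_IZR; field; lra).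
    replace ((IZR (- p) - (IZR q * y - IZR p)) / IZR (- q)) with y in H by (rewrite !opp_IZR; field; lra).
    apply H; rewrite ?Hqa; try lra; [rewrite <- Hqa at 1; apply HDN, Hqa|nra|nra|].
    replace (IZR q * y - IZR p - (IZR q * x - IZR p)) with (IZR q * (y - x)) by ring. apply Rmult_le_compat_l; lra. }
  destruct (Rle_lt_dec (IZR q * b) (IZR p)) as [Hc|Hc]; [pose proof (HLeft a b ltac:(lra) Hab ltac:(lra) Hc); lra|].
  destruct (Rle_lt_dec (IZR p) (IZR q * a)) as [Hc'|Hc']; [pose proof (HRight a b ltac:(lra) Hab ltac:(lra) Hc'); lra|].
  assert (Ez : IZR q * (IZR p / IZR q) = IZR p) by (field; lra). set (z := IZR p / IZR q) in *.
  assert (a <= z <= b) by arith.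
  rewrite <- (CInt_Chasles (Phi mu f) _ z) by (eapply Phi_ex; eassumption).
  via Cmod_triangle.
  pose proof (HLeft a z ltac:(lra) ltac:(lra) ltac:(lra) ltac:(lra)).
  pose proof (HRight z b ltac:(lra) ltac:(lra) ltac:(lra) ltac:(lra)). lra.
Qed.

(** * From integrals to exponential sums *)

(** [Ph] enters only through its integrals over initial segments, so its cancellation survives
    multiplication by a factor that varies on the scale of the interval. *)
Lemma parts_bound (Ph G dG : R -> C) a b I D0 D1 : a <= b -> 0 <= I -> 0 <= D1 ->
  (forall x, Cc Ph x) -> (forall x, Dc G x (dG x)) -> (forall x, Cc dG x) ->
  (forall x, a <= x <= b -> Cmod (CInt Ph a x) <= I) ->
  Cmod (G b) <= D0 -> (forall x, a <= x <= b -> Cmod (dG x) <= D1) ->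
  Cmod (CInt (fun x => Ph x * G x)%C a b) <= I * (D0 + D1 * (b - a)).
Proof.
  intros Hab HI HD1 HPh HG HdG HH H0 H1. set (Hi := fun x => CInt Ph a x) in *.
  assert (Hex : forall a b, @ex_RInt C_R_NormedModule Ph a b) by (intros; apply ex_CInt; intros; apply HPh).
  assert (HHi : forall v, Dc Hi v (Ph v)).
  { intros v. apply (@is_derive_RInt C_R_NormedModule Ph Hi a v); [|apply HPh].
    apply filter_forall. intros x. apply CInt_correct, Hex. }
  assert (HC1 : forall x, Cc (fun x => Ph x * G x)%C x) by (intros; apply Cc_mult; [apply HPh|eapply Dc_Cc, HG]).
  assert (HC2 : forall x, Cc (fun x => Hi x * dG x)%C x) by (intros; apply Cc_mult; [exact (Dc_Cc _ _ _ (HHi x))|apply HdG]).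
  assert (HFT := is_CInt_unique _ _ _ _ (CInt_FTC (fun x => Hi x * G x)%C (fun x => Ph x * G x + Hi x * dG x)%C a b Hab
    ltac:(intros; apply Dc_mult; [apply HHi|apply HG]) ltac:(intros; apply Cc_plus; [apply HC1|apply HC2]))).
  rewrite CInt_plus in HFT by (apply ex_CInt_le; [exact Hab|intros; auto]).
  assert (E0 : Hi a = 0%C) by apply CInt_point. rewrite E0 in HFT.
  replace (CInt (fun x => Ph x * G x)%C a b) with (Hi b * G b - CInt (fun x => Hi x * dG x)%C a b)%C.
  2:{ transitivity ((CInt (fun x => Ph x * G x)%C a b + CInt (fun x => Hi x * dG x)%C a b) - CInt (fun x => Hi x * dG x)%C a b)%C; [rewrite HFT|]; ring. }
  unfold Cminus. via Cmod_triangle. rewrite Cmod_opp, Cmod_mult, Rmult_plus_distr_l.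
  apply Rplus_le_compat.
  - apply Rmult_le_compat; try apply Cmod_ge_0; [apply HH; lra|exact H0].
  - rewrite <- Rmult_assoc. apply CInt_bound; [exact Hab|apply ex_CInt_le; [exact Hab|intros; apply HC2]|].
    intros x Hx. rewrite Cmod_mult. apply Rmult_le_compat; try apply Cmod_ge_0; [apply HH, Hx|apply H1, Hx].
Qed.

Lemma CInt_cells (F : R -> C) a h n (b : nat -> R) : 0 <= h -> (forall x, Cc F x) ->
  (forall i, (i < n)%nat -> Cmod (CInt F (a + INR i * h) (a + (INR i + 1) * h)) <= b i) ->
  Cmod (CInt F a (a + INR n * h)) <= rsum (seq 0 n) b.
Proof.
  intros Hh HF. induction n as [|n IH]; intros Hb.
  - replace (a + INR 0 * h) with a by (simpl; ring). rewrite CInt_point, Cmod_0. simpl. lra.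
  - rewrite seq_S, rsum_app, S_INR. cbn [rsum]. rewrite Rplus_0_r, Nat.add_0_l.
    rewrite <- (CInt_Chasles F a (a + INR n * h)) by (apply ex_CInt; intros; apply HF).
    via Cmod_triangle. apply Rplus_le_compat; [apply IH; intros; apply Hb; lia|apply Hb; lia].
Qed.

Lemma e_INR n t : e (RtoC (INR n * t)) = (e (RtoC t) ^ n)%C.
Proof.
  induction n as [|n IH]; [simpl; rewrite Rmult_0_l; apply e_0|].
  rewrite S_INR, Rmult_plus_distr_r, Rmult_1_l, RtoC_plus, e_add, IH. simpl. ring.
Qed.

Lemma geom_identities (z : C) N :
  (csum (seq 0 N) (fun j => z ^ j) * (1 - z) = 1 - z ^ N)%C /\
  (csum (seq 0 N) (fun j => RtoC (INR j) * z ^ j) * (1 - z) = z * csum (seq 0 N) (fun j => z ^ j) - RtoC (INR N) * z ^ N)%C.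
Proof.
  induction N as [|N [IH1 IH2]]; [split; simpl; ring|]. rewrite !csum_seq_S, S_INR, RtoC_plus. split.
  - rewrite Cmult_plus_distr_r, IH1. simpl. ring.
  - rewrite Cmult_plus_distr_r, IH2. simpl. ring.
Qed.

Lemma sin_ge_third y : 0 <= y <= PI / 2 -> y / 3 <= sin y.
Proof.
  intros Hy. pose proof PI_4.
  destruct (Req_dec y 0) as [->|Hy0]; [rewrite sin_0; lra|].
  destruct (Rle_lt_dec y (PI / 3)) as [H3|H3].
  - destruct (MVT_cor2 sin cos 0 y ltac:(lra) ltac:(intros; apply derivable_pt_lim_sin)) as (c & Ec & Hc).
    rewrite sin_0 in Ec. assert (/ 2 <= cos c).
    { replace (/ 2) with (cos (PI / 3)) by (rewrite cos_PI3; field). apply cos_decr_1; lra. }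
    nra.
  - assert (sin (PI / 3) <= sin y) by (apply sin_incr_1; lra). rewrite sin_PI3 in *.
    assert (1.65 <= sqrt 3) by (apply pow_le_inv with 2%nat; [apply sqrt_pos|lia|rewrite pow2_sqrt; lra]).
    lra.
Qed.

(** |1 - e(-w)| = 2 |sin(pi w)|. *)
Lemma one_minus_e w : 0 <= w <= 1 -> Rmin w (1 - w) <= Cmod (1 - e (RtoC (- w))).
Proof.
  intros Hw. pose proof PI2_3_2 as HPI3.
  assert (Hs : Rmin w (1 - w) <= Rabs (2 * sin (PI * w))).
  { unfold Rmin. destruct (Rle_dec w (1 - w)).
    - pose proof (sin_ge_third (PI * w) ltac:(split; nra)). rewrite Rabs_pos_eq; nra.
    - rewrite <- sin_PI_x. pose proof (sin_ge_third (PI - PI * w) ltac:(split; nra)). rewrite Rabs_pos_eq; nra. }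
  eapply Rle_trans; [exact Hs|]. rewrite <- (sqrt_pow2 (Cmod _)) by apply Cmod_ge_0. rewrite Cmod_sqr.
  rewrite <- (sqrt_pow2 (Rabs _)) by apply Rabs_pos. apply sqrt_le_1_alt. rewrite pow2_abs.
  unfold e, Cexp. simpl fst. simpl snd. simpl Re. simpl Im.
  match goal with |- context [cos ?a] => replace a with (- (2 * (PI * w))) by ring end.
  match goal with |- context [exp ?a] => replace a with 0 by ring end. rewrite exp_0, cos_neg, sin_neg, cos_2a_sin, sin_2a.
  pose proof (sin2_cos2 (PI * w)) as Hsc. unfold Rsqr in Hsc. set (S := sin (PI * w)) in *. set (c := cos (PI * w)) in *.
  right. transitivity (4 * S ^ 2 * (S * S + c * c)); [rewrite Hsc|]; ring.
Qed.

Definition kern (N : nat) (al x : R) : C := csum (seq 0 N) (fun j => e (RtoC (INR j * (al - x)))).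

Definition dkern (N : nat) (al x : R) : C :=
  (RtoC (2 * PI) * Ci * csum (seq 0 N) (fun j => RtoC (- INR j) * e (RtoC (INR j * (al - x)))))%C.

Lemma Dc_kern N al x : Dc (kern N al) x (dkern N al x).
Proof.
  unfold kern, dkern. induction N as [|N IH].
  - cbn [seq csum]. rewrite Cmult_0_r. apply Dc_const.
  - eapply Dc_ext; [intros t; symmetry; apply csum_seq_S|]. eapply Dc_eq; [apply Dc_plus; [exact IH|]|].
    + apply Dc_e, (Dc_RtoC (fun t => INR N * (al - t)) x (- INR N)). auto_derive; [trivial|ring].
    + rewrite csum_seq_S. ring.
Qed.

Lemma Cc_dkern N al x : Cc (dkern N al) x.
Proof.
  apply Cc_mult; [apply Cc_const|]. induction N as [|N IH]; [apply Cc_const|].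
  eapply Cc_ext; [intros t; symmetry; apply csum_seq_S|]. apply Cc_plus; [exact IH|].
  apply Cc_mult; [apply Cc_const|]. eapply Dc_Cc, Dc_e, (Dc_RtoC (fun t => INR N * (al - t)) x (- INR N)). auto_derive; [trivial|ring].
Qed.

(** The inequality y z <= 2 settles the cells away from the ends of the period, where w or 1 - w is
    comparable with its cell index over N; y <= N covers those next to the ends. *)
Lemma cell_min N m w y z : (m < N)%nat -> INR m / INR N <= w <= (INR m + 1) / INR N -> 0 <= y -> y <= INR N ->
  Rmin w (1 - w) <= z -> y * z <= 2 -> y <= 4 * INR N * (/ (INR m + 1) + / (INR N - INR m)).
Proof.
  intros Hm Hw Hy0 HyN Hz Hyz.
  pose proof (pos_INR m) as Hm0. assert (HmN : INR m + 1 <= INR N) by (rewrite <- S_INR; apply le_INR; lia).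
  set (n := INR N) in *.
  assert (H1 : 0 < / (INR m + 1)) by arith.
  assert (H2 : 0 < / (n - INR m)) by arith.
  assert (Hw1 : INR m <= n * w).
  { destruct Hw as [Hw _]. apply Rmult_le_compat_l with (r := n) in Hw; [|lra]. replace (n * (INR m / n)) with (INR m) in Hw by (field; lra). lra. }
  assert (Hw2 : n * w <= INR m + 1).
  { destruct Hw as [_ Hw]. apply Rmult_le_compat_l with (r := n) in Hw; [|lra]. replace (n * ((INR m + 1) / n)) with (INR m + 1) in Hw by (field; lra). lra. }
  assert (Hcase : y * (INR m + 1) <= 4 * n \/ y * (n - INR m) <= 4 * n).
  { assert (Hw3 : y * Rmin w (1 - w) <= 2) by nra. unfold Rmin in Hw3. destruct (Rle_dec w (1 - w)).
    - left. nra.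
    - right. nra. }
  destruct Hcase as [Hc|Hc].
  - apply Rle_trans with (4 * n * / (INR m + 1)); [|nra]. apply Rmult_le_reg_r with (INR m + 1); [lra|].
    rewrite (Rmult_assoc (4 * n)), Rinv_l by lra. lra.
  - apply Rle_trans with (4 * n * / (n - INR m)); [|nra]. apply Rmult_le_reg_r with (n - INR m); [lra|].
    rewrite (Rmult_assoc (4 * n)), Rinv_l by lra. lra.
Qed.

Lemma kern_cell N m al x : (m < N)%nat -> INR m / INR N <= x - al <= (INR m + 1) / INR N ->
  Cmod (kern N al x) <= 4 * INR N * (/ (INR m + 1) + / (INR N - INR m)) /\
  Cmod (dkern N al x) <= 2 * PI * INR N * (4 * INR N * (/ (INR m + 1) + / (INR N - INR m))).
Proof.
  intros Hm Hw. pose proof PI_RGT_0 as HPI.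
  assert (HmN : INR m + 1 <= INR N) by (rewrite <- S_INR; apply le_INR; lia). pose proof (pos_INR m) as Hm0.
  set (z := e (RtoC (- (x - al)))). assert (Hz : Cmod z = 1) by apply Cmod_e_real.
  assert (Hzn : forall n, Cmod (z ^ n)%C = 1) by (intros n; rewrite Cmod_pow, Hz; apply pow1).
  assert (Ek : kern N al x = csum (seq 0 N) (fun j => z ^ j)%C).
  { apply csum_ext. intros j _. unfold z. rewrite <- e_INR. do 2 f_equal. ring. }
  set (D := csum (seq 0 N) (fun j => z ^ j)%C) in *. set (T := csum (seq 0 N) (fun j => RtoC (INR j) * z ^ j)%C).
  assert (Edk : dkern N al x = (- (RtoC (2 * PI) * Ci * T))%C).
  { unfold dkern, T. rewrite (csum_ext _ _ (fun j => (- (1)) * (RtoC (INR j) * z ^ j))%C).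
    - rewrite csum_mult_l. ring.
    - intros j _. unfold z. rewrite <- e_INR, RtoC_opp. replace (INR j * - (x - al)) with (INR j * (al - x)) by ring. ring. }
  destruct (geom_identities z N) as [G1 G2]. fold D T in G1, G2.
  assert (Hmin : Rmin (x - al) (1 - (x - al)) <= Cmod (1 - z)).
  { apply one_minus_e. split.
    - eapply Rle_trans; [|apply Hw]. apply Rdiv_le_0_compat; lra.
    - via Hw. apply Rmult_le_reg_r with (INR N); [lra|]. unfold Rdiv. rewrite Rmult_assoc, Rinv_l; lra. }
  assert (HD0 : Cmod D <= INR N).
  { eapply Rle_trans; [apply Cmod_csum_le with (h := fun _ => 1); intros j _; rewrite Hzn; lra|]. rewrite rsum_const, length_seq. lra. }
  assert (HD1 : Cmod D * Cmod (1 - z) <= 2).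
  { rewrite <- Cmod_mult, G1. unfold Cminus. via Cmod_triangle. rewrite Cmod_opp, Cmod_1, Hzn. lra. }
  (* Divided by N, the differentiated sum [T] obeys the same two bounds as [D], so [cell_min] serves
     for the kernel and for its derivative. *)
  assert (HT0 : Cmod T / INR N <= INR N).
  { apply Rmult_le_reg_r with (INR N); [lra|]. unfold Rdiv. rewrite Rmult_assoc, Rinv_l, Rmult_1_r by lra.
    eapply Rle_trans; [apply Cmod_csum_le with (h := fun _ => INR N)|].
    - intros j Hj. apply in_seq in Hj. rewrite Cmod_mult, Hzn, Cmod_R, Rabs_pos_eq by apply pos_INR. rewrite Rmult_1_r. apply le_INR. lia.
    - rewrite rsum_const, length_seq. lra. }
  assert (HT1 : Cmod T / INR N * Cmod (1 - z) <= 2).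
  { replace (Cmod T / INR N * Cmod (1 - z)) with (Cmod T * Cmod (1 - z) / INR N) by (field; lra).
    apply Rmult_le_reg_r with (INR N); [lra|]. unfold Rdiv. rewrite (Rmult_assoc _ (/ INR N)), Rinv_l, Rmult_1_r by lra.
    rewrite <- Cmod_mult, G2. unfold Cminus. via Cmod_triangle.
    rewrite Cmod_opp, !Cmod_mult, Hz, Hzn, Cmod_R, Rabs_pos_eq by lra. lra. }
  split.
  - rewrite Ek. apply (cell_min N m (x - al) _ (Cmod (1 - z))); try assumption; apply Cmod_ge_0.
  - rewrite Edk, Cmod_opp, !Cmod_mult, Cmod_R, Rabs_pos_eq by lra.
    rewrite Cmod_Ci, Rmult_1_r, (Rmult_assoc (2 * PI)).
    apply Rmult_le_compat_l; [lra|]. replace (Cmod T) with (INR N * (Cmod T / INR N)) by (field; lra).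
    apply Rmult_le_compat_l; [lra|]. apply (cell_min N m (x - al) _ (Cmod (1 - z))); try assumption.
    apply Rdiv_le_0_compat; [apply Cmod_ge_0|lra].
Qed.

Lemma rsum_inv N : rsum (seq 0 N) (fun m => / (INR m + 1)) = harm N.
Proof.
  induction N as [|N IH]; [reflexivity|]. rewrite seq_S, rsum_app, IH. cbn [rsum harm]. rewrite Nat.add_0_l, S_INR. ring.
Qed.

(** One integration by parts per cell: the derivative of the kernel is larger by a factor N, which
    the cell length 1/N compensates. The kernel bounds over the cells form two harmonic sums, one
    from each end of the period. *)
Lemma kern_integral (Ph : R -> C) N al I : (1 <= N)%nat -> 0 <= I -> (forall x, Cc Ph x) ->
  (forall a b, a <= b -> b - a <= / INR N -> Cmod (CInt Ph a b) <= I) ->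
  Cmod (CInt (fun x => Ph x * kern N al x)%C al (al + 1)) <= I * (8 * (1 + 2 * PI)) * (INR N * harm N).
Proof.
  intros HN HI HPh HH. assert (HN1 : 1 <= INR N) by (apply (le_INR 1), HN). pose proof PI_RGT_0 as HPI.
  replace (al + 1) with (al + INR N * / INR N) by (field; lra).
  via (CInt_cells _ al (/ INR N) N (fun m => I * (4 * (1 + 2 * PI) * INR N) * (/ (INR m + 1) + / (INR (N - 1 - m) + 1)))).
  - left. apply Rinv_0_lt_compat. lra.
  - intros x. apply Cc_mult; [apply HPh|eapply Dc_Cc, Dc_kern].
  - intros m Hm. assert (HmN : INR m + 1 <= INR N) by (rewrite <- S_INR; apply le_INR; lia). pose proof (pos_INR m) as Hm0.
    assert (EN : INR (N - 1 - m) + 1 = INR N - INR m) by (rewrite <- S_INR, <- minus_INR by lia; f_equal; lia). rewrite EN.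
    set (be := / (INR m + 1) + / (INR N - INR m)).
    assert (Hbe : 0 < be) by (apply Rplus_lt_0_compat; apply Rinv_0_lt_compat; lra).
    assert (Hd : al + (INR m + 1) * / INR N - (al + INR m * / INR N) = / INR N) by ring.
    assert (Hi : 0 < / INR N) by arith.
    assert (Hcell : forall x, al + INR m * / INR N <= x <= al + (INR m + 1) * / INR N -> INR m / INR N <= x - al <= (INR m + 1) / INR N)
      by (intros x Hx; unfold Rdiv; lra).
    eapply Rle_trans; [apply (parts_bound Ph (kern N al) (dkern N al) _ _ I (4 * INR N * be) (2 * PI * INR N * (4 * INR N * be))); try assumption; try nra|].
    + apply Rmult_le_pos; [nra|]. apply Rmult_le_pos; nra.
    + intros x. apply Dc_kern.
    + intros x. apply Cc_dkern.
    + intros x Hx. apply HH; lra.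
    + apply kern_cell; [exact Hm|]. apply Hcell. lra.
    + intros x Hx. apply kern_cell; [exact Hm|]. apply Hcell, Hx.
    + rewrite Hd. right. field. lra.
  - rewrite rsum_scal, rsum_plus, (rsum_seq_rev N (fun i => / (INR i + 1))), rsum_inv. right. ring.
Qed.

(** Multiplication by e(j(al - x)) turns the frequency mu into mu + j. What remains is e(j al) times
    the damping exp(-2 pi j/mu), which is harmless for j <= mu. *)
Lemma coef_sum k f A mu N al : modform k f A -> (1 <= mu)%nat ->
  CInt (fun x => Phi mu f x * kern N al x)%C al (al + 1) =
  csum (seq 0 N) (fun j => A (mu + j)%nat * e (RtoC (INR j) * pt al (/ INR mu)))%C.
Proof.
  intros Hf Hmu.
  assert (Hi : 0 < / INR mu) by arith.
  assert (HP : forall x, Cc (Phi mu f) x) by (intros; eapply Phi_cont; eassumption).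
  induction N as [|N IH].
  - rewrite (CInt_ext _ (fun _ => 0 * Phi mu f al)%C) by (first [lra|intros; unfold kern; cbn [seq csum]; ring]).
    rewrite (CInt_scal 0 (fun _ => Phi mu f al)) by (apply ex_CInt; intros; apply Cc_const). cbn [seq csum]. ring.
  - rewrite csum_seq_S, <- IH.
    rewrite (CInt_ext _ (fun x => Phi mu f x * kern N al x + e (RtoC (INR N) * pt al (/ INR mu)) *
       (f (pt x (/ INR mu)) * (E (mu + N) (pt x (/ INR mu)) * 1)))%C al (al + 1)); [|lra|].
    + assert (HE : forall x, Cc (fun x => f (pt x (/ INR mu)) * (E (mu + N) (pt x (/ INR mu)) * 1))%C x).
      { intros x. apply Cc_mult.
        - apply (mf_Cc k f A (fun x => pt x (/ INR mu)) x Hf); [eapply Dc_Cc, Dc_hline|exact Hi].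
        - apply Cc_mult; [|apply Cc_const]. eapply Dc_Cc, (Dc_E (mu + N) (fun x => pt x (/ INR mu))), Dc_hline. }
      rewrite CInt_plus, CInt_scal.
      * replace (mu + N)%nat with (suc (mu + N - 1)) by lia. rewrite (coef_int k f A _ al (/ INR mu) Hf Hi). ring.
      * apply ex_CInt. intros; apply HE.
      * apply ex_CInt. intros; apply Cc_mult; [apply HP|eapply Dc_Cc, Dc_kern].
      * apply ex_CInt. intros; apply Cc_mult; [apply Cc_const|apply HE].
    + intros x _. unfold kern at 1. rewrite csum_seq_S. fold (kern N al x). rewrite Cmult_plus_distr_l. f_equal.
      unfold Phi, E. rewrite !Cmult_1_r.
      transitivity (f (pt x (/ INR mu)) * (e (RtoC (- INR mu) * pt x (/ INR mu)) * e (RtoC (INR N * (al - x)))))%C; [ring|].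
      transitivity (f (pt x (/ INR mu)) * (e (RtoC (INR N) * pt al (/ INR mu)) * e (RtoC (- INR (mu + N)) * pt x (/ INR mu))))%C; [|ring].
      rewrite <- !e_add. do 2 f_equal. apply Ceq; simpl; rewrite plus_INR; ring.
Qed.

(** Monotone weights in [0, V] have total variation at most V; [s] is the direction of
    monotonicity. *)
Lemma abel_monotone (c : nat -> C) (w : nat -> R) N G V s : s = 1 \/ s = -1 -> 0 <= V ->
  (forall T, (T <= N)%nat -> Cmod (csum (seq 0 T) c) <= G) -> (forall t, (t < N)%nat -> 0 <= w t <= V) ->
  (forall t, (suc t < N)%nat -> 0 <= s * (w (suc t) - w t)) ->
  Cmod (csum (seq 0 N) (fun t => RtoC (w t) * c t)%C) <= 2 * V * G.
Proof.
  intros Hs HV HG Hw Hmono. assert (HG0 : 0 <= G) by (eapply Rle_trans; [apply Cmod_ge_0|apply (HG 0%nat); lia]).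
  destruct N as [|W]; [simpl; rewrite Cmod_0; apply Rmult_le_pos; lra|].
  rewrite (abel_sum c (fun t => RtoC (w t))). unfold Cminus. via Cmod_triangle. rewrite Cmod_opp, Cmod_mult, Cmod_R.
  assert (H1 : Rabs (w W) * Cmod (csum (seq 0 (suc W)) c) <= V * G).
  { pose proof (Hw W ltac:(lia)). rewrite Rabs_pos_eq by lra. apply Rmult_le_compat; try lra; [apply Cmod_ge_0|apply HG; lia]. }
  assert (H2 : Cmod (csum (seq 0 W) (fun t => (RtoC (w (suc t)) + - RtoC (w t)) * csum (seq 0 (suc t)) c)%C) <=
               rsum (seq 0 W) (fun t => G * (s * (w (suc t) - w t)))).
  { apply Cmod_csum_le. intros t Ht. apply in_seq in Ht. rewrite Cmod_mult, <- RtoC_opp, <- RtoC_plus, Cmod_R, Rmult_comm.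
    apply Rmult_le_compat; try apply Cmod_ge_0; try apply Rabs_pos; [apply HG; lia|].
    pose proof (Hmono t ltac:(lia)). destruct Hs as [-> | ->]; [rewrite Rabs_pos_eq; lra|rewrite Rabs_left1; lra]. }
  assert (H3 : forall n, rsum (seq 0 n) (fun t => s * (w (suc t) - w t)) = s * (w n - w 0%nat)).
  { induction n as [|n IH]; [simpl; ring|]. rewrite seq_S, rsum_app, IH. cbn [rsum]. rewrite Nat.add_0_l. ring. }
  rewrite rsum_scal, H3 in H2.
  assert (H4 : s * (w W - w 0%nat) <= V).
  { pose proof (Hw W ltac:(lia)). pose proof (Hw 0%nat ltac:(lia)). destruct Hs as [-> | ->]; lra. }
  assert (G * (s * (w W - w 0%nat)) <= G * V) by arith. unfold Cminus in *. lra.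
Qed.

Lemma csum_seq_shift m N (F : nat -> C) : csum (seq m N) F = csum (seq 0 N) (fun j => F (m + j)%nat).
Proof.
  induction N as [|N IH]; [reflexivity|]. rewrite !seq_S, !csum_app, IH. reflexivity.
Qed.

(** Sums of every length T <= N are estimated, each with its own rho = 1/T, because the damping and
    the factor n^((k-1)/2) are removed afterwards by two partial summations. The integral estimate
    and the harmonic sum each lose mu^(eps/2). *)
Lemma block_bound k f A (eps : R) : modform k f A -> 0 < eps ->
  exists K, 0 < K /\ forall (mu N : nat) (al : R) (a : nat -> C), (1 <= mu)%nat -> (1 <= N)%nat -> INR N <= Rpower (INR mu) (2 / 3) ->
  (forall n, A n = (a n * RtoC (Rpower (INR n) ((INR k - 1) / 2)))%C) ->
  Cmod (csum (seq mu N) (fun n => a n * e (RtoC (INR n * al)))%C) <= K * (Rpower (INR N) (1 / 6) * Rpower (INR mu) (1 / 3 + eps)).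
Proof.
  intros Hf He. destruct (mf_bound k f A Hf) as (B & HB & Hb0). assert (Hb : bounded_by k f B) by (split; assumption).
  destruct (first_level k f A B (eps / 2) Hf Hb ltac:(lra)) as (K1 & HK1 & HFL).
  assert (Hk : (1 <= k)%nat) by (pose proof (mf_weight _ _ _ Hf); lia).
  set (Ch := (1 + / (eps / 2)) * Rpower 2 (eps / 2)).
  assert (HCh : 0 < Ch).
  { apply Rmult_lt_0_compat; [|apply Rpower_pos]. assert (0 < / (eps / 2)) by arith. lra. }
  pose proof PI_RGT_0 as HPI. pose proof (exp_pos (2 * PI)) as Hep.
  set (K2 := K1 * (8 * (1 + 2 * PI)) * Ch). assert (HK2 : 0 < K2) by (apply Rmult_lt_0_compat; [apply Rmult_lt_0_compat; lra|exact HCh]).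
  exists (4 * exp (2 * PI) * K2). split; [apply Rmult_lt_0_compat; lra|].
  intros mu N al a Hmu HN HNmu HA.
  assert (Hm1 : 1 <= INR mu) by (apply (le_INR 1); exact Hmu).
  set (m2 := Rpower (INR mu) (eps / 2)). assert (Hm2 : 1 <= m2) by (apply Rpower_ge1; lra).
  set (mk := Rpower (INR mu) (INR k / 2)). assert (Hmk : 0 < mk) by apply Rpower_pos.
  set (n := Rpower (INR mu) (1 / 6)). assert (Hn : 0 < n) by apply Rpower_pos.
  assert (HNle : INR N <= INR mu).
  { eapply Rle_trans; [exact HNmu|]. rewrite <- (Rpower_1 (INR mu)) at 2 by lra. apply Rle_Rpower; lra. }
  assert (Hharm : harm N <= Ch * m2).
  { eapply Rle_trans; [apply (harm_le_Rpower (eps / 2) N (2 * INR mu)); lra|]. rewrite <- Rpower_mult_distr by lra. fold m2. unfold Ch. right. ring. }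
  set (G := fun T : nat => K2 * (mk * (Rpower (INR T) (1 / 6) / n) * (m2 * m2))).
  assert (HG : forall T, (T <= N)%nat -> Cmod (csum (seq 0 T) (fun j => A (mu + j)%nat * e (RtoC (INR j) * pt al (/ INR mu)))%C) <= G N).
  { intros T HT. destruct T as [|T'].
    { simpl. rewrite Cmod_0. unfold G. apply Rmult_le_pos; [lra|]. apply Rmult_le_pos; [|nra].
      apply Rmult_le_pos; [lra|]. apply Rdiv_le_0_compat; [left; apply Rpower_pos|exact Hn]. }
    set (T := suc T') in *. assert (HT1 : 1 <= INR T) by (apply (le_INR 1); unfold T; lia).
    assert (HTN : INR T <= INR N) by (apply le_INR, HT).
    apply Rle_trans with (G T).
    2:{ apply Rmult_le_compat_l; [lra|]. apply Rmult_le_compat_r; [nra|]. apply Rmult_le_compat_l; [lra|].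
        apply Rmult_le_compat_r; [left; apply Rinv_0_lt_compat, Hn|]. apply Rle_Rpower_l; lra. }
    set (g := Rpower (INR T) (- (1 / 6))). assert (Hg : 0 < g) by apply Rpower_pos.
    assert (Hg1 : g <= 1) by (rewrite <- (Rpower_O (INR T)) by lra; apply Rle_Rpower; lra).
    assert (Hg6 : g ^ 6 = / INR T).
    { unfold g. rewrite Rpower_pow_n. replace (INR 6 * - (1 / 6)) with (Ropp 1) by (simpl; field). rewrite Rpower_Ropp, Rpower_1 by lra. reflexivity. }
    assert (Hn6 : n ^ 6 = INR mu).
    { unfold n. rewrite Rpower_pow_n. replace (INR 6 * (1 / 6)) with 1 by (simpl; field). apply Rpower_1. lra. }
    assert (Hgn : 1 <= g ^ 3 * n ^ 2).
    { apply pow_le_inv with 2%nat; [apply Rmult_le_pos; apply pow_le; lra|lia|].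
      replace ((g ^ 3 * n ^ 2) ^ 2) with (g ^ 6 * n ^ 4) by ring. rewrite Hg6, pow1.
      apply Rmult_le_reg_l with (INR T); [lra|]. rewrite <- Rmult_assoc, Rinv_r by lra.
      unfold n. rewrite Rpower_pow_n. replace (INR 4 * (1 / 6)) with (2 / 3) by (simpl; field). lra. }
    set (I := K1 * (mk * (g ^ 5 / n) * m2)).
    assert (HI : 0 <= I).
    { apply Rmult_le_pos; [lra|]. apply Rmult_le_pos; [|lra]. apply Rmult_le_pos; [lra|]. apply Rdiv_le_0_compat; [apply pow_le; lra|exact Hn]. }
    rewrite <- (coef_sum k f A) by assumption.
    eapply Rle_trans; [apply (kern_integral (Phi mu f) T al I); [unfold T; lia|exact HI|intros; eapply Phi_cont; eassumption|]|].
    - intros x y Hxy Hl. apply (HFL mu g n x y); try assumption; [split; lra|]. rewrite Hg6. exact Hl.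
    - assert (HhT : harm T <= Ch * m2).
      { eapply Rle_trans; [|exact Hharm]. clear - HT. induction HT; [lra|]. eapply Rle_trans; [exact IHHT|apply harm_le_S]. }
      assert (E1 : g ^ 5 * INR T = Rpower (INR T) (1 / 6)).
      { unfold g. rewrite Rpower_pow_n. rewrite <- (Rpower_1 (INR T)) at 2 by lra. rewrite <- Rpower_plus. f_equal. simpl. field. }
      apply Rle_trans with (I * (8 * (1 + 2 * PI)) * (INR T * (Ch * m2))).
      + apply Rmult_le_compat_l; [apply Rmult_le_pos; lra|]. apply Rmult_le_compat_l; lra.
      + right. unfold G, I, K2. rewrite <- E1. field. lra. }
  rewrite csum_seq_shift.
  set (V1 := exp (2 * PI)) in *. set (V2 := Rpower (INR mu) (- ((INR k - 1) / 2))). assert (HV2 : 0 < V2) by apply Rpower_pos.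
  set (w1 := fun j : nat => exp (2 * PI * (INR j / INR mu))). set (w2 := fun j : nat => Rpower (INR (mu + j)) (- ((INR k - 1) / 2))).
  assert (Hk1 : 1 <= INR k) by (apply (le_INR 1); exact Hk).
  (* The factor e(mu al) of modulus 1 is split off; the increasing [w1] undoes the damping and the
     decreasing [w2] restores the normalisation. *)
  assert (E0 : Cmod (csum (seq 0 N) (fun j => a (mu + j)%nat * e (RtoC (INR (mu + j) * al)))%C) =
    Cmod (csum (seq 0 N) (fun j => RtoC (w2 j) * (RtoC (w1 j) * (A (mu + j)%nat * e (RtoC (INR j) * pt al (/ INR mu)))))%C)).
  { rewrite <- (Rmult_1_l (Cmod (csum _ (fun j => RtoC (w2 j) * _)%C))), <- (Cmod_e_real (INR mu * al)), <- Cmod_mult, <- csum_mult_l.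
    f_equal. apply csum_ext. intros j _. rewrite HA. unfold w1, w2.
    assert (Hj : 0 < INR (mu + j)) by arith.
    assert (E1 : (RtoC (Rpower (INR (mu + j)) ((INR k - 1) / 2)) * RtoC (Rpower (INR (mu + j)) (- ((INR k - 1) / 2))))%C = RtoC 1).
    { rewrite <- RtoC_mult, <- Rpower_plus, Rplus_opp_r, Rpower_O by exact Hj. reflexivity. }
    assert (E2 : (RtoC (exp (2 * PI * (INR j / INR mu))) * e (RtoC (INR j) * pt al (/ INR mu)))%C = e (RtoC (INR j * al))).
    { replace (RtoC (exp (2 * PI * (INR j / INR mu)))) with (e (RtoC (INR j) * pt 0 (- / INR mu))%C).
      - rewrite <- e_add. f_equal. apply Ceq; simpl; ring.
      - unfold e, Cexp. apply Ceq; simpl.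
        + match goal with |- exp ?x * cos ?y = _ => replace x with (2 * PI * (INR j / INR mu)) by (unfold Rdiv; ring); replace y with 0 by ring end. rewrite cos_0. ring.
        + match goal with |- exp ?x * sin ?y = _ => replace y with 0 by ring end. rewrite sin_0. ring. }
    replace (INR (mu + j) * al) with (INR mu * al + INR j * al) by (rewrite plus_INR; ring). rewrite RtoC_plus, e_add, <- E2.
    set (u := RtoC (Rpower (INR (mu + j)) ((INR k - 1) / 2))) in *. set (u' := RtoC (Rpower (INR (mu + j)) (- ((INR k - 1) / 2)))) in *.
    match goal with |- ?L = ?Rr => transitivity (L * (u * u'))%C; [rewrite E1|]; ring end. }
  rewrite E0.
  pose proof (abel_monotone _ w1 N (G N) V1 1 (or_introl eq_refl) ltac:(lra) HG) as HS1.
  assert (HS1' : forall T, (T <= N)%nat -> Cmod (csum (seq 0 T) (fun j => RtoC (w1 j) * (A (mu + j)%nat * e (RtoC (INR j) * pt al (/ INR mu))))%C) <= 2 * V1 * G N).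
  { intros T HT. apply (abel_monotone _ w1 T (G N) V1 1 (or_introl eq_refl)); [lra|intros; apply HG; lia| |].
    - intros t Ht. unfold w1. split; [left; apply exp_pos|]. unfold V1.
      assert (Hr : INR t / INR mu <= 1).
      { apply Rmult_le_reg_r with (INR mu); [lra|]. unfold Rdiv. rewrite Rmult_assoc, Rinv_l by lra.
        assert (INR t <= INR N) by (apply le_INR; lia). lra. }
      destruct (Req_dec (INR t / INR mu) 1) as [->|Hne]; [rewrite Rmult_1_r; lra|]. left. apply exp_increasing. nra.
    - intros t _. unfold w1. rewrite Rmult_1_l.
      assert (exp (2 * PI * (INR t / INR mu)) < exp (2 * PI * (INR (suc t) / INR mu))); [|lra].
      apply exp_increasing. apply Rmult_lt_compat_l; [lra|]. rewrite S_INR. apply Rmult_lt_compat_r; [apply Rinv_0_lt_compat; lra|lra]. }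
  clear HS1.
  assert (Hdec : forall x y, 0 < x -> x <= y -> Rpower y (- ((INR k - 1) / 2)) <= Rpower x (- ((INR k - 1) / 2))).
  { intros x y Hx Hxy. rewrite !Rpower_Ropp. apply Rinv_le_contravar; [apply Rpower_pos|]. apply Rle_Rpower_l; lra. }
  eapply Rle_trans; [apply (abel_monotone _ w2 N (2 * V1 * G N) V2 (-1) (or_intror eq_refl)); [lra|exact HS1'| |]|].
  - intros t _. unfold w2. split; [left; apply Rpower_pos|]. apply Hdec; [lra|]. apply le_INR. lia.
  - intros t _. unfold w2. assert (Rpower (INR (mu + suc t)) (- ((INR k - 1) / 2)) <= Rpower (INR (mu + t)) (- ((INR k - 1) / 2))); [|lra].
    apply Hdec; [apply lt_0_INR; lia|apply le_INR; lia].
  - unfold G. right.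
    (* -(k-1)/2 + k/2 - 1/6 = 1/3. *)
    assert (E3 : V2 * mk / n * (m2 * m2) = Rpower (INR mu) (1 / 3 + eps)).
    { unfold V2, mk, n, m2, Rdiv. rewrite <- Rpower_Ropp, <- !Rpower_plus. f_equal. field. }
    rewrite <- E3. field. lra.
Qed.

(** * Long sums and the theorem *)

Lemma csum_blocks (F : nat -> C) (Nb s1 : nat) (Kb : R) s0 :
  (forall s N, (1 <= N <= Nb)%nat -> (s0 <= s)%nat -> (s + N <= s1)%nat -> Cmod (csum (seq s N) F) <= Kb) -> 0 <= Kb ->
  forall i N s, (N <= i * Nb)%nat -> (s0 <= s)%nat -> (s + N <= s1)%nat -> Cmod (csum (seq s N) F) <= INR i * Kb.
Proof.
  intros HF HK. induction i as [|i IH]; intros N s HN Hs HsN.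
  - assert (N = 0)%nat by lia. subst N. simpl. rewrite Cmod_0. lra.
  - rewrite S_INR. pose proof (pos_INR i) as Hi. destruct (Nat.eq_dec N 0) as [->|HN0].
    { simpl. rewrite Cmod_0. apply Rmult_le_pos; lra. }
    destruct (Nat.le_gt_cases N Nb) as [Hle|Hgt].
    + eapply Rle_trans; [apply HF; lia|]. assert (0 <= INR i * Kb) by arith. lra.
    + replace N with (Nb + (N - Nb))%nat by lia. rewrite seq_app, csum_app. via Cmod_triangle.
      assert (H1 : Cmod (csum (seq s Nb) F) <= Kb).
      { destruct Nb as [|Nb]; [lia|]. apply HF; lia. }
      pose proof (IH (N - Nb)%nat (s + Nb)%nat ltac:(lia) ltac:(lia) ltac:(lia)). lra.
Qed.

(** Blocks of length about min(N, mu^(2/3)) serve both ranges of the theorem at once. Since N <= 2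
    mu, every block starts between mu and 3 mu, so all blocks have comparable bounds. *)
Lemma long_bound k f A (eps : R) : modform k f A -> 0 < eps ->
  exists K, 0 < K /\ forall (mu N : nat) (al : R) (a : nat -> C), (1 <= mu)%nat -> (1 <= N <= 2 * mu)%nat ->
  (forall n, A n = (a n * RtoC (Rpower (INR n) ((INR k - 1) / 2)))%C) ->
  Cmod (csum (seq mu N) (fun n => a n * e (RtoC (INR n * al)))%C) <=
    K * ((1 + INR N / Rpower (INR mu) (2 / 3)) * Rpower (Rmin (INR N) (Rpower (INR mu) (2 / 3))) (1 / 6) * Rpower (INR mu) (1 / 3 + eps)).
Proof.
  intros Hf He. destruct (block_bound k f A eps Hf He) as (K & HK & HB).
  exists (3 * K * Rpower 3 (1 / 3 + eps)). pose proof (Rpower_pos 3 (1 / 3 + eps)) as H3. split; [apply Rmult_lt_0_compat; lra|].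
  intros mu N al a Hmu HN HA.
  assert (Hm1 : 1 <= INR mu) by (apply (le_INR 1); exact Hmu). assert (HN1 : 1 <= INR N) by (apply (le_INR 1); lia).
  set (m := Rpower (INR mu) (2 / 3)). assert (Hm : 1 <= m) by (apply Rpower_ge1; lra).
  set (b := Rmin (INR N) m). assert (Hb : 1 <= b) by (apply Rmin_glb; assumption).
  assert (Hbm : b <= m) by apply Rmin_r.
  destruct (nfloor_ex b) as (Nb & Hn1 & Hn2); [lra|].
  assert (HNb : 1 <= INR Nb).
  { apply (le_INR 1). destruct Nb; [|lia]. change (INR 0) with 0 in Hn2. lra. }
  destruct (nfloor_ex (INR N / INR Nb)) as (i & Hi1 & Hi2); [apply Rdiv_le_0_compat; lra|].
  assert (HiN : (N <= suc i * Nb)%nat).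
  { apply INR_le. rewrite mult_INR, S_INR. apply Rmult_lt_compat_r with (r := INR Nb) in Hi2; [|lra].
    unfold Rdiv in Hi2. rewrite Rmult_assoc, Rinv_l in Hi2 by lra. lra. }
  set (P := Rpower (INR mu) (1 / 3 + eps)). assert (HP : 0 < P) by apply Rpower_pos.
  set (Q := Rpower b (1 / 6)). assert (HQ : 0 < Q) by apply Rpower_pos.
  set (Kb := K * (Q * (Rpower 3 (1 / 3 + eps) * P))).
  assert (HKb : 0 <= Kb) by (apply Rmult_le_pos; [lra|]; apply Rmult_le_pos; [lra|]; apply Rmult_le_pos; lra).
  eapply Rle_trans; [apply (csum_blocks _ Nb (3 * mu) Kb mu) with (i := suc i); try assumption; try lia|].
  - intros s M HM Hs HsM. assert (HsR : INR mu <= INR s) by (apply le_INR, Hs).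
    assert (Hs3 : INR s <= 3 * INR mu) by (replace 3 with (INR 3) by (simpl; ring); rewrite <- mult_INR; apply le_INR; lia).
    assert (HMb : INR M <= b) by (eapply Rle_trans; [apply le_INR, HM|exact Hn1]).
    assert (HM1 : 1 <= INR M) by (apply (le_INR 1); lia).
    eapply Rle_trans; [apply HB; [lia|lia| |exact HA]|].
    + eapply Rle_trans; [exact HMb|]. eapply Rle_trans; [exact Hbm|]. apply Rle_Rpower_l; lra.
    + apply Rmult_le_compat_l; [lra|]. apply Rmult_le_compat; try (left; apply Rpower_pos).
      * apply Rle_Rpower_l; lra.
      * apply Rpower_base_le; lra.
  - rewrite S_INR.
    assert (Hii : INR i + 1 <= 3 * (1 + INR N / m)).
    { assert (Hrat : INR N / b <= 1 + INR N / m).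
      { assert (0 <= INR N / m) by arith.
        unfold b, Rmin. destruct (Rle_dec (INR N) m); [|lra]. unfold Rdiv at 1. rewrite Rinv_r by lra. lra. }
      assert (INR N / INR Nb <= 2 * (INR N / b)).
      { apply Rmult_le_reg_r with (INR Nb * b); [apply Rmult_lt_0_compat; lra|].
        replace (INR N / INR Nb * (INR Nb * b)) with (INR N * b) by (field; lra).
        replace (2 * (INR N / b) * (INR Nb * b)) with (INR N * (2 * INR Nb)) by (field; lra).
        apply Rmult_le_compat_l; lra. }
      assert (0 <= INR N / m) by arith. lra. }
    apply Rle_trans with (3 * (1 + INR N / m) * Kb); [apply Rmult_le_compat_r; assumption|]. right. unfold Kb. ring.
Qed.

Lemma cusp_modform kappa (f : C -> C) (a : nat -> C) : (0 < kappa)%nat -> is_cusp_form kappa f ->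
  has_normalized_fourier_expansion kappa f a ->
  modform kappa f (fun n => a n * RtoC (Rpower (INR n) ((INR kappa - 1) / 2)))%C.
Proof.
  intros Hk Hc Hs. split.
  - exact Hk.
  - intros z Hz. pose proof (ex_derive_continuous (K := C_AbsRing) (V := C_NormedModule) f z (cusp_form_holomorphic _ _ Hc z Hz)) as H.
    intros P HP. apply locally_C. apply H. exact HP.
  - apply (cusp_form_modular _ _ Hc).
  - intros z Hz. exact (Hs z Hz).
Qed.

Lemma sum_n_m_csum (F : nat -> C) m n : sum_n_m (G := C_AbelianMonoid) F m n = csum (seq m (suc n - m)) F.
Proof.
  induction n as [|n IH].
  - destruct m as [|m]; [rewrite sum_n_n; simpl; ring|]. rewrite sum_n_m_zero by lia. reflexivity.
  - destruct (Nat.le_gt_cases m (suc n)) as [H|H].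
    + rewrite sum_n_Sm, IH by exact H. replace (suc (suc n) - m)%nat with (suc (suc n - m)) by lia.
      rewrite seq_S, csum_app. cbn [csum]. replace (m + (suc n - m))%nat with (suc n) by lia.
      rewrite Cplus_0_r. reflexivity.
    + rewrite sum_n_m_zero by lia. replace (suc (suc n) - m)%nat with O by lia. reflexivity.
Qed.

(** Rounding [x] up and x + y down at most doubles the sizes, because x and y are at least 1. *)
Lemma sum_between_csum (F : nat -> C) x y : 1 <= x -> 1 <= y <= x ->
  exists mu N : nat, sum_between x (x + y) F = csum (seq mu N) F /\ (1 <= mu)%nat /\ (N <= 2 * mu)%nat /\
    x <= INR mu <= 2 * x /\ INR N <= 2 * y.
Proof.
  intros Hx Hy. destruct (Zceil_bound x) as [A1 A2]. destruct (Zfloor_bound (x + y)) as [B1 B2].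
  assert (C1 : (1 <= Zceil x)%Z) by (apply le_IZR; lra).
  assert (C2 : (0 <= Zfloor (x + y))%Z) by (apply Zfloor_lub; lra).
  set (mu := Z.to_nat (Zceil x)). set (n2 := Z.to_nat (Zfloor (x + y))).
  assert (E1 : INR mu = IZR (Zceil x)) by (unfold mu; rewrite INR_IZR_INZ, Z2Nat.id by lia; reflexivity).
  assert (E2 : INR n2 = IZR (Zfloor (x + y))) by (unfold n2; rewrite INR_IZR_INZ, Z2Nat.id by lia; reflexivity).
  assert (HN : INR (suc n2 - mu) <= y + 1).
  { destruct (Nat.le_gt_cases mu (suc n2)) as [H|H].
    - rewrite minus_INR, S_INR by exact H. lra.
    - replace (suc n2 - mu)%nat with O by lia. simpl. lra. }
  exists mu, (suc n2 - mu)%nat. split; [apply sum_n_m_csum|]. split; [unfold mu; lia|]. split; [|lra].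
  apply INR_le. rewrite mult_INR. simpl (INR 2). lra.
Qed.

Theorem theorem3 (kappa : nat) (f : C -> C) (a : nat -> C)
    (kappa_pos : (0 < kappa)%nat)
    (f_cusp : is_cusp_form kappa f)
    (f_fourier : has_normalized_fourier_expansion kappa f a)
    (eps : R) (eps_pos : 0 < eps) :
  (forall c : R, 0 < c ->
     exists K : R, 0 < K /\
       forall M Delta alpha : R,
         1 <= M -> 1 <= Delta <= M ->
         Delta <= c * Rpower M (2 / 3) ->
         Cmod (short_exponential_sum a M Delta alpha)
           <= K * (Rpower Delta (1 / 6) * Rpower M (1 / 3 + eps)))
  /\
  (forall c : R, 0 < c ->
     exists K : R, 0 < K /\
       forall M Delta alpha : R,
         1 <= M -> 1 <= Delta <= M ->
         Rpower M (2 / 3) <= c * Delta ->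
         Cmod (short_exponential_sum a M Delta alpha)
           <= K * (Delta * Rpower M (- (2 / 9) + eps))).
Proof.
  destruct (long_bound kappa f _ eps (cusp_modform kappa f a kappa_pos f_cusp f_fourier) eps_pos) as (K0 & HK0 & HL).
  pose proof (Rpower_pos 2 (1 / 6)) as H2. pose proof (Rpower_pos 2 (1 / 3 + eps)) as H2e. pose proof (Rpower_pos 2 (1 / 9)) as H29.
  (* The common form of both ranges: [D] bounds the number of blocks and [b] the sixth root of the
     block length. *)
  assert (Hgen : forall M Delta alpha D b, 1 <= M -> 1 <= Delta <= M -> 0 < b -> 1 + 2 * Delta / Rpower M (2 / 3) <= D ->
    (forall mu N : R, M <= mu <= 2 * M -> 0 < Rmin N (Rpower mu (2 / 3)) -> N <= 2 * Delta -> Rpower (Rmin N (Rpower mu (2 / 3))) (1 / 6) <= b) ->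
    Cmod (short_exponential_sum a M Delta alpha) <= K0 * (D * b * (Rpower 2 (1 / 3 + eps) * Rpower M (1 / 3 + eps)))).
  { intros M Delta al D b HM HD Hb HDb Hmin. pose proof (Rpower_pos M (2 / 3)) as HM23.
    assert (HD1 : 1 <= D).
    { assert (0 <= 2 * Delta / Rpower M (2 / 3)) by arith. lra. }
    destruct (sum_between_csum (fun n => a n * e (RtoC (INR n * al)))%C M Delta HM HD) as (mu & N & E & Hmu & HN & Hmu2 & HN2).
    unfold short_exponential_sum. rewrite E. pose proof (Rpower_pos M (1 / 3 + eps)) as HMe.
    destruct (Nat.eq_dec N 0) as [->|HN0].
    { simpl. rewrite Cmod_0. apply Rmult_le_pos; [lra|]. apply Rmult_le_pos; apply Rmult_le_pos; lra. }
    assert (HN1 : 1 <= INR N) by (apply (le_INR 1); lia).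
    eapply Rle_trans; [apply (HL mu N al a); [exact Hmu|lia|reflexivity]|]. apply Rmult_le_compat_l; [lra|].
    pose proof (Rpower_pos (INR mu) (2 / 3)) as Hm23.
    assert (0 <= INR N / Rpower (INR mu) (2 / 3)) by arith.
    apply Rmult_le_compat; [|left; apply Rpower_pos| |].
    - apply Rmult_le_pos; [lra|left; apply Rpower_pos].
    - apply Rmult_le_compat; [lra|left; apply Rpower_pos| |].
      + eapply Rle_trans; [|exact HDb]. apply Rplus_le_compat_l. apply Rmult_le_compat; try lra.
        * left. apply Rinv_0_lt_compat, Hm23.
        * apply Rinv_le_contravar; [exact HM23|]. apply Rle_Rpower_l; lra.
      + apply Hmin; [lra| |exact HN2]. apply Rmin_pos; lra.
    - rewrite Rpower_mult_distr by lra. apply Rle_Rpower_l; lra. }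
  split; intros c Hc.
  - exists (K0 * ((1 + 2 * c) * Rpower 2 (1 / 6) * Rpower 2 (1 / 3 + eps))).
    split; [apply Rmult_lt_0_compat; [lra|]; apply Rmult_lt_0_compat; [apply Rmult_lt_0_compat; lra|lra]|].
    intros M Delta alpha HM HD HcD. pose proof (Rpower_pos M (2 / 3)) as HM23.
    eapply Rle_trans; [apply (Hgen M Delta alpha (1 + 2 * c) (Rpower 2 (1 / 6) * Rpower Delta (1 / 6)) HM HD)|right; ring].
    + apply Rmult_lt_0_compat; apply Rpower_pos.
    + apply Rplus_le_compat_l. apply Rmult_le_reg_r with (Rpower M (2 / 3)); [exact HM23|].
      unfold Rdiv. rewrite Rmult_assoc, Rinv_l by lra. lra.
    + intros mu N Hmu Hpos HN. rewrite Rpower_mult_distr by lra. apply Rle_Rpower_l; [lra|]. split; [exact Hpos|].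
      eapply Rle_trans; [apply Rmin_l|exact HN].
  - exists (K0 * ((c + 2) * Rpower 2 (1 / 9) * Rpower 2 (1 / 3 + eps))).
    split; [apply Rmult_lt_0_compat; [lra|]; apply Rmult_lt_0_compat; [apply Rmult_lt_0_compat; lra|lra]|].
    intros M Delta alpha HM HD HcD. pose proof (Rpower_pos M (2 / 3)) as HM23.
    (* Here 1 <= c Delta/M^(2/3), so the 1 in the number of blocks is absorbed into the factor c +
       2. *)
    via (Hgen M Delta alpha ((c + 2) * (Delta / Rpower M (2 / 3))) (Rpower 2 (1 / 9) * Rpower M (1 / 9)) HM HD).
    + apply Rmult_lt_0_compat; apply Rpower_pos.
    + assert (1 <= c * (Delta / Rpower M (2 / 3))); [|lra].
      apply Rmult_le_reg_r with (Rpower M (2 / 3)); [exact HM23|]. unfold Rdiv. rewrite !Rmult_assoc, Rinv_l by lra. lra.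
    + intros mu N Hmu Hpos HN. rewrite Rpower_mult_distr by lra.
      apply Rle_trans with (Rpower (Rpower mu (2 / 3)) (1 / 6)); [apply Rle_Rpower_l; [lra|split; [exact Hpos|apply Rmin_r]]|].
      rewrite Rpower_mult. replace (2 / 3 * (1 / 6)) with (1 / 9) by field. apply Rle_Rpower_l; lra.
    (* -2/3 + 1/9 + 1/3 = -2/9: the number of blocks, the sixth root of M^(2/3), and the bound for a
       block. *)
    + right. replace (- (2 / 9) + eps) with (- (2 / 3) + 1 / 9 + (1 / 3 + eps)) by field. rewrite !Rpower_plus, Rpower_Ropp. field. lra.
Qed.
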